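(* Let $d\ge 3$, let $\Omega,\omega\subset\mathbb{R}^d$ be admissible domains and let $u^a,u^b$ be admissible functions on $\Omega$. Then there exist $\varepsilon^\#_{\mathrm{c}}>0$ (small enough) and a sequence $\{c^\#_n\}_{n\in\mathbb{N}}$ of real numbers such that \[ \mathrm{Cap}_\Omega(\varepsilon\overline{\omega},u^a,u^b)=\varepsilon^{d-2}\sum_{n=0}^\infty c^\#_n\,\varepsilon^n \] for all $\varepsilon\in\,]0,\varepsilon^\#_{\mathrm{c}}[$.
   Context: $\mathbb{N}$ contains $0$. A set $\Omega\subset\mathbb{R}^d$ is an admissible domain if it is open, bounded, connected, of Schauder class $C^{1,\alpha}$ for some $\alpha\in\,]0,1[$, $0\in\Omega$, and $\mathbb{R}^d\setminus\overline{\Omega}$ is connected. A function $u$ is admissible (on $\Omega$) if $u\in H^1(\Omega)$ and $u$ is real-analytic in a neighborhood of $0$. For a compact set $K\subseteq\Omega$ and $u\in H^1_0(\Omega)$, the potential $V_{K,u}$ is the unique function in $H^1_0(\Omega)$ with $V_{K,u}-u\in H^1_0(\Omega\setminus K)$ and $\int_\Omega\nabla V_{K,u}\cdot\nabla\varphi\,dx=0$ for all $\varphi\in H^1_0(\Omega\setminus K)$. For $u\in H^1(\Omega)$ one sets $V_{K,u}\equiv V_{K,\eta_Ku}$, where $\eta_K$ is a smooth function with $\mathrm{supp}\,\eta_K\subseteq\Omega$ compact and $\eta_K\equiv1$ in a neighborhood of $K$ (the result does not depend on $\eta_K$). For $u^a,u^b\in H^1(\Omega)$, the $(u^a,u^b)$-capacity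 of $K$ is $\mathrm{Cap}_\Omega(K,u^a,u^b)\equiv\int_\Omega\nabla V_{K,u^a}\cdot\nabla V_{K,u^b}\,dx$. For small $\varepsilon>0$, $\varepsilon\overline\omega\subset\Omega$. *)

(* Defs.v *)
From HB Require Import structures.
From mathcomp Require Import all_boot all_order all_algebra.
From mathcomp Require Import all_classical all_reals all_analysis.
From mathcomp Require Import summability.

Set Implicit Arguments.
Unset Strict Implicit.
Unset Printing Implicit Defensive.

Import Order.TTheory GRing.Theory Num.Theory.
Import numFieldNormedType.Exports.

Local Open Scope classical_set_scope.
Local Open Scope ring_scope.

(* R^d is 'rV[R]_d, with its library topology and norm (the sup norm), and the
   sigma-algebra generated by the coordinates, i.e. the Borel one. *)
Definition row_display : measure_display -> measure_display.
Proof. exact. Qed.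

Section row_measurable.
Context (R : realType) (n : nat).

Definition row_coord (i : 'I_n) (x : 'rV[R]_n) : measurableTypeR R := x ord0 i.

Let row_set0 : g_sigma_preimage row_coord set0.
Proof. exact: sigma_algebra0. Qed.

Let row_setC A : g_sigma_preimage row_coord A -> g_sigma_preimage row_coord (~` A).
Proof. exact: sigma_algebraC. Qed.

Let row_bigcup (F : (set 'rV[R]_n)^nat) : (forall i, g_sigma_preimage row_coord (F i)) ->
  g_sigma_preimage row_coord (\bigcup_i (F i)).
Proof. exact: sigma_algebra_bigcup. Qed.

HB.instance Definition _ := @isMeasurable.Build (row_display default_measure_display)
  'rV[R]_n (g_sigma_preimage row_coord) row_set0 row_setC row_bigcup.

Lemma measurable_row_coord (i : 'I_n) : measurable_fun [set: 'rV[R]_n] (row_coord i).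
Proof.
move=> _ Y mY; rewrite setTI; apply: sub_sigma_algebra => /=.
rewrite -bigcup_seq/=; exists i => /=; first by rewrite mem_index_enum.
by exists Y => //; rewrite setTI.
Qed.

Lemma measurable_fun_row d (T : measurableType d) (f : T -> 'rV[R]_n) :
  (forall i, measurable_fun [set: T] (row_coord i \o f)) ->
  measurable_fun [set: T] f.
Proof.
move=> mf _ A mA; rewrite setTI; move: A mA.
apply: smallest_sub => /=.
  split; rewrite /=.
  - by rewrite preimage_set0; exact: measurable0.
  - by move=> A mA; rewrite setTD preimage_setC; exact: measurableC.
  - by move=> F mF; rewrite preimage_bigcup; exact: bigcup_measurable.
rewrite -bigcup_seq => A [i _] [B mB <-].
by rewrite setTI -comp_preimage -[X in measurable X]setTI; exact: mf.
Qed.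

Definition rcons_row (p : measurableTypeR R * 'rV[R]_n) : 'rV[R]_n.+1 :=
  \row_i (if unlift ord_max i is Some j then p.2 ord0 j else p.1).

Definition runcons_row (x : 'rV[R]_n.+1) : measurableTypeR R * 'rV[R]_n :=
  (x ord0 ord_max, \row_i x ord0 (lift ord_max i)).

Lemma rcons_rowK : cancel rcons_row runcons_row.
Proof.
case=> a x; rewrite /runcons_row /rcons_row mxE unlift_none; congr pair.
by apply/rowP => i; rewrite !mxE liftK.
Qed.

End row_measurable.

Section prod_sigma_finite.
Context d1 d2 (T1 : measurableType d1) (T2 : measurableType d2) (R : realType).
Variable m1 : {sigma_finite_measure set T1 -> \bar R}.
Variable m2 : {sigma_finite_measure set T2 -> \bar R}.

Lemma prod_sigma_finite : sigma_finite setT (m1 \x m2)%E.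
Proof.
have /sigma_finiteP[F [TF ndF Foo]] := sigma_finiteT m1.
have /sigma_finiteP[G [TG ndG Goo]] := sigma_finiteT m2.
exists (fun n => F n `*` G n).
  rewrite -setXTT TF TG predeqE => -[x y]; split.
    move=> [/= [n _ Fnx] [k _ Gky]]; exists (maxn n k) => //; split.
    - by move: x Fnx; exact/subsetPset/ndF/leq_maxl.
    - by move: y Gky; exact/subsetPset/ndG/leq_maxr.
  by move=> [n _ []/= ? ?]; split; exists n.
move=> k; have [? ?] := Foo k; have [? ?] := Goo k.
split; first exact: measurableX.
by rewrite product_measure1E// lte_mul_pinfty// ge0_fin_numE.
Qed.

End prod_sigma_finite.

Section row_measure_step.
Context (R : realType) (n : nat).
Variable mu : {sigma_finite_measure set 'rV[R]_n -> \bar R}.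

Lemma measurable_rcons_row : measurable_fun setT (@rcons_row R n).
Proof.
apply: measurable_fun_row => i.
have [j ->|->] := unliftP ord_max i.
- rewrite (_ : _ \o _ = @row_coord R n j \o snd); last first.
    by apply/funext => -[a x]; rewrite /row_coord /= mxE liftK.
  by apply: measurableT_comp; [exact: measurable_row_coord|].
- rewrite (_ : _ \o _ = fst)//.
  by apply/funext => -[a x]; rewrite /row_coord /= mxE unlift_none.
Qed.

Lemma measurable_runcons_row : measurable_fun setT (@runcons_row R n).
Proof.
apply/measurable_fun_pairP; split.
  exact: (@measurable_row_coord R n.+1 ord_max).
apply: measurable_fun_row => i.
rewrite (_ : _ \o _ = @row_coord R n.+1 (lift ord_max i)).
  exact: measurable_row_coord.
by apply/funext => x; rewrite /row_coord /= mxE.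
Qed.

Definition row_prod : set 'rV[R]_n.+1 -> \bar R :=
  pushforward (lebesgue_measure \x mu)%E (@rcons_row R n).

Let row_prod0 : row_prod set0 = 0%E.
Proof. by rewrite /row_prod /pushforward preimage_set0 measure0. Qed.

Let measurable_preim A :
  measurable A -> measurable (@rcons_row R n @^-1` A).
Proof.
by move=> mA; rewrite -[X in measurable X]setTI; exact: measurable_rcons_row.
Qed.

Let row_prod_ge0 A : (0 <= row_prod A)%E.
Proof. exact: (measure_ge0 (lebesgue_measure \x mu)%E). Qed.

Let row_prod_sigma_additive : semi_sigma_additive row_prod.
Proof.
move=> F mF tF mUF; rewrite /row_prod /pushforward preimage_bigcup.
apply: (measure_semi_sigma_additive (s := (lebesgue_measure \x mu)%E)).
- by move=> k; exact: measurable_preim.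
- apply/trivIsetP => /= i j _ _ ij; rewrite -preimage_setI.
  by move/trivIsetP : tF => /(_ _ _ _ _ ij) ->//; rewrite preimage_set0.
- by rewrite -preimage_bigcup; exact: measurable_preim.
Qed.

HB.instance Definition _ := isMeasure.Build _ _ _
  row_prod row_prod0 row_prod_ge0 row_prod_sigma_additive.

Let row_prod_sigma_finite : sigma_finite setT row_prod.
Proof.
have [F FT Ffin] := prod_sigma_finite lebesgue_measure mu.
exists (fun k => @runcons_row R n @^-1` F k).
  by rewrite -preimage_bigcup -FT preimage_setT.
move=> k; have [mFk Fk] := Ffin k; split.
  by rewrite -[X in measurable X]setTI; exact: measurable_runcons_row.
rewrite /row_prod /pushforward -comp_preimage.
rewrite (_ : _ \o _ = id) ?preimage_id//.
by apply/funext => p; exact: rcons_rowK.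
Qed.

HB.instance Definition _ :=
  Measure_isSigmaFinite.Build _ _ _ row_prod row_prod_sigma_finite.

End row_measure_step.

(* d-dimensional Lebesgue measure, as an iterated product measure. *)
Fixpoint leb (R : realType) (d : nat) :
    {sigma_finite_measure set 'rV[R]_d -> \bar R} :=
  match d return {sigma_finite_measure set 'rV[R]_d -> \bar R} with
  | 0 => [the {sigma_finite_measure set _ -> \bar R} of dirac (0 : 'rV[R]_0)]
  | d'.+1 => [the {sigma_finite_measure set _ -> \bar R} of row_prod (leb R d')]
  end.

Lemma leb_box (R : realType) (d : nat) (A : 'I_d -> set (measurableTypeR R)) :
  (forall i, measurable (A i)) ->
  leb R d [set x | forall i, A i (x ord0 i)] =
  (\prod_(i < d) lebesgue_measure (A i))%E.
Proof.
elim: d A => [A _|d IH A mA].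
  rewrite big_ord0 /= diracE mem_set//=; by case.
rewrite big_ord_recr /= muleC.
rewrite /row_prod /pushforward.
have -> : rcons_row (n:=d) @^-1` [set x | forall i, A i (x ord0 i)] =
   A ord_max `*` [set x : 'rV[R]_d | forall i, A (lift ord_max i) (x ord0 i)].
  apply/seteqP; split => -[a x] /=.
    move=> h; split; first by have := h ord_max; rewrite mxE unlift_none.
    by move=> i; have := h (lift ord_max i); rewrite mxE liftK.
  move=> [ha hx] i; rewrite mxE; have [j ->|->//] := unliftP ord_max i.
  exact: hx.
rewrite product_measure1E//; last first.
  rewrite (_ : mkset _ = \bigcap_(i in [set: 'I_d])
      (@row_coord R d i @^-1` (A (lift ord_max i)))); last first.
    by apply/seteqP; split => x /= h i => [_|]; exact: h.
  apply: fin_bigcap_measurable; first exact: finite_finset; move=> i _.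
  by rewrite -[X in measurable X]setTI; exact: measurable_row_coord.
congr (_ * _)%E.
apply: etrans (IH (fun i => A (lift ord_max i)) (fun i => mA _)) _; apply: eq_bigr => i _.
congr (lebesgue_measure (A _)).
by apply/val_inj; rewrite /= /bump leqNgt ltn_ord.
Qed.

Section capacity.
Context {R : realType} {d : nat}.
Implicit Types (Om U K : set 'rV[R]_d) (u v f phi : 'rV[R]_d -> R).

Definition partial n (i : 'I_n) (f : 'rV[R]_n -> R) (x : 'rV[R]_n) : R :=
  'D_(delta_mx ord0 i) f x.

Fixpoint Ck (k : nat) f : Prop :=
  continuous f /\
  match k with
  | 0 => True
  | k'.+1 => forall i : 'I_d,
      (forall x, derivable f x (delta_mx ord0 i)) /\ Ck k' (partial i f)
  end.

Definition smooth f := forall k, Ck k f.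

Definition supp f : set 'rV[R]_d := closure [set x | f x != 0].

(* C_c^oo(U), each function being extended by zero to R^d *)
Definition test_function U phi :=
  [/\ smooth phi, compact (supp phi) & supp phi `<=` U].

(* An element of L^2(Om) or H^1(Om) is represented by a function on R^d of
   which only the values in Om matter. *)
Definition L2 Om u :=
  measurable_fun Om u /\ (leb R d).-integrable Om (fun x => (u x ^+ 2)%:E).

Definition weak_partial Om (i : 'I_d) u g :=
  forall phi, test_function Om phi ->
    \int[leb R d]_(x in Om) (u x * partial i phi x) =
    - \int[leb R d]_(x in Om) (g x * phi x).

Definition H1 Om u :=
  L2 Om u /\ forall i : 'I_d, exists g, L2 Om g /\ weak_partial Om i u g.

(* A representative of the weak derivative of u, unique up to a null set. *)
Definition wpartial Om (i : 'I_d) u : 'rV[R]_d -> R :=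
  xget (cst 0) [set g | L2 Om g /\ weak_partial Om i u g].

Definition dirichlet Om u v : R :=
  \int[leb R d]_(x in Om) (\sum_(i < d) wpartial Om i u x * wpartial Om i v x).

Definition H1_norm Om u : R :=
  Num.sqrt (\int[leb R d]_(x in Om) (u x ^+ 2) + dirichlet Om u u).

(* For U open in Om, H^1_0(U) is taken as a subspace of H^1(Om) through
   extension by zero: it is the closure of C_c^oo(U) in H^1(Om).  The usual
   H^1_0(Om) is H10 Om Om. *)
Definition H10 Om U u :=
  H1 Om u /\
  forall e : R, 0 < e ->
    exists phi, test_function U phi /\ H1_norm Om (u \- phi) < e.

Definition is_potential Om K u v :=
  [/\ H10 Om Om v, H10 Om (Om `\` K) (v \- u) &
      forall phi, H10 Om (Om `\` K) phi -> dirichlet Om v phi = 0].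

(* V_{K,u} for u in H^1_0(Om) *)
Definition potential0 Om K u : 'rV[R]_d -> R :=
  xget (cst 0) (is_potential Om K u).

Definition is_cutoff Om K eta :=
  test_function Om eta /\ set_nbhs K [set x | eta x = 1].

(* V_{K,u} for u in H^1(Om); the choice of the cutoff is irrelevant. *)
Definition potential Om K u : 'rV[R]_d -> R :=
  potential0 Om K (xget (cst 0) (is_cutoff Om K) \* u).

Definition Cap Om K u v : R := dirichlet Om (potential Om K u) (potential Om K v).

Definition enorm n (x : 'rV[R]_n) : R := Num.sqrt (\sum_(i < n) x ord0 i ^+ 2).

(* C^{1,alpha} up to the boundary of the ball of R^n of centre 0, radius r:
   a Hoelder gradient on the open ball extends to the closed one. *)
Definition C1_holder_ball n (alpha r : R) (g : 'rV[R]_n -> R) :=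
  (forall i x, enorm x < r -> derivable g x (delta_mx ord0 i)) /\
  exists C : R, forall i x y, enorm x < r -> enorm y < r ->
    `|partial i g x - partial i g y| <= C * enorm (x - y) `^ alpha.

(* Near each boundary point p, in orthonormal coordinates centred at p (the
   columns of P for the d - 1 tangential ones, nu for the last), Om is the
   strict hypograph of a C^{1,alpha} function inside a cylinder. *)
Definition class_C1_holder (alpha : R) Om :=
  forall p, (closure Om `\` interior Om) p ->
  exists (P : 'M[R]_(d, d.-1)) (nu : 'cV[R]_d) (r delta : R)
         (g : 'rV[R]_d.-1 -> R),
    [/\ (row_mx P nu)^T *m row_mx P nu = 1%:M, 0 < r /\ 0 < delta,
        C1_holder_ball alpha r g,
        g 0 = 0 /\ (forall y, enorm y < r -> `|g y| < delta) &
        forall x, enorm ((x - p) *m P) < r ->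
          `|((x - p) *m nu) ord0 ord0| < delta ->
          (Om x <-> ((x - p) *m nu) ord0 ord0 < g ((x - p) *m P))].

Definition admissible_domain Om :=
  [/\ [/\ open Om, bounded_set Om & connected Om],
      exists alpha : R, 0 < alpha < 1 /\ class_C1_holder alpha Om,
      Om 0 & connected (~` closure Om)].

(* Local expansion in a power series; convergence of the finite partial sums
   along the directed set of finite sets of multi-indices is absolute. *)
Definition analytic_at u (y : 'rV[R]_d) :=
  exists (c : {ffun 'I_d -> nat} -> R) (r : R), 0 < r /\
    forall x, `|x - y| < r ->
      partial_sum (fun a : {ffun 'I_d -> nat} =>
        c a * \prod_(i < d) (x ord0 i - y ord0 i) ^+ a i) A @[A --> totally]
      --> u x.

Definition admissible_function Om u :=
  H1 Om u /\ \forall y \near (0 : 'rV[R]_d), analytic_at u y.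

End capacity.

(* Main.v *)
(** Write S_e m (x) = e^-1 m(x / e): on gradient fields this is the pull-back by x -> x / e, and
    it multiplies the energy by e^(d-2).  Let K be the closure of om and X the gradient of the
    potential of e K.  Then X = S_e w - h, where w is the gradient of a function of finite energy on
    R^d harmonic outside K, and h that of one harmonic in Om.  If m is harmonic outside K and g
    harmonic in Om, Green's representation of S_e m by the fundamental solution and the expansion
    of |z - e x|^(2-d) in powers of e give
      <S_e m, g> = e^(d-2) sum_k e^k beta_k(m, g),  |beta_k(m, g)| <= C r^k |m| |g|.
    With Y = sum_k e^k Phi_k the gradient of the rescaled and cut off Taylor series of u, the
    conditions satisfied by the potential become
      <m, w> = <m, Y> + sum_k e^k beta_k(m, h),  <h, g> = e^(d-2) sum_k e^k beta_k(w, g)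
    for all such m and g.  Because d > 2 the coupling is small: the system is solved by power
    series in e, whose coefficients are obtained from the Riesz representation theorem, and the
    capacity is e^(d-2) <w^a, Y^b>. *)

From HB Require Import structures.
Require Import Defs.
From mathcomp Require Import all_boot all_order all_algebra.
From mathcomp Require Import all_classical all_reals all_analysis.
From mathcomp Require Import measurable_realfun.
From mathcomp Require Import ring lra.

Set Implicit Arguments.
Unset Strict Implicit.
Unset Printing Implicit Defensive.

Import Order.TTheory GRing.Theory Num.Theory.
Import numFieldNormedType.Exports.

Local Open Scope classical_set_scope.
Local Open Scope ring_scope.

(** The fields are known only as energy limits of gradients of test functions, without traces, so
    Green's formula is used with two cutoffs instead of boundary integrals. Multiplying by chi(x /
    e) produces a commutator density zeta: in the limit <S_e m, g> is the integral of g against e^-2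
    zeta(x / e). Since g is orthogonal to the gradient of th times the convolution of the
    fundamental solution with that density, the density can be traded for an integral over the
    region where th varies. There |z| >= b, while the density sits at points e x with |x| <= 2 A;
    hence |z - e x|^(2-d) and its gradient are smooth and expand in powers of e. Hardy's inequality,
    for d >= 3, lets the energy control local L^2 norms and makes these integrals continuous forms.
    The fundamental solution is first regularised, so that only genuine test functions are ever
    paired with g. The two conditions on w and h are orthogonality relations: X - S_e Y is a limit
    of gradients supported in Om off e K, and X is a limit of gradients supported in Om. *)

Lemma derive_line (R : realType) (V W : normedModType R) (G : V -> W) x v :
  'D_v G x = 'D_1 (fun h : R => G (h *: v + x)) 0.
Proof.
rewrite /derive; set g1 := fun h => h^-1 *: _; set g2 := fun h => h^-1 *: _.
suff -> : g1 = g2 by [].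
by apply/funext => h; rewrite /g1 /g2/= addr0 scale0r add0r [_%:A]mulr1.
Qed.

(** The inner function is only assumed derivable along [v]: restriction to the line through [x]
    reduces the claim to the one-variable chain rule. *)
Lemma derivable_comp1 (R : realType) (V : normedModType R) (F : R -> R) (f : V -> R) x v :
  derivable f x v -> derivable F (f x) 1 ->
  derivable (F \o f) x v /\ 'D_v (F \o f) x = 'D_1 F (f x) * 'D_v f x.
Proof.
pose g (h : R) := f (h *: v + x).
have g0 : g 0 = f x by rewrite /g scale0r add0r.
move=> /derivable1P df dF.
have dF' : derivable F (g 0) 1 by rewrite g0.
split.
  apply/derivable1P; apply: diff_derivable.
  move/derivable1_diffP: df => df; move/derivable1_diffP: dF' => dF'.
  exact: (@differentiable_comp _ _ _ _ g F).
rewrite (derive_line (F \o f)) (derive_line f) -[LHS]derive1E (derive1_comp df dF').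
by rewrite !derive1E scale0r add0r.
Qed.

(** * Smooth functions and test functions *)

Section Ck_theory.
Context {R : realType} {d : nat}.
Implicit Types (f g : 'rV[R]_d -> R) (U K : set 'rV[R]_d).

Local Notation E i := (delta_mx ord0 i : 'rV[R]_d).

Lemma Ck_continuous k f : Ck k f -> continuous f.
Proof. by case: k => [|k] []. Qed.

Lemma CkS k f : Ck k.+1 f -> Ck k f.
Proof.
elim: k f => [|k IH] f [cf hf]; split => // i; have [df hp] := hf i; split => //.
exact: IH.
Qed.

Lemma smooth_continuous f : smooth f -> continuous f.
Proof. by move=> /(_ 0%N)/Ck_continuous. Qed.

Lemma smooth_derivable f x i : smooth f -> derivable f x (E i).
Proof. by move=> /(_ 1%N)[_ /(_ i)[]]. Qed.

Lemma smooth_partial f i : smooth f -> smooth (partial i f).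
Proof. by move=> sf k; have [_ /(_ i)[]] := sf k.+1. Qed.

Lemma partialD f g i : (forall x, derivable f x (E i)) ->
  (forall x, derivable g x (E i)) ->
  partial i (f \+ g) = partial i f \+ partial i g.
Proof. by move=> df dg; apply/funext => x; rewrite /partial deriveD. Qed.

Lemma partialM f g i : (forall x, derivable f x (E i)) ->
  (forall x, derivable g x (E i)) ->
  partial i (f \* g) = (f \* partial i g) \+ (g \* partial i f).
Proof. by move=> df dg; apply/funext => x; rewrite /partial deriveM. Qed.

Lemma partial_cst (c : R) (i : 'I_d) : partial i (fun=> c) = (fun=> 0).
Proof. by apply/funext => x; rewrite /partial derive_cst. Qed.

Lemma smooth_cst (c : R) : smooth ((fun=> c) : 'rV[R]_d -> R).
Proof.
move=> k; elim: k c => [|k IH] c; split => //; try exact: cst_continuous.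
by move=> i; split => [x|]; [exact: derivable_cst|rewrite partial_cst; exact: IH].
Qed.

Lemma contD f g : continuous f -> continuous g -> continuous (f \+ g).
Proof. by move=> cf cg x; apply: (@continuousD _ _ _ f g x); [exact: cf|exact: cg]. Qed.

Lemma contM f g : continuous f -> continuous g -> continuous (f \* g).
Proof. by move=> cf cg x; apply: (@continuousM _ _ f g x); [exact: cf|exact: cg]. Qed.

Lemma continuous_affine (a : R) (b : 'rV[R]_d) :
  continuous (fun y : 'rV[R]_d => a *: y + b).
Proof.
move=> x; apply: (@continuousD _ _ _ (fun y : 'rV[R]_d => a *: y) (cst b) x).
  exact: scaler_continuous.
exact: cst_continuous.
Qed.

Lemma cont_affine f (a : R) (b : 'rV[R]_d) : continuous f ->
  continuous (fun y : 'rV[R]_d => f (a *: y + b)).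
Proof.
move=> cf x; apply: (@continuous_comp _ _ _ (fun y : 'rV[R]_d => a *: y + b) f x).
  exact: continuous_affine.
exact: cf.
Qed.

Lemma CkD k f g : Ck k f -> Ck k g -> Ck k (f \+ g).
Proof.
elim: k f g => [|k IH] f g [cf hf] [cg hg]; split => //; try exact: contD.
move=> i; have [df hf'] := hf i; have [dg hg'] := hg i; split.
  by move=> x; apply: derivableD.
by rewrite partialD//; exact: IH.
Qed.

Lemma CkM k f g : Ck k f -> Ck k g -> Ck k (f \* g).
Proof.
elim: k f g => [|k IH] f g hf0 hg0; have [cf hf] := hf0; have [cg hg] := hg0;
  split => //; try exact: contM.
move=> i; have [df hf'] := hf i; have [dg hg'] := hg i; split.
  by move=> x; apply: derivableM.
rewrite partialM//; apply: CkD; apply: IH => //; exact: CkS.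
Qed.

Lemma smoothD f g : smooth f -> smooth g -> smooth (f \+ g).
Proof. by move=> sf sg k; apply: CkD. Qed.

Lemma smoothM f g : smooth f -> smooth g -> smooth (f \* g).
Proof. by move=> sf sg k; apply: CkM. Qed.

Lemma smoothZ (c : R) f : smooth f -> smooth (fun x => c * f x).
Proof. by move=> sf; apply: smoothM => //; exact: smooth_cst. Qed.

Lemma smoothN f : smooth f -> smooth (\- f).
Proof.
by move=> sf; have := smoothZ (-1) sf; congr smooth; apply/funext => x; rewrite mulN1r.
Qed.

Lemma smoothB f g : smooth f -> smooth g -> smooth (f \- g).
Proof. by move=> sf sg; apply: smoothD => //; exact: smoothN. Qed.

Lemma smooth_sum I (r : seq I) (P : pred I) (F : I -> 'rV[R]_d -> R) :
  (forall i, smooth (F i)) -> smooth (fun x => \sum_(i <- r | P i) F i x).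
Proof.
move=> sF; elim: r => [|a r IH].
  have -> : (fun x => \sum_(i <- [::] | P i) F i x) = (fun=> 0); last exact: smooth_cst.
    by apply/funext => x; rewrite big_nil.
rewrite (_ : (fun _ => _) =
   fun x => if P a then F a x + \sum_(i <- r | P i) F i x else \sum_(i <- r | P i) F i x).
  by case: (P a) => //; exact: smoothD.
by apply/funext => x; rewrite big_cons.
Qed.

Lemma smooth_prod I (r : seq I) (P : pred I) (F : I -> 'rV[R]_d -> R) :
  (forall i, smooth (F i)) -> smooth (fun x => \prod_(i <- r | P i) F i x).
Proof.
move=> sF; elim: r => [|a r IH].
  have -> : (fun x => \prod_(i <- [::] | P i) F i x) = (fun=> 1); last exact: smooth_cst.
    by apply/funext => x; rewrite big_nil.
rewrite (_ : (fun _ => _) =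
   fun x => if P a then F a x * \prod_(i <- r | P i) F i x else \prod_(i <- r | P i) F i x).
  by case: (P a) => //; exact: smoothM.
by apply/funext => x; rewrite big_cons.
Qed.

Lemma smoothX f n : smooth f -> smooth (fun x => f x ^+ n).
Proof.
move=> sf; elim: n => [|n IH].
  by have := smooth_cst 1.
rewrite (_ : (fun _ => _) = f \* (fun x => f x ^+ n)); first exact: smoothM.
by apply/funext => x; rewrite exprS.
Qed.

Lemma is_derive_coord (j i : 'I_d) (x : 'rV[R]_d) :
  is_derive x (E i) (fun y : 'rV[R]_d => y ord0 j) ((j == i)%:R : R).
Proof.
apply: is_derive_eq.
  have dj : differentiable (fun y : 'rV[R]_d => y ord0 j) x by exact: differentiable_coord.
  exact/derivableP/diff_derivable.
rewrite /derive; apply: cvg_lim => //.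
apply: (@cvg_trans _ ((fun=> ((j == i)%:R : R)) @ 0^')); last exact: cvg_cst.
apply: near_eq_cvg; near=> h.
rewrite /= !mxE/= addrK [_ *: _]mulrA mulVf ?mul1r//.
by near: h; exact: nbhs_dnbhs_neq.
Unshelve. all: by end_near. Qed.

Lemma partial_coord (j i : 'I_d) :
  partial i (fun y : 'rV[R]_d => y ord0 j) = fun=> ((j == i)%:R : R).
Proof.
by apply/funext => x; have [_ <-] := is_derive_coord j i x.
Qed.

Lemma smooth_coord (j : 'I_d) : smooth (fun y : 'rV[R]_d => y ord0 j).
Proof.
case=> [|k]; split => //; try exact: coord_continuous.
move=> i; split; first by move=> x; have [] := is_derive_coord j i x.
by rewrite partial_coord; exact: smooth_cst.
Qed.

Lemma derivable_affine f (a : R) (b : 'rV[R]_d) i x :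
  derivable f (a *: x + b) (E i) ->
  is_derive x (E i) (fun y => f (a *: y + b)) (a * 'D_(E i) f (a *: x + b)).
Proof.
move=> /derivableP df.
have [->|a0] := eqVneq a 0.
  rewrite mul0r (_ : (fun _ => _) = fun=> f b); first exact: is_derive_cst.
  by apply/funext => y; rewrite scale0r add0r.
pose g (h : R) := f (h *: E i + (a *: x + b)).
have dg : derivable g 0 1 by have [/derivable1P] := df.
have Dg : 'D_(E i) f (a *: x + b) = 'D_1 g 0.
  exact: derive_line.
pose G (h : R) := f (a *: (h *: E i + x) + b).
have GE : G = g \o (fun h => a * h).
  by apply/funext => h; rewrite /G /g /= scalerDr scalerA addrA.
have da : is_derive (0 : R) 1 (fun h : R => a * h) a.
  by apply: is_derive_eq; rewrite ?scaler0 ?add0r ?mulr0 ?addr0 [LHS]mulr1.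
have dg' : is_derive (a * 0) 1 g ('D_1 g 0) by rewrite mulr0; exact/derivableP.
have dG : is_derive (0 : R) 1 G ('D_1 g 0 * a).
  rewrite GE; exact: (@is_derive1_comp _ g (fun h => a * h) 0).
apply: DeriveDef; first by apply/derivable1P; have [] := dG.
by rewrite Dg mulrC; have [_ <-] := dG; exact: derive_line.
Qed.

Lemma partial_affine f (a : R) (b : 'rV[R]_d) i : smooth f ->
  partial i (fun y => f (a *: y + b)) = fun y => a * partial i f (a *: y + b).
Proof.
move=> sf; apply/funext => x.
by rewrite /partial; have [_ ->] := @derivable_affine f a b i x (smooth_derivable sf).
Qed.

Lemma smooth_affine f (a : R) (b : 'rV[R]_d) : smooth f -> smooth (fun y => f (a *: y + b)).
Proof.
move=> sf k; elim: k f sf => [|k IH] f sf.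
  by split => //; exact/cont_affine/smooth_continuous.
split; first exact/cont_affine/smooth_continuous.
move=> i; split.
  by move=> x; have [] := @derivable_affine f a b i x (smooth_derivable sf).
rewrite partial_affine//; apply: CkM; first exact: smooth_cst.
exact/IH/smooth_partial.
Qed.

(** The family [F] packages all derivatives of the outer function, so that one induction treats
    every order at once. [I] allows outer functions that are differentiable only on a part of the
    line, such as powers. *)
Lemma smooth_comp (F : nat -> R -> R) (I : set R) f n :
  (forall m t, I t -> is_derive t 1 (F m) (F m.+1 t)) ->
  smooth f -> (forall x, I (f x)) -> smooth (F n \o f).
Proof.
move=> dF sf If.
have cF m : continuous (F m \o f).
  move=> x; apply: (@continuous_comp _ _ _ f (F m) x); first exact: smooth_continuous.
  by apply: differentiable_continuous; apply/derivable1_diffP; have [] := dF m _ (If x).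
have H m i x : derivable (F m \o f) x (E i) /\
    'D_(E i) (F m \o f) x = F m.+1 (f x) * 'D_(E i) f x.
  have [dFm DFm] := dF m _ (If x).
  have := @derivable_comp1 _ _ (F m) f x (E i) (smooth_derivable sf) dFm.
  by rewrite DFm.
move=> k; elim: k n => [|k IH] n; split => //.
move=> i; split; first by move=> x; have [] := H n i x.
rewrite (_ : partial i _ = (F n.+1 \o f) \* partial i f).
  by apply: CkM; [exact: IH|exact: smooth_partial].
by apply/funext => x; have [_] := H n i x.
Qed.

Lemma partial_comp (F : R -> R) f (x : 'rV[R]_d) i c : smooth f ->
  is_derive (f x) 1 F c -> partial i (F \o f) x = c * partial i f x.
Proof.
move=> sf [dF DF]; have [_] := @derivable_comp1 _ _ F f x (E i) (smooth_derivable sf) dF.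
by rewrite DF.
Qed.

Lemma suppP f (x : 'rV[R]_d) : ~ supp f x -> f x = 0.
Proof. by move=> h; apply: contrapT => /eqP fx; apply: h; exact: subset_closure. Qed.

(** Test functions are recognised by any compact set off which they vanish, which spares computing
    their support. *)
Lemma test_of f K U : smooth f -> compact K -> K `<=` U ->
  (forall x, ~ K x -> f x = 0) -> test_function U f.
Proof.
move=> sf cK KU f0.
have sK : supp f `<=` K.
  have <- : closure K = K.
    by apply/esym/closure_id; apply: compact_closed => //; exact: norm_hausdorff.
  apply: closure_subset => x /= fx; apply: contrapT => /f0 h; by rewrite h eqxx in fx.
split => //; last exact: subset_trans KU.
by apply: subclosed_compact cK sK; exact: closed_closure.
Qed.

Lemma testW U U' f : U `<=` U' -> test_function U f -> test_function U' f.
Proof. by move=> UU' [? ? ?]; split => //; exact: subset_trans UU'. Qed.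

Lemma testT U f : test_function U f -> test_function setT f.
Proof. exact: testW. Qed.

Lemma test_smooth U f : test_function U f -> smooth f.
Proof. by case. Qed.

Lemma test0 U : test_function U ((fun=> 0) : 'rV[R]_d -> R).
Proof.
apply: (@test_of _ set0) => //; [exact: smooth_cst|exact: compact0].
Qed.

Lemma testD U f g : test_function U f -> test_function U g -> test_function U (f \+ g).
Proof.
move=> [sf cf Uf] [sg cg Ug]; apply: (@test_of _ (supp f `|` supp g)).
- exact: smoothD.
- exact: compactU.
- by move=> x [/Uf|/Ug].
- by move=> x /not_orP[/suppP fx /suppP gx] /=; rewrite fx gx addr0.
Qed.

Lemma testMl U f g : test_function U f -> smooth g -> test_function U (f \* g).
Proof.
move=> [sf cf Uf] sg; apply: (@test_of _ (supp f)) => //.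
- exact: smoothM.
- by move=> x /suppP fx /=; rewrite fx mul0r.
Qed.

Lemma testMr U f g : smooth f -> test_function U g -> test_function U (f \* g).
Proof.
move=> sf [sg cg Ug]; apply: (@test_of _ (supp g)) => //.
- exact: smoothM.
- by move=> x /suppP gx /=; rewrite gx mulr0.
Qed.

Lemma testZ U (c : R) f : test_function U f -> test_function U (fun x => c * f x).
Proof. by move=> tf; apply: testMr => //; exact: smooth_cst. Qed.

Lemma testN U f : test_function U f -> test_function U (\- f).
Proof.
by move=> tf; have := testZ (-1) tf; congr test_function; apply/funext => x; rewrite mulN1r.
Qed.

Lemma testB U f g : test_function U f -> test_function U g -> test_function U (f \- g).
Proof. by move=> tf tg; apply: testD => //; exact: testN. Qed.

Lemma test_sum U I (r : seq I) (P : pred I) (F : I -> 'rV[R]_d -> R) :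
  (forall i, test_function U (F i)) ->
  test_function U (fun x => \sum_(i <- r | P i) F i x).
Proof.
move=> sF; elim: r => [|a r IH].
  have -> : (fun x => \sum_(i <- [::] | P i) F i x) = (fun=> 0); last exact: test0.
    by apply/funext => x; rewrite big_nil.
rewrite (_ : (fun _ => _) =
   fun x => if P a then F a x + \sum_(i <- r | P i) F i x else \sum_(i <- r | P i) F i x).
  by case: (P a) => //; exact: testD.
by apply/funext => x; rewrite big_cons.
Qed.

Lemma partial_supp f i (x : 'rV[R]_d) : ~ supp f x -> partial i f x = 0.
Proof.
move=> sx; rewrite /partial (@near_eq_derive _ _ _ f (cst 0)) ?derive_cst//.
have o : open (~` supp f) by exact/closed_openC/closed_closure.
by near=> y; apply: suppP; near: y; exact: open_nbhs_nbhs.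
Unshelve. all: by end_near. Qed.

Lemma test_partial U f i : test_function U f -> test_function U (partial i f).
Proof.
move=> [sf cf Uf]; apply: (@test_of _ (supp f)) => //; first exact: smooth_partial.
by move=> x; exact: partial_supp.
Qed.

End Ck_theory.

(** * Smooth powers, flat functions and radial cutoffs *)

Section powR_family.
Context {R : realType}.

(** The m-th derivative of the power t^a on the positive reals, in the form that [smooth_comp]
    expects. *)
Definition powR_fam (a : R) (m : nat) (t : R) : R :=
  (\prod_(j < m) (a - j%:R)) * t `^ (a - m%:R).

Lemma is_derive_powR_fam (a : R) m (t : R) : 0 < t ->
  is_derive t 1 (powR_fam a m) (powR_fam a m.+1 t).
Proof.
move=> t0; set c := \prod_(j < m) (a - j%:R).
have -> : powR_fam a m.+1 t = c * ((a - m%:R) * t `^ (a - m%:R - 1)).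
  by rewrite /powR_fam big_ord_recr/= -mulrA -natr1 opprD addrA.
have h := @is_derive1_powR R (a - m%:R) t t0.
exact: (@is_deriveZ R R R (fun s => s `^ (a - m%:R)) c t 1 _ h).
Qed.

Lemma smooth_powR d (f : 'rV[R]_d -> R) (a : R) :
  smooth f -> (forall x, 0 < f x) -> smooth (fun x => f x `^ a).
Proof.
move=> sf f0.
have := @smooth_comp R d (powR_fam a) [set t | 0 < t] f 0 _ sf f0.
rewrite (_ : powR_fam a 0 \o f = fun x => f x `^ a); last first.
  by apply/funext => x; rewrite /powR_fam /= big_ord0 mul1r subr0.
by apply => m t t0; exact: is_derive_powR_fam.
Qed.

Lemma smoothV d (f : 'rV[R]_d -> R) :
  smooth f -> (forall x, 0 < f x) -> smooth (fun x => (f x)^-1).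
Proof.
move=> sf f0; have := smooth_powR (-1) sf f0; congr smooth.
by apply/funext => x; rewrite powR_inv1// ltW.
Qed.

End powR_family.

Section flat_family.
Context {R : realType}.

(* The derivatives of exp(- 1 / t), extended by 0, are of this form. *)
Definition flat (p : {poly R}) (t : R) : R :=
  if 0 < t then p.[t^-1] * expR (- t^-1) else 0.

Lemma poly_bound (p : {poly R}) : exists C : R, 0 <= C /\
  forall s, 1 <= s -> `|p.[s]| <= C * s ^+ size p.
Proof.
exists (\sum_(i < size p) `|p`_i|); split; first exact: sumr_ge0.
move=> s s1; rewrite horner_coef mulr_suml (le_trans (ler_norm_sum _ _ _))//.
apply: ler_sum => i _; rewrite normrM ler_wpM2l// ger0_norm ?exprn_ge0//; last first.
  exact: le_trans s1.
by rewrite ler_weXn2l// ltnW.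
Qed.

(** With s = 1/t and n = size p + 2, the inequality s^n / n! <= exp(s) beats the growth s^(size p)
    of the polynomial and leaves a factor t^2, which is what makes the derivative at 0 vanish. *)
Lemma flat_bound (p : {poly R}) : exists C : R, 0 <= C /\
  forall t, t <= 1 -> `|flat p t| <= C * t ^+ 2.
Proof.
have [C [C0 hC]] := poly_bound p.
exists (C * (size p).+2`!%:R); split; first by rewrite mulr_ge0.
move=> t t1; rewrite /flat; case: ifPn => [t0|_]; last first.
  rewrite normr0; apply: mulr_ge0; last exact: sqr_ge0.
  by apply: mulr_ge0 => //; exact: ler0n.
have s1 : 1 <= t^-1 by rewrite invf_ge1.
have s0 : 0 < t^-1 by rewrite invr_gt0.
rewrite normrM (ger0_norm (expR_ge0 _)).
apply: (@le_trans _ _ (C * t^-1 ^+ size p * expR (- t^-1))).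
  by rewrite ler_wpM2r ?expR_ge0// hC.
rewrite -!mulrA ler_wpM2l//.
have : t^-1 ^+ (size p).+2 / (size p).+2`!%:R <= expR t^-1.
  by have := expR_ge1Dxn (size p).+1 (ltW s0); apply: le_trans; rewrite lerDr.
rewrite ler_pdivrMr ?ltr0n ?fact_gt0// => h.
rewrite expRN ler_pdivrMr ?expR_gt0// -mulrA mulrCA.
rewrite [leRHS](_ : _ = t ^+ 2 * (expR t^-1 * (size p).+2`!%:R)); last by ring.
apply: le_trans (ler_wpM2l (sqr_ge0 t) h).
have -> : t^-1 ^+ (size p).+2 = t^-1 ^+ size p * (t ^+ 2)^-1.
  by rewrite -addn2 exprD [t^-1 ^+ 2]exprVn.
by rewrite mulrCA divff ?mulr1// expf_neq0// gt_eqF.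
Qed.

(** In s = 1/t the chain rule turns p(s) exp(-s) into s^2 (p - p')(s) exp(-s), again of the same
    form; at t = 0 the quadratic bound of [flat_bound] gives the derivative. *)
Lemma is_derive_flat (p : {poly R}) (t : R) :
  is_derive t 1 (flat p) (flat ('X^2 * (p - p^`())) t).
Proof.
have [t0|t0|t0] := ltgtP t 0.
- have -> : flat ('X^2 * (p - p^`())) t = 0 by rewrite /flat ltNge (ltW t0).
  apply: (@near_eq_is_derive _ _ _ (cst 0) _ _ _ _ _ (@is_derive_cst R R R 0 t 1)).
  near=> s; rewrite /flat ltNge ifF//; apply/negbTE; rewrite negbK ltW//.
  by near: s; exact: lt_nbhsl.
- have tn0 : t != 0 by rewrite gt_eqF.
  have -> : flat ('X^2 * (p - p^`())) t =
     p.[t^-1] * (expR (- t^-1) * t ^- 2) + expR (- t^-1) * (p^`().[t^-1] * - t ^- 2).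
    by rewrite /flat t0 hornerM hornerXn hornerD hornerN/=; field; rewrite tn0.
  have dinv : is_derive t 1 (fun s : R => s^-1) (- t ^- 2).
    have := @is_deriveV R id t 1 1 tn0 (is_derive_id _ _).
    by rewrite [_ *: 1]mulr1.
  have dp : is_derive t 1 (fun s => p.[s^-1]) (p^`().[t^-1] * - t ^- 2).
    exact: (@is_derive1_comp R (horner p) (fun s => s^-1) t).
  have de : is_derive t 1 (fun s => expR (- s^-1)) (expR (- t^-1) * t ^- 2).
    have dN : is_derive t 1 (fun s : R => - s^-1) (t ^- 2).
      by have := @is_deriveN R R R (fun s => s^-1) t 1 _ dinv; rewrite opprK.
    exact: (@is_derive1_comp R expR (fun s => - s^-1) t).
  have H := @is_deriveM R R (fun s => p.[s^-1]) (fun s => expR (- s^-1)) t 1 _ _ dp de.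
  apply: (@near_eq_is_derive _ _ _ _ _ _ _ _ _ H).
  by near=> s; rewrite /flat ifT//; near: s; exact: lt_nbhsr.
- rewrite t0; have f0 q : flat q 0 = 0 by rewrite /flat ltxx.
  have [C [C0 hC]] := flat_bound p.
  have cv : (fun h : R => h^-1 *: ((flat p \o shift 0) (h *: 1) - flat p 0)) @ 0^' --> (0 : R).
    apply/cvgr0Pnorm_lt => e e0; near=> h.
    rewrite /= f0 subr0 addr0 [_%:A]mulr1 normrZ.
    have h1 : h <= 1.
      apply: le_trans (ler_norm _) _; near: h; apply: dnbhs0_le; exact: ltr01.
    have hn0 : h != 0 by near: h; exact: nbhs_dnbhs_neq.
    have h0 : 0 < `|h| by rewrite normr_gt0.
    have hC1 : `|h| < e / (C + 1).
      by near: h; apply: dnbhs0_lt; rewrite divr_gt0// ltr_wpDl.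
    rewrite normfV ltr_pdivrMl// (le_lt_trans (hC _ h1))//.
    rewrite -[h ^+ 2]ger0_norm ?sqr_ge0// normrX expr2 mulrA [ltRHS]mulrC ltr_pM2r//.
    move: hC1; rewrite ltr_pdivlMr ?ltr_wpDl// mulrDr mulr1 => /(le_lt_trans _); apply.
    by rewrite mulrC lerDl.
  rewrite f0; split; first by apply/cvg_ex; exists 0.
  exact: cvg_lim cv.
Unshelve. all: by end_near.
Qed.

Fixpoint flat_poly (n : nat) : {poly R} :=
  if n is n'.+1 then 'X^2 * (flat_poly n' - (flat_poly n')^`()) else 1.

Lemma smooth_flat d (f : 'rV[R]_d -> R) : smooth f -> smooth (fun x => flat 1 (f x)).
Proof.
move=> sf.
have := @smooth_comp R d (fun m => flat (flat_poly m)) setT f 0 _ sf.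
by apply => // m t _; exact: is_derive_flat.
Qed.

Lemma flat1_ge0 t : 0 <= flat 1 t.
Proof. by rewrite /flat; case: ifP => // _; rewrite hornerE mul1r expR_ge0. Qed.

Lemma flat1_gt0 t : 0 < t -> 0 < flat 1 t.
Proof. by move=> t0; rewrite /flat t0 hornerE mul1r expR_gt0. Qed.

Lemma flat1_eq0 t : t <= 0 -> flat 1 t = 0.
Proof. by move=> t0; rewrite /flat ltNge t0. Qed.

(** The denominator never vanishes because t or 1 - t is positive; the function rises smoothly from
    0 to 1 over [0, 1]. *)
Definition step (t : R) : R := flat 1 t / (flat 1 t + flat 1 (1 - t)).

Lemma step_den_gt0 t : 0 < flat 1 t + flat 1 (1 - t).
Proof.
have [t0|t0] := ltP 0 t; first by rewrite ltr_wpDr ?flat1_ge0 ?flat1_gt0.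
by rewrite ltr_wpDl ?flat1_ge0 ?flat1_gt0//; lra.
Qed.

Lemma smooth_step d (f : 'rV[R]_d -> R) : smooth f -> smooth (fun x => step (f x)).
Proof.
move=> sf.
have s1 := smooth_flat sf.
have s2 : smooth (fun x => flat 1 (1 - f x)).
  by apply: smooth_flat; apply: smoothB => //; exact: smooth_cst.
apply: smoothM => //; apply: (@smoothV R d (fun x => flat 1 (f x) + flat 1 (1 - f x))).
  exact: smoothD.
by move=> x; exact: step_den_gt0.
Qed.

Lemma step_ge0 t : 0 <= step t.
Proof. by rewrite /step divr_ge0 ?flat1_ge0// ltW// step_den_gt0. Qed.

Lemma step_le1 t : step t <= 1.
Proof. by rewrite /step ler_pdivrMr ?step_den_gt0// mul1r lerDl flat1_ge0. Qed.

Lemma step_eq1 t : 1 <= t -> step t = 1.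
Proof.
move=> t1; rewrite /step (@flat1_eq0 (1 - t)) ?subr_le0// addr0 divff//.
by rewrite gt_eqF// flat1_gt0// (lt_le_trans ltr01).
Qed.

Lemma step_eq0 t : t <= 0 -> step t = 0.
Proof. by move=> t0; rewrite /step flat1_eq0// mul0r. Qed.

Lemma step_gt0 t : 0 < t -> 0 < step t.
Proof. by move=> t0; rewrite /step divr_gt0 ?step_den_gt0// flat1_gt0. Qed.

End flat_family.

Section bumps.
Context {R : realType} {d : nat}.
Implicit Types (x y : 'rV[R]_d).

(** The squared Euclidean norm. It is a polynomial, unlike the sup norm of the row type, so all
    cutoffs and kernels are built on it; [sqn_le_norm] and [norm_le_sqn] translate between the
    two. *)
Definition sqn x : R := \sum_(i < d) x ord0 i ^+ 2.

Lemma sqn_ge0 x : 0 <= sqn x.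
Proof. by apply: sumr_ge0 => i _; exact: sqr_ge0. Qed.

Lemma smooth_sqn : smooth sqn.
Proof. by apply: smooth_sum => i; apply: smoothX; exact: smooth_coord. Qed.

Lemma continuous_sqn : continuous sqn.
Proof. exact: smooth_continuous smooth_sqn. Qed.

Lemma coord_le_sqn x i : x ord0 i ^+ 2 <= sqn x.
Proof.
by rewrite /sqn (bigD1 i)//= lerDl; apply: sumr_ge0 => j _; exact: sqr_ge0.
Qed.

Lemma coord_le_norm x i : `|x ord0 i| <= `|x|.
Proof.
rewrite [leRHS]/Num.norm /= mx_normrE; apply/bigmax_geP; right => /=.
by exists (ord0, i).
Qed.

Lemma norm_le_coord x (r : R) : 0 <= r -> (forall i, `|x ord0 i| <= r) -> `|x| <= r.
Proof.
move=> r0 h; rewrite [leLHS]/Num.norm /= mx_normrE; apply/bigmax_leP; split => //= -[i j] _ /=.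
by rewrite (ord1 i).
Qed.

Lemma sqn_le_norm x : sqn x <= d%:R * `|x| ^+ 2.
Proof.
rewrite /sqn (le_trans (@ler_sum _ _ _ _ _ (fun=> `|x| ^+ 2) _))//.
  by move=> i _; rewrite -[leLHS]ger0_norm ?sqr_ge0// normrX lerXn2r ?nnegrE// coord_le_norm.
by rewrite sumr_const card_ord mulr_natl.
Qed.

Lemma norm_le_sqn x (r : R) : 0 <= r -> sqn x <= r ^+ 2 -> `|x| <= r.
Proof.
move=> r0 h; apply: norm_le_coord => // i.
rewrite -(@ler_pXn2r _ 2)// ?nnegrE// -normrX ger0_norm ?sqr_ge0//.
exact: le_trans (coord_le_sqn _ _) h.
Qed.

Lemma sqnZ (a : R) x : sqn (a *: x) = a ^+ 2 * sqn x.
Proof. by rewrite /sqn mulr_sumr; apply: eq_bigr => i _; rewrite mxE exprMn. Qed.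

Lemma compact_sqn (r : R) : 0 <= r -> compact [set x | sqn x <= r ^+ 2].
Proof.
move=> r0; apply: bounded_closed_compact.
  exists r; split; first exact: num_real.
  by move=> M rM x /= /(norm_le_sqn r0) /le_trans; apply; exact: ltW.
apply: (@closed_comp _ _ sqn [set t | t <= r ^+ 2]) => //.
by move=> x _; exact: continuous_sqn.
Qed.

(** A radial cutoff from radius a to radius b, written with [sqn] rather than its root so that it is
    smooth at the origin too. *)
Definition bump (a b : R) x : R := step ((b ^+ 2 - sqn x) / (b ^+ 2 - a ^+ 2)).

Lemma smooth_bump a b : smooth (bump a b).
Proof.
apply: smooth_step; apply: smoothM; last exact: smooth_cst.
by apply: smoothB; [exact: smooth_cst|exact: smooth_sqn].
Qed.

Lemma bump_ge0 a b x : 0 <= bump a b x. Proof. exact: step_ge0. Qed.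

Lemma bump_le1 a b x : bump a b x <= 1. Proof. exact: step_le1. Qed.

Lemma bump_eq1 a b x : 0 <= a < b -> sqn x <= a ^+ 2 -> bump a b x = 1.
Proof.
move=> /andP[a0 ab] xa; rewrite /bump step_eq1//.
have : 0 < b ^+ 2 - a ^+ 2 by rewrite subr_gt0 ltr_pXn2r// nnegrE// (le_trans a0)// ltW.
by move=> h; rewrite ler_pdivlMr// mul1r lerD2l lerN2.
Qed.

Lemma bump_eq0 a b x : 0 <= a < b -> b ^+ 2 <= sqn x -> bump a b x = 0.
Proof.
move=> /andP[a0 ab] xb; rewrite /bump step_eq0//.
have : 0 < b ^+ 2 - a ^+ 2 by rewrite subr_gt0 ltr_pXn2r// nnegrE// (le_trans a0)// ltW.
by move=> h; rewrite ler_pdivrMr// mul0r subr_le0.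
Qed.

Lemma bump_gt0 a b x : 0 <= a < b -> sqn x < b ^+ 2 -> 0 < bump a b x.
Proof.
move=> /andP[a0 ab] xb; rewrite /bump step_gt0//.
have : 0 < b ^+ 2 - a ^+ 2 by rewrite subr_gt0 ltr_pXn2r// nnegrE// (le_trans a0)// ltW.
by move=> h; rewrite divr_gt0// subr_gt0.
Qed.

Lemma test_bump a b (U : set 'rV[R]_d) : 0 <= a < b ->
  [set x | sqn x <= b ^+ 2] `<=` U -> test_function U (bump a b).
Proof.
move=> ab bU; apply: (@test_of _ _ _ [set x | sqn x <= b ^+ 2]) => //.
- exact: smooth_bump.
- by apply: compact_sqn; case/andP: ab => /le_trans + /ltW; apply.
- by move=> x /= /negP; rewrite -ltNge => /ltW; exact: bump_eq0.
Qed.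

Lemma partial_sqn i x : partial i sqn x = 2 * x ord0 i.
Proof.
rewrite /partial; have -> : sqn = \sum_(j < d) (fun y : 'rV[R]_d => y ord0 j ^+ 2).
  by apply/funext => y; rewrite /sqn fct_sumE.
rewrite derive_sum; last first.
  move=> j; exact: (@smooth_derivable _ _ _ _ _ (smoothX 2 (smooth_coord j))).
rewrite (bigD1 i)//= big1 ?addr0; last first.
  move=> j ji; have h := is_derive_coord j i x.
  have [_ ->] := @is_deriveX _ _ _ 2 _ _ _ h.
  by rewrite (negbTE ji) scaler0.
have h := is_derive_coord i i x.
have [_ ->] := @is_deriveX _ _ _ 2 _ _ _ h.
by rewrite eqxx expr1 [_ *: 1]mulr1 mulr_natl.
Qed.

End bumps.

(** * Lebesgue measure and integration *)

Section borel.
Context {R : realType} {n : nat}.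

Lemma row_ball_measurable (q : 'rV[R]_n) (r : R) :
  measurable [set x : 'rV[R]_n | forall i, `|q ord0 i - x ord0 i| < r].
Proof.
rewrite (_ : mkset _ = \bigcap_(i in [set: 'I_n])
    (@row_coord R n i @^-1` [set t | `|q ord0 i - t| < r])); last first.
  by apply/seteqP; split => x /= h i => [_|]; exact: h.
apply: fin_bigcap_measurable; first exact: finite_finset.
move=> i _; rewrite -[X in measurable X]setTI; apply: measurable_row_coord => //.
have -> : [set t | `|q ord0 i - t| < r] = ball (q ord0 i) r by [].
exact: measurable_ball.
Qed.

(** The sigma-algebra is generated by the coordinates, so an open set is written as a countable
    union of cubes with rational centres and radii 1/(N+1), enumerated through [unpickle]. *)
Lemma open_row_measurable (A : set 'rV[R]_n) : open A -> measurable A.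
Proof.
move=> oA.
pose B (p : 'rV[rat]_n * nat) : set 'rV[R]_n :=
  [set x | forall i, `|ratr (p.1 ord0 i) - x ord0 i| < p.2.+1%:R^-1].
pose I := [set p | B p `<=` A].
have -> : A = \bigcup_(p in I) B p.
  apply/seteqP; split => [x Ax|x [p Ip] /Ip//].
  have /nbhs_ballP[e /= e0 xA] : nbhs x A by apply: open_nbhs_nbhs.
  have [N hN] : exists N : nat, N.+1%:R^-1 < e / 2.
    have e20 : 0 < e / 2 by rewrite divr_gt0.
    have [N _ hN] := near_infty_natSinv_lt (PosNum e20).
    by exists N; exact: (hN N (leqnn N)).
  have hq i : exists q : rat, `|ratr q - x ord0 i| < N.+1%:R^-1.
    have /rat_in_itvoo[q] : x ord0 i < x ord0 i + N.+1%:R^-1 by rewrite ltrDl invr_gt0.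
    rewrite in_itv/= => /andP[q1 q2]; exists q.
    by rewrite gtr0_norm ?subr_gt0// ltrBlDl.
  have [q qP] := choice hq.
  exists (\row_i q i, N); last by move=> i /=; rewrite mxE.
  move=> y By; apply: xA; split => // i j; rewrite (ord1 i) /ball/=.
  have := By j; rewrite /= mxE => h1.
  have -> : x ord0 j - y ord0 j = (x ord0 j - ratr (q j)) + (ratr (q j) - y ord0 j) by ring.
  rewrite (le_lt_trans (ler_normD _ _))//.
  rewrite (_ : e = e / 2 + e / 2); last by field.
  by rewrite ltrD// ?(lt_trans _ hN)// distrC; exact: qP.
pose F (k : nat) := if unpickle k is Some p then (if `[< I p >] then B p else set0) else set0.
rewrite (_ : \bigcup_(p in I) B p = \bigcup_k F k).
  apply: bigcupT_measurable => k; rewrite /F; case: unpickle => // -[q N].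
  by case: ifP => // _; have := row_ball_measurable (\row_i ratr (q ord0 i)) N.+1%:R^-1;
    congr measurable; apply/seteqP; split => x /= h i; have := h i; rewrite mxE.
apply/seteqP; split => x.
  by case=> p Ip Bx; exists (pickle p) => //; rewrite /F pickleK ifT//; exact/asboolP.
case=> k _; rewrite /F; case: unpickle => // p; case: ifP => // /asboolP Ip Bx.
by exists p.
Qed.

Lemma closed_row_measurable (A : set 'rV[R]_n) : closed A -> measurable A.
Proof.
by move=> /closed_openC/open_row_measurable/measurableC; rewrite setCK.
Qed.

Lemma continuous_row_measurable (f : 'rV[R]_n -> R) : continuous f ->
  measurable_fun [set: 'rV[R]_n] f.
Proof.
move=> cf; apply: (measurability _ (RGenOpens.measurableE R)).
move=> _ [_ [a [b ->]] <-]; rewrite setTI.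
apply: open_row_measurable; move/continuousP : cf; apply; exact: interval_open.
Qed.

End borel.

Section affine.
Context {R : realType}.

(** The push-forward under x -> a x + b of a times Lebesgue measure agrees with Lebesgue measure on
    half-open intervals, hence everywhere. *)
Lemma lebesgue_affine (a b : R) (f : measurableTypeR R -> \bar R) : 0 < a ->
  measurable_fun [set: measurableTypeR R] f -> (forall x, (0 <= f x)%E) ->
  (\int[lebesgue_measure]_x f (a * x + b)%R =
   (a^-1)%R%:E * \int[lebesgue_measure]_x f x)%E.
Proof.
move=> a0 mf f0.
pose T (x : measurableTypeR R) : measurableTypeR R := a * x + b.
have mT : measurable_fun [set: measurableTypeR R] T.
  by apply: measurable_funD => //; exact: measurable_funM.
pose la := mscale (NngNum (ltW a0)) (@lebesgue_measure R).
have E A : measurable A -> pushforward la T A = lebesgue_measure A.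
  move=> mA; apply/esym/lebesgue_measure_unique => //= X; rewrite /ocitv => -[[x y] _ <-].
  rewrite /la /pushforward /mscale /=.
  have -> : T @^-1` `]x, y]%classic = `](x - b) / a, (y - b) / a]%classic.
    apply/seteqP; split => z /=; rewrite /T !in_itv/= ltr_pdivrMr// ler_pdivlMr//.
      by rewrite ltrBlDr lerBrDr mulrC.
    by rewrite ltrBlDr lerBrDr mulrC.
  rewrite !lebesgue_measure_itv /= !lte_fin ltr_pM2r ?invr_gt0// ltrD2r.
  case: ifP => _; last by rewrite mule0.
  by rewrite -!EFinB -EFinM; congr EFin; field; rewrite gt_eqF.
have -> : (\int[lebesgue_measure]_x f x = \int[pushforward la T]_x f x)%E.
  by apply: eq_measure_integral => A mA _; apply/esym; exact: E.
rewrite ge0_integral_pushforward// /la ge0_integral_mscale//=; last exact: measurableT_comp.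
  by rewrite muleA -EFinM mulVf ?mul1e// gt_eqF.
by rewrite preimage_setT.
Qed.

Lemma leb_integralS d (f : 'rV[R]_d.+1 -> \bar R) :
  measurable_fun [set: 'rV[R]_d.+1] f -> (forall x, (0 <= f x)%E) ->
  (\int[leb R d.+1]_x f x =
   \int[lebesgue_measure]_s \int[leb R d]_x f (rcons_row (s, x)))%E.
Proof.
move=> mf f0.
have mg : measurable_fun setT (f \o @rcons_row R d).
  by apply: measurableT_comp => //; exact: measurable_rcons_row.
rewrite -(@fubini_tonelli1 _ _ _ _ _ lebesgue_measure (leb R d) (f \o @rcons_row R d))//=.
by rewrite /row_prod ge0_integral_pushforward//; exact: measurable_rcons_row.
Qed.

Lemma measurable_row_affine d (a : R) (b : 'rV[R]_d) :
  measurable_fun [set: 'rV[R]_d] (fun x : 'rV[R]_d => a *: x + b).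
Proof.
apply: measurable_fun_row => i.
rewrite (_ : _ \o _ = fun x => a * row_coord i x + b ord0 i).
  apply: measurable_funD => //; apply: measurable_funM => //.
  exact: measurable_row_coord.
by apply/funext => x; rewrite /row_coord /= !mxE.
Qed.

(** Induction on d: Tonelli splits off the last coordinate, [lebesgue_affine] rescales it and the
    induction hypothesis rescales the others. *)
Lemma leb_affine d (a : R) (b : 'rV[R]_d) (f : 'rV[R]_d -> \bar R) : 0 < a ->
  measurable_fun [set: 'rV[R]_d] f -> (forall x, (0 <= f x)%E) ->
  (\int[leb R d]_x f (a *: x + b)%R = (a^-1 ^+ d)%R%:E * \int[leb R d]_x f x)%E.
Proof.
move=> a0; elim: d b f => [|d IH] b f mf f0.
  rewrite expr0 mul1e; apply: eq_integral => x _.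
  by congr f; apply/rowP => -[].
have mfa : measurable_fun setT (fun x : 'rV[R]_d.+1 => f (a *: x + b)).
  by apply: measurableT_comp => //; exact: measurable_row_affine.
rewrite !leb_integralS//.
pose F s := (\int[leb R d]_x f (rcons_row (s, x)))%E.
have mg : measurable_fun setT (f \o @rcons_row R d).
  by apply: measurableT_comp => //; exact: measurable_rcons_row.
have mF : measurable_fun setT F.
  apply: (@measurable_fun_fubini_tonelli_F _ _ _ _ _ (leb R d) (f \o @rcons_row R d)) => //.
  by move=> x; exact: f0.
have F0 s : (0 <= F s)%E by apply: integral_ge0.
pose b' : 'rV[R]_d := \row_i b ord0 (lift ord_max i).
transitivity (\int[lebesgue_measure]_s ((a^-1 ^+ d)%R%:E * F (a * s + b ord0 ord_max)%R))%E.
  apply: eq_integral => s _; rewrite /F -(IH b')//.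
  - apply: eq_integral => x _; congr f; apply/rowP => i; rewrite !mxE.
    by have [j ->|->] := unliftP ord_max i; rewrite ?liftK ?unlift_none//= !mxE.
  - have hs : measurable_fun [set: 'rV[R]_d] (fun x => (a * s + b ord0 ord_max, x) : measurableTypeR R * 'rV[R]_d).
      exact: measurable_fun_pair.
    exact: (measurableT_comp mg hs).
rewrite ge0_integralZl//; last 2 first.
- apply: (@measurableT_comp _ _ _ _ _ _ F) => //.
  by apply: measurable_funD => //; exact: measurable_funM.
- by rewrite lee_fin exprn_ge0// invr_ge0 ltW.
by rewrite lebesgue_affine// muleA -EFinM -exprSr.
Qed.

End affine.

Section real_integral.
Context {R : realType} {d : nat}.
Implicit Types (f g : 'rV[R]_d -> R) (U K : set 'rV[R]_d).

Local Notation mu := (leb R d).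
Local Notation Int f := (\int[mu]_x f x).
Local Notation E i := (delta_mx ord0 i : 'rV[R]_d).

Definition intg f := mu.-integrable [set: 'rV[R]_d] (EFin \o f).

Lemma intg_measurable f : intg f -> measurable_fun [set: 'rV[R]_d] f.
Proof. by move=> /integrableP[/measurable_EFinP]. Qed.

Lemma intgD f g : intg f -> intg g -> intg (f \+ g).
Proof. by move=> hf hg; have := integrableD measurableT hf hg. Qed.

Lemma intgB f g : intg f -> intg g -> intg (f \- g).
Proof. by move=> hf hg; have := integrableB measurableT hf hg. Qed.

Lemma intgZ (c : R) f : intg f -> intg (fun x => c * f x).
Proof. by move=> hf; have := integrableZl measurableT c hf. Qed.

Lemma intg0 : intg (fun=> 0).
Proof. exact: integrable0. Qed.

Lemma intg_sum I (r : seq I) (P : pred I) (F : I -> 'rV[R]_d -> R) :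
  (forall i, intg (F i)) -> intg (fun x => \sum_(i <- r | P i) F i x).
Proof.
move=> iF; rewrite /intg (_ : _ \o _ = fun x => (\sum_(i <- r | P i) (F i x)%:E)%E).
  by apply: integrable_sum => //= i _; exact: iF.
by apply/funext => x /=; rewrite sumEFin.
Qed.

Lemma intg_norm f : intg f -> intg (fun x => `|f x|).
Proof. exact: integrable_norm. Qed.

Lemma le_intg f g : measurable_fun [set: 'rV[R]_d] f ->
  (forall x, `|f x| <= g x) -> intg g -> intg f.
Proof.
move=> mf fg ig; apply: (le_integrable measurableT _ _ ig); first exact/measurable_EFinP.
by move=> x _ /=; rewrite lee_fin (le_trans (fg x))// ler_norm.
Qed.

Lemma IntD f g : intg f -> intg g -> Int (f \+ g) = Int f + Int g.
Proof. by move=> hf hg; rewrite -RintegralD. Qed.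

Lemma IntB f g : intg f -> intg g -> Int (f \- g) = Int f - Int g.
Proof. by move=> hf hg; rewrite -RintegralB. Qed.

Lemma IntZ (c : R) f : intg f -> \int[mu]_x (c * f x) = c * Int f.
Proof. by move=> hf; rewrite RintegralZl. Qed.

Lemma Int0 : \int[mu]_x (0 : R) = 0.
Proof. by rewrite /Rintegral integral0. Qed.

Lemma Int_ext f g : f =1 g -> Int f = Int g.
Proof. by move=> fg; apply: eq_Rintegral => x _; exact: fg. Qed.

Lemma Int_sum I (r : seq I) (P : pred I) (F : I -> 'rV[R]_d -> R) :
  (forall i, intg (F i)) ->
  \int[mu]_x (\sum_(i <- r | P i) F i x) = \sum_(i <- r | P i) Int (F i).
Proof.
move=> iF; elim: r => [|a r IH].
  by rewrite big_nil (@Int_ext _ (fun=> 0)) ?Int0// => x; rewrite big_nil.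
rewrite big_cons (@Int_ext _ (fun x => if P a then F a x + \sum_(i <- r | P i) F i x
    else \sum_(i <- r | P i) F i x)); last by move=> x; rewrite big_cons.
case: (P a) => //; rewrite -IH -IntD//; exact: intg_sum.
Qed.

Lemma Int_ge0 f : (forall x, 0 <= f x) -> 0 <= Int f.
Proof. by move=> f0; exact: Rintegral_ge0. Qed.

Lemma Int_le f g : intg f -> intg g -> (forall x, f x <= g x) -> Int f <= Int g.
Proof. by move=> hf hg fg; apply: le_Rintegral. Qed.

Lemma Int_norm f : intg f -> `|Int f| <= \int[mu]_x `|f x|.
Proof. by move=> hf; apply: le_normr_Rintegral. Qed.

Lemma Int_EFin f : intg f -> (\int[mu]_x (f x)%:E)%E = (Int f)%:E.
Proof.
by move=> hf; rewrite /Rintegral fineK//; exact: integrable_fin_num.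
Qed.

Lemma intg_affine (a : R) (b : 'rV[R]_d) f : 0 < a -> intg f ->
  intg (fun x => f (a *: x + b)).
Proof.
move=> a0 hf; have mf := intg_measurable hf; apply/integrableP; split.
  apply/measurable_EFinP; apply: (measurableT_comp mf); exact: measurable_row_affine.
rewrite (leb_affine b (f := fun x => `|(f x)%:E|%E) a0)//.
  by rewrite lte_mul_pinfty ?lee_fin ?exprn_ge0 ?invr_ge0 ?ltW//; case/integrableP: hf.
by apply: measurableT_comp => //; exact/measurable_EFinP.
Qed.

Lemma Int_affine (a : R) (b : 'rV[R]_d) f : 0 < a -> intg f ->
  \int[mu]_x f (a *: x + b) = a^-1 ^+ d * Int f.
Proof.
move=> a0 hf; have mf := intg_measurable hf.
have mE : measurable_fun [set: 'rV[R]_d] (EFin \o f) by exact/measurable_EFinP.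
rewrite /Rintegral integralE [in RHS]integralE.
have := @leb_affine R d a b (funepos (EFin \o f)) a0 (measurable_funepos mE) (fun x => funepos_ge0 _ _).
have := @leb_affine R d a b (funeneg (EFin \o f)) a0 (measurable_funeneg mE) (fun x => funeneg_ge0 _ _).
have -> : (\int[mu]_x funeneg (EFin \o f) (a *: x + b)%R =
   \int[mu]_x funeneg (fun x => (f (a *: x + b)%R)%:E) x)%E by apply: eq_integral => x _; rewrite !funenegE.
have -> : (\int[mu]_x funepos (EFin \o f) (a *: x + b)%R =
   \int[mu]_x funepos (fun x => (f (a *: x + b)%R)%:E) x)%E by apply: eq_integral => x _; rewrite !funeposE.
move=> -> ->; rewrite -muleBr//; last first.
  by apply: fin_num_adde_defl; rewrite fin_numN; exact: integrable_neg_fin_num.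
rewrite fineM//.
by rewrite fin_numB integrable_pos_fin_num ?integrable_neg_fin_num.
Qed.

Lemma leb_cube (r : R) : 0 <= r ->
  leb R d [set x | forall i, x ord0 i \in `[- r, r]] = ((r *+ 2) ^+ d)%:E.
Proof.
move=> r0; have := @leb_box R d (fun=> `[- r, r]%classic) (fun=> measurable_itv _).
move=> ->; rewrite (eq_bigr (fun=> (r *+ 2)%:E)); last first.
  move=> i _; rewrite lebesgue_measure_itv/= lte_fin; case: ifPn.
    by move=> _; rewrite -EFinB opprK mulr2n.
  rewrite -leNgt => h; have -> : r = 0 by apply/eqP; rewrite eq_le r0 andbT; lra.
  by rewrite mul0rn.
by rewrite prodEFin prodr_const card_ord.
Qed.

Definition cube (r : R) : set 'rV[R]_d := [set x | `|x| <= r].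

Lemma cubeE (r : R) : 0 <= r -> cube r = [set x | forall i, x ord0 i \in `[- r, r]].
Proof.
move=> r0; apply/seteqP; split => x /=.
  by move=> xr i; rewrite in_itv/= -ler_norml (le_trans (coord_le_norm _ _)).
by move=> h; apply: norm_le_coord => // i; rewrite ler_norml; have := h i; rewrite in_itv.
Qed.

Lemma closed_cube (r : R) : closed (cube r).
Proof.
apply: (@closed_comp _ _ (fun x : 'rV[R]_d => `|x|) [set t | t <= r]).
  by move=> x _; exact: norm_continuous.
exact: closed_le.
Qed.

Lemma measurable_cube (r : R) : measurable (cube r).
Proof. by apply: closed_row_measurable; exact: closed_cube. Qed.

Definition cubevol (r : R) : R := (r *+ 2) ^+ d.

Lemma mu_cube (r : R) : 0 <= r -> mu (cube r) = (cubevol r)%:E.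
Proof. by move=> r0; rewrite cubeE// leb_cube. Qed.

Lemma mu_cube_lty (r : R) : 0 <= r -> (mu (cube r) < +oo)%E.
Proof. by move=> r0; rewrite mu_cube// ltry. Qed.

Lemma cubevol_ge0 r : 0 <= r -> 0 <= cubevol r.
Proof. by move=> r0; rewrite exprn_ge0// mulrn_wge0. Qed.

Lemma intg_bounded f (C r : R) : 0 <= r -> measurable_fun [set: 'rV[R]_d] f ->
  (forall x, `|x| <= r -> `|f x| <= C) -> (forall x, r < `|x| -> f x = 0) ->
  intg f.
Proof.
move=> r0 mf fC f0.
have h : mu.-integrable (cube r) (EFin \o f).
  apply: measurable_bounded_integrable => //.
  - exact: measurable_cube.
  - exact: mu_cube_lty.
  - exact: measurable_funTS.
  - exists C; split; first exact: num_real.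
    by move=> M CM x /= xr; rewrite (le_trans (fC _ xr))// ltW.
have := (integrable_mkcond (EFin \o f) (measurable_cube r)).1 h.
congr (integrable _ _ _); apply/funext => x; rewrite patchE; case: ifPn => // /negP xr.
rewrite /= f0// ltNge; apply/negP => h'; apply: xr; exact/mem_set.
Qed.

Lemma Int_bounded f (C r : R) : 0 <= r -> 0 <= C -> measurable_fun [set: 'rV[R]_d] f ->
  (forall x, `|x| <= r -> `|f x| <= C) -> (forall x, r < `|x| -> f x = 0) ->
  `|Int f| <= C * cubevol r.
Proof.
move=> r0 C0 mf fC f0.
have hf := intg_bounded r0 mf fC f0.
rewrite (le_trans (Int_norm hf))//.
have -> : \int[mu]_x `|f x| = \int[mu]_(x in cube r) `|f x|.
  rewrite [RHS]Rintegral_mkcond; apply: Int_ext => x; rewrite patchE; case: ifPn => // /negP xr.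
  rewrite f0 ?normr0// ltNge; apply/negP => h'; apply: xr; exact/mem_set.
have hn := intg_norm hf.
have mc := measurable_cube r.
apply: (@le_trans _ _ (\int[mu]_(x in cube r) C)).
  apply: le_Rintegral => //.
  - exact: integrableS hn.
  - apply: measurable_bounded_integrable => //; first exact: mu_cube_lty.
    by exists `|C|; split => // M CM x _ /=; rewrite ltW.
rewrite Rintegral_cst//; have /(congr1 fine)/= h := mu_cube r0.
by rewrite -h.
Qed.

Lemma test_bounded U f : test_function U f ->
  exists C r : R, [/\ 0 <= C, 0 < r, forall x, `|f x| <= C & forall x, r <= `|x| -> f x = 0].
Proof.
move=> [sf cf Uf].
have [r [rr hr]] := compact_bounded cf.
have r1 : 0 < `|r| + 1 by rewrite ltr_wpDl.
have hK x : supp f x -> `|x| < `|r| + 1.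
  move=> sx; rewrite (@le_lt_trans _ _ (`|r| + 2^-1))//; last by rewrite ltrD2l invf_lt1// ltr1n.
  by apply: hr sx => //; rewrite (le_lt_trans (ler_norm _))// ltrDl invr_gt0.
have [C [Cr hC]] : bounded_set (f @` supp f).
  apply: compact_bounded; apply: continuous_compact => //.
  by apply: continuous_subspaceT; exact: smooth_continuous.
exists (`|C| + 1), (`|r| + 1); split => //.
- move=> x; have [sx|/suppP ->] := pselect (supp f x); last by rewrite normr0 ltW// ltr_wpDl.
  by apply: hC; [rewrite (le_lt_trans (ler_norm _))// ltrDl|exists x].
- by move=> x xr; apply: suppP => /hK; rewrite ltNge xr.
Qed.

Lemma smooth_measurable f : smooth f -> measurable_fun [set: 'rV[R]_d] f.
Proof. by move=> sf; apply: continuous_row_measurable; exact: smooth_continuous. Qed.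

Lemma test_intg U f : test_function U f -> intg f.
Proof.
move=> tf; have [C [r [C0 r0 fC f0]]] := test_bounded tf.
apply: (@intg_bounded _ C r (ltW r0)) => //; first exact: smooth_measurable (test_smooth tf).
by move=> x /ltW; exact: f0.
Qed.

Lemma line_mvt f x i (t : R) : 0 < t -> smooth f ->
  exists2 s : R, 0 < s < t & f (t *: E i + x) - f x = t * partial i f (s *: E i + x).
Proof.
move=> t0 sf.
pose g (s : R) := f (s *: E i + x).
have dg s : is_derive (s : R) (1 : R) g (partial i f (s *: E i + x)).
  have E0 : (fun h : R => g (h *: (1 : R) + s)) = (fun h => f (h *: E i + (s *: E i + x))).
    by apply/funext => h; rewrite /g [_ *: 1]mulr1 scalerDl addrA.
  apply: DeriveDef; last by rewrite derive_line E0 /partial [in RHS]derive_line.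
  by apply/derivable1P; rewrite E0; have /derivable1P := @smooth_derivable _ _ f (s *: E i + x) i sf.
have cg : {within `[0, t], continuous g}.
  apply: continuous_subspaceT => s; apply: differentiable_continuous.
  by apply/derivable1_diffP; have [] := dg s.
have [s st gs] := @MVT R g (fun s => partial i f (s *: E i + x)) 0 t t0 (fun s _ => dg s) cg.
exists s; first by move: st; rewrite in_itv.
by move: gs; rewrite /g scale0r add0r subr0 mulrC.
Qed.

Lemma partial_lipschitz f (C : R) x i (t : R) : 0 < t -> smooth f ->
  (forall y, `|partial i f y| <= C) -> `|f (t *: E i + x) - f x| <= t * C.
Proof.
move=> t0 sf h; have [s _ ->] := line_mvt x i t0 sf.
by rewrite normrM gtr0_norm// ler_pM2l.
Qed.

Lemma Int_dominated (F : nat -> 'rV[R]_d -> R) f g :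
  (forall n, measurable_fun [set: 'rV[R]_d] (F n)) -> measurable_fun [set: 'rV[R]_d] f ->
  (forall x, F n x @[n --> \oo] --> f x) ->
  intg g -> (forall n x, `|F n x| <= g x) ->
  Int (F n) @[n --> \oo] --> Int f.
Proof.
move=> mF mf Ff ig Fg.
have Ff' x : ((F n x)%:E @[n --> \oo] --> (f x)%:E)%E.
  by apply/fine_cvgP; split; [exact: nearW|exact: Ff].
have Fg' x n : (`|(F n x)%:E| <= (g x)%:E)%E by rewrite lee_fin.
have [h1 _ h2] := @dominated_convergence _ _ R mu setT measurableT (fun n x => (F n x)%:E)
  (fun x => (f x)%:E) (fun x => (g x)%:E) (fun n => (measurable_EFinP _ _).2 (mF n))
  ((measurable_EFinP _ _).2 mf)
  (aeW _ (fun x _ => Ff' x)) ig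
  (aeW _ (fun x n _ => Fg' x n)).
have if_ : intg f by exact: h1.
by have := h2; rewrite (Int_EFin if_) => /fine_cvgP[_].
Qed.

(** The difference quotients have integral 0 by translation invariance, and they converge
    dominatedly to the partial derivative. *)
Lemma Int_partial U f i : test_function U f -> Int (partial i f) = 0.
Proof.
move=> tf; have sf := test_smooth tf.
have [C [r [C0 r0 fC f0]]] := test_bounded tf.
have [C' [r' [C'0 r'0 fC' f0']]] := test_bounded (test_partial i tf).
pose t (n : nat) : R := n.+1%:R^-1.
have t0 n : 0 < t n by rewrite invr_gt0.
(* The factor [1 *:] puts the translate in the form of [Int_affine]. *)
pose F n x := (t n)^-1 * (f (1 *: x + t n *: E i) - f x).
have iF n : intg (fun x => f (1 *: x + t n *: E i)) by apply: intg_affine => //; exact: test_intg tf.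
have F0 n : Int (F n) = 0.
  rewrite /F IntZ; last by apply: intgB => //; exact: test_intg tf.
  rewrite (@IntB (fun x => f (1 *: x + t n *: E i)) f) //; last exact: test_intg tf.
  by rewrite Int_affine ?ltr01//; [rewrite invr1 expr1n mul1r subrr mulr0|exact: test_intg tf].
have nE : `|E i| <= 1.
  by apply: norm_le_coord => // j; rewrite !mxE/=; case: eqP => //=; rewrite ?normr1 ?normr0.
have : Int (F n) @[n --> \oo] --> Int (partial i f).
  apply: (@Int_dominated F (partial i f) (fun x => C' * \1_(cube (r + 1)) x)).
  - move=> n; apply: measurable_funM => //; apply: measurable_funB.
      exact: intg_measurable (iF n).
    exact: smooth_measurable.
  - exact: smooth_measurable (smooth_partial _ _).
  - move=> x; have dfx := @smooth_derivable _ _ f x i sf.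
    have tc : t n @[n --> \oo] --> (0 : R) by exact: cvg_harmonic.
    have := (cvgr_dnbhsP _ _ _).1 dfx t (conj (fun n => lt0r_neq0 (t0 n)) tc).
    apply: cvg_trans; apply: near_eq_cvg; apply: nearW => n.
    by rewrite /F /= scale1r [x + _]addrC.
  - apply: (@intg_bounded _ C' (r + 1)); first by rewrite addr_ge0// ltW.
    + by apply: measurable_funM => //; apply: measurable_indic; exact: measurable_cube.
    + by move=> x xr; rewrite indicE mem_set// mulr1 ger0_norm.
    + by move=> x xr; rewrite indicE memNset ?mulr0// /cube/= leNgt xr.
  - move=> n x; rewrite /F scale1r normrM gtr0_norm ?invr_gt0//.
    rewrite indicE; case: (boolP (x \in _)) => [_|/negP xr].
      by rewrite mulr1 ler_pdivrMl// [x + _]addrC; exact: partial_lipschitz.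
    have {}xr : r + 1 < `|x| by rewrite ltNge; apply/negP => h; apply: xr; exact/mem_set.
    rewrite (f0 x) ?(f0 (x + _)) ?subrr ?normr0 ?mulr0//; last by rewrite ltW// (lt_trans _ xr)// ltrDl.
    have : `|x| <= `|x + t n *: E i| + `|t n *: E i|.
      by rewrite -[X in `|X| <= _](addrK (t n *: E i)) ler_normB.
    have : `|t n *: E i| <= 1.
      rewrite normrZ gtr0_norm// mulr_ile1//; first exact: ltW.
      by rewrite /t invf_le1 ?ltr0n// ler1n.
    by move: xr; lra.
rewrite (eq_cvg _ _ F0) => h; apply/esym.
exact: (cvg_unique (@Rhausdorff R) (cvg_cst 0) h).
Qed.

End real_integral.

(** * Geometric convergence and completeness of L^2 *)

Section geometric_sequences.
Context {R : realType}.

Lemma geo_small (c q e : R) : 0 <= q < 1 -> 0 < e ->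
  exists N : nat, forall n, (N <= n)%N -> c * q ^+ n < e.
Proof.
move=> /andP[q0 q1] e0.
have := @cvg_geometric R c q; rewrite ger0_norm// => /(_ q1) /cvgr0Pnorm_lt /(_ e e0) [N _ hN].
by exists N => n Nn; have := hN n Nn; rewrite /geometric/=; apply: le_lt_trans; exact: ler_norm.
Qed.

Lemma geo_dist (v : nat -> R) (c q : R) : 0 <= q < 1 ->
  (forall k, `|v k.+1 - v k| <= c * q ^+ k) ->
  forall k n, (k <= n)%N -> `|v n - v k| <= c / (1 - q) * q ^+ k.
Proof.
move=> /andP[q0 q1] h k n kn.
have q1' : 0 < 1 - q by rewrite subr_gt0.
have c0 : 0 <= c by have := h 0%N; rewrite expr0 mulr1; apply: le_trans.
suff : `|v n - v k| <= c / (1 - q) * (q ^+ k - q ^+ n).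
  move=> /le_trans; apply; rewrite ler_wpM2l ?divr_ge0 ?(ltW q1')//.
  by rewrite lerBlDr lerDl exprn_ge0.
rewrite -(subnKC kn); elim: (n - k)%N => [|m IH].
  by rewrite addn0 !subrr normr0 mulr0.
rewrite addnS; apply: le_trans (ler_distD (v (k + m)%N) _ _) _.
apply: le_trans (lerD (h _) IH) _.
rewrite exprS le_eqVlt; apply/orP; left; apply/eqP.
by field; rewrite gt_eqF.
Qed.

Lemma geo_cvg (v : nat -> R) (c q : R) : 0 <= q < 1 ->
  (forall k, `|v k.+1 - v k| <= c * q ^+ k) ->
  exists l : R, v n @[n --> \oo] --> l /\ forall k, `|l - v k| <= c / (1 - q) * q ^+ k.
Proof.
move=> q01 h; have hd := geo_dist q01 h.
have cv : cvgn v.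
  apply/cauchy_cvgP/cauchy_exP => e e0.
  have [N hN] := geo_small (c / (1 - q)) q01 e0.
  exists (v N); exists N => // n /= Nn.
  by rewrite /ball/= distrC (le_lt_trans (hd _ _ Nn))// hN.
exists (limn v); split => // k.
have cvk : `|v n - v k| @[n --> \oo] --> `|limn v - v k|.
  by apply: cvg_norm; apply: cvgB => //; exact: cvg_cst.
by apply: (cvgr_to_le cvk); exists k => // n /= kn; exact: hd.
Qed.

End geometric_sequences.

Section L2_functions.
Context {R : realType} {d : nat}.
Implicit Types (f g h : 'rV[R]_d -> R) (U K : set 'rV[R]_d).

Local Notation mu := (leb R d).
Local Notation Int f := (\int[mu]_x f x).

Definition sqint f := measurable_fun [set: 'rV[R]_d] f /\ intg (fun x => f x ^+ 2).

Lemma sqintM f g : sqint f -> sqint g -> intg (fun x => f x * g x).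
Proof.
move=> [mf if_] [mg ig]; apply: (@le_intg _ _ _ (fun x => f x ^+ 2 + g x ^+ 2)).
- exact: measurable_funM.
- move=> x; rewrite ler_norml; apply/andP; split; last by nra.
  by rewrite -subr_ge0 opprK; nra.
- exact: intgD.
Qed.

Lemma sqintD f g : sqint f -> sqint g -> sqint (f \+ g).
Proof.
move=> hf hg; have [mf if_] := hf; have [mg ig] := hg; split.
  exact: measurable_funD.
rewrite (_ : (fun x => _) = (fun x => f x ^+ 2) \+ (fun x => 2 * (f x * g x)) \+ (fun x => g x ^+ 2)).
  by apply: intgD => //; apply: intgD => //; apply: intgZ; exact: sqintM.
by apply/funext => x /=; ring.
Qed.

Lemma sqintZ (c : R) f : sqint f -> sqint (fun x => c * f x).
Proof.
move=> [mf if_]; split; first exact: measurable_funM.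
rewrite (_ : (fun x => _) = (fun x => c ^+ 2 * f x ^+ 2)); first exact: intgZ.
by apply/funext => x; rewrite exprMn.
Qed.

Lemma sqint0 : sqint (fun=> 0).
Proof.
split; first exact: measurable_cst.
by rewrite (_ : (fun x => _) = (fun=> 0)) ?funeqE//; [exact: intg0|move=> x; rewrite expr0n].
Qed.

Lemma sqintB f g : sqint f -> sqint g -> sqint (f \- g).
Proof.
move=> hf hg; have := sqintD hf (sqintZ (-1) hg); congr sqint.
by apply/funext => x /=; rewrite mulN1r.
Qed.

Lemma sqint_bM f g (C : R) : measurable_fun [set: 'rV[R]_d] g ->
  (forall x, `|g x| <= C) -> sqint f -> sqint (fun x => g x * f x).
Proof.
move=> mg gC [mf if_]; split; first exact: measurable_funM.
apply: (@le_intg _ _ _ (fun x => C ^+ 2 * f x ^+ 2)).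
- by apply: measurable_funX; exact: measurable_funM.
- move=> x; rewrite ger0_norm ?sqr_ge0// exprMn ler_wpM2r ?sqr_ge0//.
  by rewrite -[leLHS]ger0_norm ?sqr_ge0// normrX ler_pXn2r ?nnegrE// (le_trans _ (gC x)).
- exact: intgZ.
Qed.

Lemma test_sqint U f : test_function U f -> sqint f.
Proof.
move=> tf; split; first exact: smooth_measurable (test_smooth tf).
have := test_intg (testMl tf (test_smooth tf)).
by congr intg; apply/funext => x; rewrite expr2.
Qed.

Lemma ae_intg f g : measurable_fun [set: 'rV[R]_d] g -> intg f ->
  {ae mu, forall x, f x = g x} -> intg g /\ Int g = Int f.
Proof.
move=> mg if_ fg; have mf := intg_measurable if_.
have fg' : ae_eq mu setT (EFin \o f) (EFin \o g).
  by apply: filterS fg => x /= -> .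
have e1 : (\int[mu]_x (EFin \o f) x = \int[mu]_x (EFin \o g) x)%E.
  by apply: ae_eq_integral => //; exact/measurable_EFinP.
split; last by rewrite /Rintegral -[in LHS]e1.
apply/integrableP; split; first exact/measurable_EFinP.
rewrite (@ae_eq_integral _ _ _ mu setT (abse \o (EFin \o f)))//.
- by case/integrableP: if_.
- by apply: measurableT_comp => //; exact/measurable_EFinP.
- by apply: measurableT_comp => //; exact/measurable_EFinP.
- by apply: filterS fg => x /= <-.
Qed.

Lemma ae_sqint f g : measurable_fun [set: 'rV[R]_d] g -> sqint f ->
  {ae mu, forall x, f x = g x} -> sqint g.
Proof.
move=> mg [mf if_] fg; split => //.
apply: (proj1 (ae_intg _ if_ _)); first exact: measurable_funX.
by apply: filterS fg => x ->.
Qed.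

Lemma sq_le2 (a b c : R) : (a - c) ^+ 2 <= 2 * (a - b) ^+ 2 + 2 * (b - c) ^+ 2.
Proof. by rewrite -subr_ge0; have := sqr_ge0 (a - b - (b - c)); nra. Qed.

(** The sum of the [a k] has integral at most 2, hence is finite almost everywhere, and it dominates
    each term. [fine] replaces infinite values by 0, so the domination holds only almost
    everywhere. *)
Lemma series_bounded_integrable (a : nat -> 'rV[R]_d -> R) :
  (forall k, intg (a k)) -> (forall k x, 0 <= a k x) ->
  (forall k, Int (a k) <= (2 ^- k)) ->
  exists S, [/\ intg S, forall x, 0 <= S x &
    {ae mu, forall x, forall k, a k x <= S x}].
Proof.
move=> ia a0 hI.
pose Sx x := (\sum_(k <oo) (a k x)%:E)%E.
have mS : measurable_fun setT Sx.
  apply: (ge0_emeasurable_sum (P := xpredT)).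
    by move=> k x _ _; rewrite lee_fin.
  by move=> k _; apply/measurable_EFinP; exact: intg_measurable.
have S0 x : (0 <= Sx x)%E by apply: nneseries_ge0 => k _ _; rewrite lee_fin.
have iS : mu.-integrable setT Sx.
  apply/integrableP; split => //.
  rewrite (eq_integral Sx); last by move=> x _; rewrite gee0_abs.
  rewrite integral_nneseries//; last 2 first.
  - by move=> k; apply/measurable_EFinP; exact: intg_measurable.
  - by move=> k x _; rewrite lee_fin.
  have hs : (\sum_(k <oo) (2 / (2 ^ (k + 1))%:R)%:E = (2 / (2 ^ 0)%:R : R)%:E)%E.
    exact: cvg_lim (@cvg_geometric_eseries_half R 2 0).
  apply: (@le_lt_trans _ _ (\sum_(k <oo) (2 / (2 ^ (k + 1))%:R)%:E)%E); last by rewrite hs ltry.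
  apply: lee_nneseries => [k _ _|k _]; first by rewrite Int_EFin// lee_fin; exact: Int_ge0 (a0 k).
  by rewrite Int_EFin// lee_fin addn1 natrX exprS invfM mulrA divff ?mul1r.
have aeS := integrable_ae measurableT iS.
exists (fun x => fine (Sx x)); split.
- have mfS : measurable_fun setT (fun x => fine (Sx x)) by exact: measurableT_comp.
  apply/integrableP; split; first exact/measurable_EFinP.
  rewrite (@ae_eq_integral _ _ _ mu setT (abse \o Sx))//.
  + by case/integrableP: iS.
  + by apply: measurableT_comp => //; exact/measurable_EFinP.
  + exact: measurableT_comp.
  + by apply: filterS aeS => x /(_ I) fx _; rewrite /comp fineK.
- by move=> x; rewrite fine_ge0.
- apply: filterS aeS => x /(_ I) fx k; rewrite -lee_fin fineK//.
  rewrite /Sx (@nneseriesD1 _ (fun k => (a k x)%:E) k)//; last by move=> j; rewrite lee_fin.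
  by rewrite leeDl//; apply: nneseries_ge0 => j _ _; rewrite lee_fin.
Qed.

Theorem riesz_fischer (u : nat -> 'rV[R]_d -> R) : (forall n, sqint (u n)) ->
  (forall e, 0 < e -> exists N, forall m n, (N <= m)%N -> (N <= n)%N ->
     \int[mu]_x (u m x - u n x) ^+ 2 < e) ->
  exists v, sqint v /\ forall e, 0 < e -> exists N, forall n, (N <= n)%N ->
     \int[mu]_x (u n x - v x) ^+ 2 < e.
Proof.
move=> su cu.
(* With squared distances below 8^-k, the weights 4^k still leave integrals at most 2^-k. A common
   integrable majorant S of the weighted squares then gives pointwise increments at most sqrt(S)
   2^-k. *)
have p0 k : 0 < (8 ^- k : R) by rewrite invr_gt0 exprn_gt0.
have [M0 hM0] := choice (fun k => cu _ (p0 k)).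
pose M := fix M k := if k is k'.+1 then maxn (M k').+1 (M0 k'.+1) else M0 0%N.
have MM0 k : (M0 k <= M k)%N by case: k => [|k] //=; rewrite leq_maxr.
have MS k : (M k <= M k.+1)%N by rewrite /= leq_max leqnSn.
pose w k := u (M k).
have sw k : sqint (w k) by exact: su.
have hw k : \int[mu]_x (w k.+1 x - w k x) ^+ 2 < 8 ^- k.
  by apply: hM0; [exact: leq_trans (MM0 _) (MS _)|exact: MM0].
have hI k : \int[mu]_x (4 ^+ k * (w k.+1 x - w k x) ^+ 2) <= 2 ^- k.
  rewrite IntZ; last exact: (sqintB (sw k.+1) (sw k)).2.
  apply: le_trans (ler_wpM2l _ (ltW (hw k))) _; first exact: exprn_ge0.
  rewrite (_ : 8 = 4 * 2)%R; last by rewrite -natrM.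
  by rewrite exprMn invfM mulrA divff ?mul1r// expf_neq0.
have [S [iS S0 aS]] := @series_bounded_integrable
   (fun k x => 4 ^+ k * (w k.+1 x - w k x) ^+ 2)
   (fun k => intgZ _ (sqintB (sw k.+1) (sw k)).2)
   (fun k x => mulr_ge0 (exprn_ge0 _ (ler0n _ _)) (sqr_ge0 _)) hI.
have [A [mA A0 hA]] := aS.
(* Setting the sequence to 0 on the null set A makes it converge at every point, so that the limit
   is measurable as a pointwise limit. *)
pose w' k x := w k x * \1_(~` A) x.
have w'E k x : ~ A x -> w' k x = w k x.
  by move=> Ax; rewrite /w' indicE mem_set// mulr1.
have w'0 k x : A x -> w' k x = 0.
  by move=> Ax; rewrite /w' indicE memNset ?mulr0//; apply.
have half : 0 <= (2^-1 : R) < 1 by rewrite invr_ge0 ler0n invf_lt1// ltr1n.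
have hw' x k : `|w' k.+1 x - w' k x| <= Num.sqrt (S x) * 2^-1 ^+ k.
  have [Ax|Ax] := pselect (A x).
    by rewrite !w'0// subrr normr0 mulr_ge0// exprn_ge0//; case/andP: half.
  have {}hAx : 4 ^+ k * (w k.+1 x - w k x) ^+ 2 <= S x.
    by apply: contrapT => h; apply: Ax; apply: hA => /= /(_ k).
  rewrite !w'E// -sqrtr_sqr -[2^-1 ^+ k]ger0_norm ?exprn_ge0 ?invr_ge0//.
  rewrite -[X in _ <= _ * X]sqrtr_sqr -sqrtrM// ler_wsqrtr//.
  rewrite -exprM mulnC exprM [2^-1 ^+ 2]exprVn exprVn -natrX ler_pdivlMr ?exprn_gt0//.
  by rewrite mulrC.
have [v hv] := choice (fun x => geo_cvg half (hw' x)).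
have h2 : (1 - 2^-1 : R)^-1 = 2 by field.
have hvk k x : (v x - w' k x) ^+ 2 <= 4 * 4 ^- k * S x.
  have := (hv x).2 k; rewrite h2 => h.
  rewrite -[leLHS]ger0_norm ?sqr_ge0// normrX.
  apply: le_trans (_ : (Num.sqrt (S x) * 2 * 2^-1 ^+ k) ^+ 2 <= _).
    by rewrite ler_pXn2r ?nnegrE// mulr_ge0 ?mulr_ge0 ?exprn_ge0 ?invr_ge0.
  rewrite !exprMn sqr_sqrtr// -exprM mulnC exprM [2^-1 ^+ 2]exprVn exprVn -!natrX.
  by rewrite le_eqVlt; apply/orP; left; apply/eqP; ring.
have mw' k : measurable_fun [set: 'rV[R]_d] (w' k).
  apply: measurable_funM; first by case: (sw k).
  by apply: measurable_indic; exact: measurableC.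
have mv : measurable_fun [set: 'rV[R]_d] v.
  by apply: (measurable_fun_cvg mw') => x _; exact: (hv x).1.
have aw k : {ae mu, forall x, w k x = w' k x}.
  exists A; split => // x /= h; apply: contrapT => Ax; apply: h; by rewrite w'E.
have sw' k : sqint (w' k) by apply: ae_sqint (aw k).
have svw k : sqint (v \- w' k).
  split; first exact: measurable_funB.
  apply: (@le_intg _ _ _ (fun x => 4 * 4 ^- k * S x)); last exact: intgZ.
    by apply: measurable_funX; exact: measurable_funB.
  by move=> x; rewrite ger0_norm ?sqr_ge0//; exact: hvk.
have sv : sqint v.
  have := sqintD (svw 0%N) (sw' 0%N); congr sqint.
  by apply/funext => x /=; rewrite subrK.
exists v; split => // e e0.
have e4 : 0 < e / 4 by rewrite divr_gt0.
have [N1 hN1] := cu _ e4.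
have IS0 : 0 <= Int S by exact: Int_ge0.
have quarter : 0 <= (4^-1 : R) < 1 by rewrite invr_ge0 ler0n invf_lt1// ltr1n.
have [N2 hN2] := geo_small (4 * Int S) quarter e4.
pose k := maxn N1 N2.
have kM : (k <= M k)%N.
  elim: k => [|j IH] //; rewrite /= leq_max; apply/orP; left; exact: IH.
exists N1 => n N1n.
have hk1 : \int[mu]_x (u n x - w k x) ^+ 2 < e / 4.
  by apply: hN1 => //; rewrite (leq_trans _ kM)// leq_maxl.
have hk2 : \int[mu]_x (w k x - v x) ^+ 2 <= 4 * 4 ^- k * Int S.
  have ae2 : {ae mu, forall x, (v x - w' k x) ^+ 2 = (w k x - v x) ^+ 2}.
    by apply: filterS (aw k) => x ->; ring.
  have [i1 i2] := @ae_intg (fun x => (v x - w' k x) ^+ 2) (fun x => (w k x - v x) ^+ 2)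
    (measurable_funX 2 (measurable_funB (sw k).1 mv)) (svw k).2 ae2.
  rewrite i2 -IntZ//; apply: Int_le; [exact: (svw k).2|exact: intgZ|exact: hvk].
have hk3 : 4 * 4 ^- k * Int S < e / 4.
  by have := hN2 k (leq_maxr _ _); rewrite exprVn mulrAC.
have := @Int_le _ _ (fun x => (u n x - v x) ^+ 2)
  (fun x => 2 * (u n x - w k x) ^+ 2 + 2 * (w k x - v x) ^+ 2)
  (sqintB (su n) sv).2 (intgD (intgZ 2 (sqintB (su n) (sw k)).2) (intgZ 2 (sqintB (sw k) sv).2))
  (fun x => sq_le2 _ _ _).
rewrite IntD; last 2 first.
- exact: intgZ (sqintB (su n) (sw k)).2.
- exact: intgZ (sqintB (sw k) sv).2.
rewrite !IntZ; last 2 first.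
- exact: (sqintB (sw k) sv).2.
- exact: (sqintB (su n) (sw k)).2.
by lra.
Qed.

End L2_functions.

(** * Hilbert spaces *)

(* Only the seminorm given by ip is used: nrm x = 0 does not entail x = 0, so that
   functions need not be quotiented by equality almost everywhere. *)
Record hilbert (R : realType) := Hilbert {
  hcar :> lmodType R;
  ip : hcar -> hcar -> R;
  ipC : forall x y, ip x y = ip y x;
  ipDl : forall x y z, ip (x + y) z = ip x z + ip y z;
  ipZl : forall a x y, ip (a *: x) y = a * ip x y;
  ip_ge0 : forall x, 0 <= ip x x;
  ip_complete : forall u : nat -> hcar,
    (forall e, 0 < e -> exists N, forall m n, (N <= m)%N -> (N <= n)%N ->
       ip (u m - u n) (u m - u n) < e) ->
    exists l, forall e, 0 < e -> exists N, forall n, (N <= n)%N ->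
       ip (u n - l) (u n - l) < e }.

Section hilbert_theory.
Context {R : realType} {H : hilbert R}.
Implicit Types (x y z : H) (S : H -> Prop).

Definition nrm x : R := Num.sqrt (ip x x).

Lemma ipDr x y z : ip x (y + z) = ip x y + ip x z.
Proof. by rewrite ipC ipDl !(ipC x). Qed.

Lemma ipZr a x y : ip x (a *: y) = a * ip x y.
Proof. by rewrite ipC ipZl ipC. Qed.

Lemma ip0l x : ip 0 x = 0.
Proof. by rewrite -(scale0r 0) ipZl mul0r. Qed.

Lemma ipNl x y : ip (- x) y = - ip x y.
Proof. by rewrite -scaleN1r ipZl mulN1r. Qed.

Lemma ipNr x y : ip x (- y) = - ip x y.
Proof. by rewrite ipC ipNl ipC. Qed.

Lemma ipBl x y z : ip (x - y) z = ip x z - ip y z.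
Proof. by rewrite ipDl ipNl. Qed.

Lemma ipBr x y z : ip x (y - z) = ip x y - ip x z.
Proof. by rewrite ipDr ipNr. Qed.

Lemma ip_suml I (r : seq I) (P : pred I) (F : I -> H) y :
  ip (\sum_(i <- r | P i) F i) y = \sum_(i <- r | P i) ip (F i) y.
Proof.
elim: r => [|a r IH]; first by rewrite !big_nil ip0l.
by rewrite !big_cons; case: (P a); rewrite ?ipDl IH.
Qed.

Lemma nrm_ge0 x : 0 <= nrm x. Proof. exact: sqrtr_ge0. Qed.

Lemma nrm2 x : nrm x ^+ 2 = ip x x. Proof. exact/sqr_sqrtr/ip_ge0. Qed.

Lemma ipDD x y : ip (x + y) (x + y) = ip x x + 2 * ip x y + ip y y.
Proof. by rewrite ipDl !ipDr (ipC y x); ring. Qed.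

Lemma cauchy_schwarz2 x y : ip x y ^+ 2 <= ip x x * ip y y.
Proof.
have h (t : R) : 0 <= ip x x + 2 * t * ip x y + t ^+ 2 * ip y y.
  have := ip_ge0 (x + t *: y); rewrite ipDD !ipZl !ipZr.
  by rewrite (_ : 2 * (t * _) = 2 * t * ip x y) ?mulrA// -?expr2.
(* Here [ip y y = 0] does not give [y = 0]. The quadratic degenerates to a nonnegative affine
   function of t, whose slope must vanish: the chosen t would give it the value -1. *)
have [y0|y0] := eqVneq (ip y y) 0.
  rewrite y0 mulr0; have [->|xy] := eqVneq (ip x y) 0; first by rewrite expr0n.
  have := h (- (ip x x + 1) / (2 * ip x y)); rewrite y0 mulr0 addr0.
  rewrite (_ : 2 * _ * _ = - (ip x x + 1)); last by field.
  by move=> h'; exfalso; lra.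
have y1 : 0 < ip y y by rewrite lt_def y0 ip_ge0.
have := h (- ip x y / ip y y); rewrite -(@pmulr_rge0 _ (ip y y))// => h'.
rewrite -subr_ge0; apply: le_trans h' _; rewrite le_eqVlt; apply/orP; left; apply/eqP.
by field.
Qed.

Lemma cauchy_schwarz x y : `|ip x y| <= nrm x * nrm y.
Proof.
rewrite -(@ler_pXn2r _ 2)// ?nnegrE ?mulr_ge0 ?nrm_ge0//.
by rewrite exprMn !nrm2 -normrX ger0_norm ?sqr_ge0// cauchy_schwarz2.
Qed.

Lemma nrmD x y : nrm (x + y) <= nrm x + nrm y.
Proof.
rewrite -(@ler_pXn2r _ 2)// ?nnegrE ?addr_ge0 ?nrm_ge0//.
rewrite sqrrD !nrm2 ipDD lerD2r lerD2l.
have -> : nrm x * nrm y *+ 2 = 2 * (nrm x * nrm y) by rewrite mulr_natl.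
rewrite ler_wpM2l//.
exact: le_trans (ler_norm _) (cauchy_schwarz _ _).
Qed.

Lemma nrmZ a x : nrm (a *: x) = `|a| * nrm x.
Proof. by rewrite /nrm ipZl ipZr mulrA -expr2 sqrtrM ?sqr_ge0// sqrtr_sqr. Qed.

Lemma nrmN x : nrm (- x) = nrm x.
Proof. by rewrite /nrm ipNl ipNr opprK. Qed.

Lemma nrmB x y : nrm (x - y) <= nrm x + nrm y.
Proof. by rewrite -(nrmN y) nrmD. Qed.

Lemma nrmBC x y : nrm (x - y) = nrm (y - x).
Proof. by rewrite -nrmN opprB. Qed.

Lemma nrm_dist x y z : nrm (x - z) <= nrm (x - y) + nrm (y - z).
Proof. by rewrite (_ : x - z = (x - y) + (y - z)) ?nrmD// addrA subrK. Qed.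

Lemma nrm0 : nrm 0 = 0.
Proof. by rewrite /nrm ip0l sqrtr0. Qed.

Lemma nrm_sum I (r : seq I) (P : pred I) (F : I -> H) :
  nrm (\sum_(i <- r | P i) F i) <= \sum_(i <- r | P i) nrm (F i).
Proof.
elim: r => [|a r IH]; first by rewrite !big_nil nrm0.
by rewrite !big_cons; case: (P a) => //; apply: le_trans (nrmD _ _) _; rewrite lerD2l.
Qed.

Lemma nrm_lt_ip x e : 0 < e -> (nrm x < e) = (ip x x < e ^+ 2).
Proof.
by move=> e0; rewrite -nrm2 ltr_pXn2r// nnegrE ?nrm_ge0// ltW.
Qed.

(** Limits are unique only up to a vector of seminorm 0. *)
Definition hcvg (u : nat -> H) x := (fun n => nrm (u n - x)) @ \oo --> (0 : R).

Lemma hcvgP (u : nat -> H) x :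
  hcvg u x <-> forall e, 0 < e -> exists N, forall n, (N <= n)%N -> nrm (u n - x) < e.
Proof.
split.
  move=> /cvgr0Pnorm_lt h e /h[N _ hN]; exists N => n Nn; have := hN n Nn.
  by rewrite ger0_norm// nrm_ge0.
move=> h; apply/cvgr0Pnorm_lt => e /h[N hN]; exists N => // n /= /hN.
by rewrite ger0_norm// nrm_ge0.
Qed.

Lemma hcomplete (u : nat -> H) :
  (forall e, 0 < e -> exists N, forall m n, (N <= m)%N -> (N <= n)%N ->
       nrm (u m - u n) < e) -> exists l, hcvg u l.
Proof.
move=> h; have [|l hl] := @ip_complete R H u.
  move=> e e0; have e1 : 0 < Num.sqrt e by rewrite sqrtr_gt0.
  have [N hN] := h _ e1; exists N => m n Nm Nn; have := hN m n Nm Nn.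
  by rewrite nrm_lt_ip// sqr_sqrtr// ltW.
exists l; apply/hcvgP => e e0; have e1 : 0 < e ^+ 2 by rewrite exprn_gt0.
have [N hN] := hl _ e1; exists N => n /hN; by rewrite nrm_lt_ip.
Qed.

Lemma hcvg_cst x : hcvg (fun=> x) x.
Proof. by apply/hcvgP => e e0; exists 0%N => n _; rewrite subrr nrm0. Qed.

Lemma hcvg_nrm u x : hcvg u x -> nrm (u n) @[n --> \oo] --> nrm x.
Proof.
move=> h; apply/cvgrPdist_lt => e e0; have [N hN] := (hcvgP _ _).1 h e e0.
exists N => // n /= /hN; apply: le_lt_trans.
rewrite distrC ler_norml; apply/andP; split.
  rewrite lerNl opprB lerBlDr nrmBC; have := nrmD (x - u n) (u n); by rewrite subrK.
by rewrite lerBlDr; have := nrmD (u n - x) x; rewrite subrK.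
Qed.

Lemma hcvg_ip u v x y : hcvg u x -> hcvg v y -> ip (u n) (v n) @[n --> \oo] --> ip x y.
Proof.
move=> hu hv.
have h0 : nrm (u n - x) * nrm (v n) + nrm x * nrm (v n - y) @[n --> \oo] --> (0 : R).
  rewrite (_ : 0 = 0 * nrm y + nrm x * 0); last by rewrite mul0r mulr0 addr0.
  apply: cvgD; first by apply: cvgM => //; exact: hcvg_nrm.
  by apply: cvgM => //; exact: cvg_cst.
apply/cvgrPdist_lt => e e0.
have /cvgr0Pnorm_lt /(_ e e0) [N _ hN] := h0; exists N => // n /= /hN.
apply: le_lt_trans; rewrite distrC.
rewrite (_ : ip (u n) (v n) - ip x y = ip (u n - x) (v n) + ip x (v n - y)); last first.
  by rewrite ipBl ipBr; ring.
apply: le_trans (ler_normD _ _) _; apply: le_trans (lerD (cauchy_schwarz _ _) (cauchy_schwarz _ _)) _.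
exact: ler_norm.
Qed.

Lemma hcvg_lin a u v x y : hcvg u x -> hcvg v y -> hcvg (fun n => a *: u n + v n) (a *: x + y).
Proof.
move=> hu hv.
have h0 : `|a| * nrm (u n - x) + nrm (v n - y) @[n --> \oo] --> (0 : R).
  rewrite (_ : 0 = `|a| * 0 + 0); last by rewrite mulr0 addr0.
  by apply: cvgD => //; apply: cvgM => //; exact: cvg_cst.
apply/hcvgP => e e0; have /cvgr0Pnorm_lt /(_ e e0) [N _ hN] := h0.
exists N => n /hN; apply: le_lt_trans; apply: le_trans _ (ler_norm _).
by rewrite opprD addrACA -scalerBr -nrmZ nrmD.
Qed.

Lemma hcvgB u v x y : hcvg u x -> hcvg v y -> hcvg (fun n => u n - v n) (x - y).
Proof.
move=> hu hv; have := hcvg_lin (-1) hv hu; rewrite scaleN1r addrC.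
by congr hcvg; apply/funext => n; rewrite scaleN1r addrC.
Qed.

Definition cl S x := forall e : R, 0 < e -> exists s, S s /\ nrm (x - s) < e.

Lemma cl_sub S x : S x -> cl S x.
Proof. by move=> Sx e e0; exists x; rewrite subrr nrm0. Qed.

Lemma clS S S' x : (forall y, S y -> S' y) -> cl S x -> cl S' x.
Proof. by move=> SS h e e0; have [s [Ss hs]] := h e e0; exists s; split => //; exact: SS. Qed.

Lemma cl_seq S x : cl S x <-> exists u : nat -> H, (forall n, S (u n)) /\ hcvg u x.
Proof.
split=> [h|[u [Su /hcvgP hu]] e e0]; last first.
  by have [N hN] := hu e e0; exists (u N); split => //; rewrite nrmBC hN.
have h' n : exists s, S s /\ nrm (x - s) < n.+1%:R^-1 by apply: h; rewrite invr_gt0.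
have [u hu] := choice h'; exists u; split => [n|]; first by have [] := hu n.
apply/hcvgP => e e0.
have [N _ hN] := near_infty_natSinv_lt (PosNum e0).
exists N => n Nn; rewrite nrmBC; apply: lt_trans (hu n).2 _; exact: hN.
Qed.

Lemma cl_cl S x : cl (cl S) x -> cl S x.
Proof.
move=> h e e0; have e2 : 0 < e / 2 by rewrite divr_gt0.
have [s [Ss hs]] := h _ e2; have [t [St ht]] := Ss _ e2.
exists t; split => //; apply: le_lt_trans (nrm_dist x s t) _.
by rewrite [e]splitr ltrD.
Qed.

Definition subspace S := S 0 /\ forall a x y, S x -> S y -> S (a *: x + y).

Lemma subspace_cl S : subspace S -> subspace (cl S).
Proof.
move=> [S0 SD]; split; first exact: cl_sub.
move=> a x y /cl_seq[u [Su hu]] /cl_seq[v [Sv hv]]; apply/cl_seq.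
exists (fun n => a *: u n + v n); split; last exact: hcvg_lin.
by move=> n; apply: SD.
Qed.

Lemma subspaceD S x y : subspace S -> S x -> S y -> S (x + y).
Proof. by move=> [_ h] Sx Sy; rewrite -(scale1r x); exact: h. Qed.

Lemma subspaceZ S a x : subspace S -> S x -> S (a *: x).
Proof. by move=> [S0 h] Sx; rewrite -[_ *: _]addr0; exact: h. Qed.

Lemma subspaceB S x y : subspace S -> S x -> S y -> S (x - y).
Proof. by move=> [_ h] Sx Sy; rewrite -scaleN1r addrC; exact: h. Qed.

Lemma subspace_sum S I (r : seq I) (P : pred I) (F : I -> H) : subspace S ->
  (forall i, S (F i)) -> S (\sum_(i <- r | P i) F i).
Proof.
move=> sS SF; elim: r => [|a r IH]; first by rewrite big_nil; case: sS.
by rewrite big_cons; case: (P a) => //; exact: subspaceD.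
Qed.

Lemma orth_cl S x : (forall s, S s -> ip x s = 0) -> forall s, cl S s -> ip x s = 0.
Proof.
move=> h s /cl_seq[u [Su hu]].
have := hcvg_ip (hcvg_cst x) hu; rewrite (eq_cvg _ _ (fun n => h _ (Su n))) => h0.
exact/esym/(cvg_unique (@Rhausdorff R) (cvg_cst 0) h0).
Qed.

End hilbert_theory.

Section riesz.
Context {R : realType} {H : hilbert R} (E : lmodType R) (T : E -> Prop) (J : E -> H).
Hypothesis T0 : T 0.
Hypothesis TD : forall a e f, T e -> T f -> T (a *: e + f).
Hypothesis JD : forall a e f, T e -> T f -> J (a *: e + f) = a *: J e + J f.

Definition img (h : H) := exists2 e, T e & h = J e.

Let J0 : J 0 = 0.
Proof. by have := JD (-1) T0 T0; rewrite scaler0 addr0 scaleN1r addNr. Qed.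

Lemma subspace_img : subspace img.
Proof.
split; first by exists 0.
by move=> a x y [e Te ->] [f Tf ->]; exists (a *: e + f); [exact: TD|rewrite JD].
Qed.

(** Minimise q(e) = |J e|^2 - 2 l(e), which is bounded below by -C^2. The parallelogram identity
    makes the images of a minimising sequence Cauchy, and the first variation at the limit gives the
    representation. It is stated through a map J because the subspaces at hand are images of spaces
    of test functions under the gradient. *)
Lemma riesz (l : E -> R) (C : R) :
  (forall a e f, T e -> T f -> l (a *: e + f) = a * l e + l f) ->
  (forall e, T e -> `|l e| <= C * nrm (J e)) ->
  exists w, cl img w /\ forall e, T e -> ip w (J e) = l e.
Proof.
move=> lD lC.
pose q e := ip (J e) (J e) - 2 * l e.
have qC e : T e -> - C ^+ 2 <= q e.
  move=> Te; rewrite /q -nrm2; have := lC _ Te; rewrite ler_norml => /andP[_ h].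
  have := sqr_ge0 (nrm (J e) - C); nra.
pose Q := [set q e | e in T].
have iQ : has_inf Q.
  split; first by exists (q 0), 0.
  by exists (- C ^+ 2) => _ [e Te <-]; exact: qC.
pose m := inf Q.
have mq e : T e -> m <= q e by move=> Te; apply: ge_inf; [exact: iQ.2|exists e].
have h' n : exists e, T e /\ q e < m + n.+1%:R^-1.
  have n0 : (0 : R) < n.+1%:R^-1 by rewrite invr_gt0.
  by have [_ [e Te <-] he] := inf_adherent n0 iQ; exists e.
have [e he] := choice h'.
have par n k : ip (J (e n) - J (e k)) (J (e n) - J (e k)) <= 2 * (n.+1%:R^-1 + k.+1%:R^-1).
  have [Tn qn] := he n; have [Tk qk] := he k.
  have Ts : T (e n + e k) by rewrite -(scale1r (e n)); exact: TD.
  have Tm : T (2^-1 *: (e n + e k)) by rewrite -[_ *: _]addr0; exact: TD.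
  have := mq _ Tm; rewrite /q.
  have -> : J (2^-1 *: (e n + e k)) = 2^-1 *: (J (e n) + J (e k)).
    by rewrite -[2^-1 *: (e n + e k)]addr0 JD// J0 addr0 -{1}(scale1r (e n)) JD// scale1r.
  have l0 : l 0 = 0.
    by have := lD (-1) _ _ T0 T0; rewrite scaler0 addr0 mulN1r addNr.
  have -> : l (2^-1 *: (e n + e k)) = 2^-1 * (l (e n) + l (e k)).
    by rewrite -[2^-1 *: (e n + e k)]addr0 lD// l0 addr0 -{1}(scale1r (e n)) lD// mul1r.
  rewrite ipZl ipZr ipDD; move: qn qk; rewrite /q.
  rewrite ipBl !ipBr (ipC (J (e k)) (J (e n))).
  set a := ip _ _; set b := ip _ _; set c := ip _ _; set s := n.+1%:R^-1; set t := k.+1%:R^-1.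
  by lra.
have [|w hw] := @hcomplete R H (fun n => J (e n)).
  move=> r r0.
  have r1 : 0 < r ^+ 2 / 4 by rewrite divr_gt0// exprn_gt0.
  have [N _ hN] := near_infty_natSinv_lt (PosNum r1).
  exists N => i j Ni Nj; rewrite nrm_lt_ip//; apply: le_lt_trans (par _ _) _.
  have := hN i Ni; have := hN j Nj; rewrite /=.
  by set a := i.+1%:R^-1; set b := j.+1%:R^-1; move=> h1 h2; lra.
exists w; split.
  by apply/cl_seq; exists (fun n => J (e n)); split => // n; exists (e n) => //; have [] := he n.
move=> f Tf.
have var t n : - n.+1%:R^-1 <= 2 * t * (ip (J (e n)) (J f) - l f) + t ^+ 2 * ip (J f) (J f).
  have [Tn qn] := he n; have := mq _ (TD t Tf Tn); rewrite /q JD// lD// ipDD !ipZl !ipZr.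
  move: qn; rewrite /q (ipC (J f) (J (e n))).
  by set a := ip _ _; set b := ip _ _; set c := ip _ _; set s := n.+1%:R^-1; nra.
have lim0 : (fun n => - n.+1%:R^-1) @ \oo --> (0 : R).
  by rewrite -oppr0; apply: cvgN; exact: cvg_harmonic.
have varl t : 0 <= 2 * t * (ip w (J f) - l f) + t ^+ 2 * ip (J f) (J f).
  have hr : (fun n => 2 * t * (ip (J (e n)) (J f) - l f) + t ^+ 2 * ip (J f) (J f)) @ \oo -->
     2 * t * (ip w (J f) - l f) + t ^+ 2 * ip (J f) (J f).
    apply: cvgD; last exact: cvg_cst.
    apply: cvgM; first exact: cvg_cst.
    by apply: cvgB; [exact: hcvg_ip hw (hcvg_cst _)|exact: cvg_cst].
  by apply: (ler_cvg_to lim0 hr); apply: nearW => n; exact: var.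
have b0 := ip_ge0 (J f); set a := ip w (J f) - l f in varl *.
suff : a = 0 by move=> /subr0_eq.
set b := ip (J f) (J f) in varl b0.
have b1 : 0 < b + 1 by rewrite ltr_wpDl.
(* The minimiser of the quadratic would be -a / b, but b may vanish; with b + 1 the value is still
   negative unless a = 0. *)
have := varl (- a / (b + 1)).
have -> : 2 * (- a / (b + 1)) * a + (- a / (b + 1)) ^+ 2 * b = - a ^+ 2 * (b + 2) / (b + 1) ^+ 2.
  by field; rewrite gt_eqF.
rewrite mulNr mulNr oppr_ge0 pmulr_lle0 ?invr_gt0 ?exprn_gt0// pmulr_lle0; last by lra.
by rewrite le_eqVlt ltNge sqr_ge0 orbF sqrf_eq0 => /eqP.
Qed.

(** Extension by continuity from the image of T. The conclusion speaks of all approximating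
    sequences, so that bilinearity and bounds of B' can later be obtained by passing to the limit
    along whichever sequences are convenient. *)
Lemma ext_bilin (B : E -> E -> R) (C : R) :
  (forall a e f g, T e -> T f -> T g -> B (a *: e + f) g = a * B e g + B f g) ->
  (forall a e f g, T e -> T f -> T g -> B g (a *: e + f) = a * B g e + B g f) ->
  (forall e f, T e -> T f -> `|B e f| <= C * nrm (J e) * nrm (J f)) ->
  exists B' : H -> H -> R, forall x y e f, (forall n, T (e n)) -> (forall n, T (f n)) ->
    hcvg (fun n => J (e n)) x -> hcvg (fun n => J (f n)) y ->
    B (e n) (f n) @[n --> \oo] --> B' x y.
Proof.
move=> Bl Br BC.
have C0 : forall e f, T e -> T f -> `|B e f| <= `|C| * nrm (J e) * nrm (J f).
  move=> e f Te Tf; apply: le_trans (BC _ _ Te Tf) _.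
  by rewrite ler_wpM2r ?nrm_ge0// ler_wpM2r ?nrm_ge0// ler_norm.
have TB e f : T e -> T f -> T (e - f).
  by move=> Te Tf; rewrite -scaleN1r addrC; exact: TD.
have JB e f : T e -> T f -> J (e - f) = J e - J f.
  by move=> Te Tf; rewrite -scaleN1r addrC JD// scaleN1r addrC.
have dB e f e' f' : T e -> T f -> T e' -> T f' ->
    `|B e f - B e' f'| <= `|C| * (nrm (J e - J e') * nrm (J f) + nrm (J e') * nrm (J f - J f')).
  move=> Te Tf Te' Tf'.
  have -> : B e f - B e' f' = B (e - e') f + B e' (f - f').
    rewrite -(scaleN1r e') -(scaleN1r f') (addrC e) (addrC f) Bl// Br//.
    by ring.
  apply: le_trans (ler_normD _ _) _; rewrite mulrDr !mulrA -!JB//.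
  by apply: lerD; apply: C0 => //; exact: TB.
have key x y e f e' f' : (forall n, T (e n)) -> (forall n, T (f n)) ->
    (forall n, T (e' n)) -> (forall n, T (f' n)) ->
    hcvg (fun n => J (e n)) x -> hcvg (fun n => J (f n)) y ->
    hcvg (fun n => J (e' n)) x -> hcvg (fun n => J (f' n)) y ->
    B (e n) (f n) - B (e' n) (f' n) @[n --> \oo] --> (0 : R).
  move=> Te Tf Te' Tf' he hf he' hf'.
  have h0 : `|C| * (nrm (J (e n) - J (e' n)) * nrm (J (f n)) +
      nrm (J (e' n)) * nrm (J (f n) - J (f' n))) @[n --> \oo] --> (0 : R).
    rewrite (_ : 0 = `|C| * (nrm (x - x) * nrm y + nrm x * nrm (y - y))); last first.
      by rewrite !subrr nrm0 mul0r mulr0 addr0 mulr0.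
    apply: cvgM; first exact: cvg_cst.
    apply: cvgD; apply: cvgM; try exact: hcvg_nrm.
    - exact: (hcvg_nrm (hcvgB he he')).
    - exact: (hcvg_nrm (hcvgB hf hf')).
  apply/cvgr0Pnorm_lt => r r0; have /cvgr0Pnorm_lt /(_ r r0) [N _ hN] := h0.
  exists N => // n /= /hN; apply: le_lt_trans; apply: le_trans _ (ler_norm _).
  exact: dB.
have cv x y e f : (forall n, T (e n)) -> (forall n, T (f n)) ->
    hcvg (fun n => J (e n)) x -> hcvg (fun n => J (f n)) y ->
    cvgn (fun n => B (e n) (f n)).
  move=> Te Tf he hf.
  have bnd (u : nat -> E) z : hcvg (fun n => J (u n)) z ->
     exists N : nat, forall n, (N <= n)%N -> nrm (J (u n)) <= nrm z + 1.
    move=> /hcvgP /(_ 1 ltr01) [N hN]; exists N => n /hN h.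
    rewrite -(subrK z (J (u n))); apply: le_trans (nrmD _ _) _.
    by rewrite addrC lerD2l ltW.
  have [N1 hN1] := bnd _ _ he; have [N2 hN2] := bnd _ _ hf.
  pose A := `|C| * ((nrm y + 1) + (nrm x + 1)) + 1.
  have A0 : 0 < A.
    by rewrite ltr_wpDl// mulr_ge0// !addr_ge0 ?nrm_ge0.
  apply/cauchy_cvgP/cauchy_exP => r r0.
  have r1 : 0 < r / A / 2 by rewrite !divr_gt0.
  have [N3 hN3] := (hcvgP _ _).1 he _ r1; have [N4 hN4] := (hcvgP _ _).1 hf _ r1.
  pose N := maxn (maxn N1 N2) (maxn N3 N4).
  exists (B (e N) (f N)); exists N => // n /= Nn; rewrite /ball/=.
  have lN k : (k <= N)%N -> (k <= n)%N by move=> /leq_trans; apply.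
  have N1N : (N1 <= N)%N by rewrite /N !leq_max leqnn.
  have N2N : (N2 <= N)%N by rewrite /N !leq_max leqnn ?orbT.
  have N3N : (N3 <= N)%N by rewrite /N !leq_max leqnn ?orbT.
  have N4N : (N4 <= N)%N by rewrite /N !leq_max leqnn ?orbT.
  apply: le_lt_trans (dB _ _ _ _ (Te N) (Tf N) (Te n) (Tf n)) _.
  have d1 : nrm (J (e N) - J (e n)) <= r / A.
    apply: le_trans (nrm_dist _ x _) _; rewrite (nrmBC x) [leRHS]splitr ltW// ltrD//.
      exact: hN3.
    exact/hN3/lN.
  have d2 : nrm (J (f N) - J (f n)) <= r / A.
    apply: le_trans (nrm_dist _ y _) _; rewrite (nrmBC y) [leRHS]splitr ltW// ltrD//.
      exact: hN4.
    exact/hN4/lN.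
  have b1 : nrm (J (f N)) <= nrm y + 1 by exact: hN2.
  have b2 : nrm (J (e n)) <= nrm x + 1 by apply/hN1/lN.
  apply: (@le_lt_trans _ _ (`|C| * (r / A * (nrm y + 1) + (nrm x + 1) * (r / A)))).
    rewrite ler_wpM2l// lerD// ler_pM// nrm_ge0//.
  rewrite (_ : _ * (_ + _) = r * ((A - 1) / A)); last by rewrite /A; field; rewrite -/A gt_eqF.
  by rewrite -[ltRHS]mulr1 ltr_pM2l// ltr_pdivrMr// mul1r ltrBlDr ltrDl.
(* One approximating sequence is chosen for each vector; [key] shows that any other one yields the
   same limit. *)
pose sq x (e : nat -> E) := (forall n, T (e n)) /\ hcvg (fun n => J (e n)) x.
pose ch x := xget (fun=> 0) (sq x).
exists (fun x y => limn (fun n => B (ch x n) (ch y n))) => x y e f Te Tf he hf.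
have [Tx hx] : sq x (ch x) by apply: (@xgetPex _ _ (sq x)); exists e.
have [Ty hy] : sq y (ch y) by apply: (@xgetPex _ _ (sq y)); exists f.
have h1 := cv _ _ _ _ Tx Ty hx hy.
have h2 := key _ _ _ _ _ _ Te Tf Tx Ty he hf hx hy.
have -> : (fun n => B (e n) (f n)) = (fun n => B (e n) (f n) - B (ch x n) (ch y n)) +
    (fun n => B (ch x n) (ch y n)).
  by apply/funext => n; rewrite [RHS]/= [RHS](_ : _ = B (e n) (f n) - B (ch x n) (ch y n) +
     B (ch x n) (ch y n))// subrK.
by rewrite -[limn _]add0r; exact: cvgD h2 h1.
Qed.

End riesz.

(** * Analytic dependence in a coupled system *)

Section power_series.
Context {R : realType}.

Definition psum (a : nat -> R) (e s : R) := pseries a e @ \oo --> s.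

Lemma pseriesE (a : nat -> R) e n : pseries a e n = \sum_(i < n) a i * e ^+ i.
Proof. by rewrite /pseries /series /= big_mkord. Qed.

Lemma psum_unique a e s t : psum a e s -> psum a e t -> s = t.
Proof. exact: (cvg_unique (@Rhausdorff R)). Qed.

Lemma seq_cvg_ext (u v : nat -> R) (l : R) : u =1 v -> u @ \oo --> l -> v @ \oo --> l.
Proof. by move=> /funext ->. Qed.

Lemma seq_cvgD (u v : nat -> R) (a b : R) : u @ \oo --> a -> v @ \oo --> b ->
  (fun n => u n + v n) @ \oo --> a + b.
Proof. by move=> ha hb; exact: cvgD ha hb. Qed.

Lemma seq_cvgB (u v : nat -> R) (a b : R) : u @ \oo --> a -> v @ \oo --> b ->
  (fun n => u n - v n) @ \oo --> a - b.
Proof. by move=> ha hb; exact: cvgB ha hb. Qed.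

Lemma seq_cvgM (u v : nat -> R) (a b : R) : u @ \oo --> a -> v @ \oo --> b ->
  (fun n => u n * v n) @ \oo --> a * b.
Proof. by move=> ha hb; exact: cvgM ha hb. Qed.

Lemma seq_cvgZ (c : R) (u : nat -> R) (a : R) : u @ \oo --> a ->
  (fun n => c * u n) @ \oo --> c * a.
Proof. by move=> ha; apply: seq_cvgM => //; exact: cvg_cst. Qed.

Lemma series_geo (x : nat -> R) (c q : R) : 0 <= q < 1 -> (forall k, `|x k| <= c * q ^+ k) ->
  exists l, (fun n => \sum_(k < n) x k) @ \oo --> l /\
    forall n, `|l - \sum_(k < n) x k| <= c / (1 - q) * q ^+ n.
Proof.
move=> q01 h; apply: geo_cvg => // k.
by rewrite big_ord_recr/= addrAC subrr add0r.
Qed.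

Lemma psum_geo (a : nat -> R) (C rho e : R) : 0 <= rho * e < 1 -> 0 <= e ->
  (forall k, `|a k| <= C * rho ^+ k) ->
  exists l, psum a e l /\
    forall n, `|l - \sum_(k < n) a k * e ^+ k| <= C / (1 - rho * e) * (rho * e) ^+ n.
Proof.
move=> q01 e0 h; have [k|l [hl hb]] := @series_geo (fun k => a k * e ^+ k) C (rho * e) q01.
  by rewrite normrM exprMn mulrA [`|e ^+ k|]ger0_norm ?exprn_ge0// ler_wpM2r ?exprn_ge0.
exists l; split => //; rewrite /psum; apply: seq_cvg_ext hl => n; by rewrite pseriesE.
Qed.

Lemma psum_bound (a : nat -> R) (C rho e s : R) : 0 <= rho * e < 1 -> 0 <= e ->
  (forall k, `|a k| <= C * rho ^+ k) -> psum a e s -> `|s| <= C / (1 - rho * e).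
Proof.
move=> q01 e0 h hs; have [l [hl /(_ 0%N)]] := psum_geo q01 e0 h.
by rewrite big_ord0 subr0 expr0 mulr1 (psum_unique hs hl).
Qed.

Lemma psum_ext a b e s : a =1 b -> psum a e s -> psum b e s.
Proof. by move=> /funext ->. Qed.

Lemma psumB a b e s t : psum a e s -> psum b e t -> psum (fun k => a k - b k) e (s - t).
Proof.
move=> ha hb; rewrite /psum; apply: seq_cvg_ext (seq_cvgB ha hb) => n.
by rewrite !pseriesE -sumrB; apply: eq_bigr => i _; rewrite mulrBl.
Qed.

Lemma natr_le_exp2 n : (n%:R <= 2 ^+ n :> R).
Proof. by rewrite -natrX ler_nat ltnW// ltn_expl. Qed.

(** Truncating row k at N - k leaves a tail of at most A / (1 - q) q^N. There are N <= 2^N rows and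
    q <= 1/4, so the total error is at most A / (1 - q) 2^-N. *)
Lemma double_series (a : nat -> nat -> R) (r : nat -> R) (A q : R) :
  0 <= q <= 4^-1 -> 0 <= A -> (forall k j, `|a k j| <= A * q ^+ (k + j)) ->
  (forall k, (fun n => \sum_(j < n) a k j) @ \oo --> r k) ->
  (fun N => \sum_(k < N) r k - \sum_(n < N) \sum_(j < n.+1) a j (n - j)%N) @ \oo --> (0 : R).
Proof.
move=> /andP[q0 q4] A0 ha hr.
have q1 : q < 1 by rewrite (le_lt_trans q4)// invf_lt1// ltr1n.
have q01 : 0 <= q < 1 by rewrite q0.
have tri N : \sum_(n < N) \sum_(j < n.+1) a j (n - j)%N = \sum_(k < N) \sum_(j < N - k) a k j.
  elim: N => [|N IH]; first by rewrite !big_ord0.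
  rewrite big_ord_recr/= IH [in RHS]big_ord_recr/= subSnn big_ord1 big_ord_recr/= subnn addrA.
  congr (_ + _); rewrite -big_split/=; apply: eq_bigr => k _.
  by rewrite subSn 1?ltnW// big_ord_recr.
have tail k n : `|r k - \sum_(j < n) a k j| <= A / (1 - q) * q ^+ (k + n).
  have [j|l [hl hb]] := @series_geo (a k) (A * q ^+ k) q q01.
    by rewrite -mulrA -exprD.
  have -> : r k = l by exact: (cvg_unique (@Rhausdorff R) (hr k) hl).
  by apply: le_trans (hb n) _; rewrite exprD; rewrite le_eqVlt; apply/orP; left; apply/eqP; ring.
have q1' : 0 < 1 - q by rewrite subr_gt0.
apply/cvgr0Pnorm_lt => e e0.
have half : 0 <= (2^-1 : R) < 1 by rewrite invr_ge0 ler0n invf_lt1// ltr1n.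
have [N0 hN0] := geo_small (A / (1 - q)) half e0.
exists N0 => // N /= /hN0; apply: le_lt_trans; rewrite tri -sumrB.
apply: le_trans (ler_norm_sum _ _ _) _.
apply: (@le_trans _ _ (\sum_(k < N) A / (1 - q) * q ^+ N)).
  by apply: ler_sum => k _; have := tail k (N - k)%N; rewrite subnKC// ltnW.
rewrite sumr_const card_ord.
rewrite (_ : (A / (1 - q) * q ^+ N) *+ N = A / (1 - q) * (N%:R * q ^+ N)); last first.
  by rewrite -mulrnAr mulr_natl.
rewrite ler_wpM2l ?divr_ge0 ?(ltW q1')//.
apply: (@le_trans _ _ (2 ^+ N * 4^-1 ^+ N)).
  by rewrite ler_pM ?exprn_ge0// ?natr_le_exp2// lerXn2r ?nnegrE// ?invr_ge0.
rewrite -exprMn le_eqVlt; apply/orP; left; apply/eqP; congr (_ ^+ _); by field.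
Qed.

(** The ratio rho / sigma is at most 1/2, so the sum is dominated by its last term up to a factor
    2. *)
Lemma conv_geo (rho sigma : R) N : 0 <= rho -> 2 * rho <= sigma ->
  \sum_(j < N.+1) rho ^+ (N - j) * sigma ^+ j <= 2 * sigma ^+ N.
Proof.
move=> r0 rs; have s0 : 0 <= sigma by lra.
elim: N => [|N IH]; first by rewrite big_ord1 !expr0 !mulr1 ler1n.
rewrite big_ord_recr/= subnn expr0 mul1r.
rewrite (eq_bigr (fun j : 'I_N.+1 => rho * (rho ^+ (N - j) * sigma ^+ j))); last first.
  by move=> j _; rewrite mulrA -exprS subSn// -ltnS.
rewrite -mulr_sumr; have := ler_wpM2l r0 IH.
have : 2 * rho * sigma ^+ N <= sigma ^+ N.+1 by rewrite exprS ler_wpM2r// exprn_ge0.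
by rewrite mulrCA; lra.
Qed.

End power_series.

Section hilbert_series.
Context {R : realType} {H : hilbert R}.

Lemma hseries_cvg (S : H -> Prop) (x : nat -> H) (L q : R) : subspace S ->
  (forall z, cl S z -> S z) -> (forall n, S (x n)) ->
  0 <= q < 1 -> (forall n, nrm (x n) <= L * q ^+ n) ->
  exists2 y, S y & hcvg (fun n => \sum_(k < n) x k) y.
Proof.
move=> sS cS Sx q01 hx.
have hx' k : `|nrm (x k)| <= L * q ^+ k by rewrite ger0_norm ?nrm_ge0.
have [v [hv hvb]] := series_geo q01 hx'.
have tail m n : (m <= n)%N -> nrm (\sum_(k < n) x k - \sum_(k < m) x k) <=
    \sum_(k < n) nrm (x k) - \sum_(k < m) nrm (x k).
  move=> mn; rewrite -(subnKC mn) !big_split_ord/= [_ + _ - _]addrC addKr.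
  by rewrite [_ + _ - _]addrC addKr nrm_sum.
have [|y hy] := @hcomplete R H (fun n => \sum_(k < n) x k).
  move=> e e0; have e2 : 0 < e / 2 by rewrite divr_gt0.
  have /cvgrPdist_lt /(_ _ e2) [N _ hN] := hv.
  exists N => m n Nm Nn; wlog mn : m n Nm Nn / (m <= n)%N.
    move=> W; have [mn|/ltnW nm] := leqP m n; first exact: W.
    by rewrite nrmBC; exact: W.
  rewrite nrmBC; apply: le_lt_trans (tail _ _ mn) _; apply: le_lt_trans (ler_norm _) _.
  apply: le_lt_trans (ler_distD v _ _) _; rewrite [e]splitr ltrD//; last exact: hN.
  by rewrite distrC; exact: hN.
exists y => //; apply: cS; apply/cl_seq; exists (fun n => \sum_(k < n) x k); split => // n.
exact: subspace_sum.
Qed.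

Lemma functional_series (S : H -> Prop) (f : H -> R) (C : R) (x : nat -> H) y :
  subspace S -> (forall a u v, S u -> S v -> f (a *: u + v) = a * f u + f v) ->
  (forall u, S u -> `|f u| <= C * nrm u) -> (forall n, S (x n)) -> S y ->
  hcvg (fun n => \sum_(k < n) x k) y ->
  (fun n => \sum_(k < n) f (x k)) @ \oo --> f y.
Proof.
move=> sS fl fC Sx Sy hy.
have f0 : f 0 = 0.
  have := fl (-1) 0 0 sS.1 sS.1; rewrite scaler0 addr0 mulN1r addNr; exact.
have fS n : f (\sum_(k < n) x k) = \sum_(k < n) f (x k).
  elim: n => [|n IH]; first by rewrite !big_ord0.
  have Sn : S (\sum_(k < n) x k) by exact: subspace_sum.
  have := fl 1 _ _ (Sx n) Sn; rewrite scale1r mul1r IH => h.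
  by rewrite !big_ord_recr/= addrC h addrC.
have h0 : `|C| * nrm (\sum_(k < n) x k - y) @[n --> \oo] --> (0 : R).
  by rewrite -(mulr0 `|C|); apply: cvgM => //; exact: cvg_cst.
apply/cvgrPdist_lt => e e0; have /cvgr0Pnorm_lt /(_ e e0) [N _ hN] := h0.
exists N => // n /= /hN; apply: le_lt_trans; apply: le_trans _ (ler_norm _).
rewrite -fS nrmBC.
have Sn : S (\sum_(k < n) x k) by exact: subspace_sum.
have -> : f y - f (\sum_(k < n) x k) = f (y - \sum_(k < n) x k).
  by rewrite (addrC y) -(scaleN1r (\sum_(k < n) x k)) fl// mulN1r addrC.
apply: le_trans (fC _ (subspaceB sS Sy Sn)) _; by rewrite ler_wpM2r ?nrm_ge0// ler_norm.
Qed.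

End hilbert_series.

Section analytic_system.
Context {R : realType} {H : hilbert R}.
Variables (M G : H -> Prop) (beta : nat -> H -> H -> R) (phi psi : nat -> H -> R).
Variables (C rho : R) (s : nat).
Hypotheses (sM : subspace M) (sG : subspace G).
Hypotheses (cM : forall x, cl M x -> M x) (cG : forall x, cl G x -> G x).
Hypotheses (s1 : (0 < s)%N) (C0 : 0 <= C) (rho0 : 0 <= rho).
Hypothesis bl : forall k a x y g, M x -> M y -> G g ->
  beta k (a *: x + y) g = a * beta k x g + beta k y g.
Hypothesis br : forall k a g h x, G g -> G h -> M x ->
  beta k x (a *: g + h) = a * beta k x g + beta k x h.
Hypothesis bC : forall k x g, M x -> G g -> `|beta k x g| <= C * rho ^+ k * nrm x * nrm g.
Hypothesis fl : forall k a x y, M x -> M y -> phi k (a *: x + y) = a * phi k x + phi k y.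
Hypothesis fC : forall k x, M x -> `|phi k x| <= C * rho ^+ k * nrm x.
Hypothesis pl : forall k a x y, M x -> M y -> psi k (a *: x + y) = a * psi k x + psi k y.
Hypothesis pC : forall k x, M x -> `|psi k x| <= C * rho ^+ k * nrm x.

Let riesz_sub (S : H -> Prop) (l : H -> R) (K : R) : subspace S -> (forall x, cl S x -> S x) ->
  (forall a x y, S x -> S y -> l (a *: x + y) = a * l x + l y) ->
  (forall x, S x -> `|l x| <= K * nrm x) ->
  exists w, S w /\ forall x, S x -> ip w x = l x.
Proof.
move=> sS cS ll lK.
have [w [cw hw]] := @riesz R H H S id sS.1 sS.2 (fun _ _ _ _ _ => erefl) l K ll lK.
exists w; split => //; apply: cS; apply: clS cw => y [x Sx ->]; exact: Sx.
Qed.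

Let rep (S : H -> Prop) (l : H -> R) : H :=
  xget 0 [set w | S w /\ forall x, S x -> ip w x = l x].

Let repP (S : H -> Prop) (l : H -> R) (K : R) : subspace S -> (forall x, cl S x -> S x) ->
  (forall a x y, S x -> S y -> l (a *: x + y) = a * l x + l y) ->
  (forall x, S x -> `|l x| <= K * nrm x) ->
  S (rep S l) /\ forall x, S x -> ip (rep S l) x = l x.
Proof.
move=> sS cS ll lK; have [w hw] := riesz_sub sS cS ll lK.
by have := @xgetPex _ 0 [set w | S w /\ forall x, S x -> ip w x = l x]; apply; exists w.
Qed.

Let rep_nrm (S : H -> Prop) (l : H -> R) (K : R) w : 0 <= K -> S w -> (forall x, S x -> ip w x = l x) ->
  (forall x, S x -> `|l x| <= K * nrm x) -> nrm w <= K.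
Proof.
move=> K0 Sw hw lK; have [w0|w0] := eqVneq (nrm w) 0; first by rewrite w0.
have wp : 0 < nrm w by rewrite lt_def w0 nrm_ge0.
rewrite -(ler_pM2r wp) -expr2 nrm2; apply: le_trans (lK _ Sw); rewrite hw//; exact: ler_norm.
Qed.

(** With n = size L, this is the coefficient of e^n in e^s sum_k e^k beta_k(w, g): only the w_j with
    j <= n - s < n occur, and the sum is empty when n < s. *)
Let hfun (L : seq (H * H)) (g : H) : R :=
  \sum_(j < (size L).+1 - s) beta ((size L) - s - j) (nth (0, 0) L j).1 g.
(** The coefficient of e^n in the equation for w. Its last term involves h_n itself, which is why
    [new] determines h_n before w_n. *)
Let wfun (L : seq (H * H)) (h : H) (m : H) : R :=
  phi (size L) m + (\sum_(j < size L) beta (size L - j) m (nth (0, 0) L j).2 + beta 0 m h).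
Let new (L : seq (H * H)) : H * H :=
  let h := rep G (hfun L) in (rep M (wfun L h), h).
(** Course-of-values recursion: [tab n] lists the pairs (w_j, h_j) for j < n. *)
Let tab n := iter n (fun L => rcons L (new L)) [::].
Let size_tab n : size (tab n) = n.
Proof. by elim: n => // n IH; rewrite /= size_rcons IH. Qed.
Let wn n : H := (new (tab n)).1.
Let hn n : H := (new (tab n)).2.
Let nth_tab n j : (j < n)%N -> nth (0, 0) (tab n) j = (wn j, hn j).
Proof.
elim: n => // n IH; rewrite ltnS leq_eqVlt => /orP[/eqP ->|jn]; rewrite /= nth_rcons size_tab.
  by rewrite ltnn eqxx /wn /hn; case: new.
by rewrite jn IH.
Qed.

(** The summand 2 rho is for [conv_geo], 8 C^2 absorbs the coupling in the bound on w_n, namely C +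
    8 C^3 / sigma <= 2 C, and 1 gives sigma >= 1. *)
Let sigma : R := 2 * rho + 8 * C ^+ 2 + 1.
Let Lc : R := 2 * C.
Let sigma1 : 1 <= sigma.
Proof. by rewrite /sigma; have := sqr_ge0 C; have := rho0; lra. Qed.
Let sigma0 : 0 < sigma. Proof. exact: lt_le_trans ltr01 sigma1. Qed.
Let rs : 2 * rho <= sigma. Proof. by rewrite /sigma; have := sqr_ge0 C; lra. Qed.

(** Strong induction carrying the geometric bounds along with the equations. The bound on h_n gains
    a factor 1 / sigma because s >= 1 delays w by at least one step; this gain closes the bound on
    w_n. *)
Let main n : [/\ M (wn n), G (hn n), nrm (wn n) <= Lc * sigma ^+ n,
    nrm (hn n) <= 2 * C * Lc / sigma * sigma ^+ n &
    (forall m, M m -> ip (wn n) m = phi n m + \sum_(j < n.+1) beta (n - j) m (hn j)) /\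
    (forall g, G g -> ip (hn n) g = \sum_(j < n.+1 - s) beta (n - s - j) (wn j) g)].
Proof.
elim/ltn_ind: n => n IH.
have hfE g : hfun (tab n) g = \sum_(j < n.+1 - s) beta (n - s - j) (wn j) g.
  rewrite /hfun size_tab; apply: eq_bigr => j _; rewrite nth_tab//.
  by apply: (leq_trans (ltn_ord j)); rewrite leq_subLR -add1n leq_add2r.
have jn (j : 'I_(n.+1 - s)) : (j < n)%N.
  by apply: (leq_trans (ltn_ord j)); rewrite leq_subLR -add1n leq_add2r.
have Mw (j : 'I_(n.+1 - s)) : M (wn j) by have [] := IH j (jn j).
have hfl a x y : G x -> G y -> hfun (tab n) (a *: x + y) = a * hfun (tab n) x + hfun (tab n) y.
  move=> Gx Gy; rewrite !hfE mulr_sumr -big_split/=; apply: eq_bigr => j _.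
  by rewrite br.
have hK0 : 0 <= 2 * C * Lc / sigma * sigma ^+ n.
  by rewrite mulr_ge0 ?exprn_ge0 ?divr_ge0 ?mulr_ge0 ?(ltW sigma0)//.
have hfK x : G x -> `|hfun (tab n) x| <= 2 * C * Lc / sigma * sigma ^+ n * nrm x.
  move=> Gx; rewrite hfE; apply: le_trans (ler_norm_sum _ _ _) _.
  case: (leqP s n) => [sn|ns]; last first.
    have /eqP -> : (n.+1 - s == 0)%N by rewrite subn_eq0.
    by rewrite big_ord0 mulr_ge0 ?nrm_ge0.
  rewrite subSn//.
  apply: (@le_trans _ _ (\sum_(j < (n - s).+1) C * Lc * nrm x * (rho ^+ (n - s - j) * sigma ^+ j))).
    apply: ler_sum => j _.
    have jn' : (j < n)%N.
      by rewrite (leq_trans (ltn_ord j))// -subSn// leq_subLR -add1n leq_add2r.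
    have [Mj _ wj _ _] := IH j jn'.
    apply: le_trans (bC _ Mj Gx) _.
    rewrite [leRHS](_ : _ = C * rho ^+ (n - s - j) * (Lc * sigma ^+ j) * nrm x); last by ring.
    by rewrite ler_wpM2r ?nrm_ge0// ler_wpM2l// mulr_ge0 ?exprn_ge0.
  rewrite -mulr_sumr.
  apply: le_trans (ler_wpM2l _ (conv_geo (n - s) rho0 rs)) _.
    by rewrite !mulr_ge0 ?nrm_ge0.
  have h1 : sigma ^+ (n - s) <= sigma ^+ n / sigma.
    by rewrite ler_pdivlMr// -exprSr ler_weXn2l// -subSn// leq_subLR -add1n leq_add2r.
  rewrite [leLHS](_ : _ = 2 * C * Lc * nrm x * sigma ^+ (n - s)); last by ring.
  rewrite [leRHS](_ : _ = 2 * C * Lc * nrm x * (sigma ^+ n / sigma)); last by ring.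
  by rewrite ler_wpM2l// !mulr_ge0 ?nrm_ge0.
have [Gh hh] := repP sG cG hfl hfK.
have hb : nrm (hn n) <= 2 * C * Lc / sigma * sigma ^+ n by apply: rep_nrm hK0 Gh hh hfK.
have Gj (j : 'I_n.+1) : G (hn j) /\ nrm (hn j) <= 2 * C * Lc / sigma * sigma ^+ j.
  have := ltn_ord j; rewrite ltnS leq_eqVlt => /orP[/eqP ->|jn']; first by split.
  by have [] := IH j jn'.
have wfE m : wfun (tab n) (hn n) m = phi n m + \sum_(j < n.+1) beta (n - j) m (hn j).
  rewrite /wfun size_tab big_ord_recr/= subnn; congr (_ + (_ + _)).
  by apply: eq_bigr => j _; rewrite nth_tab.
have wfl a x y : M x -> M y ->
    wfun (tab n) (hn n) (a *: x + y) = a * wfun (tab n) (hn n) x + wfun (tab n) (hn n) y.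
  move=> Mx My; rewrite !wfE fl//.
  have -> : \sum_(j < n.+1) beta (n - j) (a *: x + y) (hn j) =
     a * (\sum_(j < n.+1) beta (n - j) x (hn j)) + \sum_(j < n.+1) beta (n - j) y (hn j).
    rewrite mulr_sumr -big_split/=; apply: eq_bigr => j _.
    by rewrite bl//; have [] := Gj j.
  by ring.
have wK0 : 0 <= Lc * sigma ^+ n by rewrite mulr_ge0 ?exprn_ge0 ?(ltW sigma0)// mulr_ge0.
have wfK x : M x -> `|wfun (tab n) (hn n) x| <= Lc * sigma ^+ n * nrm x.
  move=> Mx; rewrite wfE; apply: le_trans (ler_normD _ _) _.
  have b1 : `|phi n x| <= C * sigma ^+ n * nrm x.
    apply: le_trans (fC _ Mx) _; rewrite ler_wpM2r ?nrm_ge0// ler_wpM2l//.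
    by rewrite lerXn2r ?nnegrE// ?(ltW sigma0)//; have := rs; have := rho0; lra.
  have b2 : `|\sum_(j < n.+1) beta (n - j) x (hn j)| <=
      C * (2 * C * Lc / sigma) * nrm x * (2 * sigma ^+ n).
    apply: le_trans (ler_norm_sum _ _ _) _.
    apply: (@le_trans _ _ (\sum_(j < n.+1) C * (2 * C * Lc / sigma) * nrm x *
        (rho ^+ (n - j) * sigma ^+ j))).
      apply: ler_sum => j _; have [Ghj nhj] := Gj j.
      apply: le_trans (bC _ Mx Ghj) _.
      rewrite [leRHS](_ : _ = C * rho ^+ (n - j) * nrm x * (2 * C * Lc / sigma * sigma ^+ j)); last by ring.
      by rewrite ler_wpM2l// !mulr_ge0 ?nrm_ge0 ?exprn_ge0.
    rewrite -mulr_sumr ler_wpM2l ?conv_geo//.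
    by rewrite !mulr_ge0 ?nrm_ge0 ?invr_ge0 ?(ltW sigma0).
  apply: le_trans (lerD b1 b2) _.
  rewrite [leLHS](_ : _ = (C + 8 * C ^+ 2 / sigma * C) * (sigma ^+ n * nrm x)); last first.
    by rewrite /Lc; field; rewrite gt_eqF.
  rewrite [leRHS](_ : _ = (C + 1 * C) * (sigma ^+ n * nrm x)); last by rewrite /Lc; ring.
  rewrite ler_wpM2r ?mulr_ge0 ?nrm_ge0 ?exprn_ge0 ?(ltW sigma0)//.
  rewrite lerD2l ler_wpM2r// ler_pdivrMr// mul1r /sigma.
  by have := rho0; lra.
have [Mw' hw] := repP sM cM wfl wfK.
split => //.
- exact: rep_nrm wK0 Mw' hw wfK.
- split => [m Mm|g Gg]; first by rewrite /wn hw// wfE.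
  by rewrite /hn hh// hfE.
Qed.

(* With s = d - 2: m -> ip m w is sum_k e^k (phi k m + beta k m h), and
   g -> ip h g is e^s sum_k e^k beta k w g.  Since s > 0 the coefficients of a formal
   solution w = sum_n e^n w_n, h = sum_n e^n h_n are determined recursively. *)
Theorem analytic_system : exists (c : nat -> R) (e0 : R), 0 < e0 /\ forall e, 0 < e < e0 ->
  forall w h (F : H -> R), M w -> G h ->
  (forall m, M m -> psum (fun k => phi k m) e (F m)) ->
  (forall m, M m -> psum (fun k => beta k m h) e (ip m w - F m)) ->
  (forall g, G g -> psum (fun k => beta k w g) e (ip h g / e ^+ s)) ->
  exists S, psum c e S /\ psum (fun k => psi k w) e S.
Proof.
(* The Cauchy product of the family psi with the formal series of w. *)
exists (fun n => \sum_(j < n.+1) psi j (wn (n - j))).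
(* The radius is the inverse of this number: 4 sigma e < 1 is what [double_series] requires, 8 C^2 e
   < 1 makes the contraction factor 4 C^2 e at most 1/2, and the last summand gives e <= 1. *)
have D0 : 0 < 4 * sigma + 8 * C ^+ 2 + 1 by have := sqr_ge0 C; have := sigma0; lra.
exists (4 * sigma + 8 * C ^+ 2 + 1)^-1; split; first by rewrite invr_gt0.
move=> e /andP[e0 eD] w h F Mw Gh hF hi hii.
have {}eD : e * (4 * sigma + 8 * C ^+ 2 + 1) < 1 by rewrite -ltr_pdivlMr// mul1r.
have e0' := ltW e0.
have C2 := sqr_ge0 C.
have eC : 0 <= e * C ^+ 2 by rewrite mulr_ge0.
have {}eD : 4 * (e * sigma) + 8 * (e * C ^+ 2) + e < 1.
  by apply: le_lt_trans eD; rewrite le_eqVlt; apply/orP; left; apply/eqP; ring.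
have es0 : 0 <= e * sigma by rewrite mulr_ge0 ?(ltW sigma0).
have se4 : 0 <= sigma * e <= 4^-1.
  rewrite mulrC es0/= -[leRHS]mul1r ler_pdivlMr//.
  by move: eD eC e0'; set a := e * sigma; set b := e * C ^+ 2; lra.
have re : rho <= sigma by have := rs; have := rho0; lra.
have q01 : 0 <= sigma * e < 1.
  by case/andP: se4 => -> /= /le_lt_trans; apply; rewrite invf_lt1// ltr1n.
have r01 : 0 <= rho * e < 1.
  rewrite mulr_ge0//=; apply: le_lt_trans (andP q01).2; by rewrite ler_wpM2r.
have Lc0 : 0 <= Lc by rewrite mulr_ge0.
have wb n : nrm (e ^+ n *: wn n) <= Lc * (sigma * e) ^+ n.
  have [_ _ h1 _ _] := main n; rewrite nrmZ ger0_norm ?exprn_ge0// exprMn mulrA mulrC.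
  by rewrite ler_wpM2r ?exprn_ge0.
have hb n : nrm (e ^+ n *: hn n) <= 2 * C * Lc / sigma * (sigma * e) ^+ n.
  have [_ _ _ h1 _] := main n; rewrite nrmZ ger0_norm ?exprn_ge0// exprMn mulrA mulrC.
  by rewrite ler_wpM2r ?exprn_ge0.
have Mn n : M (e ^+ n *: wn n) by apply: subspaceZ => //; have [] := main n.
have Gn n : G (e ^+ n *: hn n) by apply: subspaceZ => //; have [] := main n.
have [w' Mw' hw'] := hseries_cvg sM cM Mn q01 wb.
have [h' Gh' hh'] := hseries_cvg sG cG Gn q01 hb.
have hom (S : H -> Prop) (f : H -> R) a x : subspace S ->
    (forall a u v, S u -> S v -> f (a *: u + v) = a * f u + f v) -> S x -> f (a *: x) = a * f x.
  move=> sS hf Sx; have f0 : f 0 = 0.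
    by have := hf (-1) 0 0 sS.1 sS.1; rewrite scaler0 addr0 mulN1r addNr.
  by rewrite -[_ *: x]addr0 hf ?f0 ?addr0//; case: sS.
(* Evaluates each f_k at y = sum_j e^j x_j and regroups the double series by powers of e. *)
have dbl (S : H -> Prop) (f : nat -> H -> R) (K Lx : R) (x : nat -> H) y : subspace S ->
    (forall k a u v, S u -> S v -> f k (a *: u + v) = a * f k u + f k v) -> 0 <= K -> 0 <= Lx ->
    (forall k u, S u -> `|f k u| <= K * rho ^+ k * nrm u) -> (forall n, S (x n)) -> S y ->
    (forall n, nrm (e ^+ n *: x n) <= Lx * (sigma * e) ^+ n) ->
    hcvg (fun n => \sum_(k < n) e ^+ k *: x k) y ->
    pseries (fun k => f k y) e N - pseries (fun n => \sum_(j < n.+1) f j (x (n - j)%N)) e N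
      @[N --> \oo] --> (0 : R).
  move=> sS lf K0 Lx0 fK Sx Sy xb hy.
  have Sex n : S (e ^+ n *: x n) by apply: subspaceZ.
  have hr k : (fun n => \sum_(j < n) e ^+ k * f k (e ^+ j *: x j)) @ \oo --> e ^+ k * f k y.
    have := @functional_series R H S (f k) (K * rho ^+ k) _ y sS (lf k) (fK k) Sex Sy hy.
    by move=> /(@seq_cvgZ _ (e ^+ k) _ _); apply: seq_cvg_ext => n; rewrite mulr_sumr.
  have ab k j : `|e ^+ k * f k (e ^+ j *: x j)| <= K * Lx * (sigma * e) ^+ (k + j).
    rewrite normrM ger0_norm ?exprn_ge0//.
    apply: (@le_trans _ _ (e ^+ k * (K * rho ^+ k * (Lx * (sigma * e) ^+ j)))).
      rewrite ler_wpM2l ?exprn_ge0//; apply: le_trans (fK _ _ (Sex j)) _.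
      by rewrite ler_wpM2l// mulr_ge0// exprn_ge0.
    rewrite [leLHS](_ : _ = K * Lx * (sigma * e) ^+ j * (rho * e) ^+ k); last by rewrite [(rho * e) ^+ k]exprMn; ring.
    rewrite [leRHS](_ : _ = K * Lx * (sigma * e) ^+ j * (sigma * e) ^+ k); last by rewrite exprD; ring.
    rewrite ler_wpM2l ?mulr_ge0 ?exprn_ge0//; first by case/andP: q01.
    by rewrite lerXn2r ?nnegrE ?mulr_ge0 ?(ltW sigma0)// ler_wpM2r.
  have := double_series se4 (mulr_ge0 K0 Lx0) ab hr.
  apply: seq_cvg_ext => N; rewrite !pseriesE; congr (_ - _).
    by apply: eq_bigr => k _; rewrite mulrC.
  apply: eq_bigr => n _; rewrite mulr_suml; apply: eq_bigr => j _.
  rewrite (hom S)//; last exact: lf.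
  by rewrite mulrA -exprD subnKC 1?mulrC// -ltnS.
have Mwn n : M (wn n) by have [] := main n.
have Ghn n : G (hn n) by have [] := main n.
have hL0 : 0 <= 2 * C * Lc / sigma by rewrite !mulr_ge0// invr_ge0 ltW.
have eqi m : M m -> psum (fun k => beta k m h') e (ip m w' - F m).
  move=> Mm.
  have d1 : pseries (fun k => beta k m h') e N -
      pseries (fun n => \sum_(j < n.+1) beta j m (hn (n - j)%N)) e N @[N --> \oo] --> (0 : R).
    apply: (dbl G (fun k => beta k m) (C * nrm m) _ hn h' sG _ _ hL0) => //.
    - by move=> k a u v Gu Gv; exact: br.
    - by rewrite mulr_ge0 ?nrm_ge0.
    - move=> k u Gu; apply: le_trans (bC _ Mm Gu) _.
      by rewrite (_ : C * rho ^+ k * nrm m = C * nrm m * rho ^+ k)//; ring.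
  have d2 : psum (fun n => ip (wn n) m) e (ip m w').
    have lipl a u v : M u -> M v -> ip m (a *: u + v) = a * ip m u + ip m v.
      by rewrite ipDr ipZr.
    have := @functional_series R H M (ip m) (nrm m) _ w' sM lipl
      (fun u _ => cauchy_schwarz m u) Mn Mw' hw'.
    by apply: seq_cvg_ext => n; rewrite pseriesE; apply: eq_bigr => k _; rewrite ipZr ipC mulrC.
  have d3 := psumB d2 (hF m Mm).
  rewrite /psum; have := seq_cvgD d1 d3; rewrite add0r; apply: seq_cvg_ext => N.
  rewrite [X in _ + X](_ : _ = pseries (fun n => \sum_(j < n.+1) beta j m (hn (n - j)%N)) e N) ?subrK//.
  rewrite !pseriesE; apply: eq_bigr => n _; congr (_ * _).
  have [_ _ _ _ [-> // _]] := main n.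
  rewrite addrC addKr (reindex_inj rev_ord_inj)/=; apply: eq_bigr => j _.
  by rewrite subSS subKn// -ltnS.
have eqii g : G g -> psum (fun k => beta k w' g) e (ip h' g / e ^+ s).
  move=> Gg.
  have d1 : pseries (fun k => beta k w' g) e N -
      pseries (fun n => \sum_(j < n.+1) beta j (wn (n - j)%N) g) e N @[N --> \oo] --> (0 : R).
    apply: (dbl M (fun k => beta k ^~ g) (C * nrm g) Lc wn w' sM) => //.
    - by move=> k a u v Mu Mv; exact: bl.
    - by rewrite mulr_ge0 ?nrm_ge0.
    - move=> k u Mu; apply: le_trans (bC _ Mu Gg) _.
      by rewrite (_ : C * rho ^+ k * nrm u * nrm g = C * nrm g * rho ^+ k * nrm u)//; ring.
  have d2 : (fun n => \sum_(k < n) ip (hn k) g * e ^+ k) @ \oo --> ip h' g.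
    have lipl a u v : G u -> G v -> ip g (a *: u + v) = a * ip g u + ip g v.
      by rewrite ipDr ipZr.
    rewrite ipC; have := @functional_series R H G (ip g) (nrm g) _ h' sG lipl
      (fun u _ => cauchy_schwarz g u) Gn Gh' hh'.
    by apply: seq_cvg_ext => n; apply: eq_bigr => k _; rewrite ipZr ipC mulrC.
  (* The first s coefficients [ip (hn k) g] are empty sums, so dividing by e^s merely shifts the
     series. *)
  have d3 : psum (fun n => \sum_(j < n.+1) beta j (wn (n - j)%N) g) e (ip h' g / e ^+ s).
    have : (fun N => \sum_(k < N + s) ip (hn k) g * e ^+ k) @ \oo --> ip h' g.
      by rewrite (cvg_shiftn s (fun n => \sum_(k < n) ip (hn k) g * e ^+ k)).
    move=> /(@seq_cvgZ _ (e ^+ s)^-1 _ _); rewrite mulrC; apply: seq_cvg_ext => N.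
    rewrite mulrC pseriesE addnC big_split_ord/= big1 ?add0r; last first.
      move=> i _; have [_ _ _ _ [_ -> //]] := main i.
      have /eqP -> : (i.+1 - s == 0)%N by rewrite subn_eq0.
      by rewrite big_ord0 mul0r.
    rewrite mulr_suml; apply: eq_bigr => n _.
    have [_ _ _ _ [_ -> //]] := main (s + n)%N.
    rewrite exprD [e ^+ s * _]mulrC mulrA mulfK ?gt_eqF ?exprn_gt0//; congr (_ * _).
    rewrite -addnS addKn addKn (reindex_inj rev_ord_inj)/=; apply: eq_bigr => j _.
    by rewrite subSS subKn// -ltnS.
  rewrite /psum; have := seq_cvgD d1 d3; rewrite add0r; apply: seq_cvg_ext => N.
  by rewrite subrK.
(* The difference with the formal solution solves the homogeneous system, a
   contraction for small e; the two solutions differ by a vector of norm 0. *)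
pose x := w - w'; pose y := h - h'.
have Mx : M x by exact: subspaceB.
have Gy : G y by exact: subspaceB.
have BlB k u v g : M u -> M v -> G g -> beta k (u - v) g = beta k u g - beta k v g.
  by move=> Mu Mv Gg; rewrite -scaleN1r addrC bl// mulN1r addrC.
have BrB k u g1 g2 : M u -> G g1 -> G g2 -> beta k u (g1 - g2) = beta k u g1 - beta k u g2.
  by move=> Mu G1 G2; rewrite -scaleN1r addrC br// mulN1r addrC.
have inv2 : C / (1 - rho * e) <= 2 * C.
  have h34 : 2^-1 <= 1 - rho * e.
    have := andP se4; have : rho * e <= sigma * e by rewrite ler_wpM2r.
    by move=> h1 [_ h2]; lra.
  rewrite ler_pdivrMr; last by lra.
  by rewrite -[leLHS]mulr1 [2 * C]mulrC -mulrA ler_wpM2l//; lra.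
have nx : nrm x <= 2 * C * nrm y.
  have hx : psum (fun k => beta k x y) e (ip x x).
    have := psumB (hi _ Mx) (eqi _ Mx).
    rewrite (_ : _ - _ - _ = ip x x); last by rewrite ipBr; ring.
    by apply: psum_ext => k; rewrite BrB.
  have := psum_bound (C := C * nrm x * nrm y) r01 e0' _ hx.
  have [x0|x0] := eqVneq (nrm x) 0; first by rewrite x0 mulr_ge0 ?nrm_ge0// mulr_ge0.
  have xp : 0 < nrm x by rewrite lt_def x0 nrm_ge0.
  move=> hb'; rewrite -(ler_pM2l xp) -expr2 nrm2.
  apply: le_trans (ler_norm _) _; apply: le_trans (hb' _) _.
    by move=> k; apply: le_trans (bC _ Mx Gy) _; rewrite (_ : C * rho ^+ k * nrm x * nrm y = C * nrm x * nrm y * rho ^+ k)//; ring.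
  rewrite [leLHS](_ : _ = nrm x * (C / (1 - rho * e) * nrm y)); last by ring.
  by rewrite ler_wpM2l ?nrm_ge0// ler_wpM2r ?nrm_ge0.
have ny : nrm y <= 2 * C * e * nrm x.
  have hy : psum (fun k => beta k x y) e (ip y y / e ^+ s).
    have := psumB (hii _ Gy) (eqii _ Gy).
    rewrite (_ : _ - _ = ip y y / e ^+ s); last by rewrite -mulrBl -ipBl.
    by apply: psum_ext => k; rewrite BlB.
  have := psum_bound (C := C * nrm x * nrm y) r01 e0' _ hy.
  have [y0|y0] := eqVneq (nrm y) 0; first by rewrite y0 !mulr_ge0 ?nrm_ge0.
  have yp : 0 < nrm y by rewrite lt_def y0 nrm_ge0.
  have es : 0 < e ^+ s by rewrite exprn_gt0.
  have se : e ^+ s <= e.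
    have e1 : e <= 1 by move: eD eC es0; set a := e * sigma; set b := e * C ^+ 2; lra.
    by case: s s1 es => // s' _ _; rewrite exprS ler_piMr// exprn_ile1.
  move=> hb'; rewrite -(ler_pM2l yp) -expr2 nrm2.
  have : ip y y / e ^+ s <= C * nrm x * nrm y / (1 - rho * e).
    apply: le_trans (ler_norm _) _; apply: hb' => k.
    by apply: le_trans (bC _ Mx Gy) _; rewrite (_ : C * rho ^+ k * nrm x * nrm y = C * nrm x * nrm y * rho ^+ k)//; ring.
  rewrite ler_pdivrMr// => /le_trans; apply.
  rewrite [leLHS](_ : _ = nrm x * nrm y * (C / (1 - rho * e)) * e ^+ s); last by ring.
  rewrite [leRHS](_ : _ = nrm x * nrm y * (2 * C) * e); last by ring.
  rewrite ler_pM ?mulr_ge0 ?nrm_ge0 ?invr_ge0 ?exprn_ge0 ?subr_ge0 ?(ltW (andP r01).2)//.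
  by rewrite ler_wpM2l// mulr_ge0 ?nrm_ge0.
have x0 : nrm x = 0.
  have h1 : nrm x <= 4 * (e * C ^+ 2) * nrm x.
    apply: le_trans nx _; apply: le_trans (ler_wpM2l _ ny) _; first by rewrite mulr_ge0.
    by rewrite le_eqVlt; apply/orP; left; apply/eqP; ring.
  have h2 : 4 * (e * C ^+ 2) <= 2^-1 by move: eD eC es0; set a := e * sigma; set b := e * C ^+ 2; lra.
  have h3 : 4 * (e * C ^+ 2) * nrm x <= 2^-1 * nrm x by rewrite ler_wpM2r ?nrm_ge0.
  by apply/eqP; rewrite eq_le nrm_ge0 andbT; lra.
have psw k : psi k w = psi k w'.
  apply/eqP; rewrite -subr_eq0 -normr_le0.
  have -> : psi k w - psi k w' = psi k x.
    by rewrite /x (addrC w) -(scaleN1r w') pl// mulN1r addrC.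
  by apply: le_trans (pC _ Mx) _; rewrite x0 mulr0.
have pw k : `|psi k w| <= C * nrm w * rho ^+ k by apply: le_trans (pC _ Mw) _; rewrite mulrAC.
have [S [hS _]] := psum_geo r01 e0' pw.
exists S; split => //.
have d1 := dbl M psi C Lc wn w' sM pl C0 Lc0 pC Mwn Mw' wb hw'.
have := seq_cvgB hS d1; rewrite subr0; apply: seq_cvg_ext => N.
have -> : psi ^~ w = psi ^~ w' by apply/funext => k; exact: psw.
by rewrite opprB addrCA subrr addr0.
Qed.

End analytic_system.

(** * The energy space *)

Section l2vec.
Context (R : realType) (d n : nat).

Local Notation mu := (leb R d).

Definition l2pred : {pred 'I_n -> 'rV[R]_d -> R} := fun X => `[< forall i, sqint (X i) >].

Lemma l2predP X : reflect (forall i, sqint (X i)) (X \in l2pred).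
Proof. exact: asboolP. Qed.

Lemma l2pred_submod : submod_closed l2pred.
Proof.
split; first by apply/l2predP => i; exact: sqint0.
move=> a X Y /l2predP hX /l2predP hY; apply/l2predP => i.
exact: sqintD (sqintZ a (hX i)) (hY i).
Qed.

HB.instance Definition _ := GRing.isSubmodClosed.Build R _ l2pred l2pred_submod.

Record l2vec := L2vec { l2val :> 'I_n -> 'rV[R]_d -> R; l2valP : l2val \in l2pred }.

HB.instance Definition _ := [isSub for l2val].
HB.instance Definition _ := [Choice of l2vec by <:].
HB.instance Definition _ := [SubChoice_isSubLmodule of l2vec by <:].

Lemma l2sq (X : l2vec) i : sqint (X i).
Proof. by case: X => X /= /l2predP. Qed.

Definition l2ip (X Y : l2vec) : R := \int[mu]_x (\sum_(i < n) X i x * Y i x).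

Lemma l2ip_intg (X Y : l2vec) : intg (fun x => \sum_(i < n) X i x * Y i x).
Proof. by apply: intg_sum => i; apply: sqintM; exact: l2sq. Qed.

Lemma l2ipE (X Y : l2vec) : l2ip X Y = \sum_(i < n) \int[mu]_x (X i x * Y i x).
Proof. by rewrite /l2ip Int_sum// => i; apply: sqintM; exact: l2sq. Qed.

Lemma l2ipC X Y : l2ip X Y = l2ip Y X.
Proof. by apply: Int_ext => x; apply: eq_bigr => i _; rewrite mulrC. Qed.

Lemma l2ipDl X Y Z : l2ip (X + Y) Z = l2ip X Z + l2ip Y Z.
Proof.
rewrite /l2ip -IntD; try exact: l2ip_intg.
by apply: Int_ext => x /=; rewrite -big_split; apply: eq_bigr => i _; exact: mulrDl.
Qed.

Lemma l2ipZl a X Y : l2ip (a *: X) Y = a * l2ip X Y.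
Proof.
rewrite /l2ip -IntZ; last exact: l2ip_intg.
by apply: Int_ext => x; rewrite mulr_sumr; apply: eq_bigr => i _; rewrite mulrA.
Qed.

Lemma l2ip_ge0 X : 0 <= l2ip X X.
Proof. by apply: Int_ge0 => x; apply: sumr_ge0 => i _; rewrite -expr2 sqr_ge0. Qed.

Lemma l2_complete (u : nat -> l2vec) :
    (forall e, 0 < e -> exists N, forall m k, (N <= m)%N -> (N <= k)%N ->
       l2ip (u m - u k) (u m - u k) < e) ->
    exists l : l2vec, forall e, 0 < e -> exists N, forall k, (N <= k)%N ->
       l2ip (u k - l) (u k - l) < e.
Proof.
move=> cu.
have E (X Y : l2vec) : l2ip (X - Y) (X - Y) = \sum_(i < n) \int[mu]_x ((X i x - Y i x) ^+ 2).
  by rewrite l2ipE; apply: eq_bigr => i _; apply: Int_ext => x; rewrite -expr2.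
have hi i : exists v, sqint v /\ forall e, 0 < e -> exists N, forall k, (N <= k)%N ->
     \int[mu]_x (u k i x - v x) ^+ 2 < e.
  apply: riesz_fischer; first by move=> k; exact: l2sq.
  move=> e e0; have [N hN] := cu e e0; exists N => m k Nm Nk; apply: le_lt_trans (hN m k Nm Nk).
  rewrite E (bigD1 i)//= lerDl; apply: sumr_ge0 => j _; apply: Int_ge0 => x; exact: sqr_ge0.
have [v hv] := choice hi.
have vP : v \in l2pred by apply/l2predP => i; have [] := hv i.
exists (L2vec vP) => e e0.
have e1 : 0 < e / n.+1%:R by rewrite divr_gt0.
have [N hN] := choice (fun i => (hv i).2 _ e1).
exists (\max_i N i)%N => k hk; rewrite E.
apply: (@le_lt_trans _ _ (\sum_(i < n) e / n.+1%:R)).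
  apply: ler_sum => i _; apply: ltW; apply: hN; apply: leq_trans hk; exact: leq_bigmax.
rewrite sumr_const card_ord (_ : (e / n.+1%:R) *+ n = e * (n%:R / n.+1%:R)); last first.
  by rewrite -[LHS]mulr_natr mulrAC mulrA.
by rewrite gtr_pMr// ltr_pdivrMr// mul1r ltr_nat.
Qed.

Definition L2H : hilbert R := Hilbert l2ipC l2ipDl l2ipZl l2ip_ge0 l2_complete.

End l2vec.

Section gradient.
Context {R : realType} {d : nat}.
Implicit Types (f g : 'rV[R]_d -> R) (U : set 'rV[R]_d).

Local Notation mu := (leb R d).
Local Notation Int f := (\int[mu]_x f x).
Local Notation test := (test_function setT).

(** Total, with default value 0 when the partial derivatives are not square integrable, so that it
    can serve as the map [J] of [riesz]. *)
Definition grad f : L2H R d d :=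
  if pselect ((fun i => partial i f) \in @l2pred R d d) is left h then L2vec h else 0.

Lemma gradE U f i : test_function U f -> (grad f : l2vec R d d) i = partial i f.
Proof.
move=> tf; rewrite /grad; case: pselect => //= h; exfalso; apply: h.
by apply/l2predP => j; exact: test_sqint (test_partial j tf).
Qed.

Definition energy f g : R := ip (grad f) (grad g).

Lemma energyE U V f g : test_function U f -> test_function V g ->
  energy f g = \int[mu]_x (\sum_(i < d) partial i f x * partial i g x).
Proof.
move=> tf tg; apply: Int_ext => x; apply: eq_bigr => i _.
by rewrite (gradE _ tf) (gradE _ tg).
Qed.

Lemma grad_lin U (a : R) f g : test_function U f -> test_function U g ->
  grad (a *: f + g) = a *: grad f + grad g.
Proof.
move=> tf tg.
have tag : test_function U (a *: f + g) by exact: testD (testZ a tf) tg.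
apply: val_inj => /=; apply/funext => i.
rewrite (gradE i tag) [RHS](_ : _ = (fun x => a * (grad f : l2vec R d d) i x) \+ (grad g : l2vec R d d) i)//.
rewrite (gradE i tf) (gradE i tg).
have -> : a *: f + g = (fun x => a * f x) \+ g by [].
rewrite partialD; last 2 first.
- move=> x; exact: smooth_derivable (test_smooth (testZ a tf)).
- move=> x; exact: smooth_derivable (test_smooth tg).
congr (_ \+ _).
rewrite (@partialM _ _ (fun=> a) f); last 2 first.
- move=> x; exact: smooth_derivable (smooth_cst a).
- move=> x; exact: smooth_derivable (test_smooth tf).
by apply/funext => x /=; rewrite partial_cst mulr0 addr0.
Qed.

Lemma test_lin U (a : R) f g : test_function U f -> test_function U g ->
  test_function U (a *: f + g).
Proof. by move=> tf tg; exact: testD (testZ a tf) tg. Qed.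

Definition grads U : L2H R d d -> Prop := img (test_function U) grad.

Lemma subspace_grads U : subspace (grads U).
Proof.
apply: subspace_img; [exact: test0|by move=> *; exact: test_lin|].
by move=> a e f te tf; apply: (@grad_lin U).
Qed.

End gradient.

Section parts.
Context {R : realType} {d : nat}.
Implicit Types (f g th : 'rV[R]_d -> R) (U : set 'rV[R]_d).

Local Notation mu := (leb R d).
Local Notation Int f := (\int[mu]_x f x).

Lemma Int_parts U f g i : test_function U f -> smooth g ->
  \int[mu]_x (f x * partial i g x) = - \int[mu]_x (partial i f x * g x).
Proof.
move=> tf sg; have := Int_partial i (testMl tf sg).
rewrite partialM; last 2 first.
- by move=> x; exact: smooth_derivable (test_smooth tf).
- by move=> x; exact: smooth_derivable.
rewrite IntD.
- move/eqP; rewrite addr_eq0 => /eqP h; rewrite [LHS]h; congr (- _).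
  by apply: Int_ext => x /=; rewrite mulrC.
- exact: test_intg (testMl tf (smooth_partial i sg)).
- exact: test_intg (testMr sg (test_partial i tf)).
Qed.

Definition lap f x : R := \sum_(i < d) partial i (partial i f) x.

Lemma smooth_lap f : smooth f -> smooth (lap f).
Proof. by move=> sf; apply: smooth_sum => i; exact/smooth_partial/smooth_partial. Qed.

Lemma test_lap U f : test_function U f -> test_function U (lap f).
Proof. by move=> tf; apply: test_sum => i; exact/test_partial/test_partial. Qed.

Lemma energy_lap U V f g : test_function U f -> test_function V g ->
  energy f g = - \int[mu]_x (f x * lap g x).
Proof.
move=> tf tg; have sg := test_smooth tg.
rewrite (energyE tf tg) Int_sum; last first.
  by move=> i; exact: test_intg (testMl (test_partial i tf) (smooth_partial i sg)).
rewrite [X in _ = - X](_ : _ = \sum_(i < d) \int[mu]_x (f x * partial i (partial i g) x)).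
  by rewrite -sumrN; apply: eq_bigr => i _; rewrite (Int_parts i tf) ?opprK//; exact: smooth_partial.
rewrite -Int_sum; first by apply: Int_ext => x; rewrite mulr_sumr.
by move=> i; exact: test_intg (testMl tf (smooth_partial i (smooth_partial i sg))).
Qed.

Lemma energyC f g : energy f g = energy g f. Proof. exact: ipC. Qed.

Definition dot (u v : 'I_d -> R) : R := \sum_(i < d) u i * v i.

Definition nab f x : 'I_d -> R := fun i => partial i f x.

Lemma cs_dot (u v : 'I_d -> R) : dot u v ^+ 2 <= dot u u * dot v v.
Proof.
have hd (t : R) : 0 <= dot u u + 2 * t * dot u v + t ^+ 2 * dot v v.
  rewrite /dot mulr_sumr mulr_sumr -!big_split /=; apply: sumr_ge0 => i _.
  by have := sqr_ge0 (u i + t * v i); nra.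
have v0 : 0 <= dot v v by apply: sumr_ge0 => i _; rewrite -expr2 sqr_ge0.
have [v00|v1] := eqVneq (dot v v) 0.
  rewrite v00 mulr0; have [->|b0] := eqVneq (dot u v) 0; first by rewrite expr0n.
  have := hd (- (dot u u + 1) / (2 * dot u v)); rewrite v00 mulr0 addr0.
  have -> : 2 * (- (dot u u + 1) / (2 * dot u v)) * dot u v = - (dot u u + 1) by field.
  by rewrite opprD addrA subrr add0r; rewrite ler0N1.
have := hd (- dot u v / dot v v).
have -> : dot u u + 2 * (- dot u v / dot v v) * dot u v + (- dot u v / dot v v) ^+ 2 * dot v v
  = (dot u u * dot v v - dot u v ^+ 2) / dot v v by field.
by rewrite pmulr_lge0 ?invr_gt0 ?lt_def ?v1//subr_ge0.
Qed.

Lemma lapM f g : smooth f -> smooth g ->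
  lap (f \* g) = fun x => lap f x * g x + 2 * dot (nab f x) (nab g x) + f x * lap g x.
Proof.
move=> sf sg; have D (h : 'rV[R]_d -> R) : smooth h -> forall i x, derivable h x (delta_mx ord0 i).
  by move=> sh i x; exact: smooth_derivable.
apply/funext => x; rewrite /lap mulr_suml mulr_sumr mulr_sumr -!big_split /=.
apply: eq_bigr => i _.
rewrite (partialM (D _ sf i) (D _ sg i)).
rewrite (partialD (D _ (smoothM sf (smooth_partial i sg)) i) (D _ (smoothM sg (smooth_partial i sf)) i)).
rewrite (partialM (D _ sf i) (D _ (smooth_partial i sg) i)).
rewrite (partialM (D _ sg i) (D _ (smooth_partial i sf) i)) /= /nab.
move: (partial i (partial i f) x) (partial i (partial i g) x) (partial i f x) (partial i g x).
by move: (f x) (g x) => a b a2 b2 a1 b1; ring.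
Qed.

End parts.

(** * Hardy's inequality and multiplication by cutoffs *)

Section hardy.
Context {R : realType} {d : nat} (hd : (3 <= d)%N).
Implicit Types (f g th : 'rV[R]_d -> R) (U : set 'rV[R]_d).

Local Notation mu := (leb R d).

(** A smooth substitute for the weight |x|^-2 of Hardy's inequality. *)
Definition hardyw (x : 'rV[R]_d) : R := (1 + sqn x)^-1.

Lemma hardyw_gt0 x : 0 < hardyw x.
Proof. by rewrite invr_gt0 ltr_pwDl// sqn_ge0. Qed.

Lemma hardyw_le1 x : hardyw x <= 1.
Proof. by rewrite invf_le1 ?ltr_pwDl ?sqn_ge0// lerDl sqn_ge0. Qed.

Lemma smooth_hardyw : smooth hardyw.
Proof.
apply: smoothV; last by move=> x; rewrite ltr_pwDl// sqn_ge0.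
by apply: smoothD; [exact: smooth_cst|exact: smooth_sqn].
Qed.

Lemma partial_hardyw i x : partial i hardyw x = - 2 * x ord0 i * hardyw x ^+ 2.
Proof.
have s1 : smooth (fun x : 'rV[R]_d => 1 + sqn x).
  by apply: smoothD; [exact: smooth_cst|exact: smooth_sqn].
have x1 : 1 + sqn x != 0 by rewrite gt_eqF// ltr_pwDl// sqn_ge0.
have dV : is_derive (1 + sqn x) 1 (fun t : R => t^-1) (- (1 + sqn x) ^- 2).
  by apply: is_derive_eq; [exact: is_deriveV|rewrite [_ *: _]mulr1].
have := @partial_comp _ _ (fun t : R => t^-1) _ x i _ s1 dV => /= ->.
rewrite (@partialD _ _ (fun=> 1) sqn); last 2 first.
- by move=> y; exact: smooth_derivable (smooth_cst _).
- by move=> y; exact: smooth_derivable smooth_sqn.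
by rewrite partial_cst /= partial_sqn add0r /hardyw exprVn; ring.
Qed.

(** Integrate the divergence of f^2 w x, with w the weight: it equals 2 f w (x . grad f) + f^2 w (d
    - 2 |x|^2 w). Since |x|^2 w = 1 - w, the last bracket is d - 2 + 2 w >= 1; the first term is
    absorbed by Young's inequality and |x . grad f|^2 w <= |grad f|^2. *)
Theorem hardy U f : test_function U f ->
  \int[mu]_x (f x ^+ 2 * hardyw x) <= 4 * energy f f.
Proof.
move=> tf; have sf := test_smooth tf.
have df i x : derivable f x (delta_mx ord0 i) by exact: smooth_derivable.
pose G i (x : 'rV[R]_d) := x ord0 i * hardyw x.
have sG i : smooth (G i) by apply: smoothM; [exact: smooth_coord|exact: smooth_hardyw].
pose F i (x : 'rV[R]_d) := f x * f x * G i x.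
have tF i : test_function U (F i) by apply: testMl => //; exact: testMl.
pose L x := \sum_(i < d) partial i (F i) x.
have tL : test_function U L by apply: test_sum => i; exact: test_partial.
have L0 : \int[mu]_x L x = 0.
  rewrite /L Int_sum; first by rewrite big1// => i _; rewrite (Int_partial i (tF i)).
  by move=> i; exact: test_intg (test_partial i (tF i)).
have dE : d%:R = 1 + 2 + (d - 3)%:R :> R by rewrite -{1}(subnKC hd) natrD; ring.
have LE x : L x = 2 * f x * dot (nab f x) (fun i => x ord0 i) * hardyw x +
    f x ^+ 2 * hardyw x * (d%:R - 2 * sqn x * hardyw x).
  have -> : d%:R - 2 * sqn x * hardyw x = \sum_(i < d) (1 - 2 * x ord0 i ^+ 2 * hardyw x).
    by rewrite sumrB sumr_const card_ord -mulr_suml -mulr_sumr.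
  rewrite /dot mulr_sumr mulr_suml mulr_sumr -big_split /=.
  apply: eq_bigr => i _; rewrite (@partialM _ _ (f \* f) (G i)); last 2 first.
  - by move=> y; exact: smooth_derivable (smoothM sf sf).
  - by move=> y; exact: smooth_derivable.
  rewrite (partialM (df i) (df i)) (@partialM _ _ (fun x : 'rV[R]_d => x ord0 i) hardyw); last 2 first.
  - by move=> y; exact: smooth_derivable (smooth_coord i).
  - by move=> y; exact: smooth_derivable smooth_hardyw.
  by rewrite partial_coord eqxx /= partial_hardyw /G /nab; ring.
have tf2w : test_function U (fun x => f x ^+ 2 * hardyw x).
  have := testMl (testMl tf sf) smooth_hardyw; congr test_function.
have key x : 2^-1 * (f x ^+ 2 * hardyw x) - 2 * dot (nab f x) (nab f x) <= L x.
  rewrite LE; set w := hardyw x; set D := dot (nab f x) (fun i => x ord0 i).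
  set N := dot (nab f x) (nab f x).
  have w0 : 0 < w by exact: hardyw_gt0.
  have sw : sqn x * w = 1 - w.
    by rewrite /w /hardyw; field; rewrite gt_eqF// ltr_pwDl// sqn_ge0.
  have D2 : D ^+ 2 * w <= N.
    have := cs_dot (nab f x) (fun i => x ord0 i); rewrite -/D -/N.
    have -> : dot (fun i => x ord0 i) (fun i => x ord0 i) = sqn x by apply: eq_bigr => i _; rewrite expr2.
    have N0 : 0 <= N by apply: sumr_ge0 => i _; rewrite -expr2 sqr_ge0.
    move=> h; apply: (@le_trans _ _ (N * sqn x * w)); first by rewrite ler_wpM2r ?(ltW w0).
    by rewrite -mulrA sw; have := ltW w0; nra.
  rewrite -[2 * sqn x * w]mulrA sw dE -/w.
  have h1 : 0 <= f x ^+ 2 * w * ((d - 3)%:R + 2 * w).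
    by apply: mulr_ge0; [rewrite mulr_ge0 ?sqr_ge0 ?(ltW w0)|rewrite addr_ge0// mulr_ge0// (ltW w0)].
  have h2 : - (2 * f x * D * w) <= 2^-1 * (f x ^+ 2 * w) + 2 * (D ^+ 2 * w).
    have : 0 <= 2^-1 * (f x + 2 * D) ^+ 2 * w by apply: mulr_ge0; [rewrite mulr_ge0 ?sqr_ge0|exact: ltW].
    by nra.
  by nra.
have tN : test_function U (fun x => dot (nab f x) (nab f x)).
  by apply: test_sum => i; apply: testMl; [exact: test_partial|exact: smooth_partial].
have EN : energy f f = \int[mu]_x dot (nab f x) (nab f x).
  by rewrite (energyE tf tf).
have := @Int_le _ _ (fun x => 2^-1 * (f x ^+ 2 * hardyw x) - 2 * dot (nab f x) (nab f x)) L.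
rewrite L0 IntB; last 2 first.
- exact: test_intg (testZ _ tf2w).
- exact: test_intg (testZ _ tN).
rewrite (IntZ _ (test_intg tf2w)) (IntZ _ (test_intg tN)).
rewrite -EN => /(_ _ _ key) h.
have : 2^-1 * (\int[mu]_x (f x ^+ 2 * hardyw x)) - 2 * energy f f <= 0.
  apply: h; last exact: test_intg tL.
  exact: test_intg (testB (testZ _ tf2w) (testZ _ tN)).
by lra.
Qed.

(** The weight of Hardy's inequality is bounded below on the support of [th], so the energy controls
    f there in L^2. *)
Lemma test_mul_L2 U V th : test_function U th -> exists C : R, 0 <= C /\
  forall f, test_function V f -> \int[mu]_x ((th x * f x) ^+ 2) <= C * energy f f.
Proof.
move=> tth; have [C [r [C0 r0 thC th0]]] := test_bounded tth.
have B0 : 0 <= 1 + d%:R * r ^+ 2 by rewrite addr_ge0// mulr_ge0// sqr_ge0.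
pose B := C ^+ 2 * (1 + d%:R * r ^+ 2).
have B1 : 0 <= B by rewrite mulr_ge0 ?sqr_ge0.
exists (4 * B); split; first by rewrite mulr_ge0.
move=> f tf; have sf := test_smooth tf.
apply: (@le_trans _ _ (\int[mu]_x (B * (f x ^+ 2 * hardyw x)))); last first.
  rewrite IntZ; last by have := test_intg (testMl (testMl tf sf) smooth_hardyw); congr intg.
  rewrite (_ : 4 * B * _ = B * (4 * energy f f)); last by ring.
  by apply: ler_wpM2l => //; exact: hardy tf.
apply: Int_le.
- have := test_intg (testMl (testMl tth sf) (smoothM (test_smooth tth) sf)).
  by congr intg; apply/funext => x /=; rewrite expr2.
- by apply: intgZ; have := test_intg (testMl (testMl tf sf) smooth_hardyw); congr intg.
move=> x; have f0 : 0 <= f x ^+ 2 * hardyw x by rewrite mulr_ge0 ?sqr_ge0 ?(ltW (hardyw_gt0 x)).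
have [xr|xr] := leP r `|x|; first by rewrite th0// mul0r expr0n/= mulr_ge0.
rewrite exprMn /B -mulrA; apply: ler_pM; rewrite ?sqr_ge0//.
  by rewrite -[leLHS]ger0_norm ?sqr_ge0// normrX lerXn2r ?nnegrE.
rewrite mulrCA -{1}[f x ^+ 2]mulr1 ler_wpM2l ?sqr_ge0//.
rewrite /hardyw ler_pdivlMr ?ltr_pwDl ?sqn_ge0// mul1r lerD2l.
apply: le_trans (sqn_le_norm x) _; rewrite ler_wpM2l//.
by rewrite lerXn2r ?nnegrE ?(ltW r0) ?(ltW xr).
Qed.

Lemma sq_add2 (a b : R) : (a + b) ^+ 2 <= 2 * a ^+ 2 + 2 * b ^+ 2.
Proof. by have := sqr_ge0 (a - b); nra. Qed.

(** Product rule; the term f grad th, which the energy of f does not see directly, is controlled by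
    [test_mul_L2]. *)
Lemma nrm_test_mul U V th : test_function U th -> exists C : R, 0 <= C /\
  forall f, test_function V f -> nrm (grad (th \* f)) <= C * nrm (grad f).
Proof.
move=> tth; have sth := test_smooth tth.
have h1 (i : 'I_d) : exists C : R, 0 <= C /\ forall f, test_function V f ->
    \int[mu]_x ((partial i th x * f x) ^+ 2) <= C * energy f f.
  exact: test_mul_L2 (test_partial i tth).
have [A hA] := choice h1; have [C [r [C0 r0 thC th0]]] := test_bounded tth.
pose B := 2 * (\sum_(i < d) A i) + 2 * C ^+ 2.
have A0 : 0 <= \sum_(i < d) A i by apply: sumr_ge0 => i _; have [] := hA i.
have B0 : 0 <= B by rewrite addr_ge0// mulr_ge0// sqr_ge0.
exists (Num.sqrt B); split; first exact: sqrtr_ge0.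
move=> f tf; have sf := test_smooth tf.
rewrite /nrm -sqrtrM// ler_sqrt; last by rewrite mulr_ge0// ip_ge0.
rewrite -/(energy f f) -/(energy _ _).
have ttf := testMl tth sf.
have i1 i : test_function U (fun x => (partial i th x * f x) ^+ 2).
  have := testMl (testMl (test_partial i tth) sf) (smoothM (smooth_partial i sth) sf).
  by congr test_function; apply/funext => x; rewrite expr2.
have i2 i : test_function V (fun x => partial i f x ^+ 2).
  have := testMl (test_partial i tf) (smooth_partial i sf).
  by congr test_function; apply/funext => x; rewrite expr2.
rewrite (energyE ttf ttf) Int_sum; last first.
  by move=> i; exact: test_intg (testMl (test_partial i ttf) (smooth_partial i (test_smooth ttf))).
apply: (@le_trans _ _ (\sum_(i < d) (2 * (A i * energy f f) +
    2 * C ^+ 2 * \int[mu]_x (partial i f x ^+ 2)))).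
  apply: ler_sum => i _; have [Ai0 hAi] := hA i.
  apply: (@le_trans _ _ (\int[mu]_x (2 * (partial i th x * f x) ^+ 2 + 2 * C ^+ 2 * partial i f x ^+ 2))).
    apply: Int_le.
    - exact: test_intg (testMl (test_partial i ttf) (smooth_partial i (test_smooth ttf))).
    - by apply: intgD; apply: intgZ; [exact: test_intg (i1 i)|exact: test_intg (i2 i)].
    move=> x; rewrite (@partialM _ _ th f); last 2 first.
    - by move=> y; exact: smooth_derivable.
    - by move=> y; exact: smooth_derivable.
    rewrite /= -expr2 addrC; apply: le_trans (sq_add2 _ _) _.
    rewrite [f x * _]mulrC lerD2l -mulrA ler_wpM2l// exprMn ler_wpM2r ?sqr_ge0//.
    by rewrite -[leLHS]ger0_norm ?sqr_ge0// normrX lerXn2r ?nnegrE.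
  rewrite (@IntD _ _ (fun x => 2 * (partial i th x * f x) ^+ 2) (fun x => 2 * C ^+ 2 * partial i f x ^+ 2)).
  - rewrite !IntZ; [|exact: test_intg (i2 i)|exact: test_intg (i1 i)].
    by rewrite lerD2r ler_wpM2l// hAi.
  - by apply: intgZ; exact: test_intg (i1 i).
  - by apply: intgZ; exact: test_intg (i2 i).
rewrite big_split /= -!mulr_sumr -mulr_suml.
have -> : B * energy f f = 2 * ((\sum_(i < d) A i) * energy f f) + 2 * C ^+ 2 * energy f f.
  by rewrite /B; ring.
rewrite lerD2l.
rewrite (energyE tf tf) Int_sum; first by under eq_bigr do under Int_ext do rewrite expr2.
by move=> i; have := test_intg (i2 i); congr intg; apply/funext => x; rewrite expr2.
Qed.

End hardy.

(** * Convolution *)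

Section smooth_local.
Context {R : realType} {d : nat}.
Implicit Types (f g : 'rV[R]_d -> R) (x y z a b : 'rV[R]_d).

Local Notation mu := (leb R d).
Local Notation E i := (delta_mx ord0 i : 'rV[R]_d).

Lemma smooth_cube_bounded f (r : R) : 0 <= r -> smooth f ->
  exists C : R, 0 <= C /\ forall x, `|x| <= r -> `|f x| <= C.
Proof.
move=> r0 sf; pose a := Num.sqrt (d%:R * r ^+ 2).
have a0 : 0 <= a by exact: sqrtr_ge0.
have ab : 0 <= a < a + 1 by rewrite a0 ltrDl ltr01.
have tf := testMl (@test_bump _ _ a (a + 1) setT ab (fun _ _ => I)) sf.
have [C [_ [C0 _ hC _]]] := test_bounded tf.
exists C; split => // x xr; have := hC x; rewrite /= bump_eq1 ?mul1r//.
rewrite /a sqr_sqrtr ?mulr_ge0 ?sqr_ge0//; apply: le_trans (sqn_le_norm x) _.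
by rewrite ler_wpM2l// lerXn2r ?nnegrE.
Qed.

Lemma coord_mvt f x i (t : R) : smooth f ->
  exists2 s : R, `|s| <= `|t| & f (t *: E i + x) - f x = t * partial i f (s *: E i + x).
Proof.
move=> sf; have [t0|t0|->] := ltgtP t 0; last first.
- by exists 0; rewrite ?normr0// scale0r add0r subrr mul0r.
- have [s /andP[s0 st] ->] := line_mvt x i t0 sf; exists s => //.
  by rewrite !gtr0_norm ?(ltW st)//.
- have nt : 0 < - t by rewrite oppr_gt0.
  have [s /andP[s0 st]] := line_mvt (t *: E i + x) i nt sf.
  rewrite addrA -scalerDl addNr scale0r add0r => h.
  exists (s + t); last first.
    by apply: oppr_inj; rewrite opprB h scalerDl addrA mulNr.
  by rewrite ltr0_norm ?ltr0_norm//; lra.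
Qed.

(** Go from b to a by changing one coordinate at a time. The points supplied by the mean value
    theorem may leave the cube of radius r, but not the one of radius 3 r, on which the partial
    derivatives are bounded. *)
Lemma smooth_lipschitz f (r : R) : 0 <= r -> smooth f -> exists L : R, 0 <= L /\
  forall a b, `|a| <= r -> `|b| <= r -> `|f a - f b| <= L * `|a - b|.
Proof.
move=> r0 sf.
have r2 : 0 <= 3 * r by rewrite mulr_ge0.
have hC (i : 'I_d) : exists C : R, 0 <= C /\ forall x, `|x| <= 3 * r -> `|partial i f x| <= C.
  by apply: smooth_cube_bounded => //; exact: smooth_partial.
have [C hC'] := choice hC.
have S0 : 0 <= \sum_(i < d) C i by apply: sumr_ge0 => i _; have [] := hC' i.
exists (d%:R * \sum_(i < d) C i); split; first by rewrite mulr_ge0.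
move=> a b ar br.
pose c (k : nat) : 'rV[R]_d := \row_(j < d) (if (j < k)%N then a ord0 j else b ord0 j).
have cE (k : 'I_d) : c k.+1 = (a - b) ord0 k *: E k + c k.
  apply/rowP => j; rewrite !mxE ltnS eqxx /=; case: (ltngtP j k) => [jk|jk|/val_inj ->].
  - have -> : (j == k) = false by apply/eqP => e; rewrite e ltnn in jk.
    by rewrite mulr0 add0r.
  - have -> : (j == k) = false by apply/eqP => e; rewrite e ltnn in jk.
    by rewrite mulr0 add0r.
  - by rewrite eqxx mulr1 subrK.
have cr k : `|c k| <= r.
  apply: norm_le_coord => // j; rewrite mxE; case: ifP => _.
    exact: le_trans (coord_le_norm _ _) ar.
  exact: le_trans (coord_le_norm _ _) br.
have c0 : c 0 = b by apply/rowP => j; rewrite mxE.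
have cd : c d = a by apply/rowP => j; rewrite mxE ltn_ord.
have -> : f a - f b = \sum_(k < d) (f (c k.+1) - f (c k)).
  by rewrite -(big_mkord xpredT (fun k => f (c k.+1) - f (c k))) telescope_sumr// c0 cd.
apply: le_trans (ler_norm_sum _ _ _) _.
have -> : d%:R * (\sum_(i < d) C i) * `|a - b| = \sum_(k < d) (\sum_(i < d) C i) * `|a - b|.
  by rewrite sumr_const card_ord -[RHS]mulr_natl mulrA.
apply: ler_sum => k _; rewrite cE.
have [s st ->] := coord_mvt (c k) k ((a - b) ord0 k) sf.
rewrite normrM mulrC; apply: ler_pM => //; last exact: coord_le_norm.
have [Ck0 hk] := hC' k; apply: (@le_trans _ _ (C k)); last first.
  by rewrite (bigD1 k)//= lerDl; apply: sumr_ge0 => i _; have [] := hC' i.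
apply: hk; apply: norm_le_coord => // j; rewrite !mxE eqxx /=.
case: (eqVneq j k) => [->|_].
  rewrite ltnn mulr1; apply: le_trans (ler_normD _ _) _.
  have bk := le_trans (coord_le_norm b k) br.
  have e : `|(a - b) ord0 k| <= r + r.
    by apply: le_trans (coord_le_norm _ _) _; apply: le_trans (ler_normB _ _) _; exact: lerD.
  by move: st; lra.
rewrite mulr0 add0r; have := le_trans (coord_le_norm (c k) j) (cr k).
by rewrite mxE => /le_trans; apply; lra.
Qed.

End smooth_local.

Section convolution.
Context {R : realType} {d : nat}.
Implicit Types (f g eta : 'rV[R]_d -> R) (x y z : 'rV[R]_d).

Local Notation mu := (leb R d).
Local Notation E i := (delta_mx ord0 i : 'rV[R]_d).

Lemma near_row z (m : R) (P : 'rV[R]_d -> Prop) : 0 < m ->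
  (forall z', `|z - z'| < m -> P z') -> \forall t \near z, P t.
Proof. by move=> m0 h; apply/nbhs_normP; exists m. Qed.

(** All derivatives fall on [f], which will be smooth on the whole space, while [eta] is integrable
    and vanishes outside a cube. *)
Definition conv f eta z : R := \int[mu]_y (f (z - y) * eta y).

Definition vanish_out eta (r : R) := forall y, r < `|y| -> eta y = 0.

Lemma cont_translate f z : smooth f -> continuous (fun y => f (z - y)).
Proof.
move=> sf; rewrite (_ : (fun y => f (z - y)) = fun y => f (-1 *: y + z)).
  exact/cont_affine/smooth_continuous.
by apply/funext => y; rewrite scaleN1r addrC.
Qed.

Lemma meas_translate f z : smooth f -> measurable_fun setT (fun y : 'rV[R]_d => f (z - y)).
Proof. by move=> sf; apply: continuous_row_measurable; exact: cont_translate. Qed.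

Lemma conv_intg f eta (r : R) z : 0 <= r -> smooth f -> intg eta -> vanish_out eta r ->
  intg (fun y => f (z - y) * eta y).
Proof.
move=> r0 sf ie ve; have zr : 0 <= `|z| + r by rewrite addr_ge0.
have [C [C0 hC]] := smooth_cube_bounded zr sf.
apply: (@le_intg _ _ _ (fun y => C * `|eta y|)).
- by apply: measurable_funM; [exact: meas_translate|exact: intg_measurable].
- move=> y; rewrite normrM; have [yr|/ve ->] := leP `|y| r; last by rewrite normr0 !mulr0.
  by rewrite ler_wpM2r// hC// (le_trans (ler_normB _ _))// lerD2l.
- by apply: intgZ; exact: intg_norm.
Qed.

Lemma Int_mul_le (g eta : 'rV[R]_d -> R) (c r : R) : intg eta -> vanish_out eta r ->
  intg (fun y => g y * eta y) -> (forall y, `|y| <= r -> `|g y| <= c) ->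
  `|\int[mu]_y (g y * eta y)| <= c * \int[mu]_y `|eta y|.
Proof.
move=> ie ve ig gc; apply: le_trans (Int_norm ig) _.
have ine := intg_norm ie.
rewrite -IntZ//; apply: Int_le; [exact: intg_norm|exact: intgZ|].
move=> y; rewrite normrM; have [yr|/ve ->] := leP `|y| r; last by rewrite normr0 !mulr0.
by rewrite ler_wpM2r// gc.
Qed.

Section conv_smooth.
Variables (f eta : 'rV[R]_d -> R) (r : R).
Hypotheses (r0 : 0 <= r) (ie : intg eta) (ve : vanish_out eta r).

Let N := \int[mu]_y `|eta y|.
Let N0 : 0 <= N. Proof. by apply: Int_ge0. Qed.

Lemma conv_lip g z : smooth g -> exists L : R, 0 <= L /\ forall z', `|z' - z| <= 1 -> `|conv g eta z' - conv g eta z| <= L * `|z' - z|.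
Proof.
move=> sg; have B0 : 0 <= `|z| + 1 + r by rewrite !addr_ge0.
have [L [L0 hL]] := smooth_lipschitz B0 sg.
exists (L * N); split; first by rewrite mulr_ge0.
move=> z' hz; rewrite /conv -IntB; [|exact: conv_intg r0 _ ie ve|exact: conv_intg r0 _ ie ve].
rewrite (_ : \int[mu]_y _ = \int[mu]_y ((g (z' - y) - g (z - y)) * eta y)); last first.
  by apply: Int_ext => y /=; rewrite mulrBl.
rewrite mulrAC; apply: (@Int_mul_le _ _ _ r) => //.
  have := intgB (conv_intg z' r0 sg ie ve) (conv_intg z r0 sg ie ve).
  by congr intg; apply/funext => y /=; rewrite mulrBl.
move=> y yr; apply: le_trans (hL _ _ _ _) _.
- apply: le_trans (ler_normB _ _) _; apply: lerD => //.
  by rewrite -(subrK z z') (le_trans (ler_normD _ _))// addrC lerD2l.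
- by apply: le_trans (ler_normB _ _) _; apply: lerD => //; rewrite lerDl.
by rewrite opprB addrA subrK.
Qed.

Lemma conv_continuous g : smooth g -> continuous (conv g eta).
Proof.
move=> sg z; have [L [L0 hL]] := conv_lip z sg.
apply: (iffRL (@cvgrPdist_lt _ _ _ (nbhs z) _ (conv g eta) (conv g eta z))) => e e0.
have L1 : 0 < L + 1 by rewrite ltr_wpDl.
have m0 : 0 < Num.min 1 (e / (L + 1)) by rewrite lt_min ltr01 divr_gt0.
apply: (near_row m0) => z'; rewrite lt_min => /andP[h1 h2].
rewrite distrC; apply: le_lt_trans (hL z' _) _; first by rewrite distrC ltW.
rewrite distrC; move: h2; rewrite ltr_pdivlMr//.
by have := normr_ge0 (z - z'); nra.
Qed.

(** The Lipschitz bound on the derivative of [g] makes the error of the difference quotient at most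
    L |h|, uniformly over the cube outside which [eta] vanishes; integrating it gives the limit. *)
Lemma conv_derive g i z : smooth g ->
  is_derive z (E i) (conv g eta) (conv (partial i g) eta z).
Proof.
move=> sg; have sg' := smooth_partial i sg.
have B0 : 0 <= `|z| + 1 + r by rewrite !addr_ge0.
have [L [L0 hL]] := smooth_lipschitz B0 sg'.
have L1 : 0 < L * N + 1 by rewrite ltr_wpDl// mulr_ge0.
have nE : `|E i| <= 1.
  by apply: norm_le_coord => // j; rewrite !mxE/=; case: eqP => //=; rewrite ?normr1 ?normr0.
have lim : h^-1 *: (conv g eta (h *: E i + z) - conv g eta z) @[h --> 0^'] -->
    conv (partial i g) eta z.
  apply/cvgrPdist_lt => e e0; near=> h.
  have h0 : h != 0 by near: h; exact: nbhs_dnbhs_neq.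
  have h1 : `|h| <= 1.
    by near: h; apply: dnbhs0_le; exact: ltr01.
  have h2 : `|h| < e / (L * N + 1).
    by near: h; apply: dnbhs0_lt; rewrite divr_gt0.
  have i1 y : y = y -> intg (fun y => h^-1 * (g (h *: E i + z - y) - g (z - y)) * eta y).
    move=> _; have := intgZ h^-1 (intgB (conv_intg (h *: E i + z) r0 sg ie ve) (conv_intg z r0 sg ie ve)).
    by congr intg; apply/funext => u /=; rewrite -mulrBl mulrA.
  rewrite distrC; have -> : h^-1 *: (conv g eta (h *: E i + z) - conv g eta z) - conv (partial i g) eta z =
      \int[mu]_y ((h^-1 * (g (h *: E i + z - y) - g (z - y)) - partial i g (z - y)) * eta y).
    rewrite /conv -IntB; [|exact: conv_intg r0 _ ie ve|exact: conv_intg r0 _ ie ve].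
    rewrite [_ *: _](_ : _ = \int[mu]_y (h^-1 * (g (h *: E i + z - y) - g (z - y)) * eta y)); last first.
      rewrite -[LHS]/(h^-1 * _) -IntZ.
        by apply: Int_ext => y /=; rewrite -mulrBl mulrA.
      by apply: intgB; exact: conv_intg r0 _ ie ve.
    rewrite -IntB; [|exact: i1|exact: conv_intg r0 _ ie ve].
    by apply: Int_ext => y /=; rewrite mulrBl.
  apply: (@le_lt_trans _ _ (L * `|h| * N)).
    apply: (@Int_mul_le _ _ _ r) => //.
      have := intgB (i1 z erefl) (conv_intg z r0 sg' ie ve).
      by congr intg; apply/funext => y /=; rewrite mulrBl.
    move=> y yr; rewrite -addrA.
    have [s sh ->] := coord_mvt (z - y) i h sg.
    rewrite mulrA mulVf// mul1r; apply: le_trans (hL _ _ _ _) _.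
    - have sE : `|s *: E i| <= 1.
        by rewrite normrZ mulr_ile1// (le_trans sh).
      apply: le_trans (ler_normD _ _) _; rewrite addrAC addrC; apply: lerD => //.
      exact: le_trans (ler_normB _ _) (lerD (lexx _) yr).
    - by apply: le_trans (ler_normB _ _) _; apply: lerD => //; rewrite lerDl.
    rewrite addrK normrZ ler_wpM2l// (le_trans _ sh)//.
    by rewrite -[leRHS]mulr1 ler_wpM2l.
  move: h2; rewrite ltr_pdivlMr//; have := normr_ge0 h; nra.
by apply: DeriveDef; [apply/cvg_ex; eexists; exact: lim|exact: cvg_lim lim].
Unshelve. all: by end_near. Qed.

Lemma partial_conv g i : smooth g -> partial i (conv g eta) = conv (partial i g) eta.
Proof. by move=> sg; apply/funext => z; have [_ <-] := conv_derive i z sg. Qed.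

Lemma smooth_conv g : smooth g -> smooth (conv g eta).
Proof.
move=> sg k; elim: k g sg => [|k IH] g sg; first by split => //; exact: conv_continuous.
split; first exact: conv_continuous.
move=> i; split; first by move=> z; have [] := conv_derive i z sg.
by rewrite partial_conv//; apply: IH; exact: smooth_partial.
Qed.

End conv_smooth.

End convolution.

(** * Gegenbauer expansion *)

Section series_operations.
Context {R : realType}.

(** The factor k + 1 of term-by-term differentiation is absorbed in 2^(k+1), so each differentiation
    doubles the geometric ratio. *)
Lemma diffs_bound (c : nat -> R) (C s : R) : 0 <= C -> 0 <= s ->
  (forall k, `|c k| <= C * s ^+ k) ->
  forall k, `|pseries_diffs c k| <= (2 * C * s) * (2 * s) ^+ k.
Proof.
move=> C0 s0 h k; rewrite /pseries_diffs normrM ger0_norm//.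
apply: le_trans (ler_wpM2l _ (h _)) _ => //.
rewrite (_ : 2 * C * s * _ = 2 ^+ k.+1 * (C * s ^+ k.+1)); last by rewrite exprMn !exprS; ring.
by rewrite ler_wpM2r ?natr_le_exp2// mulr_ge0// exprn_ge0.
Qed.

Lemma psumZ (c : R) (a : nat -> R) (e s : R) : psum a e s -> psum (fun k => c * a k) e (c * s).
Proof.
move=> ha; rewrite /psum; apply: seq_cvg_ext (@seq_cvgZ _ c _ _ ha) => n.
by rewrite !pseriesE mulr_sumr; apply: eq_bigr => i _; rewrite mulrA.
Qed.

Lemma psumD (a b : nat -> R) (e s t : R) : psum a e s -> psum b e t ->
  psum (fun k => a k + b k) e (s + t).
Proof.
move=> ha hb; rewrite /psum; apply: seq_cvg_ext (seq_cvgD ha hb) => n.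
by rewrite !pseriesE -big_split; apply: eq_bigr => i _; rewrite mulrDl.
Qed.

Definition shift (a : nat -> R) n : R := if n is k.+1 then a k else 0.

Lemma psum_shift (a : nat -> R) (e s : R) : psum a e s -> psum (shift a) e (e * s).
Proof.
move=> ha; rewrite /psum -cvg_shiftS; apply: seq_cvg_ext (@seq_cvgZ _ e _ _ ha) => n.
rewrite [in RHS]/= !pseriesE big_ord_recl /= mul0r add0r mulr_sumr.
by apply: eq_bigr => i _; rewrite /fintype.bump /= add1n exprS; ring.
Qed.

End series_operations.

Section gegenbauer.
Context (R : realType) (Z X W m rho : R).
Hypotheses (Z0 : 0 < Z) (m0 : 0 <= m) (rho0 : 0 <= rho) (XZ : `|X| <= rho * Z)
  (W0 : 0 <= W) (WZ : W <= rho ^+ 2 * Z).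

(* (a_n, a_{n+1}), where the a_n are the Taylor coefficients of (Z - 2 t X + t^2 W)^-m *)
Fixpoint gegen2 (n : nat) : R * R :=
  match n with
  | 0 => (Z `^ (- m), 2 * m * X * Z `^ (- m) / Z)
  | k.+1 => let p := gegen2 k in
      (p.2, (2 * (k.+1%:R + m) * X * p.2 - (k%:R + 2 * m) * W * p.1) / (k.+2%:R * Z))
  end.

Definition gegen n := (gegen2 n).1.

Lemma gegen0 : gegen 0 = Z `^ (- m). Proof. by []. Qed.

Lemma gegen1 : gegen 1 = 2 * m * X * gegen 0 / Z. Proof. by []. Qed.

Lemma gegenSS n : gegen n.+2 =
  (2 * (n.+1%:R + m) * X * gegen n.+1 - (n%:R + 2 * m) * W * gegen n) / (n.+2%:R * Z).
Proof. by []. Qed.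

(** Chosen so that 2 (n + 1 + m) kap + (n + 2 m) <= kap^2 (n + 2), the inequality to which the
    recurrence reduces the growth bound. *)
Let kap := 3 + 2 * m.

Lemma gegen_bound n : `|gegen n| <= Z `^ (- m) * (kap * rho) ^+ n.
Proof.
have k0 : 0 < kap by rewrite /kap; have := m0; lra.
have ZV : 0 <= Z `^ (- m) by exact: powR_ge0.
suff : `|gegen n| <= Z `^ (- m) * (kap * rho) ^+ n /\
    `|gegen n.+1| <= Z `^ (- m) * (kap * rho) ^+ n.+1 by case.
elim: n => [|n [IH1 IH2]].
  split; first by rewrite gegen0 expr0 mulr1 ger0_norm.
  rewrite gegen1 gegen0 expr1 normrM normfV (gtr0_norm Z0) ler_pdivrMr// !normrM.
  rewrite (ger0_norm m0) (ger0_norm ZV) (ger0_norm (_ : 0 <= 2))//.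
  rewrite (_ : 2 * m * `|X| * _ = Z `^ (- m) * (2 * m * `|X|)); last by ring.
  rewrite -2!mulrA ler_wpM2l//; apply: (@le_trans _ _ (2 * m * (rho * Z))).
    by rewrite mulrA ler_wpM2l// mulr_ge0.
  by rewrite -[kap * rho * Z]mulrA ler_wpM2r// ?mulr_ge0// ?(ltW Z0)// /kap lerDr.
split => //; rewrite gegenSS normrM normfV (gtr0_norm (_ : 0 < n.+2%:R * Z)); last by rewrite mulr_gt0.
rewrite ler_pdivrMr ?mulr_gt0//.
apply: le_trans (ler_normB _ _) _; rewrite !normrM (ger0_norm W0) (ger0_norm (_ : 0 <= 2))//.
rewrite (ger0_norm (_ : 0 <= n.+1%:R + m)) ?addr_ge0// (ger0_norm (_ : 0 <= n%:R + 2 * m)) ?addr_ge0 ?mulr_ge0//.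
set A := Z `^ (- m) * (kap * rho) ^+ n in IH1.
have A0 : 0 <= A by rewrite mulr_ge0// exprn_ge0// mulr_ge0// ltW.
have E1 : Z `^ (- m) * (kap * rho) ^+ n.+1 = kap * rho * A by rewrite /A exprS; ring.
have E2 : Z `^ (- m) * (kap * rho) ^+ n.+2 = (kap * rho) ^+ 2 * A by rewrite /A !exprS; ring.
rewrite E1 in IH2; rewrite E2.
apply: (@le_trans _ _ (2 * (n.+1%:R + m) * (rho * Z) * (kap * rho * A) +
    (n%:R + 2 * m) * (rho ^+ 2 * Z) * A)).
  have hN : 0 <= n%:R + 2 * m by apply: addr_ge0 => //; exact: mulr_ge0.
  have hN1 : 0 <= 2 * (n.+1%:R + m) by apply: mulr_ge0 => //; exact: addr_ge0.
  apply: lerD; apply: ler_pM => //; try exact: mulr_ge0; exact: ler_wpM2l.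
rewrite -[leLHS](_ : (2 * (n.+1%:R + m) * kap + (n%:R + 2 * m)) * (rho ^+ 2 * Z * A) = _); last by ring.
rewrite -[leRHS](_ : kap ^+ 2 * n.+2%:R * (rho ^+ 2 * Z * A) = _); last by ring.
have hP : 0 <= rho ^+ 2 * Z * A by apply: mulr_ge0 => //; apply: mulr_ge0; [exact: sqr_ge0|exact: ltW].
apply: ler_wpM2r => //.
have e1 : n.+1%:R = n%:R + 1 :> R by rewrite natr1.
have e2 : n.+2%:R = n%:R + 2 :> R by rewrite -addn2 natrD.
rewrite e1 e2 /kap; have n0 : 0 <= n%:R :> R by []; move: n0 m0; set N := n%:R.
by move=> h1 h2; have := mulr_ge0 h1 h2; nra.
Qed.

(** Let f be the sum of the series and q(t) = Z - 2 t X + t^2 W. The recurrence says q f' + m q' f =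
    0, so f q^m is constant on [0, t0], with value 1 at 0. The factor 4 in the hypothesis comes from
    differentiating twice, each time doubling the ratio. *)
Lemma gegen_psum (t0 : R) : 0 <= t0 -> 4 * (kap * rho) * t0 < 1 ->
  psum gegen t0 ((Z - 2 * t0 * X + t0 ^+ 2 * W) `^ (- m)).
Proof.
move=> t00 tk.
have kap0 : 3 <= kap by rewrite /kap lerDl mulr_ge0.
pose q (t : R) := Z - 2 * t * X + t ^+ 2 * W.
have kr : 0 <= kap * rho by rewrite mulr_ge0// (le_trans _ kap0).
have q_gt0 (t : R) : 0 <= t <= t0 -> 0 < q t.
  move=> /andP[h1 h2]; rewrite /q.
  have rt : 12 * (rho * t) < 1.
    apply: le_lt_trans tk; rewrite [leRHS](_ : _ = (4 * kap) * (rho * t0)); last by ring.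
    apply: ler_pM => //; first exact: mulr_ge0.
      by move: kap0; lra.
    by rewrite ler_wpM2l.
  have h3 : t * X <= t * (rho * Z).
    by rewrite ler_wpM2l// (le_trans (ler_norm _)).
  have h4 : 0 <= t ^+ 2 * W by rewrite mulr_ge0// sqr_ge0.
  have : 0 < Z * (1 - 12 * (rho * t)) by rewrite mulr_gt0// subr_gt0.
  have h5 : 0 <= t * (rho * Z) by rewrite !mulr_ge0// ltW.
  have e5 : t * (rho * Z) = Z * (rho * t) by ring.
  rewrite (_ : Z * (1 - 12 * (rho * t)) = Z - 12 * (t * (rho * Z))); last by ring.
  rewrite (_ : Z - 2 * t * X + t ^+ 2 * W = Z - 2 * (t * X) + t ^+ 2 * W); last by ring.
  by move: h3 h4 h5; set a := t * X; set b := t ^+ 2 * W; set c := t * (rho * Z); lra.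
(* Term-by-term differentiation needs convergence of the derived series at a point strictly beyond
   t0. *)
have [K [tK K0 K1]] : exists K : R, [/\ t0 < K, 0 < K & 4 * (kap * rho) * K < 1].
  have d0 : 0 < 4 * (kap * rho) + 1 by rewrite ltr_wpDl// mulr_ge0.
  set s := 4 * (kap * rho) in tk d0 *.
  have s0 : 0 <= s by rewrite mulr_ge0.
  have n0 : 0 < 1 - s * t0 by rewrite subr_gt0.
  have x0 : 0 < (1 - s * t0) / (s + 1) / 2 by rewrite !divr_gt0.
  exists (t0 + (1 - s * t0) / (s + 1) / 2); split; first by rewrite ltrDl.
    by rewrite ltr_wpDl.
  rewrite mulrDr; set u := 1 - s * t0 in x0 n0 *.
  have e : s * (u / (s + 1) / 2) <= u / 2.
    rewrite !mulrA ler_pM2r// ler_pdivrMr// mulrC ler_wpM2l ?(ltW n0)// lerDl//.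
  by move: n0 e; rewrite /u; lra.
pose C := Z `^ (- m); have C0 : 0 <= C by exact: powR_ge0.
have b0 := gegen_bound.
have b1 := diffs_bound C0 kr b0.
have b2 : forall k, `|pseries_diffs (pseries_diffs gegen) k| <=
    2 * (2 * C * (kap * rho)) * (2 * (kap * rho)) * (2 * (2 * (kap * rho))) ^+ k.
  by apply: diffs_bound => //; apply: mulr_ge0 => //; apply: mulr_ge0 => //; exact: mulr_ge0.
have cvK (c : nat -> R) (A s t : R) : 0 <= s <= 4 * (kap * rho) -> `|t| <= K ->
    (forall k, `|c k| <= A * s ^+ k) -> cvgn (pseries c t).
  move=> /andP[s0 sk] tK' hc; apply: normed_cvg.
  have q1 : 0 <= s * `|t| < 1.
    rewrite mulr_ge0//=; apply: le_lt_trans K1; exact: ler_pM.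
  have hc' k : `| `|c k| | <= A * s ^+ k by rewrite normr_id.
  have [l [hl _]] := psum_geo q1 (normr_ge0 t) hc'.
  apply/cvg_ex; exists l; apply: seq_cvg_ext hl => n; rewrite /pseries /series /=.
  by apply: eq_bigr => k _; rewrite normrM normrX.
have h4 : 0 <= kap * rho <= 4 * (kap * rho) by rewrite kr /=; move: kr; lra.
have h4' : 0 <= 2 * (kap * rho) <= 4 * (kap * rho) by apply/andP; split; move: kr; lra.
have h4'' : 0 <= 2 * (2 * (kap * rho)) <= 4 * (kap * rho) by apply/andP; split; move: kr; lra.
pose f (t : R) : R := limn (pseries gegen t); pose f' (t : R) : R := limn (pseries (pseries_diffs gegen) t).
have KK : `|K| <= K by rewrite gtr0_norm.
have df (t : R) : `|t| < K -> is_derive t (1 : R) f (f' t).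
  move=> tK'; apply: (@pseries_snd_diffs _ _ K).
  - exact: cvK h4 KK b0.
  - exact: cvK h4' KK b1.
  - exact: cvK h4'' KK b2.
  - by rewrite (gtr0_norm K0).
have sf (t : R) : `|t| < K -> psum gegen t (f t) by move=> /ltW tK'; exact: cvK h4 tK' b0.
have sf' (t : R) : `|t| < K -> psum (pseries_diffs gegen) t (f' t) by move=> /ltW tK'; exact: cvK h4' tK' b1.
(* The left side is a combination of shifted series whose coefficients all vanish by the recurrence;
   the first two are checked separately. *)
have ode (t : R) : `|t| < K -> q t * f' t + m * (2 * t * W - 2 * X) * f t = 0.
  move=> tK'; have h := sf t tK'; have h' := sf' t tK'.
  have hh := psumD (psumD (psumD (@psumZ _ Z _ _ _ h') (@psumZ _ (- 2 * X) _ _ _ (psum_shift h')))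
     (@psumZ _ W _ _ _ (psum_shift (psum_shift h')))) (psumD (@psumZ _ (2 * m * W) _ _ _ (psum_shift h)) (@psumZ _ (- 2 * m * X) _ _ _ h)).
  have := psum_unique hh (_ : psum _ t 0).
  have -> : q t * f' t + m * (2 * t * W - 2 * X) * f t = Z * f' t + -2 * X * (t * f' t) +
     W * (t * (t * f' t)) + (2 * m * W * (t * f t) + -2 * m * X * f t) by rewrite /q; ring.
  apply; apply: (@seq_cvg_ext _ (fun=> 0)); last exact: cvg_cst.
  move=> n; rewrite pseriesE big1// => -[[|[|k]] /= _] _.
  - rewrite /pseries_diffs gegen1 /=; field.
    by rewrite gt_eqF.
  - rewrite /pseries_diffs gegenSS gegen1 /=; field.
    by rewrite gt_eqF.
  - rewrite /pseries_diffs (gegenSS k.+1) /=.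
    have e3 : k.+3%:R != 0 :> R by [].
    rewrite (_ : k.+2%:R = k.+1%:R + 1); last by rewrite natr1.
    field; rewrite gt_eqF//=.
have dq (t : R) : is_derive t (1 : R) q (2 * t * W - 2 * X).
  apply: is_derive_eq => //=.
  by rewrite /GRing.scale /=; ring.
have dh (t : R) : 0 <= t <= t0 -> is_derive t (1 : R) (fun t => f t * q t `^ m) 0.
  move=> ht; have tK' : `|t| < K.
    by case/andP: ht => h1 h2; rewrite ger0_norm// (le_lt_trans h2).
  have dp := is_derive1_powR m (q_gt0 t ht).
  have dp' : is_derive t (1 : R) (fun t => q t `^ m) (m * q t `^ (m - 1) * (2 * t * W - 2 * X)).
    exact: (@is_derive1_comp _ (fun s => s `^ m) q t _ _ dp (dq t)).
  have hM := @is_deriveM _ _ f (fun t => q t `^ m) t 1 _ _ (df t tK') dp'.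
  have e := ode t tK'.
  have -> : 0 = f t *: (m * q t `^ (m - 1) * (2 * t * W - 2 * X)) + q t `^ m *: f' t.
    have -> : q t `^ m = q t * q t `^ (m - 1).
      rewrite -{2}(powRr1 (ltW (q_gt0 t ht))) -powRD; first by rewrite addrC subrK.
      by rewrite (gt_eqF (q_gt0 t ht)) implybT.
    have : q t `^ (m - 1) * (q t * f' t + m * (2 * t * W - 2 * X) * f t) = 0 by rewrite e mulr0.
    by move=> <-; rewrite /GRing.scale /=; ring.
  exact: hM.
have cont : {within `[0, t0], continuous (fun t => f t * q t `^ m)}.
  apply: derivable_within_continuous => x; rewrite in_itv /= => hx.
  by have [] := dh x hx.
have dh' x : x \in `]0, t0[%R -> is_derive x 1 (fun t => f t * q t `^ m) 0.
  by rewrite in_itv /= => /andP[h1 h2]; apply: dh; rewrite !ltW.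
have [c _] := @MVT_segment R (fun t => f t * q t `^ m) (fun=> 0) 0 t0 t00 dh' cont.
rewrite mul0r => /subr0_eq fq.
have f0 : f 0 = Z `^ (- m).
  have := psum_unique (sf 0 _) (_ : psum gegen 0 (Z `^ (- m))); apply; first by rewrite normr0.
  rewrite /psum -cvg_shiftS; apply: (@seq_cvg_ext _ (fun=> Z `^ (- m))); last exact: cvg_cst.
  move=> n; rewrite [in RHS]/= pseriesE big_ord_recl expr0 mulr1 big1 ?addr0// => i _.
  by rewrite /= expr0n /= mulr0.
have t0K : `|t0| < K by rewrite ger0_norm.
have q0 : q 0 = Z by rewrite /q; ring.
have qt : 0 < q t0 by apply: q_gt0; rewrite t00 lexx.
have h := sf t0 t0K; suff <- : f t0 = q t0 `^ (- m) by [].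
rewrite powRN; apply: (mulIf (lt0r_neq0 (powR_gt0 m qt))).
by rewrite fq f0 q0 powRN !mulVf// lt0r_neq0// powR_gt0.
Qed.

End gegenbauer.

(** * Green's representation *)

Section locality.
Context {R : realType} {d : nat}.
Implicit Types (f g : 'rV[R]_d -> R) (O : set 'rV[R]_d).

Lemma partial_open f g O x i : open O -> (forall y, O y -> f y = g y) -> O x ->
  partial i f x = partial i g x.
Proof.
move=> oO fg Ox; apply: near_eq_derive.
  by near=> y; apply: fg; near: y; exact: open_nbhs_nbhs.
Unshelve. all: by end_near. Qed.

Lemma lap_open f g O x : open O -> (forall y, O y -> f y = g y) -> O x -> lap f x = lap g x.
Proof.
move=> oO fg Ox; apply: eq_bigr => i _; apply: (partial_open i oO) => // y Oy.
exact: (partial_open i oO).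
Qed.

Lemma open_sqn_lt (r : R) : open [set x : 'rV[R]_d | sqn x < r].
Proof.
apply: (@open_comp _ _ (@sqn R d) [set t | t < r]); last exact: open_lt.
by move=> z _; exact: continuous_sqn.
Qed.

End locality.

(** For a kernel k and a cutoff x around a point z, with ey and ez the values of a function at y and
    z: either y is near z, so that x = 1 and the function varies by at most A, or the kernel is at
    most M. *)
Lemma kernel_split (R : realType) (k x ey ez A M C : R) : 0 <= k -> 0 <= x -> 0 <= A -> 0 <= M ->
  `|ez| <= C -> (x = 1 /\ `|ey - ez| <= A) \/ k <= M ->
  `|k * (ey - ez * x)| <= A * (k * x) + M * (`|ey| + C * x).
Proof.
move=> k0 x0 A0 M0 ezC; have C0 : 0 <= C := le_trans (normr_ge0 _) ezC.
rewrite normrM (ger0_norm k0) => -[[-> h]|kM].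
  rewrite !mulr1 -[leLHS]addr0; apply: lerD; first by rewrite mulrC ler_wpM2r.
  by rewrite mulr_ge0// addr_ge0.
rewrite -[leLHS]add0r; apply: lerD; first by rewrite mulr_ge0// mulr_ge0.
apply: ler_pM => //; apply: le_trans (ler_normB _ _) _.
by rewrite lerD2l normrM (ger0_norm x0) ler_wpM2r.
Qed.

(** Integrates the pointwise dichotomy of [kernel_split]: a is the value of [eta] at the centre, c
    the mass of the cut off kernel. *)
Lemma Int_approx (R : realType) (d : nat) (k X eta : 'rV[R]_d -> R) (a c N A M C : R) :
  intg (fun y => k y * eta y) -> intg (fun y => k y * X y) ->
  \int[leb R d]_y (k y * X y) = c -> intg X -> \int[leb R d]_y X y = N -> intg eta ->
  (forall y, `|k y * (eta y - a * X y)| <= A * (k y * X y) + M * (`|eta y| + C * X y)) ->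
  `|\int[leb R d]_y (k y * eta y) - c * a| <= A * c + M * (\int[leb R d]_y `|eta y| + C * N).
Proof.
move=> ik ikX E1 iX E2 ie h.
have iC := intgZ C iX; have iA := intgZ A ikX; have ine := intg_norm ie.
have iS := intgD ine iC; have iM := intgZ M iS; have iz := intgZ a ikX.
have -> : \int[leb R d]_y (k y * eta y) - c * a =
    \int[leb R d]_y (k y * (eta y - a * X y)).
  rewrite -E1 [X in _ - X]mulrC -(IntZ _ ikX) -(IntB ik iz).
  by apply: Int_ext => y /=; ring.
have iD : intg (fun y => k y * (eta y - a * X y)).
  have := intgB ik iz; congr intg; apply/funext => y /=; ring.
apply: le_trans (Int_norm iD) _.
have -> : A * c + M * (\int[leb R d]_y `|eta y| + C * N) =
    \int[leb R d]_y (A * (k y * X y) + M * (`|eta y| + C * X y)).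
  by rewrite -E1 -E2 -(IntZ _ ikX) -(IntZ _ iX) -(IntD ine iC) -(IntZ _ iS) -(IntD iA iM).
apply: Int_le => //; first exact: intg_norm.
exact: intgD.
Qed.

(** * The regularised fundamental solution *)

Section plummer.
Context {R : realType} {d : nat} (hd : (3 <= d)%N).
Implicit Types (x y z : 'rV[R]_d).

Local Notation mu := (leb R d).

Definition lam : R := (d%:R - 2) / 2.

Lemma lam_gt0 : 0 < lam.
Proof.
have : 3%:R <= d%:R :> R by rewrite ler_nat.
by rewrite /lam; lra.
Qed.

(* For a = - lam this is the fundamental solution of the Laplacian, up to a constant,
   smoothed at scale del; kdel is minus its Laplacian. *)
Definition plum (a del : R) y : R := (sqn y + del ^+ 2) `^ a.

Lemma sqnN y : sqn (- y) = sqn y.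
Proof. by apply: eq_bigr => i _; rewrite mxE sqrrN. Qed.

Lemma plumBC a del y z : plum a del (y - z) = plum a del (z - y).
Proof. by rewrite /plum -opprB sqnN. Qed.

Lemma plum_ge0 a del y : 0 <= plum a del y. Proof. exact: powR_ge0. Qed.

Let base_gt0 (del : R) y : 0 < del -> 0 < sqn y + del ^+ 2.
Proof. by move=> d0; rewrite ltr_wpDl ?sqn_ge0// exprn_gt0. Qed.

Let smooth_base (del : R) : smooth (fun y : 'rV[R]_d => sqn y + del ^+ 2).
Proof. by apply: smoothD; [exact: smooth_sqn|exact: smooth_cst]. Qed.

Lemma smooth_plum a (del : R) : 0 < del -> smooth (plum a del).
Proof. by move=> d0; apply: smooth_powR => // y; exact: base_gt0. Qed.

Lemma partial_plum a (del : R) i : 0 < del ->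
  partial i (plum a del) = fun y => 2 * a * y ord0 i * plum (a - 1) del y.
Proof.
move=> d0; apply/funext => y.
have h := @is_derive1_powR R a _ (base_gt0 y d0).
have := @partial_comp _ _ (fun t => t `^ a) (fun y : 'rV[R]_d => sqn y + del ^+ 2) y i _ (smooth_base del) h.
rewrite -/(plum a del) => ->.
rewrite (@partialD _ _ sqn (fun=> del ^+ 2)); last 2 first.
- by move=> z; exact: smooth_derivable smooth_sqn.
- by move=> z; exact: smooth_derivable (smooth_cst _).
by rewrite partial_cst /= partial_sqn addr0 /plum; ring.
Qed.

Definition kdel (del : R) y : R := d%:R * (d%:R - 2) * del ^+ 2 * plum (- lam - 2) del y.

Let d2_ge0 : 0 <= d%:R - 2 :> R.
Proof. by have := lam_gt0; rewrite /lam; lra. Qed.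

Let kc_ge0 (del : R) : 0 <= d%:R * (d%:R - 2) * del ^+ 2.
Proof. by apply: mulr_ge0; [apply: mulr_ge0|exact: sqr_ge0]. Qed.

Lemma kdel_ge0 del y : 0 <= kdel del y.
Proof. by apply: mulr_ge0; [exact: kc_ge0|exact: plum_ge0]. Qed.

Lemma smooth_kdel (del : R) : 0 < del -> smooth (kdel del).
Proof. by move=> d0; apply: smoothZ; exact: smooth_plum. Qed.

(** For the exponent -lam with 2 (lam + 1) = d the terms in [sqn y] cancel, and only the one in
    del^2 remains. *)
Lemma lap_plum (del : R) : 0 < del -> lap (plum (- lam) del) = fun y => - kdel del y.
Proof.
move=> d0; apply/funext => y; rewrite /lap.
set b := sqn y + del ^+ 2; have b0 : 0 < b by exact: base_gt0.
have E i : partial i (partial i (plum (- lam) del)) y =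
    2 * - lam * (plum (- lam - 2) del y * (sqn y + del ^+ 2 + 2 * (- lam - 1) * y ord0 i ^+ 2)).
  rewrite partial_plum//.
  have -> : (fun y : 'rV[R]_d => 2 * - lam * y ord0 i * plum (- lam - 1) del y) =
     (fun y : 'rV[R]_d => 2 * - lam * y ord0 i) \* plum (- lam - 1) del by [].
  rewrite (@partialM _ _ (fun y : 'rV[R]_d => 2 * - lam * y ord0 i)); last 2 first.
  - by move=> z; exact: smooth_derivable (smoothZ _ (smooth_coord i)).
  - by move=> z; exact: smooth_derivable (smooth_plum _ d0).
  rewrite (@partialM _ _ (fun=> 2 * - lam) (fun y : 'rV[R]_d => y ord0 i)); last 2 first.
  - by move=> z; exact: smooth_derivable (smooth_cst _).
  - by move=> z; exact: smooth_derivable (smooth_coord i).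
  rewrite partial_cst partial_coord eqxx partial_plum//=.
  have -> : - lam - 1 - 1 = - lam - 2 by ring.
  have -> : plum (- lam - 1) del y = plum (- lam - 2) del y * (sqn y + del ^+ 2).
    rewrite /plum -/b -{3}(powRr1 (ltW b0)) -powRD ?(gt_eqF b0) ?implybT//.
    by congr (_ `^ _); ring.
  by ring.
rewrite (eq_bigr _ (fun i _ => E i)) -!mulr_sumr big_split /= sumr_const card_ord -mulr_sumr -/(sqn y).
rewrite -[(sqn y + _) *+ d]mulr_natr /kdel.
have -> : lam = (d%:R - 2) / 2 by [].
by field.
Qed.

Lemma plum_le a (del q : R) y : a <= 0 -> 0 < q -> q <= sqn y + del ^+ 2 -> plum a del y <= q `^ a.
Proof.
move=> a0 q0 qy; rewrite /plum -[a]opprK ![_ `^ (- - a)]powRN.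
have na : 0 <= - a by rewrite oppr_ge0.
have qq : 0 < q `^ (- a) by exact: powR_gt0.
have yq : 0 < sqn y + del ^+ 2 by exact: lt_le_trans qy.
rewrite lef_pV2 ?posrE ?powR_gt0//.
by apply: ge0_ler_powR; rewrite ?nnegrE// ltW.
Qed.

Definition delta n : R := n.+1%:R^-1.

Lemma delta_gt0 n : 0 < delta n. Proof. by rewrite invr_gt0. Qed.

Lemma delta_le1 n : delta n <= 1. Proof. by rewrite invf_le1 ?ltr0n// ler1n. Qed.

Lemma delta_cvg : delta n @[n --> \oo] --> (0 : R). Proof. exact: cvg_harmonic. Qed.

Lemma plum_cvg a y : 0 < sqn y -> plum a (delta n) y @[n --> \oo] --> plum a 0 y.
Proof.
move=> y0; rewrite /plum expr0n /= addr0.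
have h : (sqn y + delta n ^+ 2) @[n --> \oo] --> sqn y.
  rewrite -[X in _ --> X]addr0; apply: cvgD; first exact: cvg_cst.
  by rewrite -(mulr0 (0 : R)); apply: cvgM; exact: delta_cvg.
have c : {for sqn y, continuous (fun t : R => t `^ a)}.
  apply: differentiable_continuous; apply/derivable1_diffP.
  by have [] := @is_derive1_powR R a _ y0.
exact: (cvg_comp _ _ h c).
Qed.

Lemma kdel_le (del r : R) y : 0 < r -> r <= sqn y ->
  kdel del y <= d%:R * (d%:R - 2) * del ^+ 2 * r `^ (- lam - 2).
Proof.
move=> r0 ry; apply: ler_wpM2l; first exact: kc_ge0.
apply: plum_le => //.
  by have := lam_gt0; lra.
by rewrite (le_trans ry)// lerDl sqr_ge0.
Qed.

Let X : 'rV[R]_d -> R := bump 1 2.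

Let tX : test_function setT X.
Proof. by apply: test_bump => //; rewrite ler01 ltr1n. Qed.

Let X12 : (0 : R) <= (1 : R) < 2.
Proof. by rewrite ler01 ltr1n. Qed.

Let XBC y z : X (y - z) = X (z - y).
Proof. by rewrite /X /bump -[in LHS](opprB z y) sqnN. Qed.

Let lapX_out y : sqn y < 1 -> lap X y = 0.
Proof.
move=> y1; rewrite (@lap_open _ _ X (fun=> 1) _ _ (@open_sqn_lt _ _ 1) _ y1); last first.
  move=> z /= z1; have h : sqn z <= 1 ^+ 2 by rewrite expr1n ltW.
  by rewrite /X (bump_eq1 X12 h).
by rewrite /lap big1// => i _; rewrite !partial_cst.
Qed.

Definition cdel (del : R) := \int[mu]_y (kdel del y * X y).

Lemma kX_intg (del : R) : 0 < del -> intg (fun y => kdel del y * X y).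
Proof. by move=> d0; exact: test_intg (testMr (smooth_kdel d0) tX). Qed.

(** Integration by parts moves the Laplacian to the cutoff. Its Laplacian vanishes near the origin,
    where the kernel becomes singular as del tends to 0, so the mass has a limit. *)
Lemma cdel_lap (del : R) : 0 < del -> cdel del = - \int[mu]_y (lap X y * plum (- lam) del y).
Proof.
move=> d0; have sP := smooth_plum (- lam) d0; have sX := test_smooth tX.
have -> : \int[mu]_y (lap X y * plum (- lam) del y) = \int[mu]_y (X y * lap (plum (- lam) del) y).
  rewrite (_ : (fun _ => lap X _ * _) = fun y => \sum_(i < d) partial i (partial i X) y * plum (- lam) del y); last first.
    by apply/funext => y; rewrite mulr_suml.
  rewrite (_ : (fun _ => X _ * _) = fun y => \sum_(i < d) X y * partial i (partial i (plum (- lam) del)) y); last first.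
    by apply/funext => y; rewrite mulr_sumr.
  rewrite Int_sum; last by move=> i; exact: test_intg (testMl (test_partial i (test_partial i tX)) sP).
  rewrite Int_sum; last by move=> i; exact: test_intg (testMl tX (smooth_partial i (smooth_partial i sP))).
  apply: eq_bigr => i _; rewrite (Int_parts i tX (smooth_partial i sP)).
  by rewrite (Int_parts i (test_partial i tX) sP) opprK.
rewrite lap_plum// -[RHS]mulN1r -IntZ.
  by apply: Int_ext => y; ring.
exact: test_intg (testMl tX (smoothN (smooth_kdel d0))).
Qed.

(** The normalising constant of the fundamental solution. It is not computed; its positivity is
    enough to divide by it. *)
Definition cgreen : R := - \int[mu]_y (lap X y * plum (- lam) 0 y).

Let lapX_meas : measurable_fun setT (lap X).
Proof. exact: smooth_measurable (test_smooth (test_lap tX)). Qed.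

Lemma sqn_measurable : measurable_fun setT (@sqn R d).
Proof. exact: smooth_measurable smooth_sqn. Qed.

Lemma plum_measurable a del : measurable_fun setT (plum a del).
Proof.
rewrite (_ : plum a del = (fun t : R => t `^ a) \o (fun y => sqn y + del ^+ 2))//.
apply: (@measurableT_comp _ _ _ _ _ _ (fun t : R => t `^ a)); first exact: measurable_powR.
by apply: measurable_funD => //; exact: sqn_measurable.
Qed.

Lemma lapX_plum n y : `|lap X y * plum (- lam) (delta n) y| <= `|lap X y|.
Proof.
rewrite normrM; have [y1|y1] := ltP (sqn y) 1.
  by rewrite lapX_out// normr0 mul0r.
rewrite -[leRHS]mulr1 ler_wpM2l// ger0_norm ?plum_ge0//.
rewrite (_ : 1 = (1 : R) `^ (- lam)); last by rewrite powR1.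
apply: plum_le => //.
  by rewrite oppr_le0 ltW// lam_gt0.
by rewrite (le_trans y1)// lerDl sqr_ge0.
Qed.

Lemma cdel_cvg : cdel (delta n) @[n --> \oo] --> cgreen.
Proof.
rewrite (_ : (fun n => cdel (delta n)) = fun n => - \int[mu]_y (lap X y * plum (- lam) (delta n) y)); last first.
  by apply/funext => n; rewrite cdel_lap// delta_gt0.
apply: cvgN; apply: (@Int_dominated _ _ _ _ (fun y => `|lap X y|)).
- by move=> n; apply: measurable_funM => //; exact: plum_measurable.
- by apply: measurable_funM => //; exact: plum_measurable.
- move=> y; have [y1|y1] := ltP (sqn y) 1.
    by rewrite lapX_out// mul0r; under eq_fun do rewrite mul0r; exact: cvg_cst.
  by apply: seq_cvgZ; apply: plum_cvg; exact: lt_le_trans y1.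
- exact: intg_norm (test_intg (test_lap tX)).
by move=> n y; exact: lapX_plum.
Qed.

Let kX_ge0 del y : 0 <= kdel del y * X y.
Proof. by apply: mulr_ge0; [exact: kdel_ge0|exact: bump_ge0]. Qed.

(* scaling by del makes the mass near the origin independent of del *)
Definition cmin : R := d%:R * (d%:R - 2) * (d%:R + 1) `^ (- lam - 2) * 2 ^+ d.

Lemma cmin_gt0 : 0 < cmin.
Proof.
have d0 : 0 < d%:R :> R by rewrite ltr0n (leq_trans _ hd).
have d3 : 3%:R <= d%:R :> R by rewrite ler_nat.
apply: mulr_gt0; last by rewrite exprn_gt0.
apply: mulr_gt0; last by rewrite powR_gt0// addr_gt0.
by rewrite mulr_gt0// subr_gt0; move: d3; lra.
Qed.

Lemma cdel_ge (del : R) : 0 < del -> d%:R * del ^+ 2 <= 1 -> cmin <= cdel del.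
Proof.
move=> d0 d1; have dd : 0 < del ^+ 2 by rewrite exprn_gt0.
have dp : 0 < d%:R + 1 :> R by rewrite ltr_wpDl.
(* A lower bound of [kdel del] on the cube of radius del, where sqn y + del^2 <= (d + 1) del^2. *)
pose K := d%:R * (d%:R - 2) * del ^+ 2 * ((d%:R + 1) * del ^+ 2) `^ (- lam - 2).
have K0 : 0 <= K by apply: mulr_ge0; [exact: kc_ge0|exact: powR_ge0].
have -> : cmin = \int[mu]_y (K * \1_(cube del) y).
  rewrite (_ : \int[mu]_y _ = \int[mu]_(y in cube del) K); last first.
    rewrite [RHS]Rintegral_mkcond; apply: Int_ext => y; rewrite patchE indicE.
    by case: ifPn => _; rewrite ?mulr1 ?mulr0.
  rewrite Rintegral_cst//; last exact: measurable_cube.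
  have /(congr1 fine) /= h := @mu_cube R d _ (ltW d0); rewrite -[fine _]/(fine (mu _)) h.
  rewrite /K /cubevol /cmin powRM ?(ltW dp) ?(ltW dd)//.
  have -> : (del ^+ 2) `^ (- lam - 2) = (del ^+ (d + 2))^-1.
    rewrite -powR_mulrn ?ltW// -powRrM -powR_invn ?ltW//; congr (_ `^ _).
    by rewrite /lam natrD; field.
  rewrite -[del *+ 2]mulr_natr exprMn exprD; field.
  by rewrite !expf_neq0// gt_eqF.
apply: Int_le; [|exact: kX_intg|].
  apply: intgZ; apply: (@intg_bounded _ _ _ 1 del (ltW d0)).
  - by apply: measurable_indic; exact: measurable_cube.
  - by move=> y _; rewrite indicE ger0_norm// lern1 leq_b1.
  - by move=> y yd; rewrite indicE memNset// /cube /= leNgt yd.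
move=> y; rewrite indicE; case: (boolP (y \in _)) => [|_]; last by rewrite mulr0.
rewrite inE /cube /= mulr1 => yd.
have sy : sqn y <= d%:R * del ^+ 2.
  apply: le_trans (sqn_le_norm y) _; rewrite ler_wpM2l//.
  by rewrite lerXn2r ?nnegrE// ltW.
rewrite /X bump_eq1 ?X12//; last by rewrite expr1n (le_trans sy).
rewrite mulr1 /K /kdel ler_wpM2l ?kc_ge0// /plum.
have b0 := base_gt0 y d0.
rewrite -[- lam - 2]opprK ![_ `^ (- - _)]powRN.
have na : 0 <= - (- lam - 2) by have := lam_gt0; lra.
rewrite lef_pV2 ?posrE ?powR_gt0 ?mulr_gt0//.
apply: ge0_ler_powR; rewrite ?nnegrE ?(ltW b0)//; first by rewrite mulr_ge0// ltW.
by rewrite mulrDl mul1r lerD2r.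
Qed.

Lemma cgreen_gt0 : 0 < cgreen.
Proof.
apply: lt_le_trans cmin_gt0 _; apply: (cvgr_to_ge cdel_cvg).
exists d => // n /= dn; apply: cdel_ge; first exact: delta_gt0.
apply: (@le_trans _ _ (d%:R * delta n)).
  by rewrite ler_wpM2l// expr2 ger_pMl ?delta_gt0// delta_le1.
by rewrite /delta ler_pdivrMr// mul1r ler_nat ltnW.
Qed.

Definition cbound : R := \int[mu]_y `|lap X y|.

Lemma cdel_bound n : cdel (delta n) <= cbound.
Proof.
rewrite cdel_lap ?delta_gt0//; apply: le_trans (ler_norm _) _; rewrite normrN.
have sP := smooth_plum (- lam) (delta_gt0 n).
have iP := test_intg (testMl (test_lap tX) sP).
apply: le_trans (Int_norm iP) _; apply: Int_le => [||y].
- exact: intg_norm.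
- exact: intg_norm (test_intg (test_lap tX)).
- exact: lapX_plum.
Qed.

Lemma cbound_ge0 : 0 <= cbound. Proof. by apply: Int_ge0. Qed.

Section kernel_limit.
Variables (eta : 'rV[R]_d -> R) (U : set 'rV[R]_d).
Hypothesis te : test_function U eta.

(* Away from the diagonal kdel is small, near it eta varies little. *)
Lemma conv_kdel : exists L B : R, [/\ 0 <= L, 0 <= B &
  forall (del r : R) z, 0 < del -> 0 < r <= 1 ->
   `|conv (kdel del) eta z - cdel del * eta z| <=
     L * r * cdel del + B * del ^+ 2 * (r ^+ 2) `^ (- lam - 2)].
Proof.
have se := test_smooth te.
have [C [r1 [C0 r10 eC e0]]] := test_bounded te.
have r1' : 0 <= r1 + 1 by rewrite addr_ge0// ltW.
have [L [L0 hL]] := smooth_lipschitz r1' se.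
have hLip x y : `|x - y| <= 1 -> `|eta x - eta y| <= L * `|x - y|.
  move=> xy.
  have [xr|xr] := leP `|x| (r1 + 1); have [yr|yr] := leP `|y| (r1 + 1).
  - exact: hL.
  - rewrite !e0 ?subrr ?normr0 ?mulr_ge0//; first by rewrite ltW// (le_lt_trans _ yr)// lerDl.
    have xy' : `|y| <= `|x| + `|x - y| by rewrite distrC -{1}(subrK x y) addrC ler_normD.
    by move: yr xy xy'; lra.
  - rewrite !e0 ?subrr ?normr0 ?mulr_ge0//; last by rewrite ltW// (le_lt_trans _ xr)// lerDl.
    have xy' : `|x| <= `|y| + `|x - y| by rewrite -{1}(subrK y x) addrC ler_normD.
    by move: xr xy xy'; lra.
  - rewrite !e0 ?subrr ?normr0 ?mulr_ge0//; first by rewrite ltW// (le_lt_trans _ yr)// lerDl.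
    by rewrite ltW// (le_lt_trans _ xr)// lerDl.
pose k0 : R := d%:R * (d%:R - 2).
have k00 : 0 <= k0 by rewrite mulr_ge0.
pose N1 := \int[mu]_y `|eta y|; pose N2 := \int[mu]_y X y.
have N10 : 0 <= N1 by exact: Int_ge0.
have N20 : 0 <= N2 by apply: Int_ge0 => y; exact: bump_ge0.
exists L, (k0 * (N1 + C * N2)); split => //; first by rewrite mulr_ge0// addr_ge0// mulr_ge0.
move=> del r z d0 /andP[r0 rle1].
have r21 : r ^+ 2 <= 1 ^+ 2 by rewrite lerXn2r ?nnegrE// ltW.
have sk := smooth_kdel d0; have sX := test_smooth tX.
have refl (f : 'rV[R]_d -> R) : intg f -> (forall y w, f (y - w) = f (w - y)) ->
    intg (fun y => f (z - y)) /\ \int[mu]_y f (z - y) = \int[mu]_y f y.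
  move=> fi fe; have -> : (fun y => f (z - y)) = fun y => f (1 *: y + - z).
    by apply/funext => y; rewrite scale1r fe.
  by split; [exact: intg_affine|rewrite Int_affine// invr1 expr1n mul1r].
have [|i1 E1] := refl _ (kX_intg d0).
  by move=> y w; rewrite /kdel plumBC XBC.
have [i2 E2] := refl X (test_intg tX) XBC.
pose M := k0 * del ^+ 2 * (r ^+ 2) `^ (- lam - 2).
have M0 : 0 <= M by rewrite mulr_ge0 ?powR_ge0// mulr_ge0// sqr_ge0.
have ve : vanish_out eta r1 by move=> y /ltW; exact: e0.
have ik := conv_intg z (ltW r10) sk (test_intg te) ve.
have EL : k0 * (N1 + C * N2) * del ^+ 2 * (r ^+ 2) `^ (- lam - 2) = M * (N1 + C * N2).
  by rewrite /M; ring.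
rewrite EL.
apply: (@Int_approx _ _ (fun y => kdel del (z - y)) (fun y => X (z - y)) eta (eta z)
  (cdel del) N2 (L * r) M C ik i1 E1 i2 E2 (test_intg te)) => y.
apply: kernel_split; [exact: kdel_ge0|exact: bump_ge0| |exact: M0|exact: eC|].
  exact: mulr_ge0 L0 (ltW r0).
have [zr|zr] := leP (sqn (z - y)) (r ^+ 2); [left|right]; last first.
  apply: kdel_le; [by rewrite exprn_gt0|exact: ltW].
split.
  exact: bump_eq1 X12 (le_trans zr r21).
have nr := norm_le_sqn (ltW r0) zr.
rewrite distrC; apply: le_trans (hLip _ _ (le_trans nr rle1)) _.
by rewrite ler_wpM2l.
Qed.

Lemma conv_kdel_bound : exists B : R, 0 <= B /\
  forall n z, `|conv (kdel (delta n)) eta z| <= B.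
Proof.
have [L [B [L0 B0 h]]] := conv_kdel.
have [C [_ [C0 _ eC _]]] := test_bounded te.
exists (L * cbound + B + cbound * C); split.
  by rewrite !addr_ge0// mulr_ge0// cbound_ge0.
move=> n z; have d0 := delta_gt0 n.
have c0 : 0 <= cdel (delta n) by apply: Int_ge0.
have := h (delta n) 1 z d0; rewrite ltr01 lexx => /(_ isT).
rewrite expr1n powR1 !mulr1 => h1.
rewrite -(subrK (cdel (delta n) * eta z) (conv _ _ _)); apply: le_trans (ler_normD _ _) _.
apply: lerD.
  apply: le_trans h1 _; apply: lerD; first by rewrite ler_wpM2l// cdel_bound.
  by rewrite -[leRHS]mulr1 ler_wpM2l// expr_le1// ?delta_le1// ltW.
by rewrite normrM (ger0_norm c0); apply: ler_pM => //; exact: cdel_bound.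
Qed.

Lemma conv_kdel_cvg z : conv (kdel (delta n)) eta z @[n --> \oo] --> cgreen * eta z.
Proof.
have [L [B [L0 B0 h]]] := conv_kdel.
have h0 : (conv (kdel (delta n)) eta z - cdel (delta n) * eta z) @[n --> \oo] --> (0 : R).
  apply/cvgr0Pnorm_lt => e e0.
  have D0 : 0 < L * cbound + 1 by rewrite ltr_wpDl// mulr_ge0// cbound_ge0.
  (* The radius r is fixed first, making the oscillation term at most e / 2 for every n; only then
     does n grow to kill the far part. *)
  pose r := Num.min 1 (e / 2 / (L * cbound + 1)).
  have r0 : 0 < r by rewrite lt_min ltr01 !divr_gt0.
  have r1 : r <= 1 by rewrite ge_min lexx.
  have lim : (B * delta n ^+ 2 * (r ^+ 2) `^ (- lam - 2)) @[n --> \oo] --> (0 : R).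
    rewrite (_ : 0 = B * (0 * 0) * (r ^+ 2) `^ (- lam - 2)); last by rewrite !(mul0r, mulr0).
    apply: seq_cvgM; last exact: cvg_cst.
    by apply: seq_cvgZ; apply: seq_cvgM; exact: delta_cvg.
  have e2 : 0 < e / 2 by rewrite divr_gt0.
  have /cvgr0Pnorm_lt /(_ _ e2) [N _ hN] := lim; exists N => // n /= /hN /= h1.
  have := h (delta n) r z (delta_gt0 n); rewrite r0 r1 => /(_ isT) h2.
  apply: le_lt_trans h2 _; rewrite [ltRHS]splitr; apply: ler_ltD; last first.
    exact: le_lt_trans (ler_norm _) h1.
  have c0 : 0 <= cdel (delta n) by apply: Int_ge0.
  apply: (@le_trans _ _ (r * (L * cbound + 1))).
    rewrite [L * r]mulrC -mulrA ler_wpM2l ?(ltW r0)// ler_wpDr// ler_wpM2l//.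
    exact: cdel_bound.
  by rewrite -ler_pdivlMr// ge_min lexx orbT.
rewrite (_ : (fun n => conv _ _ _) = fun n => (conv (kdel (delta n)) eta z - cdel (delta n) * eta z) + cdel (delta n) * eta z).
  rewrite -[X in _ --> X]add0r; apply: seq_cvgD => //; apply: seq_cvgM; last exact: cvg_cst.
  exact: cdel_cvg.
by apply/funext => n; rewrite subrK.
Qed.

End kernel_limit.

End plummer.

Section double_limits.
Context {R : realType}.

(** The bound C D is independent of n, so the sequences in i are Cauchy uniformly in n; this permits
    exchanging the two limits. *)
Lemma swap_limits (a : nat -> nat -> R) (a0 : nat -> R) (D : nat -> nat -> R) (C : R) :
  (forall n i j, `|a n i - a n j| <= C * D i j) -> (forall i j, `|a0 i - a0 j| <= C * D i j) ->
  (forall e : R, 0 < e -> exists N : nat, forall i j, (N <= i)%N -> (N <= j)%N -> D i j < e) ->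
  0 <= C ->
  (forall i, a n i @[n --> \oo] --> a0 i) -> (forall n, a n i @[i --> \oo] --> (0 : R)) ->
  a0 i @[i --> \oo] --> (0 : R).
Proof.
move=> h1 h2 hD C0 ha0 h0; apply/cvgr0Pnorm_lt => e e0.
have e4 : 0 < e / 4 by rewrite divr_gt0.
have C1 : 0 < C + 1 by rewrite ltr_wpDl.
have [N hN] := hD _ (divr_gt0 e4 C1).
have CD i j : (N <= i)%N -> (N <= j)%N -> C * D i j < e / 4.
  move=> Ni Nj; have := hN i j Ni Nj; rewrite ltr_pdivlMr//.
  have : 0 <= C * D i j by apply: le_trans (h2 i j).
  by move=> hh; have := e4; have [D0|D0] := leP 0 (D i j); nra.
have /cvgrPdist_lt /(_ _ e4) [n _ hn] := ha0 N.
have /cvgr0Pnorm_lt /(_ _ e4) [M _ hM] := h0 n.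
exists (maxn N M) => // i; rewrite /= geq_max => /andP[Ni Mi].
have k1 := le_lt_trans (h2 i N) (CD i N Ni (leqnn N)).
have k2 := hn n (leqnn n); rewrite /= in k2.
have k3 := le_lt_trans (h1 n N i) (CD N i (leqnn N) Ni).
have k4 := hM i Mi; rewrite /= in k4.
have -> : a0 i = (a0 i - a0 N) + ((a0 N - a n N) + ((a n N - a n i) + a n i)) by ring.
have t1 := ler_normD (a0 i - a0 N) ((a0 N - a n N) + ((a n N - a n i) + a n i)).
have t2 := ler_normD (a0 N - a n N) ((a n N - a n i) + a n i).
have t3 := ler_normD (a n N - a n i) (a n i).
by lra.
Qed.

(** Freezing the second index at a large N costs at most C D(i, N), uniformly in n, after which the
    limit at fixed index applies. *)
Lemma diagonal_limit (a : nat -> nat -> R) (D : nat -> nat -> R) (C : R) : 0 <= C ->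
  (forall n i j, `|a n i - a n j| <= C * D i j) ->
  (forall e : R, 0 < e -> exists N : nat, forall i j, (N <= i)%N -> (N <= j)%N -> D i j < e) ->
  (forall j, a n j @[n --> \oo] --> (0 : R)) -> a n n @[n --> \oo] --> (0 : R).
Proof.
move=> C0 h1 hD h0; apply/cvgr0Pnorm_lt => e e0.
have e2 : 0 < e / 2 by rewrite divr_gt0.
have C1 : 0 < C + 1 by rewrite ltr_wpDl.
have [N hN] := hD _ (divr_gt0 e2 C1).
have /cvgr0Pnorm_lt /(_ _ e2) [M _ hM] := h0 N.
exists (maxn N M) => // i; rewrite /= geq_max => /andP[Ni Mi].
have k1 := h1 i i N; have k2 := hM i Mi; rewrite /= in k2.
have k3 : C * D i N < e / 2.
  have := hN i N Ni (leqnn N); rewrite ltr_pdivlMr//.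
  have : 0 <= C * D i N by apply: le_trans k1.
  by move=> hh; have := e2; have [D0|D0] := leP 0 (D i N); nra.
have -> : a i i = (a i i - a i N) + a i N by ring.
have := ler_normD (a i i - a i N) (a i N).
by lra.
Qed.

End double_limits.

Section L2_cauchy_schwarz.
Context {R : realType} {d : nat}.
Implicit Types (f g : 'rV[R]_d -> R).

Local Notation mu := (leb R d).

Lemma Int_cs f g : sqint f -> sqint g ->
  `|\int[mu]_x (f x * g x)| <= Num.sqrt (\int[mu]_x (f x ^+ 2)) * Num.sqrt (\int[mu]_x (g x ^+ 2)).
Proof.
move=> hf hg.
have mk h : sqint h -> (fun _ : 'I_1 => h) \in @l2pred R d 1 by move=> hh; apply/l2predP.
pose F : L2H R d 1 := L2vec (mk f hf); pose G : L2H R d 1 := L2vec (mk g hg).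
have E (X Y : L2H R d 1) : ip X Y = \int[mu]_x ((X : l2vec R d 1) ord0 x * (Y : l2vec R d 1) ord0 x).
  by apply: Int_ext => x; rewrite big_ord_recl big_ord0 addr0.
have := cauchy_schwarz F G; rewrite /nrm !E.
by congr (_ <= Num.sqrt _ * Num.sqrt _); apply: Int_ext => x; rewrite expr2.
Qed.

End L2_cauchy_schwarz.

Section grad_sub.
Context {R : realType} {d : nat}.

Lemma gradB U (f g : 'rV[R]_d -> R) : test_function U f -> test_function U g ->
  grad (f \- g) = grad f - grad g.
Proof.
move=> tf tg; have -> : f \- g = (-1) *: g + f.
  by apply/funext => x; rewrite /= addrC; congr (_ + _); exact/esym/mulN1r.
by rewrite (grad_lin _ tg tf) addrC; congr (_ + _); exact: scaleN1r.
Qed.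

End grad_sub.

Section green.
Context {R : realType} {d : nat} (hd : (3 <= d)%N).
Implicit Types (x y z : 'rV[R]_d) (g : 'rV[R]_d -> R).

Local Notation mu := (leb R d).
Local Notation test := (test_function setT).
Local Notation la := (@lam R d).

Lemma test_mul_L1 U th : test_function U th -> exists C : R, 0 <= C /\
  forall V g, test_function V g -> \int[mu]_x `|th x * g x| <= C * nrm (grad g).
Proof.
move=> tth; have [A [r [A0 r0 thA th0]]] := test_bounded tth.
have mc : measurable_fun setT (\1_(cube r) : 'rV[R]_d -> R).
  by apply: measurable_indic; exact: measurable_cube.
have s1 : sqint (\1_(cube r) : 'rV[R]_d -> R).
  split => //; apply: (@intg_bounded _ _ _ 1 r (ltW r0)).
  - exact: measurable_funX.
  - by move=> y _; rewrite indicE normrX expr_le1// normr_nat lern1 leq_b1.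
  - by move=> y yd; rewrite indicE memNset ?expr0n// /cube /= leNgt yd.
have [C [C0 hC]] := test_mul_L2 hd setT tth.
exists (Num.sqrt C * Num.sqrt (\int[mu]_x ((\1_(cube r) x : R) ^+ 2))); split.
  by rewrite mulr_ge0 ?sqrtr_ge0.
move=> V g tg; have ttg := testMl tth (test_smooth tg).
have sg : sqint (fun x => `|th x * g x|).
  have [m i] := test_sqint ttg; split; first exact: measurableT_comp.
  by move: i; congr intg; apply/funext => x; rewrite real_normK ?num_real.
have -> : \int[mu]_x `|th x * g x| = \int[mu]_x (`|th x * g x| * \1_(cube r) x).
  apply: Int_ext => x; rewrite indicE; have [xr|xr] := leP `|x| r.
    by rewrite mem_set// mulr1.
  by rewrite (th0 x (ltW xr)) mul0r normr0 mul0r.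
apply: le_trans (ler_norm _) _; apply: le_trans (Int_cs sg s1) _.
rewrite [leRHS]mulrAC ler_wpM2r ?sqrtr_ge0//.
rewrite /nrm -sqrtrM// ler_sqrt; last by rewrite mulr_ge0// ip_ge0.
have := hC _ (testT tg); rewrite /energy; apply: le_trans.
rewrite le_eqVlt; apply/orP; left; apply/eqP; apply: Int_ext => x.
by rewrite real_normK ?num_real.
Qed.

Definition rdot x y : R := dot (fun i => x ord0 i) (fun i => y ord0 i).

Lemma rdot_cs x y : rdot x y ^+ 2 <= sqn x * sqn y.
Proof.
have := cs_dot (fun i => x ord0 i) (fun i => y ord0 i).
by congr (_ <= _ * _); apply: eq_bigr => i _; rewrite expr2.
Qed.

Lemma sqnB x y : sqn (x - y) = sqn x - 2 * rdot x y + sqn y.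
Proof.
rewrite /sqn /rdot /dot mulr_sumr -sumrB -big_split /=; apply: eq_bigr => i _.
by rewrite !mxE; ring.
Qed.

Lemma sqnB_ge x y : 16 * sqn y <= sqn x -> sqn x / 2 <= sqn (x - y).
Proof.
move=> h; have cs := rdot_cs x y; have x0 := sqn_ge0 x; have y0 := sqn_ge0 y.
have k : rdot x y <= sqn x / 4.
  have [r0|/ltW r0] := leP (rdot x y) 0; first by lra.
  rewrite -ler_sqr ?nnegrE//; last by lra.
  apply: le_trans cs _; rewrite expr_div_n expr2 -mulrA ler_wpM2l//; lra.
by rewrite sqnB; lra.
Qed.

Section kernel.
Variables (U : set 'rV[R]_d) (th eta : 'rV[R]_d -> R) (b : R).
Hypotheses (tth : test_function U th) (b0 : 0 < b) (th1 : forall z, sqn z < b ^+ 2 -> th z = 1).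

Lemma th_partial0 i z : sqn z < b ^+ 2 -> partial i th z = 0.
Proof.
by move=> zb; rewrite (@partial_open _ _ th (fun=> 1) _ _ i (@open_sqn_lt _ _ (b ^+ 2)) th1 zb) partial_cst.
Qed.

Lemma th_lap0 z : sqn z < b ^+ 2 -> lap th z = 0.
Proof.
move=> zb; rewrite (@lap_open _ _ th (fun=> 1) _ _ (@open_sqn_lt _ _ (b ^+ 2)) th1 zb).
by rewrite /lap big1// => i _; rewrite !partial_cst.
Qed.

(* 2 nabla th . nabla Gamma(z - .) + Gamma(z - .) lap th, the commutator of the cutoff
   th with the (smoothed) fundamental solution; it vanishes near 0. *)
Definition Nker (del : R) z y : R :=
  4 * - la * dot (nab th z) (fun i => (z - y) ord0 i) * plum (- la - 1) del (z - y)
  + lap th z * plum (- la) del (z - y).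

Lemma Nker0 del z y : sqn z < b ^+ 2 -> Nker del z y = 0.
Proof.
move=> zb; rewrite /Nker th_lap0// /dot big1 ?mulr0 ?mul0r ?addr0//.
by move=> i _; rewrite /nab th_partial0// mul0r.
Qed.

(** The kernel vanishes for |z| < b, and |y| <= b / 4; hence |z - y|^2 >= b^2 / 2 where it matters,
    and the bound is uniform in the regularisation. *)
Lemma Nker_bound : exists M : R, 0 <= M /\ forall del z y, 16 * sqn y <= b ^+ 2 ->
  `|Nker del z y| <= M.
Proof.
have hA (i : 'I_d) : exists A : R, 0 <= A /\ forall z y, `|y| <= b ->
    `|partial i th z * (z - y) ord0 i| <= A.
  have t1 := testMl (test_partial i tth) (smooth_coord i).
  have [A [_ [A0 _ hA _]]] := test_bounded t1.
  have [B [_ [B0 _ hB _]]] := test_bounded (test_partial i tth).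
  exists (A + B * b); split; first by rewrite addr_ge0// mulr_ge0// ltW.
  move=> z y yb; rewrite !mxE mulrBr; apply: le_trans (ler_normB _ _) _.
  apply: lerD; first exact: hA.
  by rewrite normrM ler_pM// (le_trans (coord_le_norm _ _)).
have [A hA'] := choice hA.
have [L [_ [L0 _ hL _]]] := test_bounded (test_lap tth).
have l0 := @lam_gt0 R d hd; pose q := b ^+ 2 / 2.
have q0 : 0 < q by rewrite divr_gt0// exprn_gt0.
have SA0 : 0 <= \sum_i A i by apply: sumr_ge0 => i _; have [] := hA' i.
exists (4 * la * (\sum_i A i) * q `^ (- la - 1) + L * q `^ (- la)); split.
  by rewrite addr_ge0// mulr_ge0 ?powR_ge0// mulr_ge0// mulr_ge0// ltW.
move=> del z y yb.
have [zb|zb] := ltP (sqn z) (b ^+ 2).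
  by rewrite Nker0// normr0 addr_ge0// mulr_ge0 ?powR_ge0// mulr_ge0// mulr_ge0// ltW.
have qz : q <= sqn (z - y).
  apply: le_trans (sqnB_ge (le_trans yb zb)); rewrite /q ler_pM2r//.
have qz' : q <= sqn (z - y) + del ^+ 2 by rewrite ler_wpDr// sqr_ge0.
have yn : `|y| <= b.
  apply: norm_le_sqn; first exact: ltW.
  by have := sqn_ge0 y; lra.
apply: le_trans (ler_normD _ _) _; apply: lerD; rewrite normrM.
  rewrite (ger0_norm (plum_ge0 _ _ _)); apply: ler_pM => //; first exact: plum_ge0.
    rewrite normrM normrM normrN (ger0_norm (ltW l0)) (ger0_norm (_ : 0 <= 4))//.
    apply: ler_wpM2l; first by rewrite mulr_ge0// ltW.
    rewrite /dot; apply: le_trans (ler_norm_sum _ _ _) _.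
    by apply: ler_sum => i _; have [_] := hA' i; apply.
  by apply: plum_le => //; move: l0; lra.
rewrite (ger0_norm (plum_ge0 _ _ _)); apply: ler_pM => //; first exact: plum_ge0.
by apply: plum_le => //; move: l0; lra.
Qed.

Lemma Nker_measurable del z : measurable_fun setT (Nker del z).
Proof.
have mp a : measurable_fun setT (fun y => plum a del (z - y)).
  rewrite (_ : (fun y => _) = plum a del \o (fun y => -1 *: y + z)); last first.
    by apply/funext => y /=; rewrite scaleN1r addrC.
  rewrite /plum; apply: (@measurableT_comp _ _ _ _ _ _ (fun t : R => t `^ a)); first exact: measurable_powR.
  apply: measurable_funD => //; apply: continuous_row_measurable.
  exact/cont_affine/continuous_sqn.
apply: measurable_funD; apply: measurable_funM => //.
apply: measurable_funM => //; apply: continuous_row_measurable.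
apply: smooth_continuous; apply: smooth_sum => i; apply: smoothM; first exact: smooth_cst.
rewrite (_ : (fun y => _) = fun y : 'rV[R]_d => z ord0 i - y ord0 i); last first.
  by apply/funext => y; rewrite !mxE.
by apply: smoothB; [exact: smooth_cst|exact: smooth_coord].
Qed.

Lemma Nker_cvg z y : 16 * sqn y <= b ^+ 2 -> Nker (@delta R n) z y @[n --> \oo] --> Nker 0 z y.
Proof.
move=> yb; have [zb|zb] := ltP (sqn z) (b ^+ 2).
  by rewrite Nker0//; under eq_fun do rewrite Nker0//; exact: cvg_cst.
have qz : 0 < sqn (z - y).
  apply: lt_le_trans (sqnB_ge (le_trans yb zb)); rewrite divr_gt0// (lt_le_trans _ zb)//.
  by rewrite exprn_gt0.
by apply: seq_cvgD; apply: seq_cvgZ; exact: plum_cvg.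
Qed.

Hypotheses (te : test_function setT eta) (eta0 : forall y, b ^+ 2 < 16 * sqn y -> eta y = 0).

Definition Aker del z : R := th z * conv (kdel del) eta z - \int[mu]_y (Nker del z y * eta y).

Let ie := test_intg te.

Lemma Nker_intg del z : intg (fun y => Nker del z y * eta y).
Proof.
have [M [M0 hM]] := Nker_bound.
apply: (@le_intg _ _ _ (fun y => M * `|eta y|)).
- by apply: measurable_funM; [exact: Nker_measurable|exact: intg_measurable].
- move=> y; rewrite normrM; have [yb|/eta0 ->] := leP (16 * sqn y) (b ^+ 2).
    by rewrite ler_wpM2r// hM.
  by rewrite normr0 !mulr0.
- by apply: intgZ; exact: intg_norm.
Qed.

(** In the product rule the term with all derivatives on the convolution gives [kdel]; the terms
    that differentiate [th] assemble into [Nker]. *)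
Lemma lap_th_conv (del : R) : 0 < del ->
  lap (th \* conv (plum (- la) del) eta) = fun z => - Aker del z.
Proof.
move=> d0; have [C [r [C0 r0 eC e0]]] := test_bounded te.
have ve : vanish_out eta r by move=> y /ltW; exact: e0.
have sP := @smooth_plum R d (- la) del d0.
have r0' := ltW r0.
have sp := smooth_conv r0' ie ve sP.
have pi i : partial i (conv (plum (- la) del) eta) = conv (partial i (plum (- la) del)) eta.
  by rewrite (partial_conv r0' ie ve).
have lp z : lap (conv (plum (- la) del) eta) z = - conv (kdel del) eta z.
  rewrite /lap (eq_bigr (fun i => \int[mu]_y (partial i (partial i (plum (- la) del)) (z - y) * eta y))).
    rewrite -Int_sum; last by move=> i; apply: conv_intg r0' _ ie ve; do 2!apply: smooth_partial.
    rewrite -[RHS]mulN1r /conv -IntZ; last exact: conv_intg r0' (smooth_kdel d0) ie ve.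
    apply: Int_ext => y; rewrite -mulr_suml -/(lap (plum (- la) del) (z - y)) (lap_plum d0).
    by rewrite mulrA mulN1r.
  move=> i _; rewrite pi (partial_conv r0' ie ve)//; exact: smooth_partial.
rewrite lapM//; last exact: test_smooth tth.
apply/funext => z; rewrite lp /Aker opprB mulrN; congr (_ - _).
have iD i : intg (fun y => 2 * partial i th z * (partial i (plum (- la) del) (z - y) * eta y)).
  by apply: intgZ; apply: conv_intg r0' _ ie ve; exact: smooth_partial.
have iL : intg (fun y => lap th z * (plum (- la) del (z - y) * eta y)).
  by apply: intgZ; exact: conv_intg r0' sP ie ve.
transitivity (\int[mu]_y (lap th z * (plum (- la) del (z - y) * eta y)) +
    \int[mu]_y (\sum_(i < d) 2 * partial i th z * (partial i (plum (- la) del) (z - y) * eta y))).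
  rewrite Int_sum//; congr (_ + _).
    by rewrite IntZ//; exact: conv_intg r0' sP ie ve.
  rewrite /dot mulr_sumr; apply: eq_bigr => i _; rewrite /nab pi IntZ ?mulrA//.
  by apply: conv_intg r0' _ ie ve; exact: smooth_partial.
rewrite -IntD//; last exact: intg_sum.
apply: Int_ext => y /=; rewrite /Nker /dot mulrDl addrC; congr (_ + _); last by rewrite mulrA.
rewrite mulr_sumr !mulr_suml; apply: eq_bigr => i _.
by rewrite (@partial_plum R d (- la) del i d0) /nab; ring.
Qed.

Lemma test_th_conv (del : R) : 0 < del -> test_function U (th \* conv (plum (- la) del) eta).
Proof.
move=> d0; have [C [r [C0 r0 eC e0]]] := test_bounded te.
have ve : vanish_out eta r by move=> y /ltW; exact: e0.
apply: testMl => //; apply: (smooth_conv (ltW r0) ie ve); exact: smooth_plum.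
Qed.

Lemma energy_Aker (del : R) V g : 0 < del -> test_function V g ->
  energy g (th \* conv (plum (- la) del) eta) = \int[mu]_z (g z * Aker del z).
Proof.
move=> d0 tg; rewrite (energy_lap tg (test_th_conv d0)) lap_th_conv//.
rewrite -[LHS]mulN1r -IntZ; first by apply: Int_ext => z; ring.
have := test_intg (testMl tg (smooth_lap (test_smooth (test_th_conv d0)))).
by rewrite lap_th_conv.
Qed.

Definition Bker z : R := \int[mu]_y (Nker 0 z y * eta y).

(** The limit of the regularised densities. By [eta0] the density [eta] lives in |y| <= b / 4, where
    [th] is 1, so the first term is really the multiple [cgreen] of [eta]. *)
Definition A0ker z : R := th z * (@cgreen R d * eta z) - Bker z.

Lemma Aker_cvg z : Aker (@delta R n) z @[n --> \oo] --> A0ker z.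
Proof.
apply: seq_cvgB; first by apply: seq_cvgZ; exact: conv_kdel_cvg te z.
have [M [M0 hM]] := Nker_bound.
apply: (@Int_dominated _ _ _ _ (fun y => M * `|eta y|)).
- by move=> n; exact: intg_measurable (Nker_intg _ _).
- exact: intg_measurable (Nker_intg _ _).
- move=> y; have [yb|/eta0 ->] := leP (16 * sqn y) (b ^+ 2).
    by apply: seq_cvgM; [exact: Nker_cvg|exact: cvg_cst].
  by rewrite mulr0; under eq_fun do rewrite mulr0; exact: cvg_cst.
- by apply: intgZ; exact: intg_norm.
- move=> n y; rewrite normrM; have [yb|/eta0 ->] := leP (16 * sqn y) (b ^+ 2).
    by rewrite ler_wpM2r// hM.
  by rewrite normr0 !mulr0.
Qed.

Lemma Aker_measurable n : measurable_fun setT (Aker (@delta R n)).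
Proof.
have := lap_th_conv (@delta_gt0 R n) => /(congr1 (fun f : 'rV[R]_d -> R => (fun z => - f z))) h.
rewrite (_ : Aker _ = fun z => - lap (th \* conv (plum (- la) (@delta R n)) eta) z).
  apply: measurable_funN; apply: smooth_measurable; apply: smooth_lap.
  exact: test_smooth (test_th_conv (@delta_gt0 R n)).
by rewrite h; apply/funext => z; rewrite opprK.
Qed.

Lemma A0ker_measurable : measurable_fun setT A0ker.
Proof. by apply: (measurable_fun_cvg Aker_measurable) => z _; exact: Aker_cvg. Qed.

Lemma Aker_bound : exists B : R, 0 <= B /\ forall n z, `|Aker (@delta R n) z| <= B.
Proof.
have [M [M0 hM]] := Nker_bound; have [K [K0 hK]] := conv_kdel_bound hd te.
have [T [_ [T0 _ hT _]]] := test_bounded tth.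
exists (T * K + M * \int[mu]_y `|eta y|); split.
  by rewrite addr_ge0 ?mulr_ge0//; exact: Int_ge0.
move=> n z; apply: le_trans (ler_normB _ _) _; apply: lerD.
  by rewrite normrM ler_pM.
apply: le_trans (Int_norm (Nker_intg _ _)) _.
rewrite -IntZ; last exact: intg_norm.
apply: Int_le => [||y]; [exact: intg_norm (Nker_intg _ _)|by apply: intgZ; exact: intg_norm|].
rewrite normrM; have [yb|/eta0 ->] := leP (16 * sqn y) (b ^+ 2).
  by rewrite ler_wpM2r// hM.
by rewrite normr0 !mulr0.
Qed.

Lemma Aker_supp del z : ~ supp th z -> Aker del z = 0.
Proof.
move=> hz; rewrite /Aker (suppP hz) mul0r sub0r.
have p0 i : partial i th z = 0 by exact: partial_supp.
have l0 : lap th z = 0.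
  have o : open (~` supp th) by exact/closed_openC/closed_closure.
  rewrite (@lap_open _ _ th (fun=> 0) _ _ o (fun y => @suppP _ _ th y) hz).
  by rewrite /lap big1// => i _; rewrite !partial_cst.
rewrite (_ : (fun y => _) = fun=> 0); first by rewrite Int0 oppr0.
apply/funext => y; rewrite /Nker l0 /dot big1 ?mulr0 ?mul0r ?addr0 ?mul0r//.
by move=> i _; rewrite /nab p0 mul0r.
Qed.

Lemma A0ker_supp z : ~ supp th z -> A0ker z = 0.
Proof.
move=> hz; have h := @Aker_cvg z.
apply: (@cvg_unique _ (@Rhausdorff R) _ _ _ _ h).
apply: (@seq_cvg_ext _ (fun=> 0)); last exact: cvg_cst.
by move=> n; rewrite Aker_supp.
Qed.

(* Pair G with the test functions th * (regularised fundamental solution * eta)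
   and let the regularisation tend to 0. *)
Theorem green_limit (g : nat -> 'rV[R]_d -> R) (G : L2H R d d) :
  (forall n, test (g n)) -> hcvg (fun n => grad (g n)) G ->
  (forall f, test_function U f -> ip G (grad f) = 0) ->
  \int[mu]_z (g n z * A0ker z) @[n --> \oo] --> (0 : R).
Proof.
move=> tg hg hG.
have [B [B0 hB]] := Aker_bound.
have hB0 z : `|A0ker z| <= B.
  have h := @Aker_cvg z; rewrite ler_norml; apply/andP; split.
    by apply: (cvgr_to_ge h); apply: nearW => n; have := hB n z; rewrite ler_norml => /andP[].
  by apply: (cvgr_to_le h); apply: nearW => n; have := hB n z; rewrite ler_norml => /andP[].
have [_ [r [_ r0 _ thr]]] := test_bounded tth.
have supr z : supp th z -> `|z| <= r.
  have /closure_id e := @closed_cube R d r; move=> sz; suff : cube r z by [].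
  rewrite e; move: z sz; apply: closure_subset => w /= /eqP wz; rewrite /cube /= leNgt; apply/negP => /ltW /thr.
  exact: wz.
pose a := Num.sqrt (d%:R * r ^+ 2).
have a0 : 0 <= a < a + 1 by rewrite sqrtr_ge0 ltrDl ltr01.
have tt2 := @test_bump _ d a (a + 1) setT a0 (fun _ _ => I).
have bump1 z : supp th z -> bump a (a + 1) z = 1.
  move=> /supr zr; apply: bump_eq1 => //.
  have a2 : a ^+ 2 = d%:R * r ^+ 2 by rewrite sqr_sqrtr// mulr_ge0// sqr_ge0.
  rewrite a2; apply: le_trans (sqn_le_norm z) _.
  by rewrite ler_wpM2l// lerXn2r ?nnegrE// ltW.
have [C [C0 hC]] := test_mul_L1 tt2.
have bd (f h : 'rV[R]_d -> R) : test f -> measurable_fun setT h -> (forall z, `|h z| <= B) ->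
    (forall z, ~ supp th z -> h z = 0) ->
    intg (fun z => f z * h z) /\ `|\int[mu]_z (f z * h z)| <= B * C * nrm (grad f).
  move=> tf mh hh h0.
  have ib := test_intg (testMl tt2 (test_smooth tf)).
  have E z : `|f z * h z| <= B * `|bump a (a + 1) z * f z|.
    have [sz|sz] := pselect (supp th z); last by rewrite h0// mulr0 normr0 mulr_ge0.
    by rewrite bump1// mul1r normrM mulrC ler_wpM2r.
  have i : intg (fun z => f z * h z).
    apply: le_intg E _; last by apply: intgZ; exact: intg_norm ib.
    by apply: measurable_funM => //; exact: smooth_measurable (test_smooth tf).
  split => //; apply: le_trans (Int_norm i) _.
  apply: (@le_trans _ _ (B * \int[mu]_z `|bump a (a + 1) z * f z|)).
    rewrite -IntZ; last exact: intg_norm ib.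
    by apply: Int_le => //; [exact: intg_norm|apply: intgZ; exact: intg_norm ib].
  by rewrite -mulrA ler_wpM2l// (hC _ _ tf).
have grB i j := gradB (tg i) (tg j).
have lip (h : 'rV[R]_d -> R) i j : measurable_fun setT h -> (forall z, `|h z| <= B) ->
    (forall z, ~ supp th z -> h z = 0) ->
    `|\int[mu]_z (g i z * h z) - \int[mu]_z (g j z * h z)| <= B * C * nrm (grad (g i) - grad (g j)).
  move=> mh hh h0; have [i1 _] := bd _ _ (tg i) mh hh h0; have [i2 _] := bd _ _ (tg j) mh hh h0.
  rewrite -IntB// -grB; have [_] := bd _ _ (testB (tg i) (tg j)) mh hh h0.
  by congr (`|_| <= _); apply: Int_ext => z /=; rewrite mulrBl.
(* For a fixed regularisation the pairing tends to 0, being an energy against a test function in U;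
   for a fixed g i the regularisation is removed by dominated convergence. *)
apply: (@swap_limits _ (fun k i => \int[mu]_z (g i z * Aker (@delta R k) z)) _
  (fun i j => nrm (grad (g i) - grad (g j))) (B * C)).
- move=> n i j; exact: lip (Aker_measurable n) (hB n) (@Aker_supp (delta n)).
- move=> i j; exact: lip A0ker_measurable hB0 A0ker_supp.
- move=> e e0; have e2 : 0 < e / 2 by rewrite divr_gt0.
  have [N hN] := (hcvgP _ _).1 hg _ e2; exists N => i j Ni Nj.
  rewrite [e]splitr; apply: le_lt_trans (nrm_dist _ G _) (ltrD (hN i Ni) _).
  rewrite nrmBC; exact: hN j Nj.
- exact: mulr_ge0.
- move=> i; apply: (@Int_dominated _ _ _ _ (fun z => B * `|bump a (a + 1) z * g i z|)).
  + move=> n; apply: measurable_funM; [exact: smooth_measurable (test_smooth (tg i))|exact: Aker_measurable].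
  + apply: measurable_funM; [exact: smooth_measurable (test_smooth (tg i))|exact: A0ker_measurable].
  + by move=> z; apply: seq_cvgZ; exact: Aker_cvg.
  + by apply: intgZ; apply: intg_norm; exact: test_intg (testMl tt2 (test_smooth (tg i))).
  + move=> n z; have [sz|sz] := pselect (supp th z); last by rewrite Aker_supp// mulr0 normr0 mulr_ge0.
    by rewrite bump1// mul1r normrM mulrC ler_wpM2r.
- move=> n; have d0 := @delta_gt0 R n.
  rewrite (_ : (fun i => _) = fun i => ip (grad (g i)) (grad (th \* conv (plum (- la) (@delta R n)) eta))); last first.
    by apply/funext => i; rewrite -(energy_Aker d0 (tg i)).
  rewrite -(hG _ (test_th_conv d0)).
  exact: hcvg_ip hg (hcvg_cst _).
Qed.

End kernel.

End green.

Section parametric_measurability.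
Context {R : realType} {d : nat}.
Local Notation mu := (leb R d).

Lemma measurable_Int_param (f : 'rV[R]_d * 'rV[R]_d -> R) : measurable_fun setT f ->
  (forall z, intg (fun x => f (z, x))) ->
  measurable_fun setT (fun z => \int[mu]_x f (z, x)).
Proof.
move=> mf hi.
have mE : measurable_fun setT (EFin \o f) by exact/measurable_EFinP.
have mp := @measurable_fun_fubini_tonelli_F _ _ _ _ R mu _ (measurable_funepos mE)
  (fun x => funepos_ge0 (EFin \o f) x).
have mn := @measurable_fun_fubini_tonelli_F _ _ _ _ R mu _ (measurable_funeneg mE)
  (fun x => funeneg_ge0 (EFin \o f) x).
have mB := emeasurable_funB mp mn.
apply/measurable_EFinP; apply: (eq_measurable_fun _ _ mB) => z _.
rewrite /= -Int_EFin//.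
have -> : (\int[mu]_x (f (z, x))%:E = \int[mu]_x (EFin \o (fun x => f (z, x))) x)%E by [].
rewrite [in RHS]integralE /fubini_F; congr (_ - _)%E.
  by apply: eq_integral => x _; rewrite !funeposE.
by apply: eq_integral => x _; rewrite !funenegE.
Qed.

Lemma measurable_row_coords (i : 'I_d) :
  measurable_fun setT (fun p : 'rV[R]_d * 'rV[R]_d => p.1 ord0 i) /\
  measurable_fun setT (fun p : 'rV[R]_d * 'rV[R]_d => p.2 ord0 i).
Proof.
by split; apply: (measurableT_comp (@measurable_row_coord R d i)).
Qed.

End parametric_measurability.

(** * Power series of the Green kernel *)

Section kernel_expansion.
Context {R : realType} {d : nat} (hd : (3 <= d)%N).
Implicit Types (x y z : 'rV[R]_d).

Local Notation mu := (leb R d).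
Local Notation la := (@lam R d).

Variables (U : set 'rV[R]_d) (th : 'rV[R]_d -> R) (b A : R).
Hypotheses (tth : test_function U th) (b0 : 0 < b) (A0 : 0 < A)
  (th1 : forall z, sqn z < b ^+ 2 -> th z = 1).

Let geg m k z x := gegen (sqn z) (rdot z x) (sqn x) m k.

(* The coefficient of e^k in Nker th 0 z (e *: x). *)
Definition Nk k z x : R :=
  4 * - la * (dot (nab th z) (fun i => z ord0 i) * geg (la + 1) k z x
     - dot (nab th z) (fun i => x ord0 i) * shift (fun k => geg (la + 1) k z x) k)
  + lap th z * geg la k z x.

Let rho := A / b.
Let rho0 : 0 < rho. Proof. exact: divr_gt0. Qed.
Let sig := (3 + 2 * (la + 1)) * rho.

Definition Nrate : R := sig.

Lemma Nrate_gt0 : 0 < Nrate.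
Proof. by have := @lam_gt0 R d hd; have := rho0; rewrite /Nrate /sig => ? ?; apply: mulr_gt0 => //; lra. Qed.

Lemma geg_measurable m k : measurable_fun setT (fun p : 'rV[R]_d * 'rV[R]_d => geg m k p.1 p.2).
Proof.
have m1 : measurable_fun setT (fun p : 'rV[R]_d * 'rV[R]_d => sqn p.1).
  by apply: measurable_sum => i; apply: measurable_funX; have [] := @measurable_row_coords R d i.
have m2 : measurable_fun setT (fun p : 'rV[R]_d * 'rV[R]_d => sqn p.2).
  by apply: measurable_sum => i; apply: measurable_funX; have [] := @measurable_row_coords R d i.
have mX : measurable_fun setT (fun p : 'rV[R]_d * 'rV[R]_d => rdot p.1 p.2).
  by apply: measurable_sum => i; apply: measurable_funM; have [] := @measurable_row_coords R d i.
have mp a : measurable_fun setT (fun p : 'rV[R]_d * 'rV[R]_d => sqn p.1 `^ a).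
  by apply: (@measurableT_comp _ _ _ _ _ _ (fun t : R => t `^ a)) => //; exact: measurable_powR.
have mV : measurable_fun setT (fun p : 'rV[R]_d * 'rV[R]_d => (sqn p.1)^-1).
  rewrite (_ : (fun p => _) = fun p : 'rV[R]_d * 'rV[R]_d => sqn p.1 `^ (-1)); first exact: mp.
  by apply/funext => p; rewrite powR_inv1// sqn_ge0.
suff : measurable_fun setT (fun p : 'rV[R]_d * 'rV[R]_d => geg m k p.1 p.2) /\
  measurable_fun setT (fun p : 'rV[R]_d * 'rV[R]_d => geg m k.+1 p.1 p.2) by case.
elim: k => [|k [IH1 IH2]].
  split; first exact: mp.
  rewrite (_ : (fun p => _) = fun p : 'rV[R]_d * 'rV[R]_d => 2 * m * rdot p.1 p.2 * sqn p.1 `^ (- m) * (sqn p.1)^-1)//.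
  by apply: measurable_funM => //; apply: measurable_funM => //; apply: measurable_funM.
split => //.
rewrite (_ : (fun p => _) = fun p : 'rV[R]_d * 'rV[R]_d =>
  (2 * (k.+1%:R + m) * rdot p.1 p.2 * geg m k.+1 p.1 p.2 - (k%:R + 2 * m) * sqn p.2 * geg m k p.1 p.2)
   * (k.+2%:R^-1 * (sqn p.1)^-1)); last first.
  by apply/funext => p; rewrite /geg gegenSS invfM.
apply: measurable_funM; last exact: measurable_funM.
by apply: measurable_funB; apply: measurable_funM => //; apply: measurable_funM.
Qed.

Lemma Nk_measurable k : measurable_fun setT (fun p : 'rV[R]_d * 'rV[R]_d => Nk k p.1 p.2).
Proof.
have ms (f : 'rV[R]_d -> R) : smooth f -> measurable_fun setT (fun p : 'rV[R]_d * 'rV[R]_d => f p.1).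
  by move=> sf; apply: (measurableT_comp (smooth_measurable sf)).
have sth := test_smooth tth.
have md (h : 'I_d -> 'rV[R]_d * 'rV[R]_d -> R) : (forall i, measurable_fun setT (h i)) ->
    measurable_fun setT (fun p => dot (nab th p.1) (fun i => h i p)).
  move=> mh; apply: measurable_sum => i; apply: measurable_funM => //.
  exact: ms (smooth_partial i sth).
apply: measurable_funD; last first.
  by apply: measurable_funM; [exact: ms (smooth_lap sth)|exact: geg_measurable].
apply: measurable_funM => //; apply: measurable_funB; apply: measurable_funM.
- by apply: md => i; have [] := @measurable_row_coords R d i.
- exact: geg_measurable.
- by apply: md => i; have [] := @measurable_row_coords R d i.
- by case: k => [|k] /=; [exact: measurable_cst|exact: geg_measurable].
Qed.

Lemma Nk0 k z x : sqn z < b ^+ 2 -> Nk k z x = 0.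
Proof.
move=> zb; rewrite /Nk (th_lap0 th1)// mul0r addr0.
have h (u : 'I_d -> R) : dot (nab th z) u = 0.
  by rewrite /dot big1// => i _; rewrite /nab (th_partial0 th1)// mul0r.
by rewrite !h !mul0r subrr mulr0.
Qed.

Lemma Nk_supp k z x : ~ supp th z -> Nk k z x = 0.
Proof.
move=> hz; rewrite /Nk.
have o : open (~` supp th) by exact/closed_openC/closed_closure.
have -> : lap th z = 0.
  rewrite (@lap_open _ _ th (fun=> 0) _ _ o (fun y => @suppP _ _ th y) hz).
  by rewrite /lap big1// => i _; rewrite !partial_cst.
have h (u : 'I_d -> R) : dot (nab th z) u = 0.
  by rewrite /dot big1// => i _; rewrite /nab partial_supp// mul0r.
by rewrite !h !mul0r subrr mulr0 addr0.
Qed.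

(** The hypotheses of the Gegenbauer expansion, with rho = A / b the largest possible ratio of |x|
    to |z|. *)
Lemma geg_hyps z x : sqn x <= A ^+ 2 -> b ^+ 2 <= sqn z ->
  [/\ 0 < sqn z, `|rdot z x| <= rho * sqn z & sqn x <= rho ^+ 2 * sqn z].
Proof.
move=> xA zb; have b2 : 0 < b ^+ 2 by rewrite exprn_gt0.
have z0 := lt_le_trans b2 zb.
have W : sqn x <= rho ^+ 2 * sqn z.
  apply: le_trans xA _; rewrite /rho expr_div_n mulrAC ler_pdivlMr//.
  by rewrite ler_wpM2l// sqr_ge0.
split => //; rewrite -ler_sqr ?nnegrE//; last by rewrite mulr_ge0 ?sqn_ge0// ltW.
rewrite real_normK ?num_real//; apply: le_trans (rdot_cs _ _) _.
rewrite exprMn expr2 [sqn z ^+ 2]expr2 [leRHS]mulrA [leRHS]mulrC.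
by rewrite ler_wpM2l ?(ltW z0)// -expr2.
Qed.

Let lap0 : 0 < la. Proof. exact: lam_gt0. Qed.

Lemma geg_bound m k z x : 0 <= m <= la + 1 -> sqn x <= A ^+ 2 -> b ^+ 2 <= sqn z ->
  `|geg m k z x| <= (b ^+ 2) `^ (- m) * sig ^+ k.
Proof.
move=> /andP[m0 ml] xA zb; have [z0 hX hW] := geg_hyps xA zb.
have b2 : 0 < b ^+ 2 by rewrite exprn_gt0.
have r0 := ltW rho0.
apply: le_trans (gegen_bound z0 m0 r0 hX (sqn_ge0 x) hW k) _.
apply: ler_pM; first exact: powR_ge0.
- by apply: exprn_ge0; apply: mulr_ge0 => //; move: m0; lra.
- have := @plum_le R d (- m) 0 (b ^+ 2) z; rewrite /plum expr0n /= addr0; apply => //.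
  by rewrite oppr_le0.
- apply: lerXn2r; rewrite ?nnegrE.
  + by apply: mulr_ge0 => //; move: m0; lra.
  + by apply: mulr_ge0 => //; have := lap0; lra.
  + by rewrite ler_wpM2r//; move: ml; lra.
Qed.

Lemma Nk_bound : exists M : R, 0 <= M /\ forall k z x, sqn x <= A ^+ 2 ->
  `|Nk k z x| <= M * sig ^+ k.
Proof.
have s0 : 0 < sig := Nrate_gt0.
have [T [T0 hT]] : exists T : R, 0 <= T /\ forall z, `|dot (nab th z) (fun i => z ord0 i)| <= T.
  have tt : test_function U (fun z => dot (nab th z) (fun i => z ord0 i)).
    by apply: test_sum => i; exact: testMl (test_partial i tth) (smooth_coord i).
  by have [T [_ [T0 _ hT _]]] := test_bounded tt; exists T.
have hB (i : 'I_d) : exists B : R, 0 <= B /\ forall z, `|partial i th z| <= B.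
  by have [B [_ [B0 _ hB _]]] := test_bounded (test_partial i tth); exists B.
have [B hB'] := choice hB.
have SB0 : 0 <= \sum_i B i * A by apply: sumr_ge0 => i _; rewrite mulr_ge0 ?(ltW A0)//; have [] := hB' i.
have [L [_ [L0 _ hL _]]] := test_bounded (test_lap tth).
have l0 := lap0.
pose p1 := (b ^+ 2) `^ (- (la + 1)); pose p0 := (b ^+ 2) `^ (- la).
have p10 : 0 <= p1 by exact: powR_ge0.
have p00 : 0 <= p0 by exact: powR_ge0.
pose M := 4 * la * (T * p1 + (\sum_i B i * A) * (p1 / sig)) + L * p0.
have M0 : 0 <= M.
  apply: addr_ge0; last exact: mulr_ge0.
  apply: mulr_ge0; first by rewrite mulr_ge0// ltW.
  by apply: addr_ge0; apply: mulr_ge0 => //; rewrite divr_ge0// ltW.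
exists M; split => // k z x xA.
have sk : 0 <= sig ^+ k by rewrite exprn_ge0// ltW.
have [zb|zb] := ltP (sqn z) (b ^+ 2); first by rewrite Nk0// normr0 mulr_ge0.
have lab : 0 <= la + 1 <= la + 1 by rewrite lexx andbT; lra.
have lab' : 0 <= la <= la + 1 by apply/andP; split; lra.
have g1 j : `|geg (la + 1) j z x| <= p1 * sig ^+ j by exact: geg_bound.
have g0 : `|geg la k z x| <= p0 * sig ^+ k by exact: geg_bound.
have gs : `|shift (fun k => geg (la + 1) k z x) k| <= p1 / sig * sig ^+ k.
  case: k {g0 sk} => [|k] /=.
    by rewrite normr0 mulr_ge0// divr_ge0// ltW.
  apply: le_trans (g1 k) _; rewrite exprS mulrA -[p1 / sig * sig]mulrA mulVf ?mulr1//.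
  by rewrite gt_eqF.
have hx : `|dot (nab th z) (fun i => x ord0 i)| <= \sum_i B i * A.
  apply: le_trans (ler_norm_sum _ _ _) _; apply: ler_sum => i _; rewrite normrM.
  have [B0 hBi] := hB' i; apply: ler_pM => //; first exact: hBi.
  by apply: le_trans (coord_le_norm _ _) _; apply: norm_le_sqn => //; exact: ltW.
rewrite /Nk /M [leRHS]mulrDl; apply: le_trans (ler_normD _ _) _; apply: lerD.
  rewrite normrM normrM normrN (ger0_norm (ltW l0)) (ger0_norm (_ : 0 <= 4))//.
  rewrite -[leRHS]mulrA; apply: ler_wpM2l; first by rewrite mulr_ge0// ltW.
  apply: le_trans (ler_normB _ _) _; rewrite [leRHS]mulrDl !normrM.
  by apply: lerD; rewrite -mulrA; apply: ler_pM.
by rewrite normrM -mulrA; apply: ler_pM.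
Qed.

(** The gradient of the kernel contains the vector z - e x; its part -e x multiplies a series by e,
    whence the [shift] in [Nk]. *)
Lemma Nk_psum (e : R) z x : 0 <= e -> 4 * sig * e < 1 -> sqn x <= A ^+ 2 ->
  psum (fun k => Nk k z x) e (Nker th 0 z (e *: x)).
Proof.
move=> e0 he xA; have [zb|zb] := ltP (sqn z) (b ^+ 2).
  rewrite (Nker0 th1)//; apply: (@seq_cvg_ext _ (fun=> 0)); last exact: cvg_cst.
  by move=> n; rewrite pseriesE big1// => i _; rewrite Nk0// mul0r.
have [z0 hX hW] := geg_hyps xA zb.
have l0 := lap0; have r0 := ltW rho0.
have E a : plum a 0 (z - e *: x) = (sqn z - 2 * e * rdot z x + e ^+ 2 * sqn x) `^ a.
  rewrite /plum expr0n /= addr0 sqnB sqnZ; congr ((_ - _ + _) `^ _).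
  rewrite /rdot /dot -!mulrA; congr (2 * _); rewrite mulr_sumr; apply: eq_bigr => i _.
  by rewrite !mxE; ring.
have h1 : psum (fun k => geg (la + 1) k z x) e (plum (- la - 1) 0 (z - e *: x)).
  rewrite E -opprD; apply: (gegen_psum z0 _ r0 hX (sqn_ge0 x) hW) => //; lra.
have h0 : psum (fun k => geg la k z x) e (plum (- la) 0 (z - e *: x)).
  rewrite E; apply: (gegen_psum z0 _ r0 hX (sqn_ge0 x) hW) => //; first lra.
  apply: le_lt_trans he; rewrite ler_wpM2r// ler_wpM2l// /sig ler_wpM2r//; lra.
have := psumD (@psumZ _ (4 * - la) _ _ _ (psumB
   (@psumZ _ (dot (nab th z) (fun i => z ord0 i)) _ _ _ h1)
   (@psumZ _ (dot (nab th z) (fun i => x ord0 i)) _ _ _ (psum_shift h1))))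
   (@psumZ _ (lap th z) _ _ _ h0).
rewrite /Nker; congr (psum _ _ (_ + _)).
have -> : dot (nab th z) (fun i => (z - e *: x) ord0 i) =
    dot (nab th z) (fun i => z ord0 i) - e * dot (nab th z) (fun i => x ord0 i).
  rewrite /dot mulr_sumr -sumrB; apply: eq_bigr => i _; rewrite !mxE; ring.
by ring.
Qed.

End kernel_expansion.

(** * Scaling and the expansion of the pairing *)

Section scaling.
Context {R : realType} {d : nat}.
Implicit Types (f g : 'rV[R]_d -> R) (U V : set 'rV[R]_d).
Local Notation mu := (leb R d).

(* The useless + 0 puts dil in the affine form of the change of variables lemmas. *)
Definition dil (e : R) f : 'rV[R]_d -> R := fun x => f (e^-1 *: x + 0).

Lemma dilK (e : R) f : e != 0 -> dil e (dil e^-1 f) = f.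
Proof.
by move=> e0; apply/funext => x; rewrite /dil !addr0 scalerA invrK mulfV// scale1r.
Qed.

Lemma test_dil (e : R) U V f : 0 < e -> test_function U f -> (forall x, U x -> V (e *: x)) ->
  test_function V (dil e f).
Proof.
move=> e0 [sf cf fU] UV; have e1 := lt0r_neq0 e0.
apply: (@test_of _ _ _ ((fun x => e *: x + 0) @` supp f)).
- exact: smooth_affine.
- by apply: continuous_compact => //; apply: continuous_subspaceT; exact: continuous_affine.
- by move=> _ [x fx <-]; rewrite addr0; apply/UV/fU.
- move=> x h; rewrite /dil; apply: suppP => sx; apply: h; exists (e^-1 *: x + 0) => //.
  by rewrite !addr0 scalerA mulfV// scale1r.
Qed.

Lemma test_dilT (e : R) U f : 0 < e -> test_function U f -> test_function setT (dil e f).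
Proof. by move=> e0 tf; apply: (test_dil e0 tf). Qed.

Lemma partial_dil (e : R) f i : smooth f -> partial i (dil e f) = fun x => e^-1 * dil e (partial i f) x.
Proof. exact: partial_affine. Qed.

Lemma lap_dil (e : R) f : smooth f -> lap (dil e f) = fun x => e^-1 ^+ 2 * dil e (lap f) x.
Proof.
move=> sf; apply/funext => x; rewrite /dil {2}/lap mulr_sumr; apply: eq_bigr => i _.
rewrite (partial_dil e i sf) (_ : (fun x => _) = (fun=> e^-1) \* dil e (partial i f))//.
rewrite partialM; last 2 first.
- by move=> y; exact: smooth_derivable (smooth_cst _).
- by move=> y; exact: smooth_derivable (smooth_affine _ _ (smooth_partial i sf)).
by rewrite partial_cst (partial_dil e i (smooth_partial i sf)) /= mulr0 addr0 mulrA expr2.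
Qed.

Definition scv (e : R) (X : L2H R d d) : L2H R d d :=
  if pselect ((fun i x => e^-1 * (X : l2vec R d d) i (e^-1 *: x + 0)) \in @l2pred R d d) is left h
  then L2vec h else 0.

Lemma sqint_affine (a : R) (b : 'rV[R]_d) f : 0 < a -> sqint f -> sqint (fun x => f (a *: x + b)).
Proof.
move=> a0 [mf if_]; split; last exact: (intg_affine b a0 if_).
by apply: (measurableT_comp mf); exact: measurable_row_affine.
Qed.

Lemma scvE (e : R) (X : L2H R d d) : 0 < e ->
  (scv e X : l2vec R d d) = (fun i x => e^-1 * (X : l2vec R d d) i (e^-1 *: x + 0)) :> ('I_d -> 'rV[R]_d -> R).
Proof.
move=> e0; rewrite /scv; case: pselect => //= h; exfalso; apply: h.
apply/l2predP => i; apply: sqintZ; apply: sqint_affine; first by rewrite invr_gt0.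
exact: l2sq.
Qed.

Lemma scv_lin (e a : R) X Y : 0 < e -> scv e (a *: X + Y) = a *: scv e X + scv e Y.
Proof.
move=> e0; apply: val_inj; apply/funext => i; apply/funext => x.
rewrite [LHS](_ : _ = (scv e (a *: X + Y) : l2vec R d d) i x)// (scvE _ e0).
rewrite [RHS](_ : _ = a * (scv e X : l2vec R d d) i x + (scv e Y : l2vec R d d) i x)// !(scvE _ e0).
rewrite [X in e^-1 * X](_ : _ = a * (X : l2vec R d d) i (e^-1 *: x + 0) + (Y : l2vec R d d) i (e^-1 *: x + 0))//.
by ring.
Qed.

Lemma ip_scv (e : R) X Y : (2 <= d)%N -> 0 < e -> ip (scv e X) (scv e Y) = e ^+ (d - 2) * ip X Y.
Proof.
move=> hd e0; rewrite [LHS]/(l2ip _ _) /l2ip !(scvE _ e0).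
have e1 : 0 < e^-1 by rewrite invr_gt0.
have i0 := l2ip_intg X Y.
transitivity (\int[mu]_x (e^-1 ^+ 2 * (fun y => \sum_(i < d) (X : l2vec R d d) i y * (Y : l2vec R d d) i y) (e^-1 *: x + 0))).
  by apply: Int_ext => x; rewrite mulr_sumr; apply: eq_bigr => i _; rewrite expr2; ring.
rewrite IntZ; last exact: (intg_affine 0 e1 i0).
rewrite (Int_affine 0 e1 i0) invrK mulrA; congr (_ * _).
by rewrite -{1}(subnK hd) exprD exprVn mulrC -mulrA mulfV ?mulr1// expf_neq0// gt_eqF.
Qed.

Lemma scv_grad (e : R) U f : 0 < e -> test_function U f -> scv e (grad f) = grad (dil e f).
Proof.
move=> e0 tf; apply: val_inj; apply/funext => i.
rewrite [LHS](_ : _ = (scv e (grad f) : l2vec R d d) i)// (scvE _ e0).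
rewrite [RHS](_ : _ = (grad (dil e f) : l2vec R d d) i)// (gradE i (test_dilT e0 tf)) (gradE i tf).
by rewrite partial_dil//; exact: test_smooth tf.
Qed.

Lemma nrm_scv (e : R) X : (2 <= d)%N -> 0 < e -> nrm (scv e X) = Num.sqrt (e ^+ (d - 2)) * nrm X.
Proof. by move=> hd e0; rewrite /nrm ip_scv// sqrtrM// exprn_ge0// ltW. Qed.

Lemma hcvg_scv (e : R) u X : (2 <= d)%N -> 0 < e -> hcvg u X -> hcvg (fun n => scv e (u n)) (scv e X).
Proof.
move=> hd e0 hu; rewrite /hcvg.
rewrite (_ : (fun n => _) = fun n => Num.sqrt (e ^+ (d - 2)) * nrm (u n - X)).
  by rewrite -(mulr0 (Num.sqrt (e ^+ (d - 2)))); exact: seq_cvgZ.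
apply/funext => n; rewrite -nrm_scv//; congr nrm.
have := @scv_lin e (-1) X (u n) e0; rewrite addrC => h.
have s (Z : L2H R d d) : -1 *: Z = - Z by exact: scaleN1r.
by rewrite !s in h; rewrite h addrC.
Qed.

Lemma hcvg_bounded (H : hilbert R) (u : nat -> H) x : hcvg u x ->
  exists C : R, 0 <= C /\ forall n, nrm (u n) <= C.
Proof.
move=> hu; have [N hN] := (hcvgP _ _).1 hu 1 ltr01.
exists (nrm x + 1 + \sum_(i < N) nrm (u i)); split.
  by rewrite !addr_ge0 ?nrm_ge0//; apply: sumr_ge0 => i _; exact: nrm_ge0.
move=> n; have [Nn|nN] := leqP N n; last first.
  rewrite (bigD1 (Ordinal nN))//= addrCA lerDl addr_ge0 ?nrm_ge0//.
    by rewrite addr_ge0// nrm_ge0.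
  by apply: sumr_ge0 => i _; exact: nrm_ge0.
apply: (@le_trans _ _ (nrm x + 1)); last first.
  by rewrite lerDl; apply: sumr_ge0 => i _; exact: nrm_ge0.
rewrite -(subrK x (u n)); apply: le_trans (nrmD _ _) _.
by rewrite addrC lerD2l ltW// hN.
Qed.

Lemma hcvg_cauchy (H : hilbert R) (u : nat -> H) x : hcvg u x ->
  forall e : R, 0 < e -> exists N : nat, forall i j, (N <= i)%N -> (N <= j)%N -> nrm (u i - u j) < e.
Proof.
move=> hu e e0; have e2 : 0 < e / 2 by rewrite divr_gt0.
have [N hN] := (hcvgP _ _).1 hu _ e2; exists N => i j Ni Nj.
rewrite [e]splitr; apply: le_lt_trans (nrm_dist _ x _) (ltrD (hN i Ni) _).
by rewrite nrmBC; exact: hN.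
Qed.

End scaling.

(** * Cutoffs in the energy *)

Section cutoff_energy.
Context {R : realType} {d : nat} (hd : (3 <= d)%N).
Implicit Types (f g chi phi gam : 'rV[R]_d -> R) (U V : set 'rV[R]_d).
Local Notation mu := (leb R d).
Local Notation test := (test_function setT).

(** The commutator of the Laplacian with multiplication by chi, applied to phi; it vanishes wherever
    chi is locally constant. *)
Definition zeta chi phi x : R := lap chi x * phi x + 2 * dot (nab chi x) (nab phi x).

Lemma test_zeta U V chi phi : test_function U chi -> test_function V phi -> test_function U (zeta chi phi).
Proof.
move=> tc tp; apply: testD; first exact: testMl (test_lap tc) (test_smooth tp).
apply: (testZ 2); apply: test_sum => i.
exact: testMl (test_partial i tc) (smooth_partial i (test_smooth tp)).
Qed.

Lemma zeta_lin U chi (a : R) f g : test_function U f -> test_function U g ->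
  zeta chi (a *: f + g) = fun x => a * zeta chi f x + zeta chi g x.
Proof.
move=> tf tg; have tag := test_lin a tf tg; apply/funext => x; rewrite /zeta.
have E i : partial i (a *: f + g) x = a * partial i f x + partial i g x.
  rewrite -(gradE i tag) (grad_lin a tf tg).
  by rewrite [LHS](_ : _ = a * (grad f : l2vec R d d) i x + (grad g : l2vec R d d) i x)// !(gradE i tf, gradE i tg).
have -> : dot (nab chi x) (nab (a *: f + g) x) = a * dot (nab chi x) (nab f x) + dot (nab chi x) (nab g x).
  by rewrite /dot mulr_sumr -big_split; apply: eq_bigr => i _; rewrite /nab E /=; ring.
rewrite [(a *: f + g) x](_ : _ = a * f x + g x)//; ring.
Qed.

Lemma zeta_dil (e : R) chi phi : smooth chi -> smooth phi ->
  zeta (dil e chi) (dil e phi) = fun x => e^-1 ^+ 2 * dil e (zeta chi phi) x.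
Proof.
move=> sc sp; apply/funext => x; rewrite /zeta (lap_dil _ sc).
rewrite (_ : dot (nab (dil e chi) x) _ = e^-1 ^+ 2 * dot (nab chi (e^-1 *: x + 0)) (nab phi (e^-1 *: x + 0))).
  by rewrite /dil; ring.
rewrite /dot mulr_sumr; apply: eq_bigr => i _.
by rewrite /nab (partial_dil e i sc) (partial_dil e i sp) /dil; ring.
Qed.

(** When phi approximates a field harmonic off the obstacle and gam one harmonic in Om, with chi
    equal to 1 near the obstacle and supported in Om, the first two terms on the right tend to 0:
    only the integral against [zeta] survives. *)
Lemma energy_cut chi phi gam : test chi -> test phi -> test gam ->
  energy phi gam = energy phi (gam \- chi \* gam) + energy (chi \* phi) gam
    + \int[mu]_x (gam x * zeta chi phi x).
Proof.
move=> tc tp tg; have sc := test_smooth tc; have sp := test_smooth tp; have sg := test_smooth tg.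
have tcp := testMl tc sp; have tcg := testMl tc sg.
rewrite [energy phi (gam \- _)]/energy (gradB tg tcg) ipBr -/(energy phi gam) -/(energy phi (chi \* gam)).
suff -> : energy phi (chi \* gam) = energy (chi \* phi) gam + \int[mu]_x (gam x * zeta chi phi x).
  by rewrite -addrA subrK.
rewrite energyC (energy_lap tcg tp) (energyC (chi \* phi)) (energy_lap tg tcp) (lapM sc sp).
have i1 : intg (fun x => gam x * zeta chi phi x) := test_intg (testMl tg (test_smooth (test_zeta tc tp))).
have i2 : intg (fun x => (chi \* gam) x * lap phi x) := test_intg (testMl tcg (smooth_lap sp)).
rewrite (_ : \int[mu]_x (gam x * (lap chi x * phi x + _ + _)) =
    \int[mu]_x (gam x * zeta chi phi x + (chi \* gam) x * lap phi x)); last first.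
  apply: Int_ext => x /=; rewrite /zeta.
  by move: (lap chi x) (lap phi x) (dot _ _) (gam x) (chi x) (phi x) => a b c p q r; ring.
by rewrite (IntD i1 i2) opprD addrAC addNr add0r.
Qed.

Lemma zeta_L1 U chi : test_function U chi -> exists C : R, 0 <= C /\
  forall phi, test phi -> \int[mu]_x `|zeta chi phi x| <= C * nrm (grad phi).
Proof.
move=> tc; have [A [A0 hA]] := test_mul_L1 hd (test_lap tc).
pose B := \sum_(i < d) Num.sqrt (\int[mu]_x (partial i chi x ^+ 2)).
have B0 : 0 <= B by apply: sumr_ge0 => i _; exact: sqrtr_ge0.
exists (A + 2 * B); split; first by rewrite addr_ge0// mulr_ge0.
move=> phi tp; have sp := test_smooth tp.
have sqn_abs (f : 'rV[R]_d -> R) V : test_function V f -> sqint (fun x => `|f x|).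
  move=> tf; have [m i] := test_sqint tf; split; first exact: measurableT_comp.
  by move: i; congr intg; apply/funext => x; rewrite real_normK ?num_real.
have ia : intg (fun x => `|lap chi x * phi x|).
  exact: intg_norm (test_intg (testMl (test_lap tc) sp)).
have ib i : intg (fun x => `|partial i chi x| * `|partial i phi x|).
  apply: sqintM; [exact: sqn_abs (test_partial i tc)|exact: sqn_abs (test_partial i tp)].
apply: (@le_trans _ _ (\int[mu]_x (`|lap chi x * phi x| + 2 * \sum_(i < d) `|partial i chi x| * `|partial i phi x|))).
  apply: Int_le.
  - exact: intg_norm (test_intg (test_zeta tc tp)).
  - by apply: (@intgD _ _ (fun x => `|lap chi x * phi x|)) => //; apply: intgZ; exact: intg_sum.
  move=> x; apply: le_trans (ler_normD _ _) _; rewrite lerD2l normrM ger0_norm// ler_wpM2l//.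
  apply: le_trans (ler_norm_sum _ _ _) _; apply: ler_sum => i _; by rewrite normrM.
rewrite (@IntD _ _ (fun x => `|lap chi x * phi x|))//; last by apply: intgZ; exact: intg_sum.
rewrite mulrDl; apply: lerD; first exact: hA tp.
rewrite IntZ; last exact: intg_sum.
rewrite -mulrA ler_wpM2l// Int_sum// mulr_suml; apply: ler_sum => i _.
apply: le_trans (ler_norm _) _.
apply: le_trans (Int_cs (sqn_abs _ _ (test_partial i tc)) (sqn_abs _ _ (test_partial i tp))) _.
have e f : \int[mu]_x (`|f x| ^+ 2) = \int[mu]_x (f x ^+ 2 : R).
  by apply: Int_ext => x; rewrite real_normK ?num_real.
rewrite !e ler_wpM2l ?sqrtr_ge0// /nrm ler_sqrt ?ip_ge0//.
rewrite -/(energy phi phi) (energyE tp tp) Int_sum; last first.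
  by move=> j; exact: test_intg (testMl (test_partial j tp) (smooth_partial j sp)).
rewrite (bigD1 i)//= (_ : \int[mu]_x (partial i phi x ^+ 2) = \int[mu]_x (partial i phi x * partial i phi x)).
  rewrite lerDl; apply: sumr_ge0 => j _; apply: Int_ge0 => x; rewrite -expr2; exact: sqr_ge0.
by apply: Int_ext => x; rewrite expr2.
Qed.

End cutoff_energy.

Section psum_limits.
Context {R : realType}.

(** The geometric bounds make the tails uniformly small in n, so the limit can be taken coefficient
    by coefficient. *)
Lemma psum_limit (b : nat -> nat -> R) (b0 : nat -> R) (Q : nat -> R) (l e C rho : R) :
  0 <= e -> 0 <= rho * e < 1 ->
  (forall n k, `|b n k| <= C * rho ^+ k) -> (forall k, `|b0 k| <= C * rho ^+ k) ->
  (forall k, b n k @[n --> \oo] --> b0 k) ->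
  (forall n, psum (b n) e (Q n)) -> psum b0 e l -> Q n @[n --> \oo] --> l.
Proof.
move=> e0 q01 hb hb0 hk hQ hl; have /andP[q0 q1] := q01.
apply/cvgrPdist_lt => r r0; have r3 : 0 < r / 3 by rewrite divr_gt0.
have [N hN] := geo_small (C / (1 - rho * e)) q01 r3.
have tail (c : nat -> R) s : (forall k, `|c k| <= C * rho ^+ k) -> psum c e s ->
    `|s - \sum_(k < N) c k * e ^+ k| < r / 3.
  move=> hc hs; have [s' [hs' /(_ N) h]] := psum_geo q01 e0 hc.
  rewrite (psum_unique hs hs'); apply: le_lt_trans h _.
  by have := hN N (leqnn N).
have fin : (\sum_(k < N) b n k * e ^+ k) @[n --> \oo] --> \sum_(k < N) b0 k * e ^+ k.
  elim: N {hN tail} => [|N IH].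
    rewrite big_ord0; apply: (@seq_cvg_ext _ (fun=> 0)); last exact: cvg_cst.
    by move=> n; rewrite big_ord0.
  rewrite big_ord_recr /=; apply: (@seq_cvg_ext _ (fun n => \sum_(k < N) b n k * e ^+ k + b n N * e ^+ N)).
    by move=> n; rewrite big_ord_recr.
  by apply: seq_cvgD => //; apply: seq_cvgM; [exact: hk|exact: cvg_cst].
have /cvgrPdist_lt /(_ _ r3) [M _ hM] := fin.
exists M => // n /hM /= h1.
have h2 := tail _ _ hb0 hl; have h3 := tail _ _ (hb n) (hQ n).
set x := \sum_(k < N) b0 k * e ^+ k in h1 h2; set y := \sum_(k < N) b n k * e ^+ k in h1 h3.
have -> : l - Q n = (l - x) + ((x - y) - (Q n - y)) by ring.
have t1 := ler_normD (l - x) ((x - y) - (Q n - y)).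
have t2 := ler_normB (x - y) (Q n - y).
by lra.
Qed.

End psum_limits.

Opaque grad.

Lemma subACA (V : zmodType) (x y z t : V) : x - y - (z - t) = x - z - (y - t).
Proof. by rewrite !opprD addrACA. Qed.

Section key.
Context {R : realType} {d : nat} (hd : (3 <= d)%N).
Implicit Types (f g phi gam : 'rV[R]_d -> R) (X Y : L2H R d d).
Local Notation mu := (leb R d).
Local Notation test := (test_function setT).

Variables (Om K : set 'rV[R]_d) (A b : R).
Hypotheses (A0 : 0 < A) (b0 : 0 < b) (KA : K `<=` [set x | sqn x < A ^+ 2])
  (bOm : [set x | sqn x <= (2 * b) ^+ 2] `<=` Om).

(* Gradient fields of functions harmonic outside K, resp. in Om, in the energy space of
   the whole space. *)
Definition Mspace X := cl (grads setT) X /\ forall f, test_function (~` K) f -> ip X (grad f) = 0.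
Definition Gspace X := cl (grads setT) X /\ forall f, test_function Om f -> ip X (grad f) = 0.

Let d2 : (2 <= d)%N. Proof. exact: ltnW. Qed.

(** chi is used dilated by e and cuts off around e K; th is fixed and cuts off inside Om. *)
Variables (chi th : 'rV[R]_d -> R).
Hypotheses (tchi : test chi) (chi0 : forall y, (2 * A) ^+ 2 < sqn y -> chi y = 0)
  (chi1 : forall y, sqn y < A ^+ 2 -> chi y = 1)
  (tth : test_function Om th) (th1 : forall z, sqn z < b ^+ 2 -> th z = 1)
  (th0 : supp th `<=` [set x | sqn x <= (2 * b) ^+ 2]).

Let A20 : 0 < 2 * A. Proof. by rewrite mulr_gt0. Qed.
Let rho : R := @Nrate R d b (2 * A).
Let rho0 : 0 < rho. Proof. exact: Nrate_gt0. Qed.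
Let cg := @cgreen R d.
Let cg0 : 0 < cg. Proof. exact: cgreen_gt0. Qed.

Let zt phi := zeta chi phi.

Let zt_out phi x : (2 * A) ^+ 2 < sqn x -> zt phi x = 0.
Proof.
move=> xA; have o : open [set x : 'rV[R]_d | (2 * A) ^+ 2 < sqn x].
  apply: (@open_comp _ _ (@sqn R d) [set t | (2 * A) ^+ 2 < t]); last exact: open_gt.
  by move=> z _; exact: continuous_sqn.
rewrite /zt /zeta (@lap_open _ _ chi (fun=> 0) _ _ o chi0 xA).
rewrite {1}/lap big1 ?mul0r ?add0r; last by move=> i _; rewrite !partial_cst.
rewrite /dot big1 ?mulr0// => i _.
by rewrite /nab (@partial_open _ _ chi (fun=> 0) _ _ i o chi0 xA) partial_cst mul0r.
Qed.

Let tz phi : test phi -> test (zt phi). Proof. by move=> tp; exact: test_zeta tchi tp. Qed.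

Let Bk k phi z : R := \int[mu]_x (Nk th k z x * zt phi x).

Let zL1 : exists C : R, 0 <= C /\ forall phi, test phi -> \int[mu]_x `|zt phi x| <= C * nrm (grad phi).
Proof. by have [C [C0 h]] := zeta_L1 hd tchi; exists C. Qed.

Let Nbd : exists M : R, 0 <= M /\ forall k z x, sqn x <= (2 * A) ^+ 2 -> `|Nk th k z x| <= M * rho ^+ k.
Proof. by have [M [M0 h]] := Nk_bound hd tth b0 A20 th1; exists M. Qed.

Let Nz_le (N : 'rV[R]_d -> R) (M : R) phi : test phi -> measurable_fun setT N ->
  (forall x, sqn x <= (2 * A) ^+ 2 -> `|N x| <= M) ->
  intg (fun x => N x * zt phi x) /\
  `|\int[mu]_x (N x * zt phi x)| <= M * \int[mu]_x `|zt phi x|.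
Proof.
move=> tp mN hN; have iz := intg_norm (test_intg (tz tp)).
have E x : `|N x * zt phi x| <= M * `|zt phi x|.
  rewrite normrM; have [xA|/zt_out ->] := leP (sqn x) ((2 * A) ^+ 2).
    by rewrite ler_wpM2r// hN.
  by rewrite normr0 !mulr0.
have i : intg (fun x => N x * zt phi x).
  apply: le_intg E _; last exact: intgZ.
  by apply: measurable_funM => //; exact: smooth_measurable (test_smooth (tz tp)).
split => //; apply: le_trans (Int_norm i) _; rewrite -IntZ//.
by apply: Int_le => //; [exact: intg_norm|exact: intgZ].
Qed.

Let Nkz_meas k z : measurable_fun setT (Nk th k z).
Proof.
rewrite (_ : Nk th k z = (fun p : 'rV[R]_d * 'rV[R]_d => Nk th k p.1 p.2) \o (fun x => (z, x)))//.
by apply: measurableT_comp; [exact: Nk_measurable tth k|exact: pair1_measurable].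
Qed.

Let Bk_intg k phi z : test phi -> intg (fun x => Nk th k z x * zt phi x).
Proof.
have [M [M0 hM]] := Nbd; move=> tp.
exact: (Nz_le tp (Nkz_meas k z) (fun x => hM k z x)).1.
Qed.

Let Bk_meas k phi : test phi -> measurable_fun setT (Bk k phi).
Proof.
move=> tp; apply: (@measurable_Int_param _ _ (fun p => Nk th k p.1 p.2 * zt phi p.2)); last first.
  by move=> z; exact: Bk_intg.
apply: measurable_funM; first exact: Nk_measurable tth k.
exact: (measurableT_comp (smooth_measurable (test_smooth (tz tp)))).
Qed.

Let Bk_supp k phi z : ~ supp th z -> Bk k phi z = 0.
Proof.
move=> hz; rewrite /Bk (_ : (fun x => _) = fun=> 0) ?Int0//.
by apply/funext => x; rewrite Nk_supp// mul0r.
Qed.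

(** Pairing with a bounded function carried by the support of [th] is continuous for the energy
    norm; the constant does not depend on that function. *)
Let bdI : exists C : R, 0 <= C /\ forall gam (h : 'rV[R]_d -> R) (B : R), test gam -> 0 <= B -> measurable_fun setT h ->
  (forall z, `|h z| <= B) -> (forall z, ~ supp th z -> h z = 0) ->
  intg (fun z => gam z * h z) /\ `|\int[mu]_z (gam z * h z)| <= B * C * nrm (grad gam).
Proof.
have b23 : 0 <= 2 * b < 3 * b by have := b0; lra.
have t2 := @test_bump _ d _ _ setT b23 (fun _ _ => I).
have one z : supp th z -> bump (2 * b) (3 * b) z = 1.
  by move=> /th0; exact: bump_eq1.
have [C [C0 hC]] := test_mul_L1 hd t2.
exists C; split => // gam h B tg B0 mh hh h0.
have ib := test_intg (testMl t2 (test_smooth tg)).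
have E z : `|gam z * h z| <= B * `|bump (2 * b) (3 * b) z * gam z|.
  have [sz|sz] := pselect (supp th z); last by rewrite h0// mulr0 normr0 mulr_ge0.
  by rewrite one// mul1r normrM mulrC ler_wpM2r.
have i : intg (fun z => gam z * h z).
  apply: le_intg E _; last by apply: intgZ; exact: intg_norm ib.
  by apply: measurable_funM => //; exact: smooth_measurable (test_smooth tg).
split => //; apply: le_trans (Int_norm i) _.
apply: (@le_trans _ _ (B * \int[mu]_z `|bump (2 * b) (3 * b) z * gam z|)).
  rewrite -IntZ; last exact: intg_norm ib.
  by apply: Int_le => //; [exact: intg_norm|apply: intgZ; exact: intg_norm ib].
by rewrite -mulrA; apply: ler_wpM2l => //; exact: hC tg.
Qed.

(** The coefficient of e^k on test functions; division by [cg] normalises the fundamental solution.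
    [key_aux] extends it to limits. *)
Let beta0 k phi gam : R := cg^-1 * \int[mu]_z (gam z * Bk k phi z).

Let beta0_bound : exists C : R, 0 <= C /\ forall k phi gam, test phi -> test gam ->
  intg (fun z => gam z * Bk k phi z) /\
  `|beta0 k phi gam| <= C * rho ^+ k * nrm (grad phi) * nrm (grad gam).
Proof.
have [M [M0 hM]] := Nbd; have [Z [Z0 hZ]] := zL1; have [C [C0 hC]] := bdI.
exists (cg^-1 * (M * Z * C)); split.
  by apply: mulr_ge0; [rewrite invr_ge0 ltW|rewrite !mulr_ge0].
move=> k phi gam tp tg.
pose B := M * rho ^+ k * (Z * nrm (grad phi)).
have rk : 0 <= rho ^+ k by rewrite exprn_ge0// ltW.
have B0 : 0 <= B by rewrite !mulr_ge0// nrm_ge0.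
have hB z : `|Bk k phi z| <= B.
  apply: le_trans (Nz_le tp (Nkz_meas k z) (fun x => hM k z x)).2 _.
  by apply: ler_wpM2l; [rewrite mulr_ge0|exact: hZ].
have [i h] := hC gam _ B tg B0 (Bk_meas k tp) hB (@Bk_supp k phi).
split => //; rewrite /beta0 normrM (ger0_norm (_ : 0 <= cg^-1)); last by rewrite invr_ge0 ltW.
rewrite -!mulrA ler_wpM2l ?invr_ge0 ?(ltW cg0)//; apply: le_trans h _.
rewrite /B; move: (nrm (grad phi)) (nrm (grad gam)) (rho ^+ k) => x y r.
by rewrite le_eqVlt; apply/orP; left; apply/eqP; ring.
Qed.

Let Bk_lin k (a : R) f g z : test f -> test g -> Bk k (a *: f + g) z = a * Bk k f z + Bk k g z.
Proof.
move=> tf tg; have i1 := Bk_intg k z tf; have i2 := Bk_intg k z tg.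
rewrite /Bk -(IntZ a i1) -(IntD (intgZ a i1) i2); apply: Int_ext => x /=.
rewrite /zt (zeta_lin chi a tf tg).
by move: (zeta chi f x) (zeta chi g x) (Nk th k z x) => u v w; ring.
Qed.

Let beta0_linl k (a : R) f g gam : test f -> test g -> test gam ->
  beta0 k (a *: f + g) gam = a * beta0 k f gam + beta0 k g gam.
Proof.
move=> tf tg tm; have [C [C0 hC]] := beta0_bound.
have [i1 _] := hC k f gam tf tm; have [i2 _] := hC k g gam tg tm.
rewrite /beta0 mulrCA -mulrDr -(IntZ a i1) -(IntD (intgZ a i1) i2); congr (_ * _).
apply: Int_ext => z /=; rewrite (Bk_lin k a z tf tg).
by move: (Bk k f z) (Bk k g z) (gam z) => x y w; ring.
Qed.

Let beta0_linr k (a : R) f g phi : test f -> test g -> test phi ->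
  beta0 k phi (a *: f + g) = a * beta0 k phi f + beta0 k phi g.
Proof.
move=> tf tg tm; have [C [C0 hC]] := beta0_bound.
have [i1 _] := hC k phi f tm tf; have [i2 _] := hC k phi g tm tg.
rewrite /beta0 mulrCA -mulrDr -(IntZ a i1) -(IntD (intgZ a i1) i2); congr (_ * _).
apply: Int_ext => z; rewrite [(a *: f + g) z](_ : _ = a * f z + g z)//=.
by move: (Bk k phi z) (f z) (g z) => u v w; ring.
Qed.

Section small_parameter.
Variable e : R.
(** The condition 8 A e <= b puts e x within b / 4 of the origin when |x| <= 2 A, as [Nker_bound]
    asks; 4 rho e < 1 is the convergence condition of [Nk_psum]. *)
Hypotheses (e0 : 0 < e) (eA : 8 * A * e <= b) (er : 4 * rho * e < 1).

Let q01 : 0 <= rho * e < 1.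
Proof.
have h : 0 <= rho * e by rewrite mulr_ge0 ?ltW.
by rewrite h /=; move: er h; rewrite -mulrA; lra.
Qed.

Let BS phi z : R := \int[mu]_x (Nker th 0 z (e *: x) * zt phi x).

Let Q phi gam : R := cg^-1 * \int[mu]_z (gam z * BS phi z).

Let Ne_bound : exists M : R, 0 <= M /\ forall z x, sqn x <= (2 * A) ^+ 2 -> `|Nker th 0 z (e *: x)| <= M.
Proof.
have [M [M0 hM]] := Nker_bound hd tth b0 th1; exists M; split => // z x xA.
apply: hM; rewrite sqnZ; apply: (@le_trans _ _ ((8 * A * e) ^+ 2)).
  rewrite (_ : (8 * A * e) ^+ 2 = 16 * (e ^+ 2 * (2 * A) ^+ 2)); last by ring.
  by rewrite ler_wpM2l// ler_wpM2l// sqr_ge0.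
by rewrite lerXn2r ?nnegrE// ?(ltW b0)// !mulr_ge0// ltW.
Qed.

Let Ne_meas z : measurable_fun setT (fun x : 'rV[R]_d => Nker th 0 z (e *: x)).
Proof.
rewrite (_ : (fun x => _) = Nker th 0 z \o (fun x : 'rV[R]_d => e *: x + 0)); last first.
  by apply/funext => x; rewrite /= addr0.
by apply: measurableT_comp; [exact: Nker_measurable|exact: measurable_row_affine].
Qed.

Let BS_approx : exists C : R, 0 <= C /\ forall phi z n, test phi ->
  `|BS phi z - \sum_(k < n) Bk k phi z * e ^+ k| <= C * nrm (grad phi) * (rho * e) ^+ n.
Proof.
have [M [M0 hM]] := Nbd; have [Z [Z0 hZ]] := zL1; have [M' [M'0 hM']] := Ne_bound.
have /andP[q0 q1] := q01; have q1' : 0 < 1 - rho * e by rewrite subr_gt0.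
exists (M / (1 - rho * e) * Z); split; first by rewrite !mulr_ge0// invr_ge0 ltW.
move=> phi z n tp.
have i0 := (Nz_le tp (Ne_meas z) (fun x => hM' z x)).1.
have ik (k : 'I_n) : intg (fun x => e ^+ k * (Nk th k z x * zt phi x)) by apply: intgZ; exact: Bk_intg.
have is_ : intg (fun x => \sum_(k < n) e ^+ k * (Nk th k z x * zt phi x)) by exact: intg_sum.
have -> : BS phi z - \sum_(k < n) Bk k phi z * e ^+ k =
    \int[mu]_x ((Nker th 0 z (e *: x) - \sum_(k < n) Nk th k z x * e ^+ k) * zt phi x).
  rewrite (_ : \sum_(k < n) Bk k phi z * e ^+ k = \int[mu]_x (\sum_(k < n) e ^+ k * (Nk th k z x * zt phi x))); last first.
    rewrite Int_sum//; apply: eq_bigr => k _; rewrite IntZ; last exact: Bk_intg.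
    by rewrite mulrC.
  rewrite /BS -(IntB i0 is_); apply: Int_ext => x /=; rewrite mulrBl; congr (_ - _).
  by rewrite mulr_suml; apply: eq_bigr => k _; ring.
have mm : measurable_fun setT (fun x : 'rV[R]_d => Nker th 0 z (e *: x) - \sum_(k < n) Nk th k z x * e ^+ k).
  apply: measurable_funB; first exact: Ne_meas.
  apply: measurable_sum => k; apply: measurable_funM; [exact: Nkz_meas|exact: measurable_cst].
have hb x : sqn x <= (2 * A) ^+ 2 ->
    `|Nker th 0 z (e *: x) - \sum_(k < n) Nk th k z x * e ^+ k| <= M / (1 - rho * e) * (rho * e) ^+ n.
  move=> xA; have [l [hl /(_ n)]] := psum_geo q01 (ltW e0) (fun k => hM k z x xA).
  by rewrite (psum_unique (@Nk_psum _ _ hd th b (2 * A) b0 A20 th1 e z x (ltW e0) er xA) hl).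
apply: le_trans (Nz_le tp mm hb).2 _.
rewrite (_ : M / (1 - rho * e) * Z * nrm (grad phi) * (rho * e) ^+ n =
   M / (1 - rho * e) * (rho * e) ^+ n * (Z * nrm (grad phi))); last first.
  by move: (nrm (grad phi)) => x; ring.
by apply: ler_wpM2l; [rewrite !mulr_ge0 ?exprn_ge0// invr_ge0 ltW|exact: hZ].
Qed.

Let geo_lim (u : nat -> R) (l C q : R) : 0 <= q < 1 -> (forall n, `|l - u n| <= C * q ^+ n) -> u @ \oo --> l.
Proof.
move=> q1 h; apply/cvgrPdist_lt => r r0; have [N hN] := geo_small C q1 r0.
by exists N => // n Nn; exact: le_lt_trans (h n) (hN n Nn).
Qed.

Let BS_meas phi : test phi -> measurable_fun setT (BS phi).
Proof.
move=> tp; have [C [C0 hC]] := BS_approx.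
apply: (@measurable_fun_cvg _ _ _ _ (fun n z => \sum_(k < n) Bk k phi z * e ^+ k)).
  move=> n; apply: measurable_sum => k; apply: measurable_funM; [exact: Bk_meas|exact: measurable_cst].
by move=> z _; apply: (geo_lim q01) => n; exact: hC.
Qed.

Let BS_supp phi z : ~ supp th z -> BS phi z = 0.
Proof.
move=> hz; rewrite /BS (_ : (fun x => _) = fun=> 0) ?Int0//.
apply/funext => x; rewrite /Nker.
have o : open (~` supp th) by exact/closed_openC/closed_closure.
have -> : lap th z = 0.
  rewrite (@lap_open _ _ th (fun=> 0) _ _ o (fun y => @suppP _ _ th y) hz).
  by rewrite /lap big1// => i _; rewrite !partial_cst.
rewrite /dot big1 ?mulr0 ?mul0r ?addr0 ?mul0r//.
by move=> i _; rewrite /nab partial_supp// mul0r.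
Qed.

Let Q_intg phi gam : test phi -> test gam -> intg (fun z => gam z * BS phi z).
Proof.
move=> tp tg; have [C [C0 hC]] := bdI; have [D [D0 hD]] := BS_approx.
have B0 : 0 <= D * nrm (grad phi) by rewrite mulr_ge0 ?nrm_ge0.
apply: (hC _ _ _ tg B0 (BS_meas tp) _ (@BS_supp phi)).1 => z.
by have := hD phi z 0%N tp; rewrite big_ord0 subr0 expr0 mulr1.
Qed.

Let Q_psum phi gam : test phi -> test gam -> psum (fun k => beta0 k phi gam) e (Q phi gam).
Proof.
move=> tp tg; have [C [C0 hC]] := bdI; have [D [D0 hD]] := BS_approx.
have [E [E0 hE]] := beta0_bound.
have nf : 0 <= nrm (grad phi) by exact: nrm_ge0.
apply: (@geo_lim _ _ (cg^-1 * (D * nrm (grad phi) * C * nrm (grad gam))) (rho * e) q01) => n.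
rewrite pseriesE.
have ik (k : 'I_n) : intg (fun z => e ^+ k * (gam z * Bk k phi z)) by apply: intgZ; exact: (hE _ _ _ tp tg).1.
have is_ : intg (fun z => \sum_(k < n) e ^+ k * (gam z * Bk k phi z)) by exact: intg_sum.
have iQ := Q_intg tp tg.
have -> : Q phi gam - \sum_(k < n) beta0 k phi gam * e ^+ k =
    cg^-1 * \int[mu]_z (gam z * (BS phi z - \sum_(k < n) Bk k phi z * e ^+ k)).
  rewrite (_ : \sum_(k < n) beta0 k phi gam * e ^+ k =
      cg^-1 * \int[mu]_z (\sum_(k < n) e ^+ k * (gam z * Bk k phi z))); last first.
    rewrite Int_sum// mulr_sumr; apply: eq_bigr => k _; rewrite IntZ; last exact: (hE _ _ _ tp tg).1.
    by rewrite /beta0; ring.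
  rewrite /Q -mulrBr -(IntB iQ is_); congr (_ * _); apply: Int_ext => z /=.
  by rewrite mulrBr mulr_sumr; congr (_ - _); apply: eq_bigr => k _; ring.
have mm : measurable_fun setT (fun z => BS phi z - \sum_(k < n) Bk k phi z * e ^+ k).
  apply: measurable_funB; first exact: BS_meas.
  apply: measurable_sum => k; apply: measurable_funM; [exact: Bk_meas|exact: measurable_cst].
have /andP[q0 q1] := q01.
have B0 : 0 <= D * nrm (grad phi) * (rho * e) ^+ n by rewrite !mulr_ge0// exprn_ge0.
have s0 z : ~ supp th z -> BS phi z - \sum_(k < n) Bk k phi z * e ^+ k = 0.
  move=> hz; rewrite BS_supp// big1 ?subrr// => k _; by rewrite Bk_supp// mul0r.
have [_ h] := hC gam _ _ tg B0 mm (fun z => hD phi z n tp) s0.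
rewrite normrM (ger0_norm (_ : 0 <= cg^-1)); last by rewrite invr_ge0 ltW.
rewrite -[leRHS]mulrA; apply: ler_wpM2l; first by rewrite invr_ge0 ltW.
apply: le_trans h _.
move: (nrm (grad phi)) (nrm (grad gam)) ((rho * e) ^+ n) => x y r.
by rewrite le_eqVlt; apply/orP; left; apply/eqP; ring.
Qed.

(** Lipschitz bounds in each argument separately: exactly what [diagonal_limit] consumes. *)
Definition bounded_bilinear (F : ('rV[R]_d -> R) -> ('rV[R]_d -> R) -> R) :=
  exists C : R, [/\ 0 <= C, forall f f' g, test f -> test f' -> test g ->
      `|F f g - F f' g| <= C * nrm (grad g) * nrm (grad f - grad f') &
    forall f g g', test f -> test g -> test g' ->
      `|F f g - F f g'| <= C * nrm (grad f) * nrm (grad g - grad g')].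

Let bb_lin F G (a : R) : bounded_bilinear F -> bounded_bilinear G ->
  bounded_bilinear (fun f g => a * F f g + G f g).
Proof.
move=> [C [C0 F1 F2]] [D [D0 G1 G2]]; exists (`|a| * C + D).
have tri (x x' y y' c c' u v : R) : `|x - x'| <= c * u * v -> `|y - y'| <= c' * u * v ->
    `|a * x + y - (a * x' + y')| <= (`|a| * c + c') * u * v.
  move=> h1 h2; have -> : a * x + y - (a * x' + y') = a * (x - x') + (y - y') by ring.
  apply: le_trans (ler_normD _ _) _; rewrite normrM.
  have := ler_wpM2l (normr_ge0 a) h1; move: h2; set w := `|_|; move=> h2 h3.
  apply: le_trans (lerD h3 h2) _; rewrite le_eqVlt; apply/orP; left; apply/eqP; ring.
split; first by rewrite addr_ge0// mulr_ge0.
- by move=> f f' g tf tf' tg; apply: tri; [exact: F1|exact: G1].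
- by move=> f g g' tf tg tg'; apply: tri; [exact: F2|exact: G2].
Qed.

(** Orthogonality of a limit field gives convergence to 0 only against a fixed test function;
    boundedness upgrades this to the diagonal, where both arguments move. *)
Let bb_lim1 F (u v : nat -> 'rV[R]_d -> R) X Y : bounded_bilinear F ->
  (forall n, test (u n)) -> (forall n, test (v n)) ->
  hcvg (fun n => grad (u n)) X -> hcvg (fun n => grad (v n)) Y ->
  (forall j, F (u n) (v j) @[n --> \oo] --> (0 : R)) -> F (u n) (v n) @[n --> \oo] --> (0 : R).
Proof.
move=> [C [C0 _ F2]] tu tv hu hv h; have [D [D0 hD]] := hcvg_bounded hu.
apply: (@diagonal_limit _ (fun n j => F (u n) (v j)) (fun i j => nrm (grad (v i) - grad (v j))) (C * D)).
- exact: mulr_ge0.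
- move=> n i j; apply: le_trans (F2 _ _ _ (tu n) (tv i) (tv j)) _.
  by apply: ler_wpM2r; [exact: nrm_ge0|exact: ler_wpM2l].
- exact: hcvg_cauchy hv.
- exact: h.
Qed.

Let bb_lim2 F (u v : nat -> 'rV[R]_d -> R) X Y : bounded_bilinear F ->
  (forall n, test (u n)) -> (forall n, test (v n)) ->
  hcvg (fun n => grad (u n)) X -> hcvg (fun n => grad (v n)) Y ->
  (forall j, F (u j) (v n) @[n --> \oo] --> (0 : R)) -> F (u n) (v n) @[n --> \oo] --> (0 : R).
Proof.
move=> [C [C0 F1 _]] tu tv hu hv h; have [D [D0 hD]] := hcvg_bounded hv.
apply: (@diagonal_limit _ (fun n j => F (u j) (v n)) (fun i j => nrm (grad (u i) - grad (u j))) (C * D)).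
- exact: mulr_ge0.
- move=> n i j; apply: le_trans (F1 _ _ _ (tu i) (tu j) (tv n)) _.
  by apply: ler_wpM2r; [exact: nrm_ge0|exact: ler_wpM2l].
- exact: hcvg_cauchy hu.
- exact: h.
Qed.

Let bb_ip (S T : ('rV[R]_d -> R) -> L2H R d d) (C D : R) : 0 <= C -> 0 <= D ->
  (forall f f', test f -> test f' -> nrm (S f - S f') <= C * nrm (grad f - grad f')) ->
  (forall f, test f -> nrm (S f) <= C * nrm (grad f)) ->
  (forall f f', test f -> test f' -> nrm (T f - T f') <= D * nrm (grad f - grad f')) ->
  (forall f, test f -> nrm (T f) <= D * nrm (grad f)) ->
  bounded_bilinear (fun f g => ip (S f) (T g)).
Proof.
move=> C0 D0 S1 S2 T1 T2; exists (C * D).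
have alg (x y u v : R) : 0 <= x -> 0 <= y -> x <= C * u -> y <= D * v -> x * y <= C * D * u * v.
  move=> x0 y0 h1 h2; apply: le_trans (ler_pM x0 y0 h1 h2) _.
  rewrite le_eqVlt; apply/orP; left; apply/eqP; ring.
split; first exact: mulr_ge0.
- move=> f f' g tf tf' tg; rewrite -ipBl; apply: le_trans (cauchy_schwarz _ _) _.
  rewrite mulrAC; apply: alg; try exact: nrm_ge0; [exact: S1|exact: T2].
- move=> f g g' tf tg tg'; rewrite -ipBr; apply: le_trans (cauchy_schwarz _ _) _.
  apply: alg; try exact: nrm_ge0; [exact: S2|exact: T1].
Qed.

Let che := dil e chi.
Let tche : test che. Proof. exact: test_dilT e0 tchi. Qed.

Let gradM f g : test f -> test g -> grad (che \* f) - grad (che \* g) = grad (che \* (f \- g)).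
Proof.
move=> tf tg; have sf := test_smooth tf; have sg := test_smooth tg.
rewrite -(gradB (testMl tche sf) (testMl tche sg)); congr grad.
by apply/funext => x; rewrite /= mulrBr.
Qed.

Let mulC : exists C : R, 0 <= C /\ forall f, test f -> nrm (grad (che \* f)) <= C * nrm (grad f).
Proof. by have [C [C0 h]] := nrm_test_mul hd setT tche; exists C. Qed.

Let scC := Num.sqrt (e ^+ (d - 2)).

Let dilB f g : test f -> test g -> dil e f \- dil e g = dil e (f \- g).
Proof. by []. Qed.

Let nrm_dil f : test f -> nrm (grad (dil e f)) = scC * nrm (grad f).
Proof. by move=> tf; rewrite -(scv_grad e0 tf) (nrm_scv _ d2 e0). Qed.

Let T0 phi gam := energy (dil e phi) gam.
Let T1 phi gam := energy (dil e phi) (gam \- che \* gam).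
Let T2 phi gam := energy (che \* dil e phi) gam.

Let nB1 f g : test f -> test g -> nrm (grad (dil e f) - grad (dil e g)) <= scC * nrm (grad f - grad g).
Proof.
move=> tf tg; rewrite -(gradB (test_dilT e0 tf) (test_dilT e0 tg)) (dilB tf tg) (nrm_dil (testB tf tg)) (gradB tf tg).
exact: lexx.
Qed.

Let bbT0 : bounded_bilinear T0.
Proof.
apply: (@bb_ip (fun f => grad (dil e f)) (fun f => grad f) scC 1) => //; first exact: sqrtr_ge0.
- by move=> f tf; rewrite (nrm_dil tf).
- by move=> f f' _ _; rewrite mul1r.
- by move=> f _; rewrite mul1r.
Qed.

Let bbT1 : bounded_bilinear T1.
Proof.
have [C [C0 hC]] := mulC.
have E f : test f -> grad (f \- che \* f) = grad f - grad (che \* f).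
  by move=> tf; rewrite (gradB tf (testMl tche (test_smooth tf))).
apply: (@bb_ip (fun f => grad (dil e f)) (fun f => grad (f \- che \* f)) scC (1 + C)).
- exact: sqrtr_ge0.
- by rewrite addr_ge0.
- exact: nB1.
- by move=> f tf; rewrite (nrm_dil tf).
- move=> f g tf tg; rewrite !E//.
  rewrite (subACA (grad f)).
  apply: le_trans (nrmB _ _) _; rewrite mulrDl mul1r lerD2l gradM// -(gradB tf tg).
  by apply: hC; exact: testB.
- move=> f tf; rewrite E//; apply: le_trans (nrmB _ _) _; rewrite mulrDl mul1r lerD2l; exact: hC.
Qed.

Let bbT2 : bounded_bilinear T2.
Proof.
have [C [C0 hC]] := mulC.
apply: (@bb_ip (fun f => grad (che \* dil e f)) (fun f => grad f) (C * scC) 1).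
- by rewrite mulr_ge0// sqrtr_ge0.
- exact: ler01.
- move=> f g tf tg; rewrite (gradM (test_dilT e0 tf) (test_dilT e0 tg)).
  apply: le_trans (hC _ (test_dilT e0 (testB tf tg))) _.
  by rewrite -mulrA ler_wpM2l// (nrm_dil (testB tf tg)) (gradB tf tg).
- move=> f tf; apply: le_trans (hC _ (test_dilT e0 tf)) _; by rewrite (nrm_dil tf) mulrA.
- by move=> f f' _ _; rewrite mul1r.
- by move=> f _; rewrite mul1r.
Qed.

Let bbQ : bounded_bilinear Q.
Proof.
have [C [C0 hC]] := beta0_bound; have /andP[q0 q1] := q01.
exists (C / (1 - rho * e)); split; first by rewrite divr_ge0// subr_ge0 ltW.
- move=> f f' g tf tf' tg.
  have E : (-1) *: f' + f = f \- f' by apply/funext => x; rewrite /= addrC; congr (_ + _); exact: mulN1r.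
  have h k : `|beta0 k f g - beta0 k f' g| <= C * nrm (grad g) * nrm (grad f - grad f') * rho ^+ k.
    have := beta0_linl k (-1) tf' tf tg; rewrite E mulN1r addrC => <-.
    apply: le_trans (hC k _ _ (testB tf tf') tg).2 _; rewrite (gradB tf tf').
    move: (nrm (grad f - grad f')) (nrm (grad g)) (rho ^+ k) => x y r.
    rewrite le_eqVlt; apply/orP; left; apply/eqP; ring.
  apply: le_trans (psum_bound q01 (ltW e0) h (psumB (Q_psum tf tg) (Q_psum tf' tg))) _.
  move: (nrm (grad f - grad f')) (nrm (grad g)) (_^-1) => x y r.
  rewrite le_eqVlt; apply/orP; left; apply/eqP; ring.
- move=> f g g' tf tg tg'.
  have E : (-1) *: g' + g = g \- g' by apply/funext => x; rewrite /= addrC; congr (_ + _); exact: mulN1r.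
  have h k : `|beta0 k f g - beta0 k f g'| <= C * nrm (grad f) * nrm (grad g - grad g') * rho ^+ k.
    have := beta0_linr k (-1) tg' tg tf; rewrite E mulN1r addrC => <-.
    apply: le_trans (hC k _ _ tf (testB tg tg')).2 _; rewrite (gradB tg tg').
    move: (nrm (grad g - grad g')) (nrm (grad f)) (rho ^+ k) => x y r.
    rewrite le_eqVlt; apply/orP; left; apply/eqP; ring.
  apply: le_trans (psum_bound q01 (ltW e0) h (psumB (Q_psum tf tg) (Q_psum tf tg'))) _.
  move: (nrm (grad g - grad g')) (nrm (grad f)) (_^-1) => x y r.
  rewrite le_eqVlt; apply/orP; left; apply/eqP; ring.
Qed.

Let bb0 : bounded_bilinear (fun _ _ => 0).
Proof. by exists 0; split => // *; rewrite subr0 normr0 !mul0r. Qed.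

Let eta phi := dil e (zt phi).

Let te phi : test phi -> test (eta phi).
Proof. by move=> tp; exact: test_dilT e0 (tz tp). Qed.

Let sqn_dil (y : 'rV[R]_d) : sqn (e^-1 *: y + 0) = e^-1 ^+ 2 * sqn y.
Proof. by rewrite addr0 sqnZ. Qed.

Let lt_dil (c : R) (y : 'rV[R]_d) : c * e ^+ 2 < sqn y -> c < sqn (e^-1 *: y + 0).
Proof.
move=> h; rewrite sqn_dil exprVn mulrC ltr_pdivlMr//; first by rewrite exprn_gt0.
Qed.

Let Ae2 : (8 * A * e) ^+ 2 <= b ^+ 2.
Proof. by rewrite lerXn2r ?nnegrE// ?(ltW b0)// !mulr_ge0// ltW. Qed.

Let eta0 phi y : b ^+ 2 < 16 * sqn y -> eta phi y = 0.
Proof.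
move=> hy; apply: zt_out; apply: lt_dil; have := Ae2.
rewrite (_ : (8 * A * e) ^+ 2 = 16 * ((2 * A) ^+ 2 * e ^+ 2)); last by ring.
by set x := _ ^+ 2 * _; lra.
Qed.

(** The pairing of gam with the limit density, after [energy_cut] has turned the integral of gam
    against [eta] into e^2 (T0 - T1 - T2). The nesting and the final 0 follow the shape of
    [bb_lin]. *)
Let F2 phi gam : R := cg * e ^+ 2 * T0 phi gam + (- (cg * e ^+ 2) * T1 phi gam +
   (- (cg * e ^+ 2) * T2 phi gam + (- (e ^+ d * cg) * Q phi gam + 0))).

Let bbF2 : bounded_bilinear F2.
Proof. by do 4![apply: bb_lin => //]. Qed.

Let BkerE phi z : test phi -> Bker th (eta phi) z = e ^+ d * BS phi z.
Proof.
move=> tp; have [M [M0 hM]] := Ne_bound.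
have i0 := (Nz_le tp (Ne_meas z) (fun x => hM z x)).1.
have e1 : 0 < e^-1 by rewrite invr_gt0.
have := Int_affine 0 e1 i0; rewrite invrK => <-; apply: Int_ext => y.
by rewrite addr0 scalerA mulfV ?gt_eqF// scale1r /eta /dil addr0.
Qed.

Let F2E phi gam : test phi -> test gam -> \int[mu]_z (gam z * A0ker th (eta phi) z) = F2 phi gam.
Proof.
move=> tp tg; have tdp := test_dilT e0 tp.
have ec := energy_cut tche tdp tg; rewrite -/(T0 phi gam) -/(T1 phi gam) -/(T2 phi gam) in ec.
have zd := zeta_dil e (test_smooth tchi) (test_smooth tp).
have iE : intg (fun z => gam z * eta phi z) := test_intg (testMl tg (test_smooth (te tp))).
have h1 : \int[mu]_z (gam z * eta phi z) = e ^+ 2 * (T0 phi gam - T1 phi gam - T2 phi gam).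
  rewrite ec (_ : \int[mu]_x (gam x * zeta che (dil e phi) x) = e^-1 ^+ 2 * \int[mu]_z (gam z * eta phi z)).
    set I := \int[mu]_z _; rewrite (_ : _ - _ - _ = e^-1 ^+ 2 * I).
      by rewrite mulrA exprVn mulfV ?mul1r// expf_neq0// gt_eqF.
    by move: (T1 phi gam) (T2 phi gam) (e^-1 ^+ 2 * I) => x y w; ring.
  by rewrite -IntZ//; apply: Int_ext => x; rewrite zd /eta; move: (dil _ _ _) (gam x) => x1 x2; ring.
have h2 : \int[mu]_z (gam z * BS phi z) = cg * Q phi gam by rewrite /Q mulrA mulfV ?mul1r// gt_eqF.
have iQ := Q_intg tp tg.
transitivity (\int[mu]_z (cg * (gam z * eta phi z) - e ^+ d * (gam z * BS phi z))).
  apply: Int_ext => z; rewrite /A0ker (BkerE z tp).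
  have -> : th z * (cg * eta phi z) = cg * eta phi z.
    have [zb|zb] := ltP (sqn z) (b ^+ 2); first by rewrite th1// mul1r.
    rewrite (eta0 phi) ?mulr0//; apply: (le_lt_trans zb).
    have z0 : 0 < sqn z := lt_le_trans (exprn_gt0 2 b0) zb.
    by rewrite ltr_pMl// ltr1n.
  by move: (eta phi z) (BS phi z) (gam z) => x y w; ring.
rewrite (IntB (intgZ cg iE) (intgZ (e ^+ d) iQ)) (IntZ cg iE) (IntZ (e ^+ d) iQ) h1 h2 /F2.
by move: (T0 phi gam) (T1 phi gam) (T2 phi gam) (Q phi gam) => x y w q; ring.
Qed.

(** The function gam - che gam vanishes near e K; dilated back by 1 / e it is a test function off K,
    to which m is orthogonal. *)
Let ipT1 (m : L2H R d d) gam : Mspace m -> test gam -> ip (scv e m) (grad (gam \- che \* gam)) = 0.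
Proof.
move=> [_ mK] tg; have tf := testB tg (testMl tche (test_smooth tg)).
set f := gam \- che \* gam in tf *; have en := lt0r_neq0 e0.
have e1 : 0 < e^-1 by rewrite invr_gt0.
have f'0 y : sqn y < A ^+ 2 -> dil e^-1 f y = 0.
  move=> yA; rewrite /dil invrK addr0 /f /= /che /dil addr0 scalerA mulVf// scale1r.
  by rewrite chi1// mul1r subrr.
have [sf' cf' _] := test_dilT e1 tf.
have tf' : test_function (~` K) (dil e^-1 f).
  split => // y sy Ky; have [w [/= /eqP w0 wA]] := sy _ (open_nbhs_nbhs (conj (@open_sqn_lt _ _ (A ^+ 2)) (KA Ky))).
  by apply: w0; exact: f'0.
by rewrite -(dilK f en) -(scv_grad e0 tf') (ip_scv _ _ d2 e0) (mK _ tf') mulr0.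
Qed.

Let testOm phi : test phi -> test_function Om (che \* dil e phi).
Proof.
move=> tp; have b2 : 0 <= 2 * b by rewrite mulr_ge0// ltW.
apply: (@test_of _ _ _ [set x : 'rV[R]_d | sqn x <= (2 * b) ^+ 2]) => //.
- exact: test_smooth (testMl tche (test_smooth (test_dilT e0 tp))).
- exact: compact_sqn.
move=> y /= /negP; rewrite -ltNge => hy; rewrite /che /dil chi0 ?mul0r//; apply: lt_dil.
apply: le_lt_trans hy; have := Ae2.
rewrite (_ : (8 * A * e) ^+ 2 = 16 * ((2 * A) ^+ 2 * e ^+ 2)); last by ring.
rewrite (_ : (2 * b) ^+ 2 = 4 * b ^+ 2); last by ring.
have : 0 <= (2 * A) ^+ 2 * e ^+ 2 by rewrite mulr_ge0// sqr_ge0.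
by set x := _ * _; lra.
Qed.

(** Along the approximating sequences T1 vanishes because m is harmonic off K, T2 because g is
    harmonic in Om, and F2 by [green_limit]. Solving F2 for T0, whose limit is the pairing, leaves
    e^(d-2) times the limit of Q. *)
Lemma key_limit (m g : L2H R d d) (u v : nat -> 'rV[R]_d -> R) (l : R) : Mspace m -> Gspace g ->
  (forall n, test (u n)) -> (forall n, test (v n)) ->
  hcvg (fun n => grad (u n)) m -> hcvg (fun n => grad (v n)) g ->
  Q (u n) (v n) @[n --> \oo] --> l -> ip (scv e m) g = e ^+ (d - 2) * l.
Proof.
move=> hm hg tu tv hu hv hQ.
have hsu : hcvg (fun n => grad (dil e (u n))) (scv e m).
  have E : (fun n => grad (dil e (u n))) = (fun n => scv e (grad (u n))).
    by apply/funext => n; rewrite (scv_grad e0 (tu n)).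
  by rewrite E; exact: hcvg_scv d2 e0 hu.
have l1 : T1 (u n) (v n) @[n --> \oo] --> (0 : R).
  apply: (bb_lim1 bbT1 tu tv hu hv) => j; rewrite -(ipT1 hm (tv j)).
  exact: hcvg_ip hsu (hcvg_cst _).
have l2 : T2 (u n) (v n) @[n --> \oo] --> (0 : R).
  apply: (bb_lim2 bbT2 tu tv hu hv) => j; rewrite -(hg.2 _ (testOm (tu j))) ipC.
  exact: hcvg_ip (hcvg_cst _) hv.
have l3 : F2 (u n) (v n) @[n --> \oo] --> (0 : R).
  apply: (bb_lim2 bbF2 tu tv hu hv) => j.
  apply: (@seq_cvg_ext _ (fun n => \int[mu]_z (v n z * A0ker th (eta (u j)) z))).
    by move=> n; exact: F2E.
  exact: (green_limit hd tth b0 th1 (te (tu j)) (@eta0 (u j)) tv hv hg.2).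
have l0 : T0 (u n) (v n) @[n --> \oo] --> ip (scv e m) g by exact: hcvg_ip hsu hv.
have ce : cg * e ^+ 2 != 0 by rewrite mulf_neq0 ?gt_eqF// exprn_gt0.
have l0' : T0 (u n) (v n) @[n --> \oo] --> (cg * e ^+ 2)^-1 * 0 + (0 + (0 + e ^+ (d - 2) * l)).
  apply: (@seq_cvg_ext _ (fun n => (cg * e ^+ 2)^-1 * F2 (u n) (v n) +
     (T1 (u n) (v n) + (T2 (u n) (v n) + e ^+ (d - 2) * Q (u n) (v n))))).
    move=> n; rewrite /F2; have -> : e ^+ d = e ^+ 2 * e ^+ (d - 2) by rewrite -exprD subnKC.
    move: (T0 _ _) (T1 _ _) (T2 _ _) (Q _ _) (e ^+ (d - 2)) => x y w q r.
    by field; rewrite !gt_eqF.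
  exact: (seq_cvgD (@seq_cvgZ _ (cg * e ^+ 2)^-1 _ _ l3)
    (seq_cvgD l1 (seq_cvgD l2 (@seq_cvgZ _ (e ^+ (d - 2)) _ _ hQ)))).
rewrite mulr0 !add0r in l0'.
exact: (cvg_unique (@Rhausdorff R) l0 l0').
Qed.

Lemma key_small (m g : L2H R d d) (u v : nat -> 'rV[R]_d -> R) (be : nat -> R) (C : R) :
  Mspace m -> Gspace g -> (forall n, test (u n)) -> (forall n, test (v n)) ->
  hcvg (fun n => grad (u n)) m -> hcvg (fun n => grad (v n)) g ->
  (forall n k, `|beta0 k (u n) (v n)| <= C * rho ^+ k) -> (forall k, `|be k| <= C * rho ^+ k) ->
  (forall k, beta0 k (u n) (v n) @[n --> \oo] --> be k) ->
  psum be e (ip (scv e m) g / e ^+ (d - 2)).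
Proof.
move=> hm hg tu tv hu hv b1 b2 hb.
have [l [hl _]] := psum_geo q01 (ltW e0) b2.
have hQ := psum_limit (ltW e0) q01 b1 b2 hb (fun n => Q_psum (tu n) (tv n)) hl.
have -> : ip (scv e m) g / e ^+ (d - 2) = l; last by [].
rewrite (key_limit hm hg tu tv hu hv hQ) mulrAC mulfV ?mul1r//.
by rewrite expf_neq0// gt_eqF.
Qed.

End small_parameter.

Lemma subspaceM : subspace Mspace.
Proof.
have [h0 h1] := subspace_cl (@subspace_grads R d setT).
split; first by split => // f _; rewrite ip0l.
move=> a X Y [dX oX] [dY oY]; split; first exact: h1.
by move=> f tf; rewrite ipDl ipZl oX// oY// mulr0 addr0.
Qed.

Lemma subspaceG : subspace Gspace.
Proof.
have [h0 h1] := subspace_cl (@subspace_grads R d setT).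
split; first by split => // f _; rewrite ip0l.
move=> a X Y [dX oX] [dY oY]; split; first exact: h1.
by move=> f tf; rewrite ipDl ipZl oX// oY// mulr0 addr0.
Qed.

Let cl_orth (S : L2H R d d -> Prop) Z : (forall X, S X -> ip X Z = 0) -> forall X, cl S X -> ip X Z = 0.
Proof. by move=> h X cX; rewrite ipC; apply: (orth_cl _ cX) => s /h; rewrite ipC. Qed.

Lemma clM X : cl Mspace X -> Mspace X.
Proof.
move=> cX; split; first by apply: cl_cl; apply: clS cX => Y [].
by move=> f tf; apply: (cl_orth _ cX) => Y [_]; apply.
Qed.

Lemma clG X : cl Gspace X -> Gspace X.
Proof.
move=> cX; split; first by apply: cl_cl; apply: clS cX => Y [].
by move=> f tf; apply: (cl_orth _ cX) => Y [_]; apply.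
Qed.

Lemma grads_seq U X : cl (grads U) X -> exists u : nat -> 'rV[R]_d -> R,
  (forall n, test_function U (u n)) /\ hcvg (fun n => grad (u n)) X.
Proof.
move=> /cl_seq[v [hv hX]].
have h n : exists u : 'rV[R]_d -> R, test_function U u /\ v n = grad u by have [u tu vu] := hv n; exists u.
have [u hu] := choice h; exists u; split; first by move=> n; have [] := hu n.
have E : v = (fun n => grad (u n)) by apply/funext => n; have [] := hu n.
by rewrite -E.
Qed.

(* Green's representation of scv e m by the fundamental solution, expanded in powers
   of e by the Gegenbauer series. *)
Theorem key_aux : exists (beta : nat -> L2H R d d -> L2H R d d -> R) (C r e1 : R),
  [/\ 0 <= C, 0 <= r, 0 < e1,
    (forall k a x y (g : L2H R d d), Mspace x -> Mspace y -> Gspace g ->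
       beta k (a *: x + y) g = a * beta k x g + beta k y g) /\
    (forall k a (g h : L2H R d d) x, Gspace g -> Gspace h -> Mspace x ->
       beta k x (a *: g + h) = a * beta k x g + beta k x h) &
    (forall k x (g : L2H R d d), Mspace x -> Gspace g -> `|beta k x g| <= C * r ^+ k * nrm x * nrm g) /\
    forall e, 0 < e < e1 -> forall m (g : L2H R d d), Mspace m -> Gspace g ->
      psum (fun k => beta k m g) e (ip (scv e m) g / e ^+ (d - 2))].
Proof.
have [C [C0 hC]] := beta0_bound.
(* Only test functions have a value of [beta0]; the extension satisfies bilinearity and bounds by
   passing to the limit along approximating sequences. *)
have hb k : exists B' : L2H R d d -> L2H R d d -> R, forall x y (u v : nat -> 'rV[R]_d -> R),
    (forall n, test (u n)) -> (forall n, test (v n)) ->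
    hcvg (fun n => grad (u n)) x -> hcvg (fun n => grad (v n)) y ->
    beta0 k (u n) (v n) @[n --> \oo] --> B' x y.
  apply: (@ext_bilin R (L2H R d d) ('rV[R]_d -> R) test grad _ _ (beta0 k) (C * rho ^+ k)).
  - by move=> a f g tf tg; exact: test_lin.
  - by move=> a f g tf tg; exact: (@grad_lin _ _ setT).
  - by move=> a f g h tf tg th'; exact: beta0_linl.
  - by move=> a f g h tf tg th'; exact: beta0_linr.
  - by move=> f g tf tg; exact: (hC k _ _ tf tg).2.
have [beta hbeta] := choice hb.
pose e1 := Num.min (b / (8 * A)) (1 / (4 * rho)).
have A8 : 0 < 8 * A by exact: mulr_gt0.
have r4 : 0 < 4 * rho by exact: mulr_gt0.
have e10 : 0 < e1 by rewrite lt_min (divr_gt0 b0 A8) (divr_gt0 ltr01 r4).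
have bbound k x (g : L2H R d d) : Mspace x -> Gspace g -> `|beta k x g| <= C * rho ^+ k * nrm x * nrm g.
  move=> [dx _] [dg _]; have [u [tu hu]] := grads_seq dx; have [v [tv hv]] := grads_seq dg.
  have h := hbeta k _ _ _ _ tu tv hu hv.
  have h2 : C * rho ^+ k * nrm (grad (u n)) * nrm (grad (v n)) @[n --> \oo] --> C * rho ^+ k * nrm x * nrm g.
    by apply: seq_cvgM; [apply: seq_cvgZ|]; exact: hcvg_nrm.
  rewrite ler_norml; apply/andP; split.
    apply: (ler_cvg_to (cvgN h2) h); apply: nearW => n.
    by have := (hC k _ _ (tu n) (tv n)).2; rewrite ler_norml => /andP[].
  apply: (ler_cvg_to h h2); apply: nearW => n.
  by have := (hC k _ _ (tu n) (tv n)).2; rewrite ler_norml => /andP[].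
have lin_grad (a : R) (u v : nat -> 'rV[R]_d -> R) X Y : (forall n, test (u n)) -> (forall n, test (v n)) ->
    hcvg (fun n => grad (u n)) X -> hcvg (fun n => grad (v n)) Y ->
    hcvg (fun n => grad (a *: u n + v n)) (a *: X + Y).
  move=> tu tv hu hv.
  have E : (fun n => grad (a *: u n + v n)) = (fun n => a *: grad (u n) + grad (v n)).
    by apply/funext => n; rewrite (grad_lin a (tu n) (tv n)).
  by rewrite E; exact: hcvg_lin.
exists beta, C, rho, e1; split => //; first exact: ltW.
- split.
  + move=> k a x y g [dx _] [dy _] [dg _].
    have [u [tu hu]] := grads_seq dx; have [v [tv hv]] := grads_seq dy; have [w [tw hw]] := grads_seq dg.
    have tuv n : test (a *: u n + v n) by exact: test_lin.
    have h := hbeta k _ _ _ _ tuv tw (lin_grad a _ _ _ _ tu tv hu hv) hw.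
    have h' := seq_cvgD (@seq_cvgZ _ a _ _ (hbeta k _ _ _ _ tu tw hu hw)) (hbeta k _ _ _ _ tv tw hv hw).
    apply: (cvg_unique (@Rhausdorff R) h); apply: seq_cvg_ext h' => n.
    by rewrite beta0_linl.
  + move=> k a x y g [dx _] [dy _] [dg _].
    have [u [tu hu]] := grads_seq dx; have [v [tv hv]] := grads_seq dy; have [w [tw hw]] := grads_seq dg.
    have tuv n : test (a *: u n + v n) by exact: test_lin.
    have h := hbeta k _ _ _ _ tw tuv hw (lin_grad a _ _ _ _ tu tv hu hv).
    have h' := seq_cvgD (@seq_cvgZ _ a _ _ (hbeta k _ _ _ _ tw tu hw hu)) (hbeta k _ _ _ _ tw tv hw hv).
    apply: (cvg_unique (@Rhausdorff R) h); apply: seq_cvg_ext h' => n.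
    by rewrite beta0_linr.
split => // e /andP[e0]; rewrite lt_min => /andP[ea eb] m g hm hg.
have eA : 8 * A * e <= b by move: ea; rewrite (ltr_pdivlMr _ _ A8) mulrC => /ltW.
have er : 4 * rho * e < 1 by move: eb; rewrite (ltr_pdivlMr _ _ r4) mulrC.
have [u [tu hu]] := grads_seq hm.1; have [v [tv hv]] := grads_seq hg.1.
have [D1 [D10 hD1]] := hcvg_bounded hu; have [D2 [D20 hD2]] := hcvg_bounded hv.
pose C' := C * Num.max (D1 * D2) (nrm m * nrm g).
have b1 n k : `|beta0 k (u n) (v n)| <= C' * rho ^+ k.
  apply: le_trans (hC k _ _ (tu n) (tv n)).2 _; rewrite -mulrA /C' [leRHS]mulrAC.
  apply: ler_wpM2l; first by rewrite mulr_ge0// exprn_ge0// ltW.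
  rewrite le_max; apply/orP; left; apply: ler_pM; rewrite ?nrm_ge0//.
have b2 k : `|beta k m g| <= C' * rho ^+ k.
  apply: le_trans (bbound k _ _ hm hg) _; rewrite -mulrA /C' [leRHS]mulrAC.
  apply: ler_wpM2l; first by rewrite mulr_ge0// exprn_ge0// ltW.
  by rewrite le_max lexx orbT.
exact: (key_small e0 eA er hm hg tu tv hu hv b1 b2 (fun k => hbeta k _ _ _ _ tu tv hu hv)).
Qed.

End key.

(** * Mollification and weak derivatives *)

Section fundamental_lemma.
Context {R : realType} {d : nat}.
Implicit Types (f g phi : 'rV[R]_d -> R) (A B : set 'rV[R]_d) (l : seq ('I_d * R)).
Local Notation mu := (leb R d).
Local Notation Int f := (\int[mu]_x f x).
Local Notation test := (test_function setT).

(** A list of upper bounds on coordinates: concatenation of lists is intersection, and the empty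
    list gives the whole space. *)
Definition orthant l : set 'rV[R]_d := [set x | all (fun p => x ord0 p.1 < p.2) l].

Lemma orthant_setI : setI_closed [set orthant l | l in setT].
Proof.
move=> _ _ [l _ <-] [l' _ <-]; exists (l ++ l') => //.
by apply/seteqP; split => x; rewrite /orthant /= all_cat => /andP.
Qed.

Lemma orthant_generates A : measurable A -> <<s [set orthant l | l in setT] >> A.
Proof.
set G := [set orthant l | l in setT] => mA.
have sG : sigma_algebra setT <<s G >> by exact: smallest_sigma_algebra.
move: A mA; apply: smallest_sub => //.
rewrite -bigcup_seq => A [i _] [B mB <-]; rewrite setTI.
have : measurable_fun [set: g_sigma_algebraType G]
    (fun x : g_sigma_algebraType G => (x : 'rV[R]_d) ord0 i : measurableTypeR R).
  apply: (measurability _ (RGenInftyO.measurableE R)) => /= _ [_ [b ->] <-].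
  apply: sub_sigma_algebra; exists [:: (i, b)] => //; rewrite setTI.
  by apply/seteqP; split => x; rewrite /orthant /= in_itv /= andbT.
by move=> /(_ (@measurableT _ _) _ mB); rewrite setTI.
Qed.

Lemma measurable_orthant l : measurable (orthant l).
Proof.
elim: l => [|p l IH].
  by rewrite (_ : orthant [::] = setT)//; apply/seteqP; split.
rewrite (_ : orthant _ = (row_coord p.1 @^-1` `]-oo, p.2[%classic) `&` orthant l).
  apply: measurableI => //; rewrite -[X in measurable X]setTI.
  exact: measurable_row_coord.
apply/seteqP; split => x; rewrite /orthant /= in_itv/= /row_coord.
  by move/andP.
by move=> [-> ->].
Qed.

(* Smooth approximations of the indicators of a pi-system generating the Borel sets. *)
Definition soft_orthant l (n : nat) (x : 'rV[R]_d) : R :=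
  \prod_(p <- l) step (n%:R * (p.2 - x ord0 p.1)).

Lemma smooth_soft_orthant l n : smooth (soft_orthant l n).
Proof.
apply: smooth_prod => p; apply: smooth_step; apply: smoothM; first exact: smooth_cst.
by apply: smoothB; [exact: smooth_cst|exact: smooth_coord].
Qed.

Lemma step_cvg (t : R) : step (n%:R * t) @[n --> \oo] --> (if 0 < t then 1 else 0 : R).
Proof.
have [t0|t0] := ltP 0 t; last first.
  under eq_fun do rewrite step_eq0 ?mulr_ge0_le0//; exact: cvg_cst.
apply: (cvg_near_cst); near=> n; apply/step_eq1.
rewrite -ler_pdivrMr// div1r ltW//; near: n; exact: nbhs_infty_gtr.
Unshelve. all: by end_near. Qed.

Lemma soft_orthant_cvg l x : soft_orthant l n x @[n --> \oo] --> (\1_(orthant l) x : R).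
Proof.
rewrite /soft_orthant indicE; elim: l => [|p l IH].
  have -> : (x \in orthant [::]) = true by apply/mem_set.
  by under eq_fun do rewrite big_nil; exact: cvg_cst.
under eq_fun do rewrite big_cons.
have -> : ((x \in orthant (p :: l))%:R : R) =
    (if 0 < p.2 - x ord0 p.1 then 1 else 0) * (x \in orthant l)%:R.
  rewrite subr_gt0; case: (boolP (x \in orthant (p :: l))).
    rewrite inE /orthant /= => /andP[-> h]; rewrite mem_set ?mulr1//.
  rewrite notin_setE /orthant /= => /negP; rewrite negb_and => /orP[/negbTE->|h].
    by rewrite mul0r.
  by rewrite memNset ?mulr0// /=; apply/negP.
by apply: seq_cvgM => //; exact: step_cvg.
Qed.

Lemma soft_orthant_bound l n x : `|soft_orthant l n x| <= 1.
Proof.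
rewrite /soft_orthant; elim: l => [|p l IH]; first by rewrite big_nil normr1.
rewrite big_cons normrM mulr_ile1//; by rewrite ger0_norm ?step_ge0 ?step_le1.
Qed.

Lemma bump_cvg (x : 'rV[R]_d) : bump n%:R n.+1%:R x @[n --> \oo] --> (1 : R).
Proof.
apply: (cvg_near_cst); near=> n; apply: bump_eq1; first by rewrite ler0n ltr_nat ltnSn.
have : sqn x + 1 < n%:R by near: n; exact: nbhs_infty_gtr.
by have := sqn_ge0 x; move: (sqn x) (n%:R : R) => a b *; nra.
Unshelve. all: by end_near. Qed.

Lemma intg_indic f A : measurable A -> intg f -> intg (fun x => f x * \1_A x).
Proof.
move=> mA hf; apply: (@le_intg _ _ _ (fun x => `|f x|)); last exact: intg_norm.
  by apply: measurable_funM; [exact: intg_measurable|exact: measurable_indic].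
by move=> x; rewrite normrM indicE normr_nat ler_piMr// lern1 leq_b1.
Qed.

(** Test functions approximate indicators of orthants, a pi-system generating the Borel sets; so f
    has integral 0 over every Borel set by the pi-lambda theorem. Taking the set P where f >= 0 and
    writing |f| = 2 f 1_P - f concludes. *)
Theorem fundamental_lemma f : intg f -> (forall phi, test phi -> \int[mu]_x (f x * phi x) = 0) ->
  {ae mu, forall x, f x = 0}.
Proof.
move=> hf h.
have mf := intg_measurable hf; have nf := intg_norm hf.
have E1 l : \int[mu]_x (f x * \1_(orthant l) x) = 0.
  have mo : measurable (orthant l).
    exact: measurable_orthant.
  apply: (@cvg_unique _ (@Rhausdorff R) ((fun n => \int[mu]_x (f x * (bump n%:R n.+1%:R x * soft_orthant l n x))) @ \oo)).
    apply: (@Int_dominated _ _ _ _ (fun x => `|f x|)) => //.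
    - move=> n; apply: measurable_funM => //; apply: smooth_measurable.
      by apply: smoothM; [exact: smooth_bump|exact: smooth_soft_orthant].
    - by apply: measurable_funM => //; exact: measurable_indic.
    - move=> x; apply: seq_cvgZ; rewrite -[X in _ --> X]mul1r; apply: seq_cvgM.
        exact: bump_cvg.
      exact: soft_orthant_cvg.
    - move=> n x; rewrite normrM ler_piMr// normrM mulr_ile1//.
        by rewrite ger0_norm ?bump_ge0 ?bump_le1.
      exact: soft_orthant_bound.
  rewrite (_ : (fun _ => _) = fun=> (0 : R)); first exact: cvg_cst.
  apply/funext => n; apply: (h (bump n%:R n.+1%:R \* soft_orthant l n)).
  apply: testMl; last exact: smooth_soft_orthant.
  by apply: test_bump => //; rewrite ler0n ltr_nat ltnSn.
have E A : measurable A -> \int[mu]_x (f x * \1_A x) = 0.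
  move=> mA; pose H := [set A | measurable A /\ \int[mu]_x (f x * \1_A x) = 0].
  suff : H A by case.
  have mo A' : <<s [set orthant l | l in setT] >> A' -> measurable A'.
    apply: smallest_sub; first exact: sigma_algebra_measurable.
    by move=> _ [l _ <-]; exact: measurable_orthant.
  apply: (@lambda_system_subset _ _ orthant_setI setT H) => //; last exact: orthant_generates.
  - split => //.
    + split; first exact: measurableT.
      rewrite -[RHS](E1 [::]); apply: Int_ext => x.
      by rewrite /orthant indicE mem_set// indicE mem_set.
    + move=> B C CB [mB hB] [mC hC]; split; first exact: measurableD.
      rewrite (_ : (fun x => _) = (fun x => f x * \1_B x) \- (fun x => f x * \1_C x)).
        by rewrite IntB ?hB ?hC ?subrr//; exact: intg_indic.
      apply/funext => x /=; rewrite -mulrBr; congr (_ * _); rewrite !indicE in_setD.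
      have [xC|xC] := boolP (x \in C); last by rewrite andbT subr0.
      by rewrite (_ : x \in B) ?subrr ?andbF//; apply/mem_set/CB; exact: set_mem.
    + move=> F ndF hF; split; first by apply: bigcupT_measurable => k; case: (hF k).
      apply: (@cvg_unique _ (@Rhausdorff R) ((fun n => \int[mu]_x (f x * \1_(F n) x)) @ \oo)).
        apply: (@Int_dominated _ _ _ _ (fun x => `|f x|)) => //.
        * by move=> n; apply: measurable_funM => //; apply: measurable_indic; case: (hF n).
        * apply: measurable_funM => //; apply: measurable_indic.
          by apply: bigcupT_measurable => k; case: (hF k).
        * move=> x; apply: seq_cvgZ; rewrite !indicE.
          have [|xF] := boolP (x \in _).
            rewrite inE => -[k _ Fk]; apply: cvg_near_cst; exists k => // n /= kn.
            by rewrite indicE mem_set//; move: x Fk; apply/subsetPset/ndF.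
          have e n : \1_(F n) x = (0 : R).
            rewrite indicE memNset// => Fn; move/negP : xF; apply; apply/mem_set.
            by exists n.
          by under eq_fun do rewrite e; exact: cvg_cst.
        * by move=> n x; rewrite normrM indicE normr_nat ler_piMr// lern1 leq_b1.
      rewrite (_ : (fun _ => _) = fun=> (0 : R)); first exact: cvg_cst.
      by apply/funext => n; case: (hF n).
  - move=> _ [l _ <-]; split => //; apply: mo.
    by apply: sub_sigma_algebra; exists l.
have I0 : \int[mu]_x `|f x| = 0.
  pose P := [set x | 0 <= f x].
  have mP : measurable P.
    rewrite (_ : P = f @^-1` `[0, +oo[%classic).
      by rewrite -[X in measurable X]setTI; apply: mf.
    by apply/seteqP; split => x; rewrite /P /= in_itv/= andbT.
  have hT : Int f = 0.
    rewrite -(E setT measurableT); apply: Int_ext => x.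
    by rewrite indicE mem_set// mulr1.
  transitivity (Int ((fun x => 2 * (f x * \1_P x)) \- f)).
    apply: Int_ext => x /=; rewrite indicE; have [f0|f0] := leP 0 (f x).
      by rewrite mem_set// mulr1 ger0_norm//; ring.
    by rewrite memNset ?ltr0_norm// ?mulr0 ?sub0r// /P /=; apply/negP; rewrite -ltNge.
  rewrite IntB//; last exact/intgZ/intg_indic.
  by rewrite IntZ ?E ?hT ?mulr0 ?subrr//; exact: intg_indic.
have : (\int[mu]_(x in setT) `|(f x)%:E| = 0)%E.
  by rewrite -[RHS]/(0%:E) -I0 -Int_EFin.
have mE : measurable_fun setT (EFin \o f) by exact/measurable_EFinP.
move/(iffLR (ae_eq_integral_abs mu measurableT mE)).
by apply: filterS => x /(_ Logic.I) [].
Qed.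

End fundamental_lemma.

(** * Localisation and density of test functions *)

Section density.
Context {R : realType} {d : nat}.
Implicit Types (f g h phi v : 'rV[R]_d -> R) (A B Om U : set 'rV[R]_d).
Local Notation mu := (leb R d).
Local Notation Int f := (\int[mu]_x f x).
Local Notation test := (test_function setT).

Lemma test_bump_at (q : 'rV[R]_d) (r : R) U : 0 < r ->
  (forall x, sqn (x - q) <= r ^+ 2 -> U x) -> test_function U (fun x => bump 0 r (1 *: x + - q)).
Proof.
move=> r0 hU; have r01 : 0 <= (0 : R) < r by rewrite lexx.
apply: (@test_of _ _ _ ((fun x => 1 *: x + q) @` [set x | sqn x <= r ^+ 2])).
- by apply: smooth_affine; exact: smooth_bump.
- apply: continuous_compact; last exact/compact_sqn/ltW.
  by apply: continuous_subspaceT; exact: continuous_affine.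
- by move=> _ [x hx <-]; apply: hU; rewrite scale1r addrK.
- move=> x hx; apply: bump_eq0 => //; rewrite leNgt; apply/negP => hr; apply: hx.
  by exists (1 *: x + - q); [exact: ltW|rewrite !scale1r subrK].
Qed.

(** A countable family of bumps on rational balls inside Om, whose positivity sets cover Om: it lets
    statements that hold almost everywhere after multiplication by a test function be glued. *)
Lemma bump_cover Om : open Om -> exists th : nat -> 'rV[R]_d -> R,
  (forall k, test_function Om (th k)) /\ forall x, Om x -> exists k, 0 < th k x.
Proof.
move=> oOm.
pose rr (N : nat) : R := N.+1%:R^-1.
have rr0 N : 0 < rr N by rewrite invr_gt0.
pose Q (p : 'rV[rat]_d * nat) : 'rV[R]_d := \row_i ratr (p.1 ord0 i).
pose I (p : 'rV[rat]_d * nat) := forall x, sqn (x - Q p) <= rr p.2 ^+ 2 -> Om x.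
pose F (k : nat) : 'rV[R]_d -> R := if unpickle k is Some p then
  (if `[< I p >] then (fun x => bump 0 (rr p.2) (1 *: x + - Q p)) else fun=> 0) else fun=> 0.
exists F; split.
  move=> k; rewrite /F; case: unpickle => [p|]; last exact: test0.
  case: ifPn => [/asboolP h|_]; last exact: test0.
  exact: test_bump_at.
move=> x Omx.
have /nbhs_ballP[e /= e0 xA] : nbhs x Om by apply: open_nbhs_nbhs.
have [N hN] : exists N : nat, N.+1%:R^-1 < e / 2.
  have e20 : 0 < e / 2 by rewrite divr_gt0.
  have [N _ hN] := near_infty_natSinv_lt (PosNum e20).
  by exists N; exact: (hN N (leqnn N)).
have dp : 0 < d%:R + 1 :> R by rewrite ltr_wpDl.
(* A sup-norm error s has squared Euclidean length at most d s^2, which is below (d + 1)^2 s^2 = (rr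
   N)^2. *)
pose s : R := rr N / (d%:R + 1).
have s0 : 0 < s by rewrite divr_gt0.
have sr : s <= rr N by rewrite /s ler_pdivrMr// ler_peMr ?(ltW (rr0 N))// lerDr.
have hq i : exists q : rat, `|ratr q - x ord0 i| < s.
  have /rat_in_itvoo[q] : x ord0 i < x ord0 i + s by rewrite ltrDl.
  rewrite in_itv/= => /andP[q1 q2]; exists q.
  by rewrite gtr0_norm ?subr_gt0// ltrBlDl.
have [q qP] := choice hq.
pose p : 'rV[rat]_d * nat := (\row_i q i, N).
have xq : `|x - Q p| <= s.
  apply: norm_le_coord (ltW s0) _ => i; rewrite !mxE distrC; exact: ltW.
have Ip : I p.
  move=> y hy; apply: xA; rewrite -ball_normE /=.
  rewrite (_ : x - y = (x - Q p) - (y - Q p)); last by rewrite opprB addrA subrK.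
  apply: le_lt_trans (ler_normB _ _) _.
  have := norm_le_sqn (ltW (rr0 N)) hy.
  by move: xq sr hN; rewrite -/(rr N); move: (`|x - Q p|) (`|y - Q p|) => a b *; lra.
exists (pickle p); rewrite /F pickleK ifT; last exact/asboolP.
apply: bump_gt0; first by rewrite lexx/=.
rewrite scale1r; apply: le_lt_trans (sqn_le_norm _) _.
apply: (@le_lt_trans _ _ (d%:R * s ^+ 2)).
  by apply: ler_wpM2l => //; rewrite lerXn2r ?nnegrE// ltW.
have -> : rr p.2 = s * (d%:R + 1) by rewrite /s /=; field; rewrite gt_eqF.
rewrite [ltRHS]exprMn; have : 0 < s ^+ 2 by rewrite exprn_gt0.
have : 0 <= (d%:R : R) by [].
by move: (d%:R : R) (s ^+ 2) => D S D0 S0; nra.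
Qed.

Lemma ae_cover Om f : open Om ->
  (forall th, test_function Om th -> {ae mu, forall x, th x * f x = 0}) ->
  {ae mu, forall x, Om x -> f x = 0}.
Proof.
move=> oOm h; have [th [tth thc]] := bump_cover oOm.
have : {ae mu, forall x, forall k, th k x * f x = 0}.
  by apply: ae_foralln => k; exact: h.
apply: filterS => x hx Omx; have [k tk] := thc x Omx.
by move: (hx k) => /eqP; rewrite mulf_eq0 gt_eqF// => /eqP.
Qed.

Lemma test_orth Om f : open Om -> sqint f ->
  (forall phi, test_function Om phi -> \int[mu]_x (f x * phi x) = 0) ->
  {ae mu, forall x, Om x -> f x = 0}.
Proof.
move=> oOm sf h; apply: ae_cover oOm _ => th tth.
apply: fundamental_lemma; first by apply: sqintM => //; exact: test_sqint tth.
move=> phi tphi; rewrite -[RHS](h (th \* phi)); first by apply: Int_ext => x /=; ring.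
by apply: testMl => //; exact: test_smooth tphi.
Qed.

Lemma ae_Int0 f : measurable_fun setT f -> {ae mu, forall x, f x = 0} -> Int f = 0.
Proof.
move=> mf h; have [|_ ->] := ae_intg mf (@intg0 R d); last exact: Int0.
by apply: filterS h => x.
Qed.

Let J f : L2H R d 1 :=
  if pselect ((fun=> f) \in @l2pred R d 1) is left h then L2vec h else 0.

Let JE f : sqint f -> (J f : l2vec R d 1) = (fun=> f) :> ('I_1 -> 'rV[R]_d -> R).
Proof.
move=> sf; rewrite /J; case: pselect => //= h; exfalso; apply: h.
by apply/l2predP.
Qed.

Let ipJ f g : sqint f -> sqint g -> ip (J f) (J g) = \int[mu]_x (f x * g x).
Proof. by move=> sf sg; rewrite /ip /= l2ipE big_ord1 !JE. Qed.

Let JB f g : sqint f -> sqint g -> J f - J g = J (f \- g).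
Proof.
move=> sf sg; apply: val_inj; apply/funext => i.
change ((J f : l2vec R d 1) i \- (J g : l2vec R d 1) i = (J (f \- g) : l2vec R d 1) i).
by rewrite !JE//; exact: sqintB.
Qed.

(** Represent the functional phi -> <f, phi> by some W in the closure of the test functions. Then f
    - W is orthogonal to all of them, hence zero almost everywhere. *)
Theorem test_dense f (e : R) : 0 < e -> sqint f ->
  exists2 phi, test phi & \int[mu]_x ((f x - phi x) ^+ 2) < e.
Proof.
move=> e0 sf.
have ts phi : test phi -> sqint phi by exact: test_sqint.
have JD (a : R) u v : test u -> test v -> J (a *: u + v) = a *: J u + J v.
  move=> tu tv; apply: val_inj; apply/funext => i.
  change ((J (a *: u + v) : l2vec R d 1) i =
    (fun x => a * (J u : l2vec R d 1) i x) \+ (J v : l2vec R d 1) i).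
  by rewrite !JE//; [exact: ts|exact: ts|exact: sqintD (sqintZ a (ts _ tu)) (ts _ tv)].
have [a u v tu tv|u tu|w [clw hw]] := @riesz R (L2H R d 1) ('rV[R]_d -> R) test J (test0 _)
   (fun a u v => @test_lin _ _ _ a u v) JD (fun u => ip (J f) (J u)) (nrm (J f)).
- by rewrite JD// ipDr ipZr.
- exact: cauchy_schwarz.
have sw : sqint ((w : l2vec R d 1) ord0) by exact: l2sq.
pose W := (w : l2vec R d 1) ord0.
have wJ : w = J W.
  by apply: val_inj; apply/funext => i; rewrite (ord1 i) /= -/(l2val _) JE.
have fW : {ae mu, forall x, setT x -> (f \- W) x = 0}.
  apply: test_orth; [exact: openT|exact: sqintB|move=> phi tphi].
  have sphi := ts _ tphi.
  have := hw _ tphi; rewrite wJ !ipJ// => E.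
  rewrite (_ : (fun x => _) = (fun x => f x * phi x) \- (fun x => W x * phi x)).
    by rewrite IntB ?E ?subrr//; exact: sqintM.
  by apply/funext => x /=; ring.
have se : 0 < Num.sqrt e by rewrite sqrtr_gt0.
have [_ [[phi tphi ->]]] := clw _ se.
rewrite wJ nrm_lt_ip// sqr_sqrtr ?(ltW e0)// => h.
have sphi := ts _ tphi.
exists phi => //; move: h; rewrite JB// ipJ; try exact: sqintB.
congr (_ < e).
have [|||_ ->//] := @ae_intg R d (fun x => (W \- phi) x * (W \- phi) x) (fun x => (f x - phi x) ^+ 2).
- apply: measurable_funX; exact: (sqintB sf sphi).1.
- by apply: sqintM; exact: sqintB.
- apply: filterS fW => x /(_ Logic.I) /= /eqP; rewrite subr_eq0 => /eqP ->.
  by rewrite expr2.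
Qed.

End density.

(** * Mollification in L^2 *)

Section mollifier.
Context {R : realType} {d : nat}.
Implicit Types (f g h phi v : 'rV[R]_d -> R) (A B Om U : set 'rV[R]_d) (x y z : 'rV[R]_d).
Local Notation mu := (leb R d).
Local Notation Int f := (\int[mu]_x f x).
Local Notation test := (test_function setT).

Lemma sqint_indic_cube (r : R) : 0 <= r -> sqint (\1_(@cube R d r) : 'rV[R]_d -> R).
Proof.
move=> r0; have mi : measurable_fun setT (\1_(@cube R d r) : 'rV[R]_d -> R).
  by apply: measurable_indic; exact: measurable_cube.
split=> //; apply: (@intg_bounded _ _ _ 1 r) => //.
- exact: measurable_funX.
- by move=> y _; rewrite indicE normrX expr_le1// normr_nat lern1 leq_b1.
- by move=> y yd; rewrite indicE memNset ?expr0n// /cube /= leNgt yd.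
Qed.

Lemma sqint_intg f (r : R) : 0 <= r -> vanish_out f r -> sqint f -> intg f.
Proof.
move=> r0 vf sf; rewrite (_ : f = fun x => \1_(@cube R d r) x * f x).
  by apply: sqintM => //; exact: sqint_indic_cube.
apply/funext => x; rewrite indicE; have [xr|xr] := leP `|x| r.
  by rewrite mem_set// mul1r.
by rewrite vf// mulr0.
Qed.

Lemma Int_bump_gt0 (a b : R) : 0 < a < b -> 0 < Int (@bump R d a b).
Proof.
move=> /andP[a0 ab]; have ab' : 0 <= a < b by rewrite ltW.
pose s : R := a / (d%:R + 1).
have dp : 0 < d%:R + 1 :> R by rewrite ltr_wpDl.
have s0 : 0 < s by rewrite divr_gt0.
apply: (@lt_le_trans _ _ (\int[mu]_y \1_(cube s) y)); last first.
  apply: Int_le.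
  - have [ms is_] := sqint_indic_cube (ltW s0).
    by apply: (@sqint_intg _ s (ltW s0)) => // y ys; rewrite indicE memNset// /cube /= leNgt ys.
  - exact: test_intg (@test_bump R d a b setT ab' (fun x _ => Logic.I)).
  - move=> y; rewrite indicE; case: (boolP (y \in _)) => [|_]; last exact: bump_ge0.
    rewrite inE /cube /= => ys; rewrite bump_eq1//.
    apply: le_trans (sqn_le_norm y) _; apply: (@le_trans _ _ (d%:R * s ^+ 2)).
      by apply: ler_wpM2l => //; rewrite lerXn2r ?nnegrE// ltW.
    have -> : a = s * (d%:R + 1) by rewrite /s; field; rewrite gt_eqF.
    rewrite [leRHS]exprMn; have : 0 < s ^+ 2 by rewrite exprn_gt0.
    have : 0 <= (d%:R : R) by [].
    by move: (d%:R : R) (s ^+ 2) => D S D0 S0; nra.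
have -> : \int[mu]_y \1_(cube s) y = \int[mu]_(y in cube s) (1 : R).
  rewrite [RHS]Rintegral_mkcond; apply: Int_ext => y; rewrite patchE indicE.
  by case: ifPn => _.
rewrite Rintegral_cst//; last exact: measurable_cube.
have /(congr1 fine) /= E := @mu_cube R d _ (ltW s0); rewrite -[fine _]/(fine (mu _)) E.
by rewrite mul1r /cubevol exprn_gt0// mulrn_wgt0.
Qed.

Definition molli (n : nat) : 'rV[R]_d -> R :=
  fun x => (Int (@bump R d (delta n / 2) (delta n)))^-1 * bump (delta n / 2) (delta n) x.

Let del_lt n : 0 < @delta R n / 2 < @delta R n.
Proof. by have := @delta_gt0 R n; move: (@delta R n) => t t0; lra. Qed.

Let del_le n : 0 <= @delta R n / 2 < @delta R n.
Proof. by have /andP[/ltW -> ->] := del_lt n. Qed.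

Let bi n : intg (@bump R d (delta n / 2) (delta n)).
Proof. exact: test_intg (@test_bump R d _ _ setT (del_le n) (fun x _ => Logic.I)). Qed.

Lemma smooth_molli n : smooth (molli n).
Proof. by apply: smoothZ; exact: smooth_bump. Qed.

Lemma molli_ge0 n x : 0 <= molli n x.
Proof. by rewrite /molli mulr_ge0 ?bump_ge0// invr_ge0 ltW// Int_bump_gt0. Qed.

Lemma molli0 n x : delta n < `|x| -> molli n x = 0.
Proof.
move=> h; rewrite /molli bump_eq0 ?mulr0// leNgt; apply/negP => hx'; have hx := ltW hx'.
by have := norm_le_sqn (ltW (@delta_gt0 R n)) hx; rewrite leNgt h.
Qed.

Lemma intg_molli n : intg (molli n).
Proof. exact: intgZ (bi n). Qed.

Lemma Int_molli n : Int (molli n) = 1.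
Proof. by rewrite /molli IntZ// mulVf// gt_eqF// Int_bump_gt0. Qed.

Lemma molliC n x y : molli n (x - y) = molli n (1 *: y + - x).
Proof.
rewrite /molli /bump (_ : sqn (x - y) = sqn (1 *: y - x))//.
rewrite scale1r -opprB -scaleN1r sqnZ; ring.
Qed.

Lemma intg_molli_sub n x : intg (fun y => molli n (x - y)).
Proof.
have := @intg_affine R d 1 (- x) (molli n) ltr01 (intg_molli n); congr intg.
by apply/funext => y; rewrite molliC.
Qed.

Lemma Int_molli_sub n x : \int[mu]_y molli n (x - y) = 1.
Proof.
under Int_ext do rewrite molliC.
by rewrite Int_affine ?invr1 ?expr1n ?mul1r ?Int_molli//; exact: intg_molli.
Qed.

(** Jensen's inequality: the mollifier is a probability density, and the variance of h for it is
    nonnegative. *)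
Lemma conv_molli_sq n h (r : R) z : 0 <= r -> sqint h -> vanish_out h r ->
  conv (molli n) h z ^+ 2 <= conv (molli n) (fun y => h y ^+ 2) z.
Proof.
move=> r0 sh vh; have ih := sqint_intg r0 vh sh.
have vh2 : vanish_out (fun y => h y ^+ 2) r by move=> y /vh ->; rewrite expr0n.
have i1 := conv_intg z r0 (smooth_molli n) ih vh.
have i2 := conv_intg z r0 (smooth_molli n) sh.2 vh2.
set c := conv (molli n) h z.
have : 0 <= \int[mu]_y (molli n (z - y) * (h y - c) ^+ 2).
  by apply: Int_ge0 => y; rewrite mulr_ge0 ?molli_ge0 ?sqr_ge0.
rewrite (_ : (fun y => molli n (z - y) * (h y - c) ^+ 2) = (fun y => molli n (z - y) * h y ^+ 2) \+
   ((fun y => (- 2 * c) * (molli n (z - y) * h y)) \+ (fun y => c ^+ 2 * molli n (z - y)))); last first.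
  by apply/funext => y /=; ring.
have i3 := intg_molli_sub n z.
rewrite IntD//; last by apply: intgD; exact: intgZ.
rewrite IntD//; try exact: intgZ.
rewrite (IntZ _ i1) (IntZ _ i3) Int_molli_sub.
rewrite -[\int[mu]_x (molli n (z - x) * h x)]/c.
rewrite -[\int[mu]_x (molli n (z - x) * h x ^+ 2)]/(conv (molli n) (fun y => h y ^+ 2) z).
by move: (conv _ (fun y => h y ^+ 2) z) c => a b; lra.
Qed.

Lemma Int_conv_molli n h (r : R) : 0 <= r -> (forall x, 0 <= h x) -> intg h -> vanish_out h r ->
  intg (conv (molli n) h) /\ Int (conv (molli n) h) = Int h.
Proof.
move=> r0 h0 ih vh; have mh := intg_measurable ih.
have i1 z := conv_intg z r0 (smooth_molli n) ih vh.
have c0 z : 0 <= conv (molli n) h z.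
  by apply: Int_ge0 => y; rewrite mulr_ge0 ?molli_ge0.
have mc : measurable_fun setT (conv (molli n) h).
  by apply: smooth_measurable; apply: (smooth_conv r0 ih vh); exact: smooth_molli.
pose F (p : 'rV[R]_d * 'rV[R]_d) : \bar R := (molli n (p.1 - p.2) * h p.2)%:E.
have mF : measurable_fun setT F.
  apply/measurable_EFinP; apply: measurable_funM; last exact: measurableT_comp.
  apply: (measurableT_comp (smooth_measurable (smooth_molli n))).
  apply: measurable_fun_row => i.
  rewrite (_ : _ \o _ = fun p : 'rV[R]_d * 'rV[R]_d => p.1 ord0 i - p.2 ord0 i).
    by apply: measurable_funB; have [] := @measurable_row_coords R d i.
  by apply/funext => p; rewrite /row_coord /= !mxE.
have F0 p : (0 <= F p)%E by rewrite lee_fin mulr_ge0 ?molli_ge0.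
have E1 : (\int[mu]_z (conv (molli n) h z)%:E = \int[mu]_y (h y)%:E)%E.
  have := @fubini_tonelli _ _ _ _ R mu mu F mF F0.
  rewrite (_ : (\int[mu]_x \int[mu]_y F (x, y))%E = (\int[mu]_z (conv (molli n) h z)%:E)%E); last first.
    by apply: eq_integral => z _; rewrite /F /= Int_EFin.
  move=> ->; apply: eq_integral => y _.
  rewrite /F /= -[X in integral _ _ X]/(fun x => (molli n (x - y) * h y)%:E).
  have E x : molli n (x - y) * h y = h y * molli n (1 *: x + - y).
    by rewrite scale1r mulrC.
  under eq_integral do rewrite E.
  have im := @intg_affine R d 1 (- y) (molli n) ltr01 (intg_molli n).
  rewrite Int_EFin; last exact: intgZ.
  by rewrite IntZ// Int_affine ?invr1 ?expr1n ?mul1r ?Int_molli ?mulr1//; exact: intg_molli.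
have ic : intg (conv (molli n) h).
  apply/integrableP; split; first exact/measurable_EFinP.
  rewrite (_ : (\int[mu]_x `|(EFin \o conv (molli n) h) x|)%E = (\int[mu]_z (conv (molli n) h z)%:E)%E).
    by rewrite E1 Int_EFin// ltry.
  by apply: eq_integral => z _; rewrite /= ger0_norm.
split => //; move: E1; rewrite !Int_EFin//.
by move/(congr1 fine).
Qed.

Lemma young n h (r : R) : 0 <= r -> sqint h -> vanish_out h r ->
  sqint (conv (molli n) h) /\ \int[mu]_z (conv (molli n) h z ^+ 2) <= \int[mu]_y (h y ^+ 2).
Proof.
move=> r0 sh vh; have ih := sqint_intg r0 vh sh.
have vh2 : vanish_out (fun y => h y ^+ 2) r by move=> y /vh ->; rewrite expr0n.
have [i2 E2] := Int_conv_molli n r0 (fun x => sqr_ge0 _) sh.2 vh2.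
have mc : measurable_fun setT (conv (molli n) h).
  by apply: smooth_measurable; apply: (smooth_conv r0 ih vh); exact: smooth_molli.
have ic : intg (fun z => conv (molli n) h z ^+ 2).
  apply: le_intg i2; first exact: measurable_funX.
  by move=> z; rewrite ger0_norm ?sqr_ge0//; exact: (conv_molli_sq n z r0).
split=> //; rewrite -E2; apply: Int_le => // z; exact: (conv_molli_sq n z r0).
Qed.

Lemma conv_molli_test U f : test_function U f -> exists C r : R, [/\ 0 <= C, 0 < r &
  forall n z, `|conv (molli n) f z - f z| <= C * delta n /\
              (r < `|z| -> conv (molli n) f z - f z = 0)].
Proof.
move=> tf; have sf := test_smooth tf.
have [B [r [B0 r0 fB fr]]] := test_bounded tf.
have r2 : 0 <= r + 2 by rewrite addr_ge0// ltW.
have [L [L0 hL]] := smooth_lipschitz r2 sf.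
have vf : vanish_out f r by move=> y /ltW; exact: fr.
have i1 n z := conv_intg z (ltW r0) (smooth_molli n) (test_intg tf) vf.
have E n z : conv (molli n) f z - f z = \int[mu]_y (molli n (z - y) * (f y - f z)).
  rewrite (_ : (fun y => molli n (z - y) * (f y - f z)) =
    (fun y => molli n (z - y) * f y) \- (fun y => f z * molli n (z - y))); last first.
    by apply/funext => y /=; ring.
  have i3 := intg_molli_sub n z.
  by rewrite IntB ?(IntZ _ i3) ?Int_molli_sub ?mulr1//; exact: intgZ.
have d1 n : @delta R n <= 1 by exact: delta_le1.
exists L, (r + 1); split => //; first by rewrite addr_gt0.
move=> n z; have zr : r + 1 < `|z| -> forall y, molli n (z - y) * (f y - f z) = 0.
  move=> zr y; have [zy|zy] := ltP (delta n) `|z - y|; first by rewrite molli0 ?mul0r.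
  rewrite (fr z) ?(fr y) ?subrr ?mulr0//.
    have := lerB_dist z y; have := d1 n; move: zr zy.
    by move: `|z| `|y| `|z - y| (@delta R n) => a b c e; lra.
  by apply: ltW; apply: lt_trans zr; rewrite ltrDl.
split; last by move=> /zr h; rewrite E; under Int_ext do rewrite h; exact: Int0.
have [/zr h|{}zr] := ltP (r + 1) `|z|.
  rewrite E; under Int_ext do rewrite h.
  by rewrite Int0 normr0 mulr_ge0 ?(ltW (delta_gt0 _)).
have i3 := intg_molli_sub n z.
have i4 : intg (fun y => molli n (z - y) * (f y - f z)).
  rewrite (_ : (fun y => molli n (z - y) * (f y - f z)) =
    (fun y => molli n (z - y) * f y) \- (fun y => f z * molli n (z - y))); last first.
    by apply/funext => y /=; ring.
  by apply: intgB => //; exact: intgZ.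
rewrite E; apply: le_trans (Int_norm i4) _.
rewrite (_ : L * delta n = \int[mu]_y ((L * delta n) * molli n (z - y))); last first.
  by rewrite (IntZ _ i3) Int_molli_sub mulr1.
apply: Int_le => [||y]; [exact: intg_norm|exact: intgZ|].
rewrite normrM (ger0_norm (molli_ge0 _ _)) mulrC.
have [zy|zy] := ltP (delta n) `|z - y|; first by rewrite molli0 ?mulr0.
apply: ler_wpM2r; first exact: molli_ge0.
have zr2 : `|z| <= r + 2 by move: zr; move: `|z| => a; lra.
have yr2 : `|y| <= r + 2.
  have := lerB_dist y z; have := d1 n; rewrite distrC; move: zr zy.
  by move: `|z| `|y| `|z - y| (@delta R n) => a b c e; lra.
apply: le_trans (hL _ _ yr2 zr2) _; apply: ler_wpM2l => //.
by rewrite distrC.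
Qed.

Lemma sq_add3 (a b c : R) : (a + b + c) ^+ 2 <= 3 * a ^+ 2 + 3 * b ^+ 2 + 3 * c ^+ 2.
Proof.
have := sqr_ge0 (a - b); have := sqr_ge0 (b - c); have := sqr_ge0 (a - c); nra.
Qed.

Theorem molli_cvg h (r : R) : 0 <= r -> sqint h -> vanish_out h r ->
  forall e : R, 0 < e -> exists N : nat, forall n, (N <= n)%N ->
    \int[mu]_z ((conv (molli n) h z - h z) ^+ 2) < e.
Proof.
move=> r0 sh vh e e0; have ih := sqint_intg r0 vh sh.
(* Three terms, each weighted by the 3 of [sq_add3], must add up to less than e. *)
have e9 : 0 < e / 9 by rewrite divr_gt0.
have [f tf hf] := test_dense e9 sh; have sf := test_sqint tf.
have [C [s [C0 s0 hC]]] := conv_molli_test tf.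
have [B [t [B0 t0 fB ft]]] := test_bounded tf.
have vf : vanish_out f t by move=> y /ltW; exact: ft.
pose K : R := C ^+ 2 * @cubevol R d s.
have K0 : 0 <= K by rewrite mulr_ge0 ?sqr_ge0 ?cubevol_ge0// ltW.
have [N hN] : exists N : nat, forall n, (N <= n)%N -> K * delta n < e / 9.
  have k0 : 0 < e / 9 / (K + 1) by rewrite divr_gt0// ltr_wpDl.
  have [N _ hN] := near_infty_natSinv_lt (PosNum k0).
  exists N => n Nn; have := hN n Nn; rewrite /= -/(delta n) ltr_pdivlMr ?ltr_wpDl//.
  by apply: le_lt_trans; rewrite mulrDr mulr1 mulrC lerDl invr_ge0.
exists N => n Nn.
pose m := Num.max r t.
have m0 : 0 <= m by rewrite le_max r0.
have vg : vanish_out (h \- f) m.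
  by move=> y; rewrite gt_max => /andP[/vh /= -> /vf ->]; rewrite subrr.
have sg := sqintB sh sf.
have [syg yg] := young n m0 sg vg.
have cE z : conv (molli n) h z - h z =
    conv (molli n) (h \- f) z + (conv (molli n) f z - f z) + (f \- h) z.
  have i1 := conv_intg z r0 (smooth_molli n) ih vh.
  have i2 := conv_intg z (ltW t0) (smooth_molli n) (test_intg tf) vf.
  have -> : conv (molli n) (h \- f) z = conv (molli n) h z - conv (molli n) f z.
    rewrite -IntB//; apply: Int_ext => y /=; ring.
  by rewrite /=; ring.
have scf : sqint (fun z => conv (molli n) f z - f z).
  by apply: (@sqintB _ _ (conv (molli n) f) f) => //; exact: (young n (ltW t0) sf vf).1.
have hcf : \int[mu]_z ((conv (molli n) f z - f z) ^+ 2) < e / 9.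
  apply: le_lt_trans (hN n Nn); apply: le_trans (ler_norm _) _.
  have d1 := @delta_le1 R n; have d0 := @delta_gt0 R n.
  have -> : K * delta n = (C ^+ 2 * delta n) * @cubevol R d s by rewrite /K; ring.
  apply: Int_bounded; [exact: ltW|by rewrite mulr_ge0 ?sqr_ge0// ltW|exact: measurable_funX scf.1| |].
    move=> z _; rewrite normrX; have [h1 _] := hC n z.
    apply: (@le_trans _ _ ((C * delta n) ^+ 2)).
      by rewrite lerXn2r ?nnegrE// mulr_ge0// ltW.
    rewrite exprMn; apply: ler_wpM2l; first exact: sqr_ge0.
    by rewrite expr2 ler_piMr// ltW.
  by move=> z sz; have [_ ->] := hC n z; rewrite ?expr0n.
have sfh := sqintB sf sh.
have hfh : \int[mu]_z ((f \- h) z ^+ 2) < e / 9.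
  by apply: le_lt_trans hf; rewrite le_eqVlt; apply/orP; left; apply/eqP; apply: Int_ext => x /=; ring.
have hy : \int[mu]_z (conv (molli n) (h \- f) z ^+ 2) < e / 9.
  apply: le_lt_trans yg _; apply: le_lt_trans hf.
  by rewrite le_eqVlt; apply/orP; left; apply/eqP; apply: Int_ext.
set F1 := (fun z => conv (molli n) (h \- f) z ^+ 2) in hy.
set F2 := (fun z => (conv (molli n) f z - f z) ^+ 2) in hcf.
set F3 := (fun z => (f \- h) z ^+ 2) in hfh.
have i1 : intg F1 := syg.2. have i2 : intg F2 := scf.2. have i3 : intg F3 := sfh.2.
have iT : intg ((fun z => 3 * F1 z) \+ (fun z => 3 * F2 z) \+ (fun z => 3 * F3 z)).
  by apply: intgD; [apply: intgD|]; exact: intgZ.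
have mc : measurable_fun setT (conv (molli n) h).
  by apply: smooth_measurable; apply: (smooth_conv r0 ih vh); exact: smooth_molli.
apply: (@le_lt_trans _ _ (Int ((fun z => 3 * F1 z) \+ (fun z => 3 * F2 z) \+ (fun z => 3 * F3 z)))).
  have bnd z : (conv (molli n) h z - h z) ^+ 2 <= 3 * F1 z + 3 * F2 z + 3 * F3 z.
    by rewrite cE; exact: sq_add3.
  apply: Int_le => //; apply: le_intg iT.
    by apply: measurable_funX; apply: measurable_funB => //; exact: sh.1.
  by move=> z; rewrite ger0_norm ?sqr_ge0.
have i3' := intgZ 3 i3.
rewrite IntD ?IntD; try exact: intgZ; last by apply: intgD; exact: intgZ.
rewrite (IntZ _ i1) (IntZ _ i2) (IntZ _ i3).
by move: hy hcf hfh; move: (Int F1) (Int F2) (Int F3) => a b c; lra.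
Qed.

Lemma compact_thicken (K U : set 'rV[R]_d) : compact K -> open U -> K `<=` U ->
  exists N : nat, forall n, (N <= n)%N -> forall x y, K x -> `|x - y| <= delta n -> U y.
Proof.
move=> cK oU KU.
have /compact_near_coveringP ncK := cK.
have := ncK nat \oo (fun n x => forall y, `|x - y| <= delta n -> U y) _.
case=> [x Kx|N _ hN]; last by exists N => n Nn x y Kx; exact: (hN n Nn x Kx).
have /nbhs_ballP[e /= e0 xU] : nbhs x U by apply: open_nbhs_nbhs; split => //; exact: KU.
have e2 : 0 < e / 2 by rewrite divr_gt0.
have [N _ hN] := near_infty_natSinv_lt (PosNum e2).
exists (ball x (e / 2), [set n | (N <= n)%N]) => /=.
  by split; [exact: nbhsx_ballx|exists N].
move=> [x' n] /= [xx' Nn] y yx'; apply: xU; move: xx'; rewrite -!ball_normE /= => xx'.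
have := hN n Nn; rewrite /= -/(delta n) => hn.
rewrite (_ : x - y = (x - x') + (x' - y)); last by rewrite addrA subrK.
apply: le_lt_trans (ler_normD _ _) _.
by move: xx' yx' hn; move: `|x - x'| `|x' - y| (@delta R n) => a b c; lra.
Qed.

Lemma molli_test (K U : set 'rV[R]_d) h : compact K -> open U -> K `<=` U ->
  sqint h -> (forall x, ~ K x -> h x = 0) ->
  exists N : nat, forall n, (N <= n)%N -> test_function U (conv (molli n) h).
Proof.
move=> cK oU KU sh hK.
have [r [r0 Kr]] : exists r : R, 0 <= r /\ forall x, K x -> `|x| <= r.
  have [M [_ hM]] := compact_bounded cK.
  exists (Num.max M 0 + 1); split; first by rewrite addr_ge0// le_max lexx orbT.
  by apply: hM; rewrite ltr_pwDr// le_max lexx.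
have vh : vanish_out h r.
  by move=> y ry; apply: hK => /Kr; rewrite leNgt ry.
have ih := sqint_intg r0 vh sh.
have [N hN] := compact_thicken cK oU KU; exists N => n Nn.
apply: (@test_of _ _ _ ((fun p : 'rV[R]_d * 'rV[R]_d => p.1 + p.2) @` (K `*` cube (delta n)))).
- by apply: (smooth_conv r0 ih vh); exact: smooth_molli.
- apply: continuous_compact.
    apply: continuous_subspaceT => p; exact: add_continuous.
  apply: compact_setX => //; apply: bounded_closed_compact; last exact: closed_cube.
  exists (delta n); split; first exact: num_real.
  by move=> M dM x /= hx; apply: le_trans hx _; exact: ltW.
- move=> _ [[x y] /= [Kx hy] <-]; apply: (hN n Nn x) => //.
  by rewrite opprD addrA subrr sub0r normrN.
- move=> z hz; rewrite /conv -[RHS](@Int0 R d); apply: Int_ext => y.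
  have [Ky|/hK ->] := pselect (K y); last by rewrite mulr0.
  rewrite molli0 ?mul0r// ltNge; apply/negP => zy; apply: hz.
  by exists (y, z - y) => /=; [split|rewrite addrC subrK].
Qed.

End mollifier.

Section nrm_zero.
Context {R : realType} {H : hilbert R}.
Implicit Types (x y z : H).

Lemma nrm0_ip x y z : nrm (x - y) = 0 -> ip x z = ip y z.
Proof.
move=> h; apply/eqP; rewrite -subr_eq0 -ipBl -normr_le0.
by apply: le_trans (cauchy_schwarz _ _) _; rewrite h mul0r.
Qed.

Lemma nrm0_sym x y : nrm (x - y) = 0 -> nrm (y - x) = 0.
Proof. by rewrite nrmBC. Qed.

Lemma nrm0_trans x y z : nrm (x - y) = 0 -> nrm (y - z) = 0 -> nrm (x - z) = 0.
Proof.
move=> h1 h2; apply/eqP; rewrite eq_le nrm_ge0 andbT.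
by apply: le_trans (nrm_dist x y z) _; rewrite h1 h2 addr0.
Qed.

Lemma nrm0_lin (a : R) x x' y y' : nrm (x - x') = 0 -> nrm (y - y') = 0 ->
  nrm ((a *: x + y) - (a *: x' + y')) = 0.
Proof.
move=> h1 h2; apply/eqP; rewrite eq_le nrm_ge0 andbT.
have -> : (a *: x + y) - (a *: x' + y') = a *: (x - x') + (y - y').
  by rewrite scalerBr opprD addrACA.
by apply: le_trans (nrmD _ _) _; rewrite nrmZ h1 h2 mulr0 addr0.
Qed.

Lemma nrm0_cl (S : H -> Prop) x y : nrm (x - y) = 0 -> cl S x -> cl S y.
Proof.
move=> h clx e e0; have [s [Ss xs]] := clx e e0; exists s; split => //.
by apply: le_lt_trans (nrm_dist y x s) _; rewrite nrmBC h add0r.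
Qed.

Lemma hcvg_nrm0 (u : nat -> H) x y : nrm (x - y) = 0 -> hcvg u x -> hcvg u y.
Proof.
move=> h /hcvgP ux; apply/hcvgP => e e0; have [N hN] := ux e e0; exists N => n Nn.
by apply: le_lt_trans (nrm_dist _ x y) _; rewrite h addr0; exact: hN.
Qed.

Lemma nrm0_refl x : nrm (x - x) = 0. Proof. by rewrite subrr nrm0. Qed.

Lemma nrm0_self x y : nrm (x - (y - y)) = 0 -> nrm x = 0.
Proof. by rewrite subrr subr0. Qed.

Lemma addN1r x y : (-1) *: y + x = x - y. Proof. by rewrite scaleN1r addrC. Qed.

Lemma nrm0_sub x x' y y' : nrm (x - x') = 0 -> nrm (y - y') = 0 ->
  nrm ((x - y) - (x' - y')) = 0.
Proof. by move=> h1 h2; have := nrm0_lin (-1) h2 h1; rewrite !addN1r. Qed.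

End nrm_zero.

Section L2_components.
Context {R : realType} {d n : nat}.
Local Notation mu := (leb R d).
Implicit Types X Y : L2H R d n.

Lemma l2ip_sq X : ip X X = \sum_(i < n) \int[mu]_x ((X : l2vec R d n) i x ^+ 2).
Proof. by rewrite /ip /= l2ipE; apply: eq_bigr => i _; apply: Int_ext => x; rewrite expr2. Qed.

Lemma l2_comp_le X i : \int[mu]_x ((X : l2vec R d n) i x ^+ 2) <= ip X X.
Proof.
rewrite l2ip_sq (bigD1 i)//= lerDl; apply: sumr_ge0 => j _; apply: Int_ge0 => x.
exact: sqr_ge0.
Qed.

Lemma l2_nrm0 X Y : (forall i, {ae mu, forall x, (X : l2vec R d n) i x = (Y : l2vec R d n) i x}) ->
  nrm (X - Y) = 0.
Proof.
move=> h; rewrite /nrm l2ip_sq big1 ?sqrtr0// => i _; apply: ae_Int0.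
  by apply: measurable_funX; exact: (l2sq _ i).1.
apply: filterS (h i) => x xy.
rewrite -[(_ : l2vec R d n) i x]/((X : l2vec R d n) i x - (Y : l2vec R d n) i x).
by rewrite xy subrr expr0n.
Qed.

End L2_components.

Lemma quarters (R : realType) (a b e : R) : a < e / 4 -> b < e / 4 -> 2 * a + 2 * b < e.
Proof. by lra. Qed.

Lemma halves (R : realType) (a b e : R) : a < e / 2 -> b < e / 2 -> a + b < e.
Proof. by lra. Qed.

(** * Sobolev functions and potentials *)

Section linking.
Context {R : realType} {d : nat}.
Implicit Types (f g phi u v th : 'rV[R]_d -> R) (U : set 'rV[R]_d) (X Y Z : L2H R d d).
Local Notation mu := (leb R d).
Local Notation Int f := (\int[mu]_x f x).
Local Notation test := (test_function setT).
Variable Om : set 'rV[R]_d.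
Hypothesis oOm : open Om.

Let mOm : measurable Om := open_row_measurable oOm.

Lemma L2_restrict u : L2 Om u -> sqint (u \_ Om).
Proof.
move=> [mu_ iu]; split; first exact/(measurable_restrictT _ mOm).
move: iu; rewrite /intg (integrable_mkcond _ mOm); congr (_.-integrable _ _).
by apply/funext => x /=; rewrite !patchE; case: ifP => // _; rewrite expr0n.
Qed.

Lemma sqint_L2 f u : sqint f -> (forall x, Om x -> u x = f x) -> L2 Om u.
Proof.
move=> [mf if_] uf; split.
  by apply: (eq_measurable_fun f) => [x|]; [rewrite inE => /uf|exact: measurable_funTS].
have := integrableS measurableT mOm (@subsetT _ Om) if_.
by apply: eq_integrable => // x; rewrite inE => /uf /= ->.
Qed.

Lemma restrictM u phi x : (u \_ Om) x * phi x = ((fun y => u y * phi y) \_ Om) x.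
Proof. by rewrite !patchE; case: ifP => // _; rewrite mul0r. Qed.

Lemma Int_restrict u phi : \int[mu]_(x in Om) (u x * phi x) = \int[mu]_x ((u \_ Om) x * phi x).
Proof. by rewrite Rintegral_mkcond; apply: Int_ext => x; rewrite restrictM. Qed.

Lemma test_restrict U phi : U `<=` Om -> test_function U phi -> phi \_ Om = phi.
Proof.
move=> UO [_ _ sU]; apply/funext => x; rewrite patchE.
case: ifPn => // /negP xO; rewrite suppP// => /sU/UO h; apply: xO; exact/mem_set.
Qed.

Lemma weak_partialP i u g : weak_partial Om i u g <-> forall phi, test_function Om phi ->
  \int[mu]_x ((u \_ Om) x * partial i phi x) = - \int[mu]_x ((g \_ Om) x * phi x).
Proof. by split => h phi /h; rewrite !Int_restrict. Qed.

Lemma wpartialP i u : H1 Om u -> L2 Om (wpartial Om i u) /\ weak_partial Om i u (wpartial Om i u).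
Proof. by move=> [_ /(_ i) [g hg]]; exact: (@xgetPex _ (cst 0) [set g | _ /\ _] (ex_intro _ g hg)). Qed.

(** The weak gradient on Om extended by 0, which places it in the same Hilbert space as the
    gradients of test functions on the whole space. *)
Definition wvec u : L2H R d d :=
  if pselect ((fun i => wpartial Om i u \_ Om) \in @l2pred R d d) is left h then L2vec h else 0.

Lemma wvecE u i : H1 Om u -> (wvec u : l2vec R d d) i = wpartial Om i u \_ Om.
Proof.
move=> h1; rewrite /wvec; case: pselect => //= h; exfalso; apply: h.
by apply/l2predP => j; apply: L2_restrict; exact: (wpartialP j h1).1.
Qed.

Lemma dirichletE u v : H1 Om u -> H1 Om v -> dirichlet Om u v = ip (wvec u) (wvec v).
Proof.
move=> hu hv; rewrite /dirichlet Rintegral_mkcond /ip /= /l2ip; apply: Int_ext => x.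
under eq_bigr do rewrite !wvecE//.
rewrite patchE; under [RHS]eq_bigr do rewrite !patchE.
by case: ifP => // _; rewrite big1// => i _; rewrite mul0r.
Qed.

Lemma wvec_weak u i phi : H1 Om u -> test_function Om phi ->
  \int[mu]_x ((u \_ Om) x * partial i phi x) = - \int[mu]_x ((wvec u : l2vec R d d) i x * phi x).
Proof.
by move=> hu tp; rewrite wvecE//; apply: (iffLR (weak_partialP _ _ _)) tp; case: (wpartialP i hu).
Qed.

(** [wpartial] picks an arbitrary representative, so identities between weak gradients hold only up
    to a vector of norm 0. Here such an identity is obtained from the weak equation in Om together
    with vanishing almost everywhere outside. *)
Lemma wvec_char u Z : L2 Om u ->
  (forall i phi, test_function Om phi ->
    \int[mu]_x ((u \_ Om) x * partial i phi x) = - \int[mu]_x ((Z : l2vec R d d) i x * phi x)) ->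
  (forall i, {ae mu, forall x, ~ Om x -> (Z : l2vec R d d) i x = 0}) ->
  H1 Om u /\ nrm (wvec u - Z) = 0.
Proof.
move=> L2u hZ Z0.
have sZ i := l2sq (Z : l2vec R d d) i.
have mR i : measurable_fun setT ((Z : l2vec R d d) i \_ Om).
  by apply/(measurable_restrictT _ mOm); apply: measurable_funTS; exact: (sZ i).1.
have ZE i phi : test phi -> \int[mu]_x (((Z : l2vec R d d) i \_ Om) x * phi x) =
    \int[mu]_x ((Z : l2vec R d d) i x * phi x).
  move=> tp; have [|||_ ->//] := @ae_intg R d (fun x => (Z : l2vec R d d) i x * phi x)
    (fun x => ((Z : l2vec R d d) i \_ Om) x * phi x).
  - by apply: measurable_funM; [exact: mR|exact: smooth_measurable (test_smooth tp)].
  - by apply: sqintM => //; exact: test_sqint tp.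
  - apply: filterS (Z0 i) => x hx; rewrite patchE; case: ifPn => // /negP xO.
    by rewrite hx// => h; apply: xO; exact/mem_set.
have hu : H1 Om u.
  split => // i; exists ((Z : l2vec R d d) i); split; first exact: sqint_L2 (sZ i) _.
  by apply/weak_partialP => phi tp; rewrite hZ// ZE//; exact: testT tp.
split => //; apply: l2_nrm0 => i.
have : {ae mu, forall x, Om x -> ((wvec u : l2vec R d d) i \- (Z : l2vec R d d) i) x = 0}.
  apply: test_orth => //; first by apply: sqintB => //; exact: l2sq.
  move=> phi tp; have sp := test_sqint tp.
  rewrite (_ : (fun x => _) = (fun x => (wvec u : l2vec R d d) i x * phi x) \-
    (fun x => (Z : l2vec R d d) i x * phi x)); last by apply/funext => x /=; ring.
  rewrite IntB; try by apply: sqintM => //; exact: l2sq.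
  have := hZ i phi tp; rewrite wvec_weak// => /oppr_inj ->; exact: subrr.
move=> h1; apply: filterS2 h1 (Z0 i) => x h1 h2.
have [Ox|nO] := pselect (Om x); first by apply/eqP; rewrite -subr_eq0; apply/eqP; exact: h1.
by rewrite h2// wvecE// patchE memNset.
Qed.

Lemma wvec_out u i x : H1 Om u -> ~ Om x -> (wvec u : l2vec R d d) i x = 0.
Proof. by move=> hu nO; rewrite wvecE// patchE memNset. Qed.

Lemma H1_lin (a : R) u v : H1 Om u -> H1 Om v ->
  H1 Om (a *: u + v) /\ nrm (wvec (a *: u + v) - (a *: wvec u + wvec v)) = 0.
Proof.
move=> hu hv; have su := L2_restrict hu.1; have sv := L2_restrict hv.1.
have E x : ((a *: u + v) \_ Om) x = a * (u \_ Om) x + (v \_ Om) x.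
  by rewrite !patchE; case: ifP => // _; rewrite mulr0 addr0.
apply: wvec_char.
- apply: (sqint_L2 (f := fun x => a * (u \_ Om) x + (v \_ Om) x)).
    exact: sqintD (sqintZ a su) sv.
  by move=> x Ox; rewrite !patchE mem_set.
- move=> i phi tp; have sp := test_sqint tp; have spp := test_sqint (test_partial i tp).
  have iu := sqintM su spp. have iv := sqintM sv spp.
  have iu' := sqintM (l2sq (wvec u : l2vec R d d) i) sp.
  have iv' := sqintM (l2sq (wvec v : l2vec R d d) i) sp.
  transitivity (Int ((fun x => a * ((u \_ Om) x * partial i phi x)) \+ (fun x => (v \_ Om) x * partial i phi x))).
    by apply: Int_ext => x; rewrite E /=; ring.
  rewrite IntD//; last exact: intgZ.
  rewrite (IntZ _ iu) !wvec_weak//.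
  transitivity (- (Int ((fun x => a * ((wvec u : l2vec R d d) i x * phi x)) \+
      (fun x => (wvec v : l2vec R d d) i x * phi x)))).
    rewrite IntD//; last exact: intgZ.
    by rewrite (IntZ _ iu') opprD mulrN.
  congr (- _); apply: Int_ext => x /=.
  change (a * ((wvec u : l2vec R d d) i x * phi x) + (wvec v : l2vec R d d) i x * phi x =
    (a * (wvec u : l2vec R d d) i x + (wvec v : l2vec R d d) i x) * phi x).
  by rewrite mulrDl mulrA.
- move=> i; apply: nearW => x nO.
  change (a * (wvec u : l2vec R d d) i x + (wvec v : l2vec R d d) i x = 0).
  by rewrite !wvec_out// mulr0 addr0.
Qed.

Lemma H1_test U phi : U `<=` Om -> test_function U phi ->
  H1 Om phi /\ nrm (wvec phi - grad phi) = 0.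
Proof.
move=> UO tp; apply: wvec_char.
- exact: sqint_L2 (test_sqint tp) _.
- move=> i psi tpsi; rewrite (test_restrict UO tp) (gradE i tp).
  by rewrite (Int_parts i tp)//; exact: test_smooth tpsi.
- move=> i; apply: nearW => x nO; rewrite (gradE i tp).
  by apply: partial_supp; case: tp => _ _ h /h /UO.
Qed.

Lemma sub_lin (f g : 'rV[R]_d -> R) : f \- g = (-1) *: g + f.
Proof. by apply/funext => x; change (f x - g x = (-1) * g x + f x); ring. Qed.

Lemma H1_sub u v : H1 Om u -> H1 Om v ->
  H1 Om (u \- v) /\ nrm (wvec (u \- v) - (wvec u - wvec v)) = 0.
Proof.
move=> hu hv; rewrite sub_lin; have [h1 h2] := H1_lin (-1) hv hu; split => //.
by rewrite addN1r in h2.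
Qed.

Definition L2cvg (u : nat -> 'rV[R]_d -> R) v := forall e : R, 0 < e ->
  exists N : nat, forall n, (N <= n)%N -> \int[mu]_x ((u n x - (v \_ Om) x) ^+ 2) < e.

Lemma L2cvg_int (u : nat -> 'rV[R]_d -> R) v psi : (forall n, sqint (u n)) -> L2 Om v -> sqint psi -> L2cvg u v ->
  \int[mu]_x (u n x * psi x) @[n --> \oo] --> \int[mu]_x ((v \_ Om) x * psi x).
Proof.
move=> su /L2_restrict sv sp uv; apply/cvgrPdist_lt => e e0.
pose P := Num.sqrt (\int[mu]_x (psi x ^+ 2)).
have P1 : 0 < P + 1 by rewrite ltr_wpDl ?sqrtr_ge0.
have e1 : 0 < (e / (P + 1)) ^+ 2 by rewrite exprn_gt0// divr_gt0.
have [N hN] := uv _ e1; exists N => // n /= Nn.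
rewrite distrC -IntB; try exact: sqintM.
rewrite (_ : (fun x => _) \- _ = fun x => (u n \- (v \_ Om)) x * psi x); last first.
  by apply/funext => x /=; ring.
apply: le_lt_trans (Int_cs (sqintB (su n) sv) sp) _; rewrite -/P.
have h : Num.sqrt (\int[mu]_x ((u n \- (v \_ Om)) x ^+ 2)) < e / (P + 1).
  rewrite -[ltRHS]ger0_norm ?divr_ge0 ?(ltW e0) ?(ltW P1)// -sqrtr_sqr ltr_sqrt//.
  exact: hN.
apply: (@le_lt_trans _ _ (e / (P + 1) * P)).
  by apply: ler_wpM2r; [exact: sqrtr_ge0|exact: ltW].
by rewrite mulrAC ltr_pdivrMr// ltr_pM2l// ltrDl.
Qed.

Lemma hcvg_int (u : nat -> L2H R d d) Z i psi : hcvg u Z -> sqint psi ->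
  \int[mu]_x ((u n : l2vec R d d) i x * psi x) @[n --> \oo] --> \int[mu]_x ((Z : l2vec R d d) i x * psi x).
Proof.
move=> uZ sp.
pose e (j : 'I_d) : 'rV[R]_d -> R := if j == i then psi else fun=> 0.
have se : e \in @l2pred R d d.
  by apply/l2predP => j; rewrite /e; case: eqP => // _; exact: sqint0.
have ipE X : ip X (L2vec se : L2H R d d) = \int[mu]_x ((X : l2vec R d d) i x * psi x).
  rewrite /ip /= l2ipE (bigD1 i)//= [X in _ + X]big1 ?addr0.
    by rewrite /e eqxx.
  move=> j /negbTE ji; rewrite /e ji -[RHS](@Int0 R d); apply: Int_ext => x.
  by rewrite mulr0.
have := hcvg_ip uZ (hcvg_cst (L2vec se : L2H R d d)); rewrite ipE.
by apply: cvg_trans; apply: near_eq_cvg; apply: nearW => n; rewrite ipE.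
Qed.

(** Gradients of test functions in U vanish off Om, so the L^2 mass of Z there is at most the
    squared distance from Z to any of them. *)
Lemma grads_out U Z : U `<=` Om -> cl (grads U) Z ->
  forall i, {ae mu, forall x, ~ Om x -> (Z : l2vec R d d) i x = 0}.
Proof.
move=> UO clZ i.
pose W := (Z : l2vec R d d) i; have sW : sqint W by exact: l2sq.
pose V : 'rV[R]_d -> R := fun x => \1_(~` Om) x * W x.
have mi : measurable_fun setT (\1_(~` Om) : 'rV[R]_d -> R).
  by apply: measurable_indic; exact: measurableC.
have sV : sqint V.
  apply: (sqint_bM (C := 1)) sW => // x; by rewrite indicE normr_nat lern1 leq_b1.
have I0 : \int[mu]_x (V x ^+ 2) = 0.
  apply/eqP; rewrite eq_le Int_ge0 ?andbT; last by move=> x; exact: sqr_ge0.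
  rewrite leNgt; apply/negP => e0.
  have e1 : 0 < Num.sqrt (\int[mu]_x (V x ^+ 2)) by rewrite sqrtr_gt0.
  have [_ [[f tf ->]]] := clZ _ e1.
  rewrite nrm_lt_ip// sqr_sqrtr ?(ltW e0)//; apply/negP; rewrite -leNgt.
  apply: le_trans (l2_comp_le _ i).
  have sD : sqint ((Z - grad f : l2vec R d d) i) by exact: l2sq.
  apply: Int_le => [||x]; [exact: sV.2|exact: sD.2|].
  change (V x ^+ 2 <= (W x - (grad f : l2vec R d d) i x) ^+ 2).
  rewrite (gradE i tf) /V indicE; have [Ox|nO] := pselect (Om x).
    by rewrite memNset ?mul0r ?expr0n ?sqr_ge0// => /(_ Ox).
  rewrite mem_set// mul1r partial_supp ?subr0//.
  by case: tf => _ _ h /h /UO.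
have {}I0 : {ae mu, forall x, V x ^+ 2 = 0}.
  have mE : measurable_fun setT (EFin \o (fun x => V x ^+ 2)) by apply/measurable_EFinP/measurable_funX; exact: sV.1.
  have : (\int[mu]_(x in setT) `|(V x ^+ 2)%:E| = 0)%E.
    rewrite -[RHS]/(0%:E) -I0 -(Int_EFin sV.2); apply: eq_integral => x _.
    by rewrite /= ger0_norm// sqr_ge0.
  move/(iffLR (ae_eq_integral_abs mu measurableT mE)).
  by apply: filterS => x /(_ Logic.I) [].
apply: filterS I0 => x /eqP; rewrite sqrf_eq0 /V indicE => /eqP + nO.
by rewrite mem_set// mul1r.
Qed.

(** The weak equation passes to the limit against a fixed test function, which identifies Z with the
    weak gradient of v. Together with [H10_seq] it replaces the norm in the definition of [H10] by
    two separate convergences. *)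
Lemma H10_of_seq U (f : nat -> 'rV[R]_d -> R) v Z : U `<=` Om ->
  (forall n, test_function U (f n)) -> hcvg (fun n => grad (f n)) Z -> L2 Om v -> L2cvg f v ->
  H10 Om U v /\ nrm (wvec v - Z) = 0.
Proof.
move=> UO tf fZ L2v fv.
have clZ : cl (grads U) Z.
  by apply/cl_seq; exists (fun n => grad (f n)); split => // n; exists (f n).
have [hv vZ] : H1 Om v /\ nrm (wvec v - Z) = 0.
  apply: wvec_char => //; last exact: grads_out clZ.
  move=> i phi tp; have sp := test_sqint tp; have spp := test_sqint (test_partial i tp).
  have c1 := L2cvg_int (fun n => test_sqint (tf n)) L2v spp fv.
  have c2 := @seq_cvgZ _ (-1) _ _ (hcvg_int (i := i) fZ sp).
  rewrite mulN1r in c2; apply: (cvg_unique (@Rhausdorff R) c1).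
  apply: seq_cvg_ext c2 => n /=; rewrite (gradE i (tf n)) mulN1r (Int_parts i (tf n))//.
  exact: test_smooth tp.
split=> //; split => // e e0.
have fW : hcvg (fun n => grad (f n)) (wvec v) by apply: hcvg_nrm0 fZ; exact: nrm0_sym.
have e2 : 0 < e ^+ 2 / 2 by rewrite divr_gt0// exprn_gt0.
have [N1 h1] := fv _ e2.
have se2 : 0 < Num.sqrt (e ^+ 2 / 2) by rewrite sqrtr_gt0.
have [N2 h2] := iffLR (hcvgP _ _) fW _ se2.
pose n := maxn N1 N2; exists (f n); split => //.
have [hf nf] := H1_test UO (tf n).
have [hs ns] := H1_sub hv hf.
rewrite /H1_norm dirichletE// -[ltRHS]ger0_norm ?(ltW e0)// -sqrtr_sqr ltr_sqrt ?exprn_gt0//.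
have -> : \int[mu]_(x in Om) ((v \- f n) x ^+ 2) = \int[mu]_x ((f n x - (v \_ Om) x) ^+ 2).
  rewrite Rintegral_mkcond; apply: Int_ext => x; rewrite !patchE.
  case: ifPn => [_|/negP xO]; first by rewrite /=; ring.
  rewrite -(test_restrict UO (tf n)) patchE ifN ?subrr ?expr0n//; exact/negP.
have -> : ip (wvec (v \- f n)) (wvec (v \- f n)) = nrm (grad (f n) - wvec v) ^+ 2.
  have E : nrm (wvec (v \- f n) - (wvec v - grad (f n))) = 0.
    exact: nrm0_trans ns (nrm0_sub (nrm0_refl _) nf).
  by rewrite nrmBC nrm2 (nrm0_ip _ E) ipC (nrm0_ip _ E).
have := h1 n (leq_maxl _ _); have : nrm (grad (f n) - wvec v) ^+ 2 < e ^+ 2 / 2.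
  rewrite -[ltRHS]sqr_sqrtr ?(ltW e2)// ltrXn2r ?nrm_ge0 ?sqrtr_ge0//.
  exact: h2 (leq_maxr _ _).
by move=> a b; exact: halves b a.
Qed.

Lemma H10_seq U v : U `<=` Om -> H10 Om U v -> exists f : nat -> 'rV[R]_d -> R,
  [/\ forall n, test_function U (f n), hcvg (fun n => grad (f n)) (wvec v) & L2cvg f v].
Proof.
move=> UO [hv h].
have e1 n : 0 < @delta R n by exact: delta_gt0.
have [f hf] := choice (fun n => h _ (e1 n)).
have tf n : test_function U (f n) by case: (hf n).
have key n : \int[mu]_x ((f n x - (v \_ Om) x) ^+ 2) + nrm (grad (f n) - wvec v) ^+ 2 < delta n ^+ 2.
  have [hfn nf] := H1_test UO (tf n).
  have [hs ns] := H1_sub hv hfn.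
  have := (hf n).2; rewrite /H1_norm dirichletE// -[ltRHS]ger0_norm ?(ltW (e1 n))// -sqrtr_sqr ltr_sqrt ?exprn_gt0//.
  have -> : \int[mu]_(x in Om) ((v \- f n) x ^+ 2) = \int[mu]_x ((f n x - (v \_ Om) x) ^+ 2).
    rewrite Rintegral_mkcond; apply: Int_ext => x; rewrite !patchE.
    case: ifPn => [_|/negP xO]; first by rewrite /=; ring.
    rewrite -(test_restrict UO (tf n)) patchE ifN ?subrr ?expr0n//; exact/negP.
  suff -> : ip (wvec (v \- f n)) (wvec (v \- f n)) = nrm (grad (f n) - wvec v) ^+ 2 by [].
  have E : nrm (wvec (v \- f n) - (wvec v - grad (f n))) = 0.
    exact: nrm0_trans ns (nrm0_sub (nrm0_refl _) nf).
  by rewrite nrmBC nrm2 (nrm0_ip _ E) ipC (nrm0_ip _ E).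
exists f; split => //.
  apply/hcvgP => e e0; have [N _ hN] := near_infty_natSinv_lt (PosNum e0).
  exists N => n Nn; apply: lt_trans (hN n Nn); rewrite /= -/(delta n).
  rewrite -(@ltr_pXn2r _ 2)// ?nnegrE ?nrm_ge0 ?(ltW (e1 n))//.
  apply: le_lt_trans (key n); rewrite lerDr; apply: Int_ge0 => x; exact: sqr_ge0.
move=> e e0; have [N _ hN] := near_infty_natSinv_lt (PosNum e0).
exists N => n Nn; apply: lt_trans (hN n Nn); rewrite /= -/(delta n).
apply: (@lt_le_trans _ _ (delta n ^+ 2)); last by rewrite expr2 ler_piMr ?delta_le1// ltW.
by apply: le_lt_trans (key n); rewrite lerDl sqr_ge0.
Qed.

Lemma H10_cl U v : U `<=` Om -> H10 Om U v -> cl (grads U) (wvec v).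
Proof.
move=> UO hv; have [f [tf fv _]] := H10_seq UO hv.
by apply/cl_seq; exists (fun n => grad (f n)); split => // n; exists (f n).
Qed.

Lemma H10W U U' v : U `<=` U' -> H10 Om U v -> H10 Om U' v.
Proof.
move=> UU' [hv h]; split => // e e0; have [f [tf hf]] := h e e0.
by exists f; split => //; exact: testW tf.
Qed.

Lemma H10_sub U u v : U `<=` Om -> H10 Om U u -> H10 Om U v -> H10 Om U (u \- v).
Proof.
move=> UO hu hv; have [f [tf fu fu2]] := H10_seq UO hu; have [g [tg gv gv2]] := H10_seq UO hv.
have su := L2_restrict hu.1.1; have sv := L2_restrict hv.1.1.
have E x : ((u \- v) \_ Om) x = (u \_ Om) x - (v \_ Om) x.
  by rewrite !patchE; case: ifP => // _; rewrite subrr.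
apply: (@H10_of_seq _ (fun n => f n \- g n) _ (wvec u - wvec v) UO _ _ _ _).1.
- by move=> n; exact: testB.
- have -> : (fun n => grad (f n \- g n)) = (fun n => grad (f n) - grad (g n)).
    by apply/funext => n; exact: gradB (tf n) (tg n).
  exact: hcvgB.
- apply: (sqint_L2 (sqintB su sv)) => x Ox.
  by rewrite /= !patchE mem_set.
- move=> e e0; have e4 : 0 < e / 4 by rewrite divr_gt0.
  have [N1 h1] := fu2 _ e4; have [N2 h2] := gv2 _ e4.
  exists (maxn N1 N2) => n; rewrite geq_max => /andP[n1 n2].
  have i1 := sqintB (test_sqint (tf n)) su; have i2 := sqintB (test_sqint (tg n)) sv.
  have i3 := sqintB i1 i2.
  apply: (@le_lt_trans _ _ (Int ((fun x => 2 * (f n x - (u \_ Om) x) ^+ 2) \+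
     (fun x => 2 * (g n x - (v \_ Om) x) ^+ 2)))); last first.
    rewrite IntD; [|exact: intgZ i1.2|exact: intgZ i2.2].
    by rewrite (IntZ _ i1.2) (IntZ _ i2.2); exact: quarters (h1 n n1) (h2 n n2).
  have B x : ((f n \- g n) x - ((u \- v) \_ Om) x) ^+ 2 =
     ((f n x - (u \_ Om) x) - (g n x - (v \_ Om) x)) ^+ 2 by rewrite E /=; ring.
  apply: Int_le.
  - by move: i3.2; congr intg; apply/funext => x; rewrite B.
  - by apply: intgD; [exact: intgZ i1.2|exact: intgZ i2.2].
  - move=> x; rewrite B /=; move: (f n x - _) (g n x - _) => a b.
    by have := sqr_ge0 (a + b); lra.
Qed.

End linking.

Lemma eq_opp_add (V : zmodType) (a b c : V) : a + b = - c -> a = - (c + b).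
Proof. by move=> h; rewrite opprD -h addrK. Qed.

(** * Existence and characterisation of potentials *)

Section sobolev.
Context {R : realType} {d : nat} (hd : (3 <= d)%N).
Implicit Types (f g phi u v th : 'rV[R]_d -> R) (U : set 'rV[R]_d) (X Y Z : L2H R d d).
Local Notation mu := (leb R d).
Local Notation Int f := (\int[mu]_x f x).
Local Notation test := (test_function setT).
Variable Om : set 'rV[R]_d.
Hypothesis oOm : open Om.

(** Poincare's inequality, read off from [hardy]: on a bounded set its weight is bounded below. *)
Lemma bounded_test_L2 U : bounded_set Om -> U `<=` Om -> exists C : R, 0 <= C /\
  forall f, test_function U f -> \int[mu]_x (f x ^+ 2) <= C * nrm (grad f) ^+ 2.
Proof.
move=> [M0 [_ hM]] UO.
pose M := `|M0| + 1.
have hM' x : Om x -> `|x| <= M.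
  by apply: hM; rewrite (le_lt_trans (ler_norm _))// ltrDl.
pose W : R := 1 + d%:R * M ^+ 2.
have W0 : 0 < W by rewrite ltr_pwDl// mulr_ge0// sqr_ge0.
exists (4 * W); split; first by rewrite mulr_ge0// ltW.
move=> f tf; rewrite nrm2.
have h := hardy hd tf.
have sf := test_sqint tf.
have ih : intg (fun x => f x ^+ 2 * hardyw x).
  apply: le_intg sf.2.
    apply: measurable_funM; first exact: measurable_funX sf.1.
    exact: smooth_measurable smooth_hardyw.
  move=> x; rewrite normrM !ger0_norm ?sqr_ge0 ?(ltW (hardyw_gt0 x))//.
  by rewrite ler_piMr ?sqr_ge0// hardyw_le1.
apply: (@le_trans _ _ (W * \int[mu]_x (f x ^+ 2 * hardyw x))); last first.
  have := ler_wpM2l (ltW W0) h; rewrite /energy.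
  by move=> h'; rewrite [4 * W]mulrC -mulrA.
rewrite -(IntZ _ ih); apply: Int_le; [exact: sf.2|exact: intgZ|move=> x].
have [Ox|nO] := pselect (Om x); last first.
  rewrite (_ : f x = 0) ?expr0n ?mul0r ?mulr0//.
  by apply: suppP; case: tf => _ _ s /s /UO.
rewrite mulrCA ler_peMr ?sqr_ge0// /hardyw ler_pdivlMr ?mul1r; last first.
  by have := sqn_ge0 x; lra.
rewrite lerD2l; apply: le_trans (sqn_le_norm x) _; apply: ler_wpM2l => //.
have xM := hM' x Ox.
by rewrite lerXn2r ?nnegrE// (le_trans _ xM).
Qed.

(** By Poincare's inequality, functions whose gradients form a Cauchy sequence are themselves Cauchy
    in L^2; this recovers a function from a limit of gradients. *)
Lemma H10_realize U Z : bounded_set Om -> U `<=` Om -> cl (grads U) Z ->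
  exists v, H10 Om U v /\ nrm (wvec Om v - Z) = 0.
Proof.
move=> bO UO clZ; have [f [tf fZ]] := grads_seq clZ.
have [C [C0 hC]] := bounded_test_L2 bO UO.
have [|v [sv hv]] := @riesz_fischer R d f (fun n => test_sqint (tf n)).
  move=> e e0; have k0 : 0 < Num.sqrt (e / (C + 1)) by rewrite sqrtr_gt0 divr_gt0// ltr_wpDl.
  have [N hN] := hcvg_cauchy fZ k0; exists N => m n Nm Nn.
  apply: le_lt_trans (hC _ (testB (tf m) (tf n))) _.
  rewrite (gradB (tf m) (tf n)).
  have : nrm (grad (f m) - grad (f n)) ^+ 2 < e / (C + 1).
    have e1 : 0 <= e / (C + 1) by rewrite divr_ge0 ?addr_ge0// ltW.
    by rewrite -[ltRHS]sqr_sqrtr// ltrXn2r ?nrm_ge0 ?sqrtr_ge0//; exact: hN.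
  rewrite ltr_pdivlMr ?ltr_wpDl//; apply: le_lt_trans.
  by rewrite mulrC; apply: ler_wpM2l; [exact: sqr_ge0|rewrite lerDl].
pose w := v \_ Om.
have mOm := open_row_measurable oOm.
have wv : w \_ Om = w.
  by apply/funext => x; rewrite /w !patchE; case: (x \in Om).
have f0 n x : ~ Om x -> f n x = 0.
  by move=> nO; apply: suppP; case: (tf n) => _ _ s /s /UO.
have sw : sqint w.
  rewrite (_ : w = fun x => \1_Om x * v x).
    apply: (sqint_bM (C := 1)) sv; first exact: measurable_indic.
    by move=> x; rewrite indicE normr_nat lern1 leq_b1.
  by apply/funext => x; rewrite /w patchE indicE; case: (x \in Om); rewrite ?mul1r ?mul0r.
exists w.
apply: (H10_of_seq oOm UO tf fZ).
  exact: (sqint_L2 oOm sw).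
move=> e e0; have [N hN] := hv e e0; exists N => n Nn; apply: le_lt_trans (hN n Nn).
rewrite wv; apply: Int_le => [||x].
- exact: (sqintB (test_sqint (tf n)) sw).2.
- exact: (sqintB (test_sqint (tf n)) sv).2.
- rewrite /w patchE; case: ifPn => // /negP xO.
  by rewrite f0 ?subrr ?expr0n ?sqr_ge0// => h; apply: xO; exact/mem_set.
Qed.

(** Mollify th u: the result stays supported in U once the mollifier is small enough, and its
    gradient is the mollification of the weak gradient G, so both converge in L^2. *)
Lemma H10_cutoff U th u : open U -> U `<=` Om -> test_function U th -> H1 Om u ->
  H10 Om U (th \* u).
Proof.
move=> oU UO tth hu; have sth := test_smooth tth.
have su := L2_restrict oOm hu.1.
pose g i := (wvec Om u : l2vec R d d) i; have sg i : sqint (g i) by exact: l2sq.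
pose v0 x := th x * (u \_ Om) x.
pose G i x := th x * g i x + partial i th x * (u \_ Om) x.
have [B [_ [_ _ thB _]]] := test_bounded tth.
have sv0 : sqint v0 by apply: (sqint_bM (C := B)) su => //; exact: smooth_measurable.
have sG i : sqint (G i).
  have [B' [_ [_ _ thB' _]]] := test_bounded (test_partial i tth).
  apply: sqintD; first by apply: (sqint_bM (C := B)) (sg i) => //; exact: smooth_measurable.
  apply: (sqint_bM (C := B')) su => //; apply: smooth_measurable; exact: smooth_partial.
have vK x : ~ supp th x -> v0 x = 0 by move=> nx; rewrite /v0 suppP// mul0r.
have GK i x : ~ supp th x -> G i x = 0.
  by move=> nx; rewrite /G suppP// partial_supp// !mul0r addr0.
have cK : compact (supp th) by case: tth.
have KU : supp th `<=` U by case: tth.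
have [r [r0 Kr]] : exists r : R, 0 <= r /\ forall x, supp th x -> `|x| <= r.
  have [M [_ hM]] := compact_bounded cK.
  exists (Num.max M 0 + 1); split; first by rewrite addr_ge0// le_max lexx orbT.
  by apply: hM; rewrite ltr_pwDr// le_max lexx.
have vv : vanish_out v0 r by move=> y ry; apply: vK => /Kr; rewrite leNgt ry.
have vG i : vanish_out (G i) r by move=> y ry; apply: GK => /Kr; rewrite leNgt ry.
have iv := sqint_intg r0 vv sv0.
(* The function th u has compact support in Om, so its weak equation holds against every smooth psi,
   with no support condition; this allows translates of the mollifier. *)
have weak i psi : smooth psi -> \int[mu]_y (v0 y * partial i psi y) = - \int[mu]_y (G i y * psi y).
  move=> sp; have tp : test_function Om (th \* psi) by apply: testMl => //; exact: testW tth.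
  have := wvec_weak oOm i hu tp.
  have tpth := test_partial i tth.
  have i1 : intg (fun y => v0 y * partial i psi y).
    rewrite (_ : (fun y => _) = fun y => (u \_ Om) y * (th \* partial i psi) y).
      by apply: sqintM => //; apply: (test_sqint (U := U)); apply: testMl => //; exact: smooth_partial.
    by apply/funext => y; rewrite /v0 /=; ring.
  have i2 : intg (fun y => (u \_ Om) y * (partial i th \* psi) y).
    by apply: sqintM => //; apply: (test_sqint (U := U)); exact: testMl.
  have i3 : intg (fun y => g i y * (th \* psi) y) by apply: sqintM => //; exact: test_sqint tp.
  have -> : \int[mu]_x ((u \_ Om) x * partial i (th \* psi) x) =
      \int[mu]_y (v0 y * partial i psi y) + \int[mu]_y ((u \_ Om) y * (partial i th \* psi) y).
    rewrite -IntD//; apply: Int_ext => y; rewrite partialM; last 2 first.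
    - by move=> x; exact: smooth_derivable.
    - by move=> x; exact: smooth_derivable.
    by rewrite /v0 /=; ring.
  have -> : \int[mu]_y (G i y * psi y) =
      \int[mu]_x (g i x * (th \* psi) x) + \int[mu]_y ((u \_ Om) y * (partial i th \* psi) y).
    by rewrite -IntD//; apply: Int_ext => y; rewrite /G /=; ring.
  exact: eq_opp_add.
pose phi n := conv (molli n) v0.
have sphi n : smooth (phi n) by apply: (smooth_conv r0 iv vv); exact: smooth_molli.
(* The weak equation is tested with y -> molli n (z - y), which moves the derivative from the
   mollifier to G. *)
have pE n i : partial i (phi n) = conv (molli n) (G i).
  rewrite /phi (partial_conv r0 iv vv); last exact: smooth_molli.
  apply/funext => z.
  have sm := @smooth_molli R d n.
  have sA := smooth_affine (-1) z sm.
  have E y : (-1) *: y + z = z - y by rewrite scaleN1r addrC.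
  have := weak i _ sA; rewrite (partial_affine (-1) z i sm).
  have -> : \int[mu]_y (v0 y * (-1 * partial i (molli n) (-1 *: y + z))) =
      - conv (partial i (molli n)) v0 z.
    have ic := conv_intg z r0 (smooth_partial i sm) iv vv.
    transitivity (\int[mu]_y (-1 * (partial i (molli n) (z - y) * v0 y))).
      by apply: Int_ext => y; rewrite E; ring.
    by rewrite (IntZ _ ic) mulN1r.
  move/oppr_inj => ->; rewrite /conv; apply: Int_ext => y; rewrite E mulrC.
  by [].
have [N hN] := molli_test cK oU KU sv0 vK.
have GL : (fun i => G i) \in @l2pred R d d by apply/l2predP.
pose Z : L2H R d d := L2vec GL.
have vE : (th \* u) \_ Om = v0.
  apply/funext => x; rewrite /v0 !patchE; case: ifP => // _; by rewrite mulr0.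
apply: (@H10_of_seq _ _ Om oOm U (fun n => phi (n + N)%N) _ Z UO _ _ _ _).1.
- by move=> n; apply: hN; exact: leq_addl.
- apply/hcvgP => e e0.
  have e1 : 0 < e ^+ 2 / (d%:R + 1) by rewrite divr_gt0 ?exprn_gt0// ltr_wpDl.
  have [M hM] := choice (fun i => molli_cvg r0 (sG i) (vG i) e1).
  exists (\max_(i < d) M i) => n Mn.
  have tn : test_function U (phi (n + N)%N) by apply: hN; exact: leq_addl.
  rewrite nrm_lt_ip// l2ip_sq.
  apply: (@le_lt_trans _ _ (\sum_(i < d) (e ^+ 2 / (d%:R + 1)))).
    apply: ler_sum => i _; apply: ltW.
    have Mi : (M i <= n + N)%N by apply: leq_trans (leq_addr _ _); apply: leq_trans Mn; exact: leq_bigmax.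
    apply: le_lt_trans (hM i _ Mi); rewrite le_eqVlt; apply/orP; left; apply/eqP.
    apply: Int_ext => x.
    change (((grad (phi (n + N)%N) : l2vec R d d) i x - G i x) ^+ 2 = (conv (molli (n + N)) (G i) x - G i x) ^+ 2).
    by rewrite (gradE i tn) pE.
  rewrite sumr_const card_ord -[ltLHS]mulr_natr mulrAC ltr_pdivrMr ?ltr_wpDl//.
  by rewrite ltr_pM2l ?exprn_gt0// ltrDl.
- apply: (sqint_L2 oOm sv0) => x Ox.
  by rewrite -vE patchE mem_set.
- move=> e e0; have [M hM] := molli_cvg r0 sv0 vv e0; exists M => n Mn.
  by rewrite vE; apply: hM; apply: leq_trans Mn _; exact: leq_addr.
Qed.

Lemma H10_test U f : U `<=` Om -> test_function U f -> H10 Om U f.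
Proof.
move=> UO tf; have [hf nf] := H1_test oOm UO tf; split; first exact: hf.
move=> e e0; exists f; split; first exact: tf.
have [hs ns] := H1_sub oOm hf hf.
rewrite /H1_norm (dirichletE oOm hs hs) -nrm2.
have -> : nrm (wvec Om (f \- f)) = 0 by exact: nrm0_self ns.
rewrite (_ : \int[mu]_(x in Om) _ = 0) ?expr0n ?addr0 ?sqrtr0//.
rewrite Rintegral_mkcond -[RHS](@Int0 R d); apply: Int_ext => x.
by rewrite patchE; case: ifP => // _; rewrite /= subrr expr0n.
Qed.

(** Subtract from u a function q whose gradient is, up to norm 0, the orthogonal projection of that
    of u on the closure of the gradients supported in Om off K. *)
Lemma is_potential_exists U K u : bounded_set Om -> closed K -> K `<=` Om ->
  H10 Om Om u -> exists v, is_potential Om K u v.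
Proof.
move=> bO cK KO hu.
have UO : Om `\` K `<=` Om by move=> x [].
pose W := wvec Om u.
have [||p [clp hp]] := @riesz R (L2H R d d) _ (test_function (Om `\` K)) grad (test0 _)
   (fun a e f te tf => test_lin a te tf) (fun a e f te tf => grad_lin a te tf)
   (fun f => ip W (grad f)) (nrm W).
- by move=> a e f te tf; rewrite (grad_lin a te tf) ipDr ipZr.
- by move=> e te; exact: cauchy_schwarz.
have [q [hq qp]] := H10_realize bO UO clp.
exists (u \- q).
have hq' := H10W UO hq.
have hv : H10 Om Om (u \- q) by exact: H10_sub.
split; first exact: hv.
  have -> : (u \- q) \- u = (fun=> 0) \- q by apply/funext => x /=; ring.
  have h0 : H10 Om (Om `\` K) (fun=> 0) by apply: H10_test => //; exact: test0.
  by apply: H10_sub.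
move=> f hf.
have [hs ns] := H1_sub oOm hu.1 hq.1.
rewrite (dirichletE oOm hv.1 hf.1) (nrm0_ip _ ns).
have clf := H10_cl oOm UO hf.
rewrite (nrm0_ip _ (nrm0_sub (nrm0_refl W) qp)).
have h : forall s, grads (Om `\` K) s -> ip (W - p) s = 0.
  by move=> _ [e te ->]; rewrite ipBl hp// subrr.
exact: orth_cl h _ clf.
Qed.

Theorem potential_props K u th : bounded_set Om -> closed K -> K `<=` Om -> H1 Om u ->
  test_function Om th -> set_nbhs K [set x | th x = 1] ->
  let X := wvec Om (potential Om K u) in
  [/\ H1 Om (potential Om K u), cl (grads Om) X,
      forall f, test_function (Om `\` K) f -> ip X (grad f) = 0 &
      cl (grads (Om `\` K)) (X - wvec Om (th \* u))].
Proof.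
move=> bO cK KO hu tth thK X.
have UO : Om `\` K `<=` Om by move=> x [].
pose eta := xget (cst 0) (is_cutoff Om K).
have [teta etaK] : is_cutoff Om K eta.
  by apply: (@xgetPex _ (cst 0) (is_cutoff Om K)); exists th.
have heta : H10 Om Om (eta \* u) by exact: H10_cutoff.
have hth : H10 Om Om (th \* u) by exact: H10_cutoff.
have [v hv] := is_potential_exists Om bO cK KO heta.
have [p1 p2 p3] : is_potential Om K (eta \* u) (potential Om K u).
  by apply: (@xgetPex _ (cst 0) (is_potential Om K (eta \* u))); exists v.
have oU : open (Om `\` K) by rewrite setDE; apply: openI => //; exact: closed_openC.
split.
- exact: p1.1.
- exact: H10_cl.
- move=> f tf; have [hf nf] := H1_test oOm UO tf.
  have := p3 f; rewrite (dirichletE oOm p1.1 hf) ipC (nrm0_ip _ nf) ipC; apply.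
  exact: H10_test.
(* The cutoff chosen by [xget] and th agree near K, so (eta - th) u lies in the H^1_0 space of Om
   off K: exchanging them changes the difference only by an element of the closure. *)
- have td : test_function (Om `\` K) (eta \- th).
    have [sd cd sO] := testB teta tth; split => // x sx; split; first exact: sO.
    move=> Kx.
    have [C1 [oC1 KC1 C1e]] := iffLR (set_nbhsP _ _) etaK.
    have [C2 [oC2 KC2 C2e]] := iffLR (set_nbhsP _ _) thK.
    have nC : nbhs x (C1 `&` C2).
      by apply: filterI; apply: open_nbhs_nbhs; split => //; [exact: KC1|exact: KC2].
    have [y [/= dy [/C1e /= e1 /C2e /= e2]]] := sx _ nC.
    by move: dy; rewrite e1 e2 subrr eqxx.
  have hd' := H10_cutoff oU UO td hu.
  have := H10_cl oOm UO hd'.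
  have -> : (eta \- th) \* u = (eta \* u) \- (th \* u) by apply/funext => x /=; ring.
  have [_ n1] := H1_sub oOm heta.1 hth.1; move/(nrm0_cl n1) => c1.
  have := H10_cl oOm UO p2; have [_ n2] := H1_sub oOm p1.1 heta.1; move/(nrm0_cl n2) => c2.
  have := subspaceD (subspace_cl (subspace_grads _)) c2 c1; rewrite -/X.
  by rewrite addrA subrK.
Qed.

End sobolev.

From mathcomp Require Import finmap summability.

#[local] Existing Instance totally_filter.

(** * Real-analytic data *)

Section multiindices.
Context {R : realType} {d : nat}.
Local Notation I := {ffun 'I_d -> nat}.
Implicit Types (a : I) (f : I -> R).

Definition mdeg a : nat := \sum_(i < d) a i.

(** Enumerates the multi-indices of degree below n: all their components are below n, so they come
    from finite functions into 'I_n. These sets are cofinal among the finite sets, which turns the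
    unordered sum into the limit of a sequence. *)
Definition mlow n : seq I :=
  [seq a <- [seq ([ffun i => val (b i)] : I) | b : {ffun 'I_d -> 'I_n} <- enum {: {ffun 'I_d -> 'I_n}}] | (mdeg a < n)%N].

Lemma mem_mlow n a : (a \in mlow n) = (mdeg a < n)%N.
Proof.
rewrite mem_filter; case: ltnP => //= an; apply/mapP.
have ai i : (a i < n)%N.
  by apply: leq_ltn_trans an; rewrite /mdeg (bigD1 i)//= leq_addr.
exists [ffun i => Ordinal (ai i)]; first by rewrite mem_enum.
by apply/ffunP => i; rewrite !ffunE.
Qed.

Lemma uniq_mlow n : uniq (mlow n).
Proof.
rewrite filter_uniq// map_inj_uniq ?enum_uniq// => b b' /ffunP h.
by apply/ffunP => i; apply: val_inj; have := h i; rewrite !ffunE.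
Qed.

Lemma size_mlow n : (size (mlow n) <= n ^ d)%N.
Proof.
rewrite size_filter; apply: leq_trans (count_size _ _) _.
by rewrite size_map -cardE card_ffun !card_ord.
Qed.

Lemma sum_mlow n f : \sum_(a <- mlow n) f a =
  \sum_(k < n) \sum_(a <- mlow k.+1 | mdeg a == k) f a.
Proof.
elim: n => [|n IH].
  rewrite big_ord0 big_seq big1// => a; by rewrite mem_mlow.
rewrite big_ord_recr /= -IH (bigID (fun a => mdeg a == n)) /= addrC; congr (_ + _).
rewrite -big_filter; apply: perm_big; apply: uniq_perm.
- by rewrite filter_uniq// uniq_mlow.
- exact: uniq_mlow.
- by move=> a; rewrite mem_filter !mem_mlow ltnS ltn_neqAle.
Qed.

Lemma partial_sum_seq f (A : {fset I}) : partial_sum f A = \sum_(a <- A) f a.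
Proof. by rewrite /partial_sum big_seq_fsetE. Qed.

Lemma partial_sum_mlow f n : partial_sum f [fset a in mlow n]%fset = \sum_(a <- mlow n) f a.
Proof.
rewrite partial_sum_seq; apply: perm_big; apply: uniq_perm; rewrite ?fset_uniq ?uniq_mlow//.
by move=> a; rewrite in_fset.
Qed.

Lemma mlow_cvg f (l : R) : partial_sum f A @[A --> totally] --> l ->
  \sum_(a <- mlow n) f a @[n --> \oo] --> l.
Proof.
move=> h; have e : (fun n => \sum_(a <- mlow n) f a) = partial_sum f \o (fun n => [fset a in mlow n]%fset).
  by apply/funext => n /=; rewrite partial_sum_mlow.
rewrite e; apply: cvg_comp h => P [A _ hA].
exists (\sum_(a <- A) mdeg a).+1 => // n /= hn; apply: hA => /=.
apply/fsubsetP => a aA; rewrite in_fset mem_mlow; apply: leq_trans hn.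
by rewrite ltnS (big_fsetD1 a aA) /= leq_addr.
Qed.

(** Outside a finite set A0 adding one index moves the partial sum between two values within 1 of
    the limit, so the term is at most 2; the indices in A0 are covered by the sum of their absolute
    values. *)
Lemma totally_bounded_terms f (l : R) : partial_sum f A @[A --> totally] --> l ->
  exists C : R, 0 <= C /\ forall a, `|f a| <= C.
Proof.
move=> /cvgrPdist_lt /(_ 1 ltr01) [A0 _ hA].
have S0 : 0 <= \sum_(a <- A0) `|f a| by apply: sumr_ge0.
exists (2 + \sum_(a <- A0) `|f a|); split; first by rewrite addr_ge0.
move=> a; have [aA|aA] := boolP (a \in A0).
  rewrite (big_fsetD1 a aA) /= addrCA lerDl addr_ge0//; exact: sumr_ge0.
have h1 := hA A0 (fsubset_refl _).
have h2 := hA (a |` A0)%fset (fsubsetU1 _ _).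
move: h1 h2; rewrite /= !partial_sum_seq big_fsetU1//=.
move: (\sum_(i <- A0) f i) (\sum_(a <- A0) `|f a|) S0 (f a) => s S S0 t h1 h2.
have -> : t = (l - s) - (l - (t + s)) by ring.
by apply: le_trans (ler_normB _ _) _; lra.
Qed.

Definition monom a (x : 'rV[R]_d) : R := \prod_(i < d) x ord0 i ^+ a i.

Lemma monomZ a (e : R) x : monom a (e *: x) = e ^+ mdeg a * monom a x.
Proof.
rewrite /monom /mdeg; under eq_bigr do rewrite mxE exprMn.
by rewrite big_split /= -expr_sum.
Qed.

Lemma monom_const a (t : R) : monom a (const_mx t) = t ^+ mdeg a.
Proof. by rewrite /monom /mdeg expr_sum; apply: eq_bigr => i _; rewrite mxE. Qed.

End multiindices.

(** * C^1 bounds for monomials and energy of cut off functions *)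

Section C1_bounds.
Context {R : realType} {d : nat}.
Implicit Types (f g chi : 'rV[R]_d -> R).
Local Notation mu := (leb R d).
Variable M : R.
Hypothesis M0 : 0 < M.

Definition C1le (B : R) f := [/\ smooth f, forall x, `|x| <= M -> `|f x| <= B &
  forall i x, `|x| <= M -> `|partial i f x| <= B].

Let sder f x i : smooth f -> derivable f x (delta_mx ord0 i).
Proof. exact: smooth_derivable. Qed.

(* The estimates of a monomial of degree k, stated in a form stable under products. *)
Definition pwle (k : nat) f := [/\ smooth f, forall x, `|x| <= M -> `|f x| <= M ^+ k &
  forall i x, `|x| <= M -> `|partial i f x| * M <= k%:R * M ^+ k].

Lemma pwle1 : pwle 0 (fun=> 1).
Proof.
split; first exact: smooth_cst.
  by move=> x _; rewrite normr1 expr0.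
by move=> i x _; rewrite partial_cst normr0 !mul0r.
Qed.

Lemma pwleM k l f g : pwle k f -> pwle l g -> pwle (k + l) (f \* g).
Proof.
move=> [sf f1 f2] [sg g1 g2]; split; first exact: smoothM.
  by move=> x xM; rewrite normrM exprD ler_pM ?normr_ge0 ?f1 ?g1.
move=> i x xM; rewrite partialM; [|by move=> y; exact: sder..].
have := f1 x xM; have := g1 x xM; have := f2 i x xM; have := g2 i x xM.
rewrite /= natrD exprD; have := ltW M0.
have := exprn_ge0 k (ltW M0); have := exprn_ge0 l (ltW M0).
move: (M ^+ k) (M ^+ l) (k%:R : R) (l%:R : R) (f x) (g x) (partial i f x) (partial i g x) => a b m n s t s' t'.
move=> a0 b0 M0' h1 h2 h3 h4.
apply: (@le_trans _ _ (`|s| * (`|t'| * M) + `|t| * (`|s'| * M))).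
  rewrite !mulrA -mulrDl ler_wpM2r//.
  by apply: le_trans (ler_normD _ _) _; rewrite !normrM.
rewrite (_ : (m + n) * (a * b) = a * (n * b) + b * (m * a)); last by ring.
by apply: lerD; apply: ler_pM => //; rewrite mulr_ge0.
Qed.

Lemma pwle_coord j : pwle 1 (fun x => x ord0 j).
Proof.
split; first exact: smooth_coord.
  by move=> x xM; rewrite expr1; apply: le_trans xM; exact: coord_le_norm.
move=> i x _; rewrite partial_coord mul1r expr1 normr_nat.
by case: eqP => _; rewrite ?mul1r ?mul0r// ltW.
Qed.

Lemma pwleX k n f : pwle k f -> pwle (k * n) (fun x => f x ^+ n).
Proof.
move=> h; elim: n => [|n IH]; first by rewrite muln0; exact: pwle1.
have := pwleM h IH; rewrite mulnS; congr pwle.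
by apply/funext => x /=; rewrite exprS.
Qed.

Lemma pwle_monom (a : {ffun 'I_d -> nat}) : pwle (mdeg a) (@monom R d a).
Proof.
rewrite /mdeg (_ : monom a = fun x => \prod_(i <- index_enum 'I_d) x ord0 i ^+ a i)//.
elim: (index_enum _) => [|j s IH].
  by rewrite big_nil; have := pwle1; congr pwle; apply/funext => x; rewrite big_nil.
rewrite big_cons; have := pwleM (pwleX (a j) (pwle_coord j)) IH; rewrite mul1n; congr pwle.
by apply/funext => x; rewrite big_cons.
Qed.

Lemma C1le_monom (a : {ffun 'I_d -> nat}) :
  C1le ((1 + M^-1) * ((mdeg a).+1%:R * M ^+ mdeg a)) (@monom R d a).
Proof.
have [s h1 h2] := pwle_monom a; set k := mdeg a in h1 h2 *.
have Mk := exprn_ge0 k (ltW M0).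
have Mi : 0 <= M^-1 by rewrite invr_ge0 ltW.
have k0 : 0 <= (k%:R : R) by [].
split => // [x xM|i x xM].
  apply: le_trans (h1 x xM) _; rewrite -natr1.
  move: (M ^+ k) (M^-1) (k%:R : R) Mk Mi k0 => a' b c a0 b0 c0.
  have : 0 <= b * (c * a') by rewrite !mulr_ge0.
  have : 0 <= c * a' by rewrite mulr_ge0.
  have : 0 <= b * a' by rewrite mulr_ge0.
  by lra.
have : `|partial i (@monom R d a) x| <= M^-1 * (k%:R * M ^+ k).
  by rewrite mulrC ler_pdivlMr// h2.
move=> h; apply: le_trans h _; rewrite -natr1.
move: (M ^+ k) (M^-1) (k%:R : R) Mk Mi k0 => a' b c a0 b0 c0.
have : 0 <= c * a' by rewrite mulr_ge0.
have : 0 <= b * a' by rewrite mulr_ge0.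
by lra.
Qed.

Lemma C1le_sum (J : Type) (s : seq J) (P : pred J) (c : J -> R) (F : J -> 'rV[R]_d -> R) (B : R) :
  0 <= B -> (forall j, P j -> C1le B (F j)) ->
  forall D : R, 0 <= D -> (forall j, P j -> `|c j| <= D) ->
  C1le ((size s)%:R * (D * B)) (fun x => \sum_(j <- s | P j) c j * F j x).
Proof.
move=> B0 hF D D0 hc; elim: s => [|j s IH].
  rewrite mul0r (_ : (fun x => _) = fun=> 0); last by apply/funext => x; rewrite big_nil.
  by split => [|x _|i x _]; [exact: smooth_cst|rewrite normr0|rewrite partial_cst normr0].
rewrite [size _]/= -natr1 mulrDl mul1r.
have [Pj|nPj] := boolP (P j); last first.
  have -> : (fun x => \sum_(j <- j :: s | P j) c j * F j x) = (fun x => \sum_(j <- s | P j) c j * F j x).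
    by apply/funext => x; rewrite big_cons (negbTE nPj).
  case: IH => s1 s2 s3.
  by split => // [x xM|i x xM]; [apply: le_trans (s2 _ xM) _|apply: le_trans (s3 i _ xM) _];
    rewrite lerDl mulr_ge0.
have -> : (fun x => \sum_(j <- j :: s | P j) c j * F j x) =
   (fun x => c j * F j x) \+ (fun x => \sum_(j <- s | P j) c j * F j x).
  by apply/funext => x; rewrite big_cons Pj.
case: IH => s1 s2 s3; have [t1 t2 t3] := hF j Pj.
have sc : smooth (fun x => c j * F j x) by apply: smoothZ.
split.
- exact: smoothD.
- move=> x xM; rewrite addrC; apply: le_trans (ler_normD _ _) _; apply: lerD; last exact: s2.
  by rewrite normrM ler_pM ?hc ?t2.
- move=> i x xM; rewrite partialD; [|by move=> y; exact: sder..].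
  rewrite addrC; apply: le_trans (ler_normD _ _) _; apply: lerD; last exact: s3.
  rewrite (@partialM _ _ (fun=> c j) (F j)); [|by move=> y; apply: sder; exact: smooth_cst|by move=> y; exact: sder].
  by rewrite /= partial_cst mulr0 addr0 normrM ler_pM ?hc ?t3.
Qed.

Lemma nrm_grad_cut chi : test_function setT chi -> (forall x, M < `|x| -> chi x = 0) ->
  exists K : R, 0 <= K /\ forall (B : R) p, 0 <= B -> C1le B p -> nrm (grad (chi \* p)) <= K * B.
Proof.
move=> tc cM; have sc := test_smooth tc.
have [D0 [_ [D00 _ cD _]]] := test_bounded tc.
have hD : exists D : R, forall i x, `|partial i chi x| <= D.
  have h i : exists D : R, forall x, `|partial i chi x| <= D.
    by have [D [_ [_ _ h _]]] := test_bounded (test_partial i tc); exists D.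
  have [f hf] := choice h.
  exists (\sum_(i < d) `|f i|) => i x; apply: le_trans (hf i x) _; apply: le_trans (ler_norm _) _.
  by rewrite (bigD1 i)//= lerDl; apply: sumr_ge0.
have [D hD'] := hD.
pose W : R := D0 + `|D|.
have W0 : 0 <= W by rewrite addr_ge0.
pose K2 : R := d%:R * (W ^+ 2 * @cubevol R d M).
have cv0 : 0 <= @cubevol R d M by apply: cubevol_ge0; exact: ltW.
have K20 : 0 <= K2 by rewrite !mulr_ge0 ?sqr_ge0.
exists (Num.sqrt K2); split; first exact: sqrtr_ge0.
move=> B p B0 [sp p1 p2].
have tcp : test_function setT (chi \* p) by exact: testMl.
rewrite /nrm -[X in _ * X]ger0_norm// -sqrtr_sqr -sqrtrM//.
rewrite ler_sqrt ?mulr_ge0 ?sqr_ge0//.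
rewrite l2ip_sq /K2 -mulrA -[d in d%:R * _]card_ord mulr_natl -sumr_const.
apply: ler_sum => i _; rewrite (gradE i tcp).
have cp x : chi x * p x = (chi \* p) x by [].
have z0 x : M < `|x| -> partial i (chi \* p) x = 0.
  move=> xM; apply: partial_supp => sx.
  have o : open [set y : 'rV[R]_d | M < `|y|].
    rewrite (_ : [set y | M < `|y|] = ~` cube M); first exact/closed_openC/closed_cube.
    by apply/seteqP; split => y /=; rewrite /cube /= ltNge => /negP.
  have [y [/= ny My]] := sx _ (open_nbhs_nbhs (conj o xM)).
  by move: ny; rewrite cM// mul0r eqxx.
apply: le_trans (ler_norm _) _.
rewrite mulrAC; apply: Int_bounded; [exact: ltW|by rewrite mulr_ge0 ?sqr_ge0| | |].
- apply: measurable_funX; apply: smooth_measurable; apply: smooth_partial; exact: test_smooth tcp.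
- move=> x xM; rewrite normrX -exprMn lerXn2r ?nnegrE ?mulr_ge0//.
  rewrite partialM; [|by move=> y; exact: sder..].
  rewrite /W mulrDl; apply: le_trans (ler_normD _ _) _; rewrite !normrM; apply: lerD.
    by rewrite ler_pM// p2.
  rewrite mulrC ler_pM ?p1//; apply: le_trans (hD' i x) _; exact: ler_norm.
- by move=> x xM; rewrite z0// expr0n.
Qed.

End C1_bounds.

Section analytic_cut.
Context {R : realType} {d : nat} (hd : (3 <= d)%N).
Implicit Types (f g chi : 'rV[R]_d -> R).
Local Notation mu := (leb R d).

Lemma grad0 : grad (fun=> 0 : R) = 0 :> L2H R d d.
Proof.
have t0 := @test0 R d setT.
have -> : (fun=> 0) = (fun=> 0) \- (fun=> 0) :> ('rV[R]_d -> R).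
  by apply/funext => x /=; rewrite subrr.
by rewrite (gradB t0 t0) subrr.
Qed.

Lemma scv0 (e : R) : 0 < e -> scv e 0 = 0 :> L2H R d d.
Proof.
move=> e0; have := @scv_lin R d e 1 0 0 e0; rewrite !scale1r addr0 => /eqP.
by rewrite -{1}[scv e 0]addr0 (inj_eq (addrI _)) eq_sym => /eqP.
Qed.

Definition mpart (c : {ffun 'I_d -> nat} -> R) k : 'rV[R]_d -> R :=
  fun x => \sum_(a <- mlow k.+1 | mdeg a == k) c a * monom a x.

Lemma mpartZ c k (e : R) x : mpart c k (e *: x) = e ^+ k * mpart c k x.
Proof.
rewrite /mpart mulr_sumr; apply: eq_bigr => a /eqP ak.
by rewrite monomZ ak mulrCA.
Qed.

Lemma smooth_mpart c k : smooth (mpart c k).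
Proof.
apply: smooth_sum => a; apply: smoothZ.
by have [] := @C1le_monom R d 1 ltr01 a.
Qed.

(** At most (k+1)^d multi-indices have degree k, and differentiation costs another factor k + 1;
    with k + 1 <= 2^k this is absorbed in the factor 2^(d+1) of the ratio. *)
Lemma mpart_C1le c (C t M : R) : 0 < M -> 0 < t -> 0 <= C ->
  (forall a, `|c a * t ^+ mdeg a| <= C) -> exists C' rho : R, [/\ 0 <= C', 0 <= rho &
  forall k, C1le M (C' * rho ^+ k) (mpart c k)].
Proof.
move=> M0 t0 C0 hc.
have Mi : 0 <= M^-1 by rewrite invr_ge0 ltW.
exists (C * (1 + M^-1)), (2 ^+ d.+1 * (M / t)); split.
- by rewrite mulr_ge0// addr_ge0.
- by rewrite !mulr_ge0 ?exprn_ge0 ?invr_ge0// ltW.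
move=> k.
pose B : R := (1 + M^-1) * (k.+1%:R * M ^+ k).
have B0 : 0 <= B by rewrite !mulr_ge0 ?addr_ge0 ?exprn_ge0// ltW.
have D0 : 0 <= C * t^-1 ^+ k by rewrite mulr_ge0// exprn_ge0// invr_ge0 ltW.
have hD (a : {ffun 'I_d -> nat}) : mdeg a == k -> `|c a| <= C * t^-1 ^+ k.
  move=> /eqP ak; have := hc a; rewrite ak normrM (ger0_norm (exprn_ge0 _ (ltW t0))).
  by rewrite -ler_pdivlMr ?exprn_gt0// exprVn.
have [|s1 s2 s3] := @C1le_sum R d M _ (mlow k.+1) (fun a => mdeg a == k) c (@monom R d) B B0 _ _ D0 hD.
  by move=> a /eqP ak; have := C1le_monom M0 a; rewrite ak.
have le : (size (@mlow d k.+1))%:R * (C * t^-1 ^+ k * B) <= C * (1 + M^-1) * (2 ^+ d.+1 * (M / t)) ^+ k.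
  apply: (@le_trans _ _ ((k.+1%:R ^+ d) * (C * t^-1 ^+ k * B))).
    apply: ler_wpM2r; first exact: mulr_ge0.
    by rewrite -natrX ler_nat; exact: size_mlow.
  have -> : k.+1%:R ^+ d * (C * t^-1 ^+ k * B) = C * (1 + M^-1) * (k.+1%:R ^+ d.+1 * (M / t) ^+ k).
    by rewrite /B exprMn exprS; ring.
  apply: ler_wpM2l; first by rewrite mulr_ge0// addr_ge0.
  rewrite [leRHS]exprMn; apply: ler_wpM2r; first by rewrite exprn_ge0// divr_ge0// ltW.
  rewrite exprAC lerXn2r ?nnegrE ?exprn_ge0//.
  rewrite -natrX ler_nat; exact: ltn_expl.
split => // [x xM|i x xM]; [apply: le_trans (s2 x xM) le|apply: le_trans (s3 i x xM) le].
Qed.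

(** The homogeneous part p_k of the Taylor series satisfies chi(x / e) p_k(x) = e^k (chi p_k)(x /
    e). Hence the gradient of each cut off term is e^k S_e applied to the gradient of chi p_k, a
    field that does not depend on e. *)
Theorem analytic_cut (Om : set 'rV[R]_d) u chi (M : R) : open Om -> 0 < M ->
  test_function setT chi -> (forall x, M < `|x| -> chi x = 0) -> H1 Om u -> analytic_at u 0 ->
  exists (Phi : nat -> L2H R d d) (C rho e1 : R),
  [/\ 0 <= C, 0 <= rho, 0 < e1, forall k, nrm (Phi k) <= C * rho ^+ k &
   forall e, 0 < e < e1 -> test_function Om (dil e chi) ->
   exists Y, hcvg (fun n => \sum_(k < n) e ^+ k *: Phi k) Y /\
     nrm (wvec Om (dil e chi \* u) - scv e Y) = 0].
Proof.
move=> oOm M0 tchi chiM hu [c [r [r0 hc]]].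
have cvgu x : `|x| < r -> (fun n => \sum_(k < n) mpart c k x) @ \oo --> u x.
  move=> xr; have := hc x; rewrite subr0 => /(_ xr) h.
  have {h}/mlow_cvg h : partial_sum (fun a => c a * monom a x) A @[A --> totally] --> u x.
    have E : (fun a : {ffun 'I_d -> nat} => c a * \prod_(i < d) (x ord0 i - (0 : 'rV[R]_d) ord0 i) ^+ a i)
        = (fun a => c a * monom a x).
      apply/funext => a; congr (_ * _).
      by apply: eq_bigr => i _; rewrite mxE subr0.
    by move: h; rewrite E.
  by apply: seq_cvg_ext h => n; rewrite sum_mlow.
(* At the point with all coordinates r / 2 every monomial is a power of r / 2, so convergence there
   bounds all coefficients geometrically. *)
have [C0 [C00 hC0]] : exists C0 : R, 0 <= C0 /\ forall a, `|c a * (r / 2) ^+ mdeg a| <= C0.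
  have r2 : 0 < r / 2 by rewrite divr_gt0.
  have : `|const_mx (r / 2) - 0 : 'rV[R]_d| < r.
    rewrite subr0; apply: (@le_lt_trans _ _ (r / 2)); last by lra.
    by apply: norm_le_coord (ltW r2) _ => i; rewrite mxE ger0_norm// ltW.
  move/hc/totally_bounded_terms => [C0 [C00 hC]]; exists C0; split => // a.
  have := hC a; congr (`| _ * _| <= _).
  by rewrite -monom_const; apply: eq_bigr => i _; rewrite !mxE subr0.
have r2 : 0 < r / 2 by rewrite divr_gt0.
have [C1 [rho [C10 rho0 hp]]] := mpart_C1le M0 r2 C00 hC0.
have [K [K0 hK]] := nrm_grad_cut M0 tchi chiM.
have tP k : test_function setT (chi \* mpart c k) by apply: testMl => //; exact: smooth_mpart.
pose Phi k := grad (chi \* mpart c k).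
have nPhi k : nrm (Phi k) <= K * C1 * rho ^+ k.
  by rewrite -mulrA; apply: hK (hp k); rewrite mulr_ge0// exprn_ge0.
(* The first bound on e keeps the support of the dilated cutoff inside the domain of convergence;
   the second gives rho e < 1. *)
exists Phi, (K * C1), rho, (Num.min (r / M) (rho + 1)^-1); split => //.
- exact: mulr_ge0.
- by rewrite lt_min divr_gt0//= invr_gt0 ltr_wpDl.
move=> e /andP[e0]; rewrite lt_min => /andP[eM er] tpsi.
have {}eM : e * M < r by rewrite -ltr_pdivlMr.
have q1 : 0 <= rho * e < 1.
  rewrite mulr_ge0 ?(ltW e0)//=; have : e * (rho + 1) < 1.
    by rewrite -ltr_pdivlMr ?ltr_wpDl// div1r.
  by lra.
have sT : @subspace R (L2H R d d) (fun=> True) by split.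
have nx n : nrm (e ^+ n *: Phi n) <= K * C1 * (rho * e) ^+ n.
  rewrite nrmZ ger0_norm ?exprn_ge0 ?(ltW e0)// exprMn mulrA mulrC.
  by apply: ler_wpM2r; [exact: exprn_ge0 (ltW e0)|exact: nPhi].
have [Y _ hY] := @hseries_cvg R (L2H R d d) (fun=> True) (fun k => e ^+ k *: Phi k) (K * C1) (rho * e)
  sT (fun _ _ => Logic.I) (fun=> Logic.I) q1 nx.
exists Y; split; first exact: hY.
pose psi := dil e chi.
pose f n := psi \* (fun x => \sum_(k < n) mpart c k x).
have tf n : test_function Om (f n).
  by apply: testMl => //; apply: smooth_sum => k; exact: smooth_mpart.
have pE k : e ^+ k *: dil e (chi \* mpart c k) = psi \* mpart c k.
  apply/funext => x.
  change (e ^+ k * (chi (e^-1 *: x + 0) * mpart c k (e^-1 *: x + 0)) = chi (e^-1 *: x + 0) * mpart c k x).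
  by rewrite mulrCA -mpartZ addr0 scalerA mulfV ?gt_eqF// scale1r.
have gE n : grad (f n) = scv e (\sum_(k < n) e ^+ k *: Phi k).
  elim: n => [|n IH].
    rewrite big_ord0 scv0// -grad0; congr grad; apply/funext => x.
    by rewrite /f /= big_ord0 mulr0.
  have -> : f n.+1 = e ^+ n *: dil e (chi \* mpart c n) + f n.
    rewrite pE; apply/funext => x; rewrite /f.
    change (psi x * (\sum_(k < n.+1) mpart c k x) = psi x * mpart c n x + psi x * (\sum_(k < n) mpart c k x)).
    by rewrite big_ord_recr /= mulrDr addrC.
  have t1 : test_function setT (dil e (chi \* mpart c n)) by exact: test_dilT (tP n).
  rewrite (grad_lin _ t1 (testT (tf n))) IH -(scv_grad e0 (tP n)) -/(Phi n) -scv_lin//.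
  by rewrite big_ord_recr /= addrC.
have fZ : hcvg (fun n => grad (f n)) (scv e Y).
  have -> : (fun n => grad (f n)) = (fun n => scv e (\sum_(k < n) e ^+ k *: Phi k)) by apply/funext.
  by apply: hcvg_scv => //; exact: ltnW.
have UO : Om `<=` Om by [].
have hpsi : H10 Om Om (psi \* u) := H10_cutoff oOm oOm UO tpsi hu.
have psi0 x : e * M < `|x| -> psi x = 0.
  move=> ex; apply: chiM; rewrite addr0 normrZ gtr0_norm ?invr_gt0// mulrC.
  by rewrite ltr_pdivlMr// mulrC.
have [D [_ [D0 _ hD _]]] := test_bounded tpsi.
pose q := rho * e; pose L : R := D * (C1 / (1 - q)).
have q1' : 0 < 1 - q by case/andP: q1 => _; rewrite subr_gt0.
have L0 : 0 <= L by rewrite !mulr_ge0// invr_ge0 ltW.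
have key n x : Om x -> `|f n x - (psi \* u) x| <= L * q ^+ n.
  move=> Ox; have [xe|xe] := ltP (e * M) `|x|.
    rewrite /f /= psi0// !mul0r subrr normr0 mulr_ge0// exprn_ge0//.
    by case/andP: q1.
  have [|l [h1 h2]] := @series_geo R (fun k => mpart c k x) C1 q q1.
    move=> k; have -> : x = e *: (e^-1 *: x) by rewrite scalerA mulfV ?gt_eqF// scale1r.
    rewrite mpartZ normrM ger0_norm ?exprn_ge0 ?(ltW e0)// /q exprMn mulrA mulrC.
    apply: ler_wpM2r; first exact: exprn_ge0 (ltW e0).
    have [_ + _] := hp k; apply.
    by rewrite normrZ gtr0_norm ?invr_gt0// mulrC ler_pdivrMr// mulrC.
  have lu : l = u x.
    by apply: (cvg_unique (@Rhausdorff R) h1); apply: cvgu; apply: le_lt_trans eM.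
  rewrite /f /= -mulrBr normrM /L -mulrA distrC -lu.
  by apply: ler_pM; [exact: normr_ge0|exact: normr_ge0|exact: hD|exact: h2].
apply: (H10_of_seq oOm UO tf fZ hpsi.1.1 _).2.
move=> e' e'0.
have qq : 0 <= q ^+ 2 < 1.
  by case/andP: q1 => a b; rewrite sqr_ge0 expr_lt1.
have [N hN] := @geo_small R (L ^+ 2 * @cubevol R d (e * M)) (q ^+ 2) e' qq e'0.
exists N => n Nn; apply: le_lt_trans (hN n Nn); apply: le_trans (ler_norm _) _.
rewrite mulrAC.
have eM0 : 0 <= e * M by rewrite mulr_ge0// ltW.
have fo x : ~ Om x -> f n x = 0.
  by move=> nO; apply: suppP; case: (tf n) => _ _ s /s.
have su := L2_restrict oOm hpsi.1.1.
apply: Int_bounded; first exact: eM0.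
- by rewrite mulr_ge0 ?sqr_ge0// exprn_ge0// sqr_ge0.
- by apply: measurable_funX; apply: measurable_funB; [exact: (test_sqint (tf n)).1|exact: su.1].
- move=> x _; rewrite patchE; case: ifPn => [|/negP xO].
    move=> /set_mem Ox; rewrite normrX exprAC -exprMn lerXn2r ?nnegrE//.
      by rewrite mulr_ge0// exprn_ge0//; case/andP: q1.
    exact: key.
  rewrite fo ?subrr ?expr0n/= ?normr0; last by move=> h; apply: xO; exact/mem_set.
  by rewrite mulr_ge0 ?sqr_ge0// exprn_ge0// sqr_ge0.
- move=> x xe; rewrite patchE /f /= psi0// !mul0r.
  by case: ifP => _; rewrite subrr expr0n.
Qed.

End analytic_cut.

Lemma mul_lin (R : comPzRingType) (a p q r : R) : r * (a * p + q) = a * (r * p) + r * q.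
Proof. by rewrite mulrDr mulrCA. Qed.

(** * Expansion of the capacity *)

Section scaled_potential.
Context {R : realType} {d : nat} (hd : (3 <= d)%N).
Implicit Types (f g chi u : 'rV[R]_d -> R) (X Y Z : L2H R d d) (U V : set 'rV[R]_d).
Local Notation test := (test_function setT).

Lemma test_setI U V f g : test_function U f -> test_function V g -> test_function (U `&` V) (f \* g).
Proof.
move=> [sf cf fU] [sg cg gV].
apply: (@test_of _ _ _ (supp f `&` supp g)).
- exact: smoothM.
- by apply: (subclosed_compact _ cf) => [|x []//]; apply: closedI; exact: closed_closure.
- by move=> x [/fU Ux /gV Vx].
- move=> x nx; have [fx|/suppP h] := pselect (supp f x); last by rewrite /= h mul0r.
  have [gx|/suppP h] := pselect (supp g x); last by rewrite /= h mulr0.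
  by case: nx.
Qed.

Variables (Om K : set 'rV[R]_d) (chi : 'rV[R]_d -> R) (e : R) (C : set 'rV[R]_d).
Hypotheses (oOm : open Om) (bOm : bounded_set Om) (cK : compact K) (e0 : 0 < e).
Let Ke : set 'rV[R]_d := [set e *: x | x in K].
Hypotheses (KO : Ke `<=` Om)
  (tpsi : test_function Om (dil e chi)) (oC : open C) (KC : K `<=` C)
  (chi1 : forall x, C x -> chi x = 1).

Let en : e != 0. Proof. by rewrite gt_eqF. Qed.

Let d2 : (2 <= d)%N. Proof. exact: ltnW. Qed.

Lemma closed_scaled : closed Ke.
Proof.
apply: compact_closed; first exact: norm_hausdorff.
have -> : Ke = (fun x => e *: x + 0) @` K.
  by apply/seteqP; split => _ [x Kx <-]; exists x; rewrite ?addr0.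
by apply: continuous_compact => //; apply: continuous_subspaceT; exact: continuous_affine.
Qed.

Let psi := dil e chi.
Let Ce : set 'rV[R]_d := [set x | C (e^-1 *: x + 0)].

Let oCe : open Ce.
Proof. by move/continuousP: (@continuous_affine R d e^-1 0); apply. Qed.

Let psi1 x : Ce x -> psi x = 1. Proof. by move=> h; exact: chi1. Qed.

Let KCe : Ke `<=` Ce.
Proof. by move=> _ [x Kx <-]; rewrite /Ce /= scalerA mulVf// scale1r addr0; exact: KC. Qed.

Lemma scaled_cutoff_nbhs : set_nbhs Ke [set x | psi x = 1].
Proof. by apply/set_nbhsP; exists Ce. Qed.

Lemma test_one_sub f : test_function Om f -> test_function (Om `\` Ke) (f \- psi \* f).
Proof.
move=> tf; have [sf cf fO] := tf.
have tt := testB tf (testMl tpsi sf).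
apply: (@test_of _ _ _ (supp f `&` ~` Ce)).
- exact: test_smooth tt.
- apply: (subclosed_compact _ cf) => [|x []//]; apply: closedI; first exact: closed_closure.
  exact: open_closedC.
- by move=> x [/fO Ox nC]; split => // /KCe.
- move=> x nx; have [fx|/suppP h] := pselect (supp f x); last by rewrite /= h mulr0 subrr.
  have [Cx|nC] := pselect (Ce x); last by case: nx.
  by rewrite /= psi1// mul1r subrr.
Qed.

Lemma test_dil_out f : test_function (~` K) f -> test_function (Om `\` Ke) (psi \* dil e f).
Proof.
move=> tf; rewrite setDE; apply: test_setI => //; apply: (test_dil e0 tf) => x nK [y Ky].
by move/(scalerI en) => xy; apply: nK; rewrite -xy.
Qed.

Lemma test_undil_out f : test_function (Om `\` Ke) f -> test_function (~` K) (dil e^-1 f).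
Proof.
move=> tf; have ei : 0 < e^-1 by rewrite invr_gt0.
apply: (test_dil ei tf) => x [_ nK] Kx; apply: nK; exists (e^-1 *: x) => //.
by rewrite scalerA mulfV// scale1r.
Qed.

Lemma scv_undil f : test f -> scv e (grad (dil e^-1 f)) = grad f.
Proof.
move=> tf; have ei : 0 < e^-1 by rewrite invr_gt0.
by rewrite (scv_grad e0 (test_dilT ei tf)) dilK.
Qed.

Lemma cl_scv X : cl (grads setT) X -> cl (grads setT) (scv e X).
Proof.
move=> /grads_seq [f [tf fX]]; apply/cl_seq.
exists (fun n => grad (dil e (f n))); split.
  by move=> n; exists (dil e (f n)) => //; exact: test_dilT e0 (tf n).
have := hcvg_scv d2 e0 fX.
have -> : (fun n => scv e (grad (f n))) = (fun n => grad (dil e (f n))) by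
  apply/funext => n; exact: scv_grad e0 (tf n).
by [].
Qed.

Lemma scv_Mspace_orth m Z : Mspace K m -> cl (grads (Om `\` Ke)) Z -> ip (scv e m) Z = 0.
Proof.
move=> [_ hm]; apply: orth_cl => _ [f tf ->].
by rewrite -(scv_undil (testT tf)) ip_scv// hm ?mulr0//; exact: test_undil_out.
Qed.

(** Produces the splitting X = S_e w - h. The field w captures the action of X near e K: testing X
    only through the cutoff psi gives a functional on the whole space which vanishes on test
    functions off K, so its representative is harmonic there. In Om the two fields act alike,
    because (1 - psi) f avoids e K and X is harmonic off e K. *)
Lemma scaled_potential u Y : H1 Om u -> nrm (wvec Om (psi \* u) - scv e Y) = 0 ->
  H1 Om (potential Om Ke u) /\ exists2 X, X = wvec Om (potential Om Ke u) &
  [/\ cl (grads Om) X,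
      forall Z, cl (grads (Om `\` Ke)) Z -> ip X Z = 0,
      cl (grads (Om `\` Ke)) (X - scv e Y) &
      cl (grads Om) (scv e Y) /\
      exists w, Mspace K w /\ Gspace Om (scv e w - X)].
Proof.
move=> hu hY; pose X := wvec Om (potential Om Ke u).
have [h1 h2 h3 h4] := potential_props hd oOm bOm closed_scaled KO hu tpsi scaled_cutoff_nbhs.
have OO : Om `<=` Om by [].
have sT : subspace (cl (@grads R d setT)) by exact/subspace_cl/subspace_grads.
have clT : cl (grads setT) X.
  by apply: clS h2 => _ [f tf ->]; exists f => //; exact: testT tf.
split; [exact: h1|exists X; first by []].
split; [exact: h2| | |].
- move=> Z; apply: orth_cl => _ [f tf ->]; exact: h3.
- by apply: nrm0_cl h4; apply: nrm0_sub hY; exact: nrm0_refl.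
split; first by apply: (nrm0_cl hY); apply: (H10_cl oOm OO); exact: H10_cutoff.
have [C1 [C10 hC1]] := nrm_test_mul hd setT tpsi.
have es0 : 0 < e ^+ (d - 2) by rewrite exprn_gt0.
(* The factor undoes the scaling of the energy: the representative w satisfies <S_e w, grad (dil e
   f)> = <X, grad (psi dil e f)>. *)
pose l f := (e ^+ (d - 2))^-1 * ip X (grad (psi \* dil e f)).
have td f : test f -> test (dil e f) by exact: test_dilT.
have tpd f : test f -> test (psi \* dil e f).
  by move=> tf; apply: testMl (testT tpsi) _; exact: test_smooth (td f tf).
have llin a f g : test f -> test g -> l (a *: f + g) = a * l f + l g.
  move=> tf tg; rewrite /l.
  have -> : psi \* dil e (a *: f + g) = a *: (psi \* dil e f) + (psi \* dil e g).
    apply/funext => x.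
    change (psi x * (a * dil e f x + dil e g x) = a * (psi x * dil e f x) + psi x * dil e g x).
    ring.
  rewrite (grad_lin a (tpd f tf) (tpd g tg)) ipDr ipZr.
  exact: mul_lin.
have lbd f : test f -> `|l f| <= (e ^+ (d - 2))^-1 * (nrm X * (C1 * Num.sqrt (e ^+ (d - 2)))) * nrm (grad f).
  move=> tf; rewrite /l normrM ger0_norm ?invr_ge0 ?(ltW es0)// -mulrA.
  apply: ler_wpM2l; first by rewrite invr_ge0 ltW.
  apply: le_trans (cauchy_schwarz _ _) _; rewrite -!mulrA.
  apply: ler_wpM2l; first exact: nrm_ge0.
  apply: le_trans (hC1 _ (td f tf)) _; apply: ler_wpM2l; first exact: C10.
  by rewrite -(scv_grad e0 tf) (nrm_scv _ d2 e0).
have [w [clw hw]] := @riesz R (L2H R d d) _ test grad (test0 _)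
   (fun a e f te tf => test_lin a te tf) (fun a e f te tf => grad_lin a te tf) l _ llin lbd.
exists w; split; first split.
- exact: clw.
- move=> f tf; rewrite (hw _ (testT tf)) /l h3 ?mulr0//; exact: test_dil_out.
- split; first by apply: (subspaceB sT); [exact: cl_scv|exact: clT].
  move=> f tf; rewrite ipBl.
  have ei : 0 < e^-1 by rewrite invr_gt0.
  rewrite -{1}(scv_undil (testT tf)) (ip_scv _ _ d2 e0) (hw _ (test_dilT ei (testT tf))) /l dilK//.
  rewrite mulrA mulfV ?gt_eqF// mul1r -ipBr.
  have tpf : test_function Om (psi \* f) by apply: testMl tpsi _; exact: test_smooth tf.
  rewrite -(gradB tpf tf).
  have -> : (psi \* f) \- f = \- (f \- psi \* f) by apply/funext => x /=; ring.
  by apply: h3; apply: testN; exact: test_one_sub.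
Qed.

Lemma Cap_ip K' ua ub Xa Xb : H1 Om (potential Om K' ua) -> H1 Om (potential Om K' ub) ->
  Xa = wvec Om (potential Om K' ua) -> Xb = wvec Om (potential Om K' ub) ->
  Cap Om K' ua ub = ip Xa Xb.
Proof. by move=> ha hb -> ->; exact: dirichletE. Qed.

End scaled_potential.

Lemma psum_functional (R : realType) (H : hilbert R) (x : nat -> H) (y m : H) (e : R) :
  hcvg (fun n => \sum_(k < n) e ^+ k *: x k) y -> psum (fun k => ip m (x k)) e (ip m y).
Proof.
move=> h; have := hcvg_ip (hcvg_cst m) h; apply: seq_cvg_ext => n /=.
rewrite pseriesE ipC ip_suml; apply: eq_bigr => k _.
by rewrite ipZl mulrC ipC.
Qed.

Lemma geo_mono (R : realType) (C C' r r' : R) k : 0 <= C -> C <= C' -> 0 <= r -> r <= r' ->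
  C * r ^+ k <= C' * r' ^+ k.
Proof.
move=> C0 CC r0 rr; apply: ler_pM => //; first exact: exprn_ge0.
by rewrite lerXn2r// nnegrE// (le_trans r0).
Qed.

Section capacity_expansion.
Context {R : realType} {d : nat} (hd : (3 <= d)%N).
Implicit Types (X Y Z : L2H R d d).

Let d2 : (2 <= d)%N. Proof. exact: ltnW. Qed.

Lemma bounded_in_sqn (om : set 'rV[R]_d) : bounded_set om -> exists A : R, 0 < A /\
  closure om `<=` [set x | sqn x < A ^+ 2].
Proof.
move=> [M0 [_ hM]]; pose M := `|M0| + 1.
have M1 : 0 < M by rewrite ltr_wpDl.
have omM : om `<=` cube M.
  by move=> x /hM h; apply: h; rewrite (le_lt_trans (ler_norm _))// ltrDl.
exists ((d%:R + 1) * M); split; first by rewrite mulr_gt0// ltr_wpDl.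
move=> x cx.
have xM : `|x| <= M.
  have := closure_subset omM cx; rewrite -(iffLR (closure_id _) (@closed_cube R d M)).
  by [].
apply: le_lt_trans (sqn_le_norm x) _.
apply: (@le_lt_trans _ _ (d%:R * M ^+ 2)).
  by apply: ler_wpM2l => //; rewrite lerXn2r ?nnegrE ?(ltW M1).
rewrite exprMn; have : 0 < M ^+ 2 by rewrite exprn_gt0.
have : 0 <= (d%:R : R) by [].
by move: (d%:R : R) (M ^+ 2) => D S D0 S0; nra.
Qed.

Lemma open_contains_ball (Om : set 'rV[R]_d) : open Om -> Om 0 -> exists b : R, 0 < b /\
  [set x | sqn x <= (2 * b) ^+ 2] `<=` Om.
Proof.
move=> oOm O0; have /nbhs_ballP[r /= r0 rO] : nbhs (0 : 'rV[R]_d) Om by apply: open_nbhs_nbhs.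
exists (r / 4); split; first by rewrite divr_gt0.
move=> x /= hx; apply: rO; rewrite -ball_normE /= sub0r normrN.
have r4 : 0 <= 2 * (r / 4) by rewrite mulr_ge0// divr_ge0// ltW.
by apply: le_lt_trans (norm_le_sqn r4 hx) _; lra.
Qed.

Theorem Cap_expansion (Om K : set 'rV[R]_d) (ua ub : 'rV[R]_d -> R) (A : R) :
  open Om -> bounded_set Om -> Om 0 -> 0 < A -> compact K -> K `<=` [set x | sqn x < A ^+ 2] ->
  admissible_function Om ua -> admissible_function Om ub ->
  exists (e0 : R) (c : nat -> R), 0 < e0 /\
    forall e : R, 0 < e < e0 ->
      [set e *: x | x in K] `<=` Om /\
      exists S : R, psum c e S /\ Cap Om [set e *: x | x in K] ua ub = e ^+ (d - 2) * S.
Proof.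
move=> oOm bOm O0 A0 cK KA [hua /nbhs_singleton aua] [hub /nbhs_singleton aub].
have [b [b0 bO]] := open_contains_ball oOm O0.
have AA : 0 <= A < 2 * A by rewrite (ltW A0) mulr_natl mulr2n ltrDl.
have bb : 0 <= b < 2 * b by rewrite (ltW b0) mulr_natl mulr2n ltrDl.
have A20 : 0 < 2 * A by rewrite mulr_gt0.
pose chi := @bump R d A (2 * A); pose th := @bump R d b (2 * b).
have tchi0 : test_function [set x | sqn x <= (2 * A) ^+ 2] chi by exact: test_bump.
have tchi := testT tchi0.
have chi0 y : (2 * A) ^+ 2 < sqn y -> chi y = 0 by move=> /ltW; exact: bump_eq0.
have chi1 y : sqn y < A ^+ 2 -> chi y = 1 by move=> /ltW; exact: bump_eq1.
have tth : test_function Om th by exact: test_bump.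
have th1 z : sqn z < b ^+ 2 -> th z = 1 by move=> /ltW; exact: bump_eq1.
have th0 : supp th `<=` [set x | sqn x <= (2 * b) ^+ 2].
  by have [] : test_function [set x | sqn x <= (2 * b) ^+ 2] th by exact: test_bump.
have [beta [Cb [rb [e1 [Cb0 rb0 e10 [bl br] [bC bK]]]]]] :=
  key_aux hd A0 b0 KA bO tchi chi0 chi1 tth th1 th0.
have chiM x : 2 * A < `|x| -> chi x = 0.
  move=> hx; apply: chi0; rewrite ltNge; apply/negP => h.
  by have := norm_le_sqn (ltW A20) h; rewrite leNgt hx.
have [Pa [Ca [ra [ea [Ca0 ra0 ea0 nPa hPa]]]]] := analytic_cut hd oOm A20 tchi chiM hua aua.
have [Pb [Cc [rc [eb [Cc0 rc0 eb0 nPb hPb]]]]] := analytic_cut hd oOm A20 tchi chiM hub aub.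
pose C := Cb + Ca + Cc; pose rho := rb + ra + rc.
have CbC : Cb <= C by rewrite /C; lra.
have CaC : Ca <= C by rewrite /C; lra.
have CcC : Cc <= C by rewrite /C; lra.
have rbr : rb <= rho by rewrite /rho; lra.
have rar : ra <= rho by rewrite /rho; lra.
have rcr : rc <= rho by rewrite /rho; lra.
have C0 : 0 <= C := le_trans Cb0 CbC.
have rho0 : 0 <= rho := le_trans rb0 rbr.
have s1 : (0 < d - 2)%N by rewrite subn_gt0.
have bC' k (x g : L2H R d d) : Mspace K x -> Gspace Om g ->
    `|beta k x g| <= C * rho ^+ k * nrm x * nrm g.
  move=> Mx Gg; apply: le_trans (bC k x g Mx Gg) _.
  apply: ler_wpM2r; first exact: nrm_ge0.
  apply: ler_wpM2r; first exact: nrm_ge0.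
  exact: geo_mono.
have phil (P : nat -> L2H R d d) k (a : R) (x y : L2H R d d) : Mspace K x -> Mspace K y ->
  ip (a *: x + y) (P k) = a * ip x (P k) + ip y (P k) by move=> _ _; rewrite ipDl ipZl.
have paC k (x : L2H R d d) : Mspace K x -> `|ip x (Pa k)| <= C * rho ^+ k * nrm x.
  move=> _; apply: le_trans (cauchy_schwarz _ _) _; rewrite mulrC.
  apply: ler_wpM2r; first exact: nrm_ge0.
  by apply: le_trans (nPa k) _; exact: geo_mono.
have pbC k (x : L2H R d d) : Mspace K x -> `|ip x (Pb k)| <= C * rho ^+ k * nrm x.
  move=> _; apply: le_trans (cauchy_schwarz _ _) _; rewrite mulrC.
  apply: ler_wpM2r; first exact: nrm_ge0.
  by apply: le_trans (nPb k) _; exact: geo_mono.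
have [c [e2 [e20 sys]]] := @analytic_system R (L2H R d d) (Mspace K) (Gspace Om) beta
  (fun k m => ip m (Pa k)) (fun k m => ip m (Pb k)) C rho (d - 2)
  (subspaceM K) (subspaceG Om) (@clM R d K) (@clG R d Om) s1 C0 rho0 bl br bC'
  (phil Pa) paC (phil Pb) pbC.
(* Besides the thresholds already obtained, e A < b keeps the support of the dilated cutoff, of
   radius 2 A e, inside the ball of radius 2 b contained in Om. *)
exists (Num.min (Num.min e1 e2) (Num.min (Num.min ea eb) (b / A))), c; split.
  by rewrite !lt_min e10 e20 ea0 eb0 divr_gt0.
move=> e /andP[e0]; rewrite !lt_min => /andP[/andP[ee1 ee2] /andP[/andP[eea eeb] eeA]].
have eA : e * A < b by rewrite -ltr_pdivlMr.
have inO x : sqn x <= (2 * A) ^+ 2 -> Om (e *: x).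
  move=> hx; apply: bO => /=; rewrite sqnZ.
  apply: (@le_trans _ _ (e ^+ 2 * (2 * A) ^+ 2)); first by apply: ler_wpM2l => //; exact: sqr_ge0.
  rewrite -exprMn lerXn2r ?nnegrE//; first by rewrite !mulr_ge0// ltW.
    by rewrite mulr_ge0// ltW.
  by lra.
have KO : [set e *: x | x in K] `<=` Om.
  move=> _ [x Kx <-]; apply: inO; apply: ltW; apply: lt_le_trans (KA x Kx) _.
  by rewrite lerXn2r ?nnegrE// ltW//; case/andP: AA.
split; first exact: KO.
have tpsi : test_function Om (dil e chi) by apply: (test_dil e0 tchi0).
have ee a : e < a -> 0 < e < a by move=> h; rewrite e0.
have [Ya [Ya1 Ya2]] := hPa e (ee _ eea) tpsi.
have [Yb [Yb1 Yb2]] := hPb e (ee _ eeb) tpsi.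
have oC : open [set x : 'rV[R]_d | sqn x < A ^+ 2] by exact: open_sqn_lt.
have [a1 [Xa EXa [a2 a3 a4 [a5 [w [Mw Gh]]]]]] :=
  scaled_potential hd oOm bOm cK e0 KO tpsi oC KA chi1 hua Ya2.
have [b1 [Xb EXb [b2 b3 b4 [b5 _]]]] :=
  scaled_potential hd oOm bOm cK e0 KO tpsi oC KA chi1 hub Yb2.
have ECap := Cap_ip oOm a1 b1 EXa EXb; clear EXa EXb a1 b1.
have es0 : e ^+ (d - 2) != 0 by rewrite expf_neq0// gt_eqF.
have oG (g Z : L2H R d d) : Gspace Om g -> cl (grads Om) Z -> ip g Z = 0.
  by move=> [_ hg]; apply: orth_cl => _ [f tf ->]; exact: hg.
have H1 m : Mspace K m -> psum (fun k => ip m (Pa k)) e (ip m Ya).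
  by move=> _; exact: psum_functional.
(* S_e m is orthogonal to X - S_e Y, a limit of gradients supported in Om off e K; so <S_e m, X> =
   e^(d-2) <m, Y>. *)
have H2 m : Mspace K m -> psum (fun k => beta k m (scv e w - Xa)) e (ip m w - ip m Ya).
  move=> Mm; have := bK e (ee _ ee1) m _ Mm Gh.
  have -> : ip (scv e m) (scv e w - Xa) = e ^+ (d - 2) * (ip m w - ip m Ya).
    have := scv_Mspace_orth hd e0 Mm a4; rewrite ipBr (ip_scv _ _ d2 e0) => /eqP.
    rewrite subr_eq0 => /eqP Em.
    by rewrite ipBr (ip_scv _ _ d2 e0) Em mulrBr.
  by rewrite mulrC mulKf.
(* g is orthogonal to X, a limit of gradients supported in Om, so <S_e w - X, g> is the full pairing
   <S_e w, g>. *)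
have H3 g : Gspace Om g -> psum (fun k => beta k w g) e (ip (scv e w - Xa) g / e ^+ (d - 2)).
  move=> Gg; have := bK e (ee _ ee1) w g Mw Gg.
  by rewrite ipBl [ip Xa g]ipC (oG _ _ Gg a2) subr0.
have [S [S1 S2]] := sys e (ee _ ee2) w _ (fun m => ip m Ya) Mw Gh H1 H2 H3.
exists S; split; first exact: S1.
rewrite ECap; clear ECap.
have -> : S = ip w Yb by apply: (psum_unique S2); exact: psum_functional.
rewrite -(ip_scv _ _ d2 e0).
(* The potential Xb may be replaced by S_e Yb, as Xa is orthogonal to their difference; then Xa by
   S_e w, as S_e w - Xa is orthogonal to S_e Yb. *)
have E1 : ip Xa Xb = ip Xa (scv e Yb).
  by apply/eqP; rewrite -subr_eq0 -ipBr; apply/eqP; exact: a3.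
have E2 : ip (scv e w) (scv e Yb) = ip Xa (scv e Yb).
  by apply/eqP; rewrite -subr_eq0 -ipBl; apply/eqP; exact: oG Gh b5.
by rewrite E1 E2.
Qed.

End capacity_expansion.

Theorem theorem1p6 (R : realType) (d : nat) (hd : (3 <= d)%N)
    (Om om : set 'rV[R]_d) (ua ub : 'rV[R]_d -> R)
    (hOm : admissible_domain Om) (hom : admissible_domain om)
    (hua : admissible_function Om ua) (hub : admissible_function Om ub) :
  exists (e0 : R) (c : nat -> R), 0 < e0 /\
    forall e : R, 0 < e < e0 ->
      let K := [set e *: x | x in closure om] in
      [/\ K `<=` Om,
          cvgn (pseries c e) &
          Cap Om K ua ub = e ^+ (d - 2) * limn (pseries c e)].
Proof.
have [[oOm bOm _] _ O0 _] := hOm; have [[_ bom _] _ _ _] := hom.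
have [A [A0 KA]] := bounded_in_sqn bom.
have cK : compact (closure om).
  apply: (subclosed_compact _ (compact_sqn (ltW A0))); first exact: closed_closure.
  by move=> x /KA /ltW.
have [e0 [c [e00 h]]] := Cap_expansion hd oOm bOm O0 A0 cK KA hua hub.
exists e0, c; split => // e he K; have [KO [S [hS ->]]] := h e he.
split; [exact: KO|exact: (cvgP S hS)|].
by congr (_ * _); apply/esym/cvg_lim => //; exact: Rhausdorff.
Qed.
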